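(* Let $G$ be a finitely generated group with a finite generating set $X$, let $\omega$ be a non-principal ultrafilter on $\mathbb{N}$, and let $(d_n)$ be a sequence of positive reals with $\lim_\omega d_n=\infty$. If the asymptotic cone $\mathrm{Con}^\omega(G,(d_n))$ contains a compact closed ball of positive radius, then $G$ is virtually nilpotent. In particular, if some asymptotic cone of $G$ is locally compact, then $G$ is virtually nilpotent.
   Context: $G$ is regarded as a metric space with the word metric: $\mathrm{dist}(g,h)$ is the length of a shortest word over $X\cup X^{-1}$ representing $g^{-1}h$. A non-principal ultrafilter $\omega$ on $\mathbb{N}$ is a finitely additive function $P(\mathbb{N})\to\{0,1\}$ with $\omega(\mathbb{N})=1$ and $\omega(A)=0$ for every finite $A$. For a sequence of reals $r_i\ge 0$, $\lim_\omega r_i$ is the unique $r\in\mathbb{R}\cup\{\infty\}$ such that for every $\epsilon>0$ the set $\{i: |r_i-r|<\epsilon\}$ has $\omega$-measure $1$. The asymptotic cone is defined as follows: on $G^{\mathbb{N}}$ define the pseudo-metric $\overline{\mathrm{dist}}((u_i),(v_i))=\lim_\omega \mathrm{dist}(u_i,v_i)/d_i$; let $G^{\mathbb{N}}_b$ be the set of sequences at finite pseudo-distance from $(1,1,\dots)$; identify sequences at pseudo-distance $0$. The resulting metric space is $\mathrm{Con}^\omega(G,(d_n))$. *)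

(* Defs.v *)
From Stdlib Require Import Reals List Classical ClassicalEpsilon.
Open Scope R_scope.

Record Group := {
  gcar :> Type;
  gmul : gcar -> gcar -> gcar;
  gone : gcar;
  ginv : gcar -> gcar;
  gassoc : forall x y z, gmul x (gmul y z) = gmul (gmul x y) z;
  gidl : forall x, gmul gone x = x;
  ginvl : forall x, gmul (ginv x) x = gone
}.

Section GroupDefs.
Variable G : Group.

Definition letter (p : bool * G) : G :=
  if fst p then snd p else ginv G (snd p).

Definition eval_word (w : list (bool * G)) : G :=
  fold_right (fun p acc => gmul G (letter p) acc) (gone G) w.

Definition word_over (X : list G) (w : list (bool * G)) : Prop :=
  Forall (fun p => In (snd p) X) w.

Definition generates (X : list G) : Prop :=
  forall g : G, exists w, word_over X w /\ eval_word w = g.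

Definition shortest_length (X : list G) (g : G) (n : nat) : Prop :=
  (exists w, word_over X w /\ eval_word w = g /\ length w = n) /\
  (forall w, word_over X w -> eval_word w = g -> (n <= length w)%nat).

(** word length of g (meaningful when X generates G) *)
Definition word_norm (X : list G) (g : G) : nat :=
  epsilon (inhabits 0%nat) (fun n => shortest_length X g n).

Definition word_dist (X : list G) (g h : G) : R :=
  INR (word_norm X (gmul G (ginv G g) h)).

Definition is_subgroup (H : G -> Prop) : Prop :=
  H (gone G) /\ (forall x y, H x -> H y -> H (gmul G x y)) /\
  (forall x, H x -> H (ginv G x)).

Definition finite_index (H : G -> Prop) : Prop :=
  exists l : list G, forall g : G, exists t, In t l /\ H (gmul G (ginv G t) g).

Inductive gen_subgroup (S : G -> Prop) : G -> Prop :=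
| gs_one : gen_subgroup S (gone G)
| gs_in : forall x, S x -> gen_subgroup S x
| gs_mul : forall x y, gen_subgroup S x -> gen_subgroup S y ->
    gen_subgroup S (gmul G x y)
| gs_inv : forall x, gen_subgroup S x -> gen_subgroup S (ginv G x).

Definition commutator (x y : G) : G :=
  gmul G (gmul G (ginv G x) (ginv G y)) (gmul G x y).

(** lower central series of H: gamma 1 = H, gamma (k+1) = [gamma k, H];
    gamma 0 is also set to H. *)
Fixpoint lower_central (H : G -> Prop) (k : nat) : G -> Prop :=
  match k with
  | O => H
  | S O => H
  | S k' => gen_subgroup
      (fun z => exists x y, lower_central H k' x /\ H y /\ z = commutator x y)
  end.

Definition nilpotent_subgroup (H : G -> Prop) : Prop :=
  is_subgroup H /\ exists c : nat, forall x, lower_central H (S c) x -> x = gone G.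

Definition virtually_nilpotent : Prop :=
  exists H : G -> Prop, is_subgroup H /\ finite_index H /\ nilpotent_subgroup H.

End GroupDefs.

(** * Ultrafilters as finitely additive {0,1}-valued measures on P(N) *)
Definition finite_set (A : nat -> Prop) : Prop :=
  exists N : nat, forall i, A i -> (i < N)%nat.

Definition nonprincipal_ultrafilter (om : (nat -> Prop) -> R) : Prop :=
  (forall A, om A = 0 \/ om A = 1) /\
  (forall A B, (forall i, ~ (A i /\ B i)) ->
     om (fun i => A i \/ B i) = om A + om B) /\
  om (fun _ => True) = 1 /\
  (forall A, finite_set A -> om A = 0).

Definition ulim (om : (nat -> Prop) -> R) (r : nat -> R) (L : R) : Prop :=
  forall eps, 0 < eps -> om (fun i => Rabs (r i - L) < eps) = 1.

Definition ulim_infty (om : (nat -> Prop) -> R) (r : nat -> R) : Prop :=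
  forall M : R, om (fun i => M < r i) = 1.

(** * Asymptotic cone Con^omega(G,(d_n)), presented as the pseudo-metric
    space of bounded sequences (points at pseudo-distance 0 are identified
    in the cone; topological notions below are invariant under this). *)
Section Cone.
Variable G : Group.
Variable X : list G.
Variable om : (nat -> Prop) -> R.
Variable d : nat -> R.

Definition cdist (u v : nat -> G) (a : R) : Prop :=
  ulim om (fun i => word_dist G X (u i) (v i) / d i) a.

Definition cbounded (u : nat -> G) : Prop :=
  exists a, cdist (fun _ => gone G) u a.

Definition cone_open (U : (nat -> G) -> Prop) : Prop :=
  forall u, cbounded u -> U u ->
    exists eps, 0 < eps /\
      forall v, cbounded v -> (exists a, cdist u v a /\ a < eps) -> U v.

Definition cone_compact (K : (nat -> G) -> Prop) : Prop :=
  (forall u, K u -> cbounded u) /\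
  forall (I : Type) (U : I -> (nat -> G) -> Prop),
    (forall i, cone_open (U i)) ->
    (forall u, K u -> exists i, U i u) ->
    exists l : list I, forall u, K u -> exists i, In i l /\ U i u.

Definition cone_closed_ball (p : nat -> G) (r : R) : (nat -> G) -> Prop :=
  fun v => cbounded v /\ exists a, cdist p v a /\ a <= r.

Definition cone_has_compact_ball : Prop :=
  exists p r, cbounded p /\ 0 < r /\ cone_compact (cone_closed_ball p r).

Definition cone_locally_compact : Prop :=
  forall p, cbounded p ->
    exists U K, cone_open U /\ U p /\ cone_compact K /\
      (forall v, cbounded v -> U v -> K v).
End Cone.

Definition scaling_sequence (om : (nat -> Prop) -> R) (d : nat -> R) : Prop :=
  (forall n, 0 < d n) /\ ulim_infty om d.

(* Main.v *)
(** A compact ball in the cone says that, along the radii [R_n ~ r d_n], balls of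
    radius [a R_n] contain boundedly many points at mutual distance [R_n / b].

    Start from [G] and repeatedly pass to the kernel of a nonzero homomorphism
    to [Z], after a finite index restriction.  Each infinite cyclic layer doubles
    the number of separated points available in a ball, so the packing bound limits
    the number of layers: the process stops at a finite group, and the resulting
    series shows that [G] is virtually nilpotent.

    It remains to show that an infinite finitely generated subgroup [Gam] of [G]
    has a finite index subgroup with infinite abelianization (compare Kleiner's
    proof of Gromov's theorem; there are no harmonic functions here).  Let [Gam] act by left
    translation on finitely supported functions on [G], normalised by the volume
    of the [R_n]-ball.  The operator [top] averages the projections onto the
    translates of a tent function; it is of trace class and almost commutes with
    short words, so its spectral subspaces are finite dimensional invariant
    spaces in the ultraproduct.  Orthogonal representations of [Gam] have finite
    image (otherwise the conclusion holds), so a finite index subgroup [Gam1] fixes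
    the spectral subspace that contains most of the tent function.  Since long
    words do move the tent function, some eigenvector [v] is moved at an
    intermediate scale; regularising it along [Gam1] and rescaling its
    differences gives an unbounded cocycle [g |-> Q (fb - g fb)] with values in the
    ultraproduct.  Tested against a second spectral subspace it becomes an
    unbounded cocycle in a finite dimensional representation, that is, after
    another finite index restriction, a nonzero homomorphism to [R^k]. *)
Require Import Defs.
From Stdlib Require Import Reals List Lra Lia ZArith Classical ClassicalEpsilon
  FunctionalExtensionality PropExtensionality ssreflect.
Import ListNotations.
Global Set SsrOldRewriteGoalsOrder.
Open Scope nat_scope.

Notation "x ** y" := (gmul _ x y) (at level 40, left associativity).
Notation iv := (ginv _).
Notation one := (gone _).

(** * Groups and subgroups of finite index *)

(** Packing is controlled only at the radii [Rn n], for almost every [n]; nothing is known at other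
    scales, so there is no growth exponent and no limit group to work with. Estimates are made at a
    single scale with constants independent of [n] and are then transported by countable saturation.
    The inner product spaces stay incomplete and degenerate: identities are tested against all
    vectors, and maximisers come from saturation.

    Two obstacles shape the cocycle. Displacements are small in L2, and only on words of length
    about [Q n], whereas the cocycle must stay bounded on each fixed element after multiplication by
    [Q n]. Values of the averaging operator are Lipschitz on the right, which turns L2 smallness
    into uniform smallness; a Lipschitz majorant on the left then has slope of order [1 / Q n] at
    every scale. Moreover the large increment occurs only after a translation of length comparable
    to [Rn n]; hence the second spectral subspace, that of an operator with a wider window. *)

Section GroupFacts.
Variable G : Group.
Implicit Types x y z : G.

Lemma invr x : x ** iv x = one.
Proof.
  rewrite -(gidl G (x ** iv x)) -{1}(ginvl G (iv x)) -gassoc (gassoc G (iv x)).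
  by rewrite ginvl gidl ginvl.
Qed.

Lemma idr x : x ** one = x.
Proof. by rewrite -(ginvl G x) gassoc invr gidl. Qed.

Lemma assocr x y z : (x ** y) ** z = x ** (y ** z).
Proof. by rewrite gassoc. Qed.

Lemma mulKl x y : iv x ** (x ** y) = y.
Proof. by rewrite gassoc ginvl gidl. Qed.

Lemma mulKr x y : x ** (iv x ** y) = y.
Proof. by rewrite gassoc invr gidl. Qed.

Lemma cancel_l x y z : x ** y = x ** z -> y = z.
Proof. by move=> H; rewrite -(mulKl x y) H mulKl. Qed.

Lemma cancel_r x y z : y ** x = z ** x -> y = z.
Proof. by move=> H; rewrite -(idr y) -(invr x) gassoc H -gassoc invr idr. Qed.

Lemma invK x : iv (iv x) = x.
Proof. by apply: (cancel_l (iv x)); rewrite invr ginvl. Qed.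

Lemma inv1 : iv (one : G) = one.
Proof. by apply: (cancel_l one); rewrite invr gidl. Qed.

Lemma invM x y : iv (x ** y) = iv y ** iv x.
Proof. by apply: (cancel_l (x ** y)); rewrite invr -gassoc mulKr invr. Qed.

End GroupFacts.

Global Hint Rewrite assocr invr ginvl mulKl mulKr invK inv1 invM idr gidl : grp.
Ltac gs := autorewrite with grp.
Ltac gsin H := autorewrite with grp in H.
Notation sub := (fun A B : _ -> Prop => forall x, A x -> B x).
Notation FOP := ForallOrdPairs.

Section Subgroups.
Variable G : Group.
Implicit Types (H K L D : G -> Prop) (x y z : G).

Lemma sg1 H : is_subgroup G H -> H one. Proof. by case. Qed.
Lemma sgM H x y : is_subgroup G H -> H x -> H y -> H (x ** y).
Proof. by move=> [_ [h _]]; apply: h. Qed.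
Lemma sgV H x : is_subgroup G H -> H x -> H (iv x).
Proof. by move=> [_ [_ h]]; apply: h. Qed.
Lemma sgVM H x y : is_subgroup G H -> H (iv x ** y) -> H (iv y ** x).
Proof. by move=> sH h; have := sgV _ _ sH h; gs. Qed.
Lemma sg_and H K : is_subgroup G H -> is_subgroup G K -> is_subgroup G (fun x => H x /\ K x).
Proof.
  move=> sH sK; split; [|split].
  - split; exact: sg1.
  - move=> x y [? ?] [? ?]; split; exact: sgM.
  - move=> x [? ?]; split; exact: sgV.
Qed.

(** [K] meets [H] in finite index; the representatives [t] of the left cosets
    [t K] are taken in [H]. *)
Definition fi H K := exists l : list G, (forall t, In t l -> H t) /\
  forall x, H x -> exists t, In t l /\ K (iv t ** x).

(** One element of [H] is picked for each label that occurs, and elements sharing a label lie in one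
    left coset of [K]. Most index bounds below come from such a finite labelling. *)
Lemma fi_class T (l : list T) (Q : T -> G -> Prop) H K :
  (forall x, H x -> exists t, In t l /\ Q t x) ->
  (forall t x y, H x -> H y -> Q t x -> Q t y -> K (iv x ** y)) -> fi H K.
Proof.
  move=> h1 h2.
  have : exists l' : list G, (forall t, In t l' -> H t) /\
     forall x, H x -> (exists t, In t l /\ Q t x) -> exists t, In t l' /\ K (iv t ** x).
  { clear h1; elim: l => [|a l [l' [IH1 IH2]]].
    - by exists []; split => // x _ [t [[] _]].
    - case: (classic (exists x, H x /\ Q a x)) => [[u [Hu Qu]]|no].
      + exists (u :: l'); split=> [t [<-|]|x Hx [t [[<-|it] q]]] //; first exact: IH1.
        * exists u; split; [by left|exact: (h2 a)].
        * have [|t' [? ?]] := IH2 x Hx; first by exists t.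
          by exists t'; split; [right|].
      + exists l'; split=> // x Hx [t [[e|it] q]].
        * by case: no; exists x; rewrite e.
        * by apply: IH2 => //; exists t. }
  by move=> [l' [a b]]; exists l'; split=> // x Hx; apply: b => //; apply: h1.
Qed.

Lemma wfi_fi H K (l : list G) : is_subgroup G K ->
  (forall x, H x -> exists t, In t l /\ K (iv t ** x)) -> fi H K.
Proof.
  move=> sK h; apply: (fi_class _ l (fun t x => K (iv t ** x))) => // t x y _ _ h1 h2.
  by have := sgM _ _ _ sK (sgV _ _ sK h1) h2; gs.
Qed.

Lemma fi_refl H : is_subgroup G H -> fi H H.
Proof.
  move=> sH; exists [one]; split=> [t [<-|[]]|x Hx]; first exact: sg1.
  by exists one; split; [left|gs].
Qed.

Lemma fi_sub H H' K : is_subgroup G K -> sub H' H -> fi H K -> fi H' K.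
Proof. by move=> sK s [l [_ h]]; apply: (wfi_fi _ _ l) => // x Hx; apply: h; apply: s. Qed.

Lemma fi_mono H K K' : sub K K' -> fi H K -> fi H K'.
Proof.
  move=> s [l [h1 h2]]; exists l; split=> // x Hx.
  by have [t [? ?]] := h2 x Hx; exists t; split; [|apply: s].
Qed.

Lemma fi_and H K K' : is_subgroup G K -> is_subgroup G K' ->
  fi H K -> fi H K' -> fi H (fun x => K x /\ K' x).
Proof.
  move=> sK sK' [l [_ h]] [l' [_ h']].
  apply: (fi_class _ (list_prod l l')
    (fun t x => K (iv (fst t) ** x) /\ K' (iv (snd t) ** x))).
  - move=> x Hx; have [t [? ?]] := h x Hx; have [t' [? ?]] := h' x Hx.
    by exists (t, t'); split => //; apply: in_prod.
  - move=> [t t'] x y _ _ [/= a b] [c d]; split.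
    + by have := sgM _ _ _ sK (sgV _ _ sK a) c; gs.
    + by have := sgM _ _ _ sK' (sgV _ _ sK' b) d; gs.
Qed.

Lemma fi_restrict H H' K : is_subgroup G H' -> is_subgroup G K -> sub H' H ->
  fi H K -> fi H' (fun x => H' x /\ K x).
Proof.
  move=> sH' sK s f; apply: fi_and => //; first exact: fi_refl.
  exact: (fi_sub H).
Qed.

Lemma fi_trans H K L : is_subgroup G L -> fi H K -> fi K L -> fi H L.
Proof.
  move=> sL [l [_ h]] [l' [_ h']].
  apply: (wfi_fi _ _ (map (fun p => fst p ** snd p) (list_prod l l'))) => // x Hx.
  have [t [it kt]] := h x Hx; have [t' [it' lt']] := h' _ kt.
  exists (t ** t'); split; last by move: lt'; gs.
  by apply/in_map_iff; exists (t, t'); split=> //; apply: in_prod.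
Qed.

Definition fin H := exists l : list G, forall x, H x -> In x l.

Lemma dec_split (A : Type) (P : A -> Prop) (l : list A) :
  exists l', (forall a, In a l' <-> In a l /\ P a).
Proof.
  elim: l => [|a l [l' h]]; first by exists [] => x; split=> [[]|[[]]].
  case: (classic (P a)) => Pa.
  - exists (a :: l') => x; rewrite /= h; split; first by move=> [<-|[]]; auto.
    by move=> [[]]; auto.
  - exists l' => x; rewrite h /=; split; first by move=> []; auto.
    by move=> [[<-|]] //; auto.
Qed.

Fixpoint pw (Y : list G) (j : nat) (x : G) : Prop :=
  match j with
  | 0 => x = one
  | S j' => pw Y j' x \/ exists s y, In s Y /\ pw Y j' y /\ x = s ** y
  end.

Definition symm (Y : list G) := forall s, In s Y -> In (iv s) Y.

Lemma pw_mono Y j k x : j <= k -> pw Y j x -> pw Y k x.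
Proof. by elim=> // k' _ IH h; left; apply: IH. Qed.

Lemma pw_one Y j : pw Y j one.
Proof. by apply: (pw_mono Y 0) => //; lia. Qed.

Lemma pw_gen Y s : In s Y -> pw Y 1 s.
Proof. by move=> h; right; exists s, one; split=> //; split=> //; gs. Qed.

Lemma pw_add Y j k x y : pw Y j x -> pw Y k y -> pw Y (j + k) (x ** y).
Proof.
  elim: j x => [|j IH] x /=; first by move=> -> h; gs.
  move=> [h|[s [z [i [p ->]]]]] q; first by left; apply: IH.
  by right; exists s, (z ** y); gs; split=> //; split=> //; apply: IH.
Qed.

Lemma pw_inv Y j x : symm Y -> pw Y j x -> pw Y j (iv x).
Proof.
  move=> sS; elim: j x => [|j IH] x /=; first by move=> ->; gs.
  move=> [h|[s [z [i [p ->]]]]]; first by left; apply: IH.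
  have h : pw Y (j + 1) (iv z ** iv s).
  { by apply: pw_add; [apply: IH|apply: pw_gen; apply: sS]. }
  by gs; move: h; rewrite Nat.add_1_r.
Qed.

Lemma pw_split Y j k x : pw Y (j + k) x -> exists y z, pw Y j y /\ pw Y k z /\ x = y ** z.
Proof.
  elim: j k x => [|j IH] k x /=; first by move=> h; exists one, x; gs.
  move=> [h|[s [z [i [p ->]]]]].
  - by have [y [z [? [? ->]]]] := IH _ _ h; exists y, z; split; [left|].
  - have [y [w [? [? ->]]]] := IH _ _ p; exists (s ** y), w; split; last by gs.
    by right; exists s, y.
Qed.

Lemma pw_pw Y Y' c j x : (forall s, In s Y' -> pw Y c s) -> pw Y' j x -> pw Y (c * j) x.
Proof.
  move=> h; elim: j x => [|j IH] x /=; first by move=> ->; exact: pw_one.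
  have e : c * S j = c + c * j by lia.
  move=> [/IH p|[s [z [i [/IH p ->]]]]]; rewrite e.
  - by apply: (pw_mono _ (c * j)) => //; lia.
  - by apply: pw_add => //; apply: h.
Qed.

Lemma pw_sg Y j x H : is_subgroup G H -> (forall s, In s Y -> H s) -> pw Y j x -> H x.
Proof.
  move=> sH h; elim: j x => [|j IH] x /=; first by move=> ->; exact: sg1.
  move=> [/IH //|[s [z [i [/IH p ->]]]]]; apply: sgM => //; exact: h.
Qed.

Lemma pw_fin Y j : exists l, forall x, In x l <-> pw Y j x.
Proof.
  elim: j => [|j [l h]]; first by exists [one] => x /=; split; [case|left].
  exists (l ++ map (fun p => fst p ** snd p) (list_prod Y l)) => x.
  rewrite in_app_iff h /= in_map_iff; split.
  - move=> [|[[s y] [<- /in_prod_iff [? /h ?]]]]; [by left|right].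
    by exists s, y.
  - move=> [|[s [y [? [? ->]]]]]; [by left|right].
    by exists (s, y); split=> //; apply: in_prod => //; apply/h.
Qed.

Definition gen_by Y H := symm Y /\ forall x, H x <-> exists j, pw Y j x.
Definition fg H := exists Y, gen_by Y H.

Lemma gen_by_sg Y H : gen_by Y H -> is_subgroup G H.
Proof.
  move=> [sS h]; split; [|split].
  - by apply/h; exists 0.
  - move=> x y /h [j p] /h [k q]; apply/h; exists (j + k); exact: pw_add.
  - move=> x /h [j p]; apply/h; exists j; exact: pw_inv.
Qed.

Lemma gen_by_in Y H s : gen_by Y H -> In s Y -> H s.
Proof. by move=> [_ h] i; apply/h; exists 1; apply: pw_gen. Qed.

Lemma gen_by_intro Y H : is_subgroup G H -> symm Y -> (forall s, In s Y -> H s) ->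
  (forall x, H x -> exists j, pw Y j x) -> gen_by Y H.
Proof. by move=> sH sS h1 h2; split=> // x; split; [apply: h2|case=> j; apply: pw_sg]. Qed.

(** Pushing a coset representative through a word turns each letter of [Y] into one letter of [S1].
    Besides finite generation this yields the length control in the conclusion, needed later to
    compare words in [Y] with words in [S1]. *)
Lemma schreier Y H K : gen_by Y H -> is_subgroup G K -> sub K H -> fi H K ->
  exists S1 T, gen_by S1 K /\ forall j x, pw Y j x ->
    exists t x1, In t T /\ pw S1 j x1 /\ x = t ** x1.
Proof.
  move=> gS sK s [l [lH lc]].
  set T := one :: l.
  set U := list_prod (one :: Y) (list_prod T T).
  have [S1 hS1] := dec_split _ K
    (map (fun p => iv (fst (snd p)) ** fst p ** snd (snd p)) U
     ++ map (fun p => iv (iv (fst (snd p)) ** fst p ** snd (snd p))) U).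
  have inU : forall a t t', In a (one :: Y) -> In t T -> In t' T -> K (iv t ** a ** t') ->
      In (iv t ** a ** t') S1.
  { move=> a t t' ia it it' k; apply/hS1; split=> //; apply/in_or_app; left.
    apply/in_map_iff; exists (a, (t, t')); split=> //.
    by apply: in_prod => //; apply: in_prod. }
  have sym1 : symm S1.
  { move=> s1 /hS1 [i k]; apply/hS1; split; last exact: sgV.
    apply/in_or_app; have [/in_map_iff [p [<- ip]]|/in_map_iff [p [<- ip]]] := in_app_or _ _ _ i.
    - by right; apply/in_map_iff; exists p.
    - by left; apply/in_map_iff; exists p; split=> //; rewrite invK. }
  have key : forall j x, pw Y j x -> exists t x1, In t T /\ pw S1 j x1 /\ x = t ** x1.
  { elim=> [|j IH] x /=; first by move=> ->; exists one, one; split; [left|gs].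
    move=> [/IH [t [x1 [? [? ->]]]]|[a [y [ia [/IH [t [x1 [it [p ->]]]] ->]]]]].
    - by exists t, x1; split=> //; split; [left|].
    - have Hat : H (a ** t).
      { apply: sgM; [exact: (gen_by_sg _ _ gS)|exact: (gen_by_in _ _ _ gS)|].
        case: it => [<-|/lH //]; exact: (sg1 _ (gen_by_sg _ _ gS)). }
      have [t' [it' kt']] := lc _ Hat.
      exists t', (iv t' ** a ** t ** x1); split; [by right|split; last by gs].
      right; exists (iv t' ** a ** t), x1; split=> //.
      apply: inU => //; [by right|by right|by move: kt'; gs]. }
  exists S1, T; split=> //.
  apply: gen_by_intro => //; first by move=> s1 /hS1 [].
  move=> x Kx; have [j p] : exists j, pw Y j x by apply gS; apply: s.
  have [t [x1 [it [p1 e]]]] := key _ _ p.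
  have K1 : K x1 by apply: (pw_sg S1 j) => // s1 /hS1 [].
  have Kt : K t.
  { have -> : t = x ** iv x1 by rewrite e; gs.
    by apply: sgM => //; apply: sgV. }
  exists (1 + j); rewrite e; apply: pw_add => //; apply: pw_gen.
  have -> : t = iv one ** one ** t by gs.
  by apply: inU => //; [left|left|gs].
Qed.

Lemma fg_fi H K : fg H -> is_subgroup G K -> sub K H -> fi H K -> fg K.
Proof. by move=> [Y gS] sK s f; have [S1 [T [g _]]] := schreier _ _ _ gS sK s f; exists S1. Qed.

(** Either the cosets met by words of length [j] already exhaust, or there are
    more than [j] of them. *)
Lemma coset_growth Y H K N : gen_by Y H -> is_subgroup G K ->
  (forall l, Forall (pw Y N) l -> FOP (fun x y => ~ K (iv x ** y)) l -> length l <= N) ->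
  fi H K.
Proof.
  move=> gS sK hN.
  have sH := gen_by_sg _ _ gS.
  have key : forall j, fi H K \/ exists l, length l = j + 1 /\ Forall (pw Y j) l /\
     FOP (fun x y => ~ K (iv x ** y)) l /\ In one l.
  { elim=> [|j]; [right|case=> [IH|[l [ll [lp [lf l1]]]]]; [by left|]].
    - exists [one]; split=> //; split; [by constructor|split; [by constructor; constructor|by left]].
    - case: (classic (exists s t, In s Y /\ In t l /\
                        forall t', In t' l -> ~ K (iv t' ** (s ** t)))).
      + move=> [s [t [iY [it h]]]]; right; exists (s ** t :: l); split=> /=; first lia.
        split; last split; last by right.
        * constructor.
          -- right; exists s, t; split=> //; split=> //.
             by move/Forall_forall: lp; apply.
          -- apply: Forall_impl lp => x; by left.
        * constructor=> //; apply/Forall_forall => t' it' k; apply: (h t' it').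
          exact: sgVM.
      + move=> no; left.
        have cl : forall k x, pw Y k x -> exists t, In t l /\ K (iv t ** x).
        { elim=> [|k IH] x /=.
          - by move=> ->; exists one; split=> //; gs; exact: sg1.
          - move=> [/IH //|[s [y [iY [/IH [t [it kt]] ->]]]]].
            apply: NNPP => no1; apply: no; exists s, t; split=> //; split=> // t' it' k'.
            apply: no1; exists t'; split=> //.
            by have := sgM _ _ _ sK k' kt; gs. }
        apply: (wfi_fi _ _ l) => // x /(proj2 gS) [k p]; exact: (cl k). }
  case: (key N) => // [[l [ll [lp [lf _]]]]].
  by have := hN l lp lf; lia.
Qed.
End Subgroups.
Arguments pw {G}. Arguments fi {G}. Arguments fin {G}. Arguments gen_by {G}.
Arguments fg {G}. Arguments symm {G}.

(** * Pigeonhole counting *)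

Section Counting.
Variables A T : Type.
Implicit Types (l : list A) (V : list T).

Definition cb (P : Prop) : bool :=
  match excluded_middle_informative P with left _ => true | right _ => false end.
Lemma cbP P : cb P = true <-> P.
Proof. by rewrite /cb; case: excluded_middle_informative. Qed.
Lemma cbN P : cb (~ P) = negb (cb P).
Proof. by rewrite /cb; case: excluded_middle_informative; case: excluded_middle_informative. Qed.
Definition cfilter (P : A -> Prop) l := filter (fun x => cb (P x)) l.
Lemma in_cfilter P l x : In x (cfilter P l) <-> In x l /\ P x.
Proof. by rewrite /cfilter filter_In cbP. Qed.

Lemma FOP_cfilter P R l : FOP R l -> FOP R (cfilter P l).
Proof.
  elim=> [|a l' h1 h2 IH] /=; first by constructor.
  rewrite /cfilter /=; case: (cb (P a)) => //; constructor=> //.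
  apply/Forall_forall => x /in_cfilter [i _].
  by move/Forall_forall: h1; apply.
Qed.

Lemma FOP_impl (R R' : A -> A -> Prop) l :
  (forall x y, In x l -> In y l -> R x y -> R' x y) -> FOP R l -> FOP R' l.
Proof.
  elim: l => [|a l IH] h H; first by constructor.
  inversion H; subst; constructor.
  - apply/Forall_forall => x i; apply: h; [by left|by right|].
    by move/Forall_forall: H2; apply.
  - apply: IH => // x y i j; apply: h; by right.
Qed.

Lemma FOP_map B (f : A -> B) R l : FOP R (map f l) <-> FOP (fun x y => R (f x) (f y)) l.
Proof.
  elim: l => [|a l IH] /=; first by split; constructor.
  split=> H; inversion H; subst; constructor; try by apply/IH.
  - by move: H2; rewrite Forall_map.
  - by rewrite Forall_map.
Qed.

Lemma NoDup_FOP l : NoDup l <-> FOP (fun x y => x <> y) l.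
Proof.
  elim: l => [|a l IH]; first by split; constructor.
  split=> H; inversion H; subst; constructor; try by apply/IH.
  - by apply/Forall_forall => x i e; subst.
  - by move=> i; move/Forall_forall: H2 => /(_ a i).
Qed.

Lemma count_classes (R : A -> A -> Prop) (Q : T -> A -> Prop) V N l :
  (forall x, In x l -> exists v, In v V /\ Q v x) ->
  (forall v l', In v V -> incl l' l -> Forall (Q v) l' -> FOP R l' -> length l' <= N) ->
  FOP R l -> length l <= N * length V.
Proof.
  elim: V l => [|v V IH] l h1 h2 h3 /=.
  - case: l h1 {h2 h3} => [|a l] h1 //=; first lia.
    by have [|v [[]]] := h1 a; left.
  - have e : length l = length (cfilter (Q v) l) + length (cfilter (fun x => ~ Q v x) l).
    { elim: l {h1 h2 h3} => [|a l IHl] //=.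
      rewrite /cfilter /= cbN; case: (cb (Q v a)) => /=; rewrite IHl /cfilter; lia. }
    have a1 : length (cfilter (Q v) l) <= N.
    { apply: (h2 v); [by left| | |exact: FOP_cfilter].
      - by move=> x /in_cfilter [].
      - by apply/Forall_forall => x /in_cfilter []. }
    have a2 : length (cfilter (fun x => ~ Q v x) l) <= N * length V.
    { apply: IH; last exact: FOP_cfilter.
      - move=> x /in_cfilter [i nq]; have [w [[e'|iw] q]] := h1 x i; first by subst.
        by exists w.
      - move=> w l' iw inc; apply: h2; first by right.
        by move=> x /inc /in_cfilter []. }
    lia.
Qed.

Lemma FOP_values (f : A -> T) V l : (forall x, In x l -> In (f x) V) ->
  FOP (fun x y => f x <> f y) l -> length l <= length V.
Proof.
  move=> h H; rewrite -(length_map f); apply: NoDup_incl_length.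
  - elim: H {h} => [|a l' h1 h2 IH] /=; constructor=> //.
    move=> /in_map_iff [x [e i]]; move/Forall_forall: h1 => /(_ x i); congruence.
  - by move=> y /in_map_iff [x [<- i]]; apply: h.
Qed.
End Counting.
Arguments cfilter {A}. Arguments in_cfilter {A}.

Fixpoint codes (m c : nat) : list (list nat) :=
  match m with
  | 0 => [[]]
  | S m' => map (fun p => fst p :: snd p) (list_prod (seq 0 c) (codes m' c))
  end.

Lemma in_codes c (l : list nat) : Forall (fun i => i < c) l -> In l (codes (length l) c).
Proof.
  elim=> [|i l' h1 h2 IH] /=; first by left.
  apply/in_map_iff; exists (i, l'); split=> //; apply: in_prod => //.
  by apply/in_seq; lia.
Qed.

Lemma max_nat (P : nat -> Prop) N : (exists n, P n) -> (forall n, P n -> n <= N) ->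
  exists n, P n /\ forall m, P m -> m <= n.
Proof.
  elim: N P => [|N IH] P [n Pn] h.
  - by exists n; split=> // m Pm; have := h _ Pm; have := h _ Pn; lia.
  - case: (classic (P (S N))) => PN; first by exists (S N).
    apply: IH; first by exists n.
    move=> m Pm; have := h _ Pm; have : m <> S N by move=> e; subst.
    lia.
Qed.

Lemma min_nat (P : nat -> Prop) : (exists n, P n) -> exists n, P n /\ forall m, P m -> n <= m.
Proof.
  move=> [n]; elim/(well_founded_induction lt_wf): n => n IH Pn.
  case: (classic (exists m, P m /\ m < n)) => [[m [Pm l]]|no]; first exact: (IH m).
  by exists n; split=> // m Pm; apply/Nat.nlt_ge => l; apply: no; exists m.
Qed.

Lemma finite_image (A T : Type) (D : A -> Prop) (f : A -> T) (V : list T) :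
  (forall a, D a -> In (f a) V) ->
  exists l, (forall a, In a l -> D a) /\ forall a, D a -> exists b, In b l /\ f a = f b.
Proof.
  move=> h.
  have : exists l, (forall a, In a l -> D a) /\
    forall a, D a -> In (f a) V -> exists b, In b l /\ f a = f b.
  { clear h; elim: V => [|v V [l [h1 h2]]]; first by exists []; split.
    case: (classic (exists b, D b /\ f b = v)) => [[b [Db e]]|no].
    - exists (b :: l); split=> [a [<-|]|a Da /= [e'|i]] //; first exact: h1.
      + by exists b; split; [left|rewrite e].
      + by have [b' [? ?]] := h2 a Da i; exists b'; split; [right|].
    - exists l; split=> // a Da /= [e|i]; last exact: h2.
      by case: no; exists a. }
  by move=> [l [h1 h2]]; exists l; split=> // a Da; apply: h2 => //; apply: h.
Qed.

(** * Word length, balls and packings *)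

Definition alphabet (G : Group) (X : list G) := X ++ map (ginv G) X.

Lemma pw_words (G : Group) (X : list G) j x :
  pw (alphabet G X) j x <-> exists w, word_over G X w /\ eval_word G w = x /\ length w <= j.
Proof.
  split.
  - elim: j x => [|j IH] x /=; first by move=> ->; exists []; split=> //; constructor.
    move=> [/IH [w [? [? ?]]]|[s [y [i [/IH [w [h1 [<- h2]]] ->]]]]].
    + by exists w; split=> //; split=> //; lia.
    + have [h|/in_map_iff [t [<- h]]] := in_app_or _ _ _ i.
      * by exists ((true, s) :: w); split; [constructor|split=> //=; lia].
      * by exists ((false, t) :: w); split; [constructor|split=> //=; lia].
  - move=> [w [h [<- l]]]; apply: (pw_mono _ _ (length w)) => // {l}.
    elim: h => [|[b s] w' /= h1 h2 IH] //=.
    right; exists (letter G (b, s)), (eval_word G w'); split=> //; apply/in_or_app.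
    case: b; [by left|right]; rewrite /letter /=; exact: in_map.
Qed.

Lemma alphabet_symm (G : Group) (X : list G) : symm (alphabet G X).
Proof.
  move=> s /(@in_app_or _ _ _ _) [h|/in_map_iff [t [<- h]]]; apply/in_or_app.
  - by right; apply: in_map.
  - by left; rewrite invK.
Qed.

Section Length.
Variables (G : Group) (X : list G).
Hypothesis HX : generates G X.
Notation len := (word_norm G X).
Notation Xs := (alphabet G X).
Implicit Types x y z : G.

Lemma len_spec x : shortest_length G X x (len x).
Proof.
  apply: epsilon_spec.
  have [w [h1 h2]] := HX x.
  have [n [[w' [a [b c]]] hn]] := min_nat
    (fun n => exists w, word_over G X w /\ eval_word G w = x /\ length w = n)
    (ex_intro _ (length w) (ex_intro _ w (conj h1 (conj h2 eq_refl)))).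
  exists n; split; first by exists w'.
  by move=> w2 ? ?; apply: hn; exists w2.
Qed.

Lemma len_le x j : len x <= j <-> pw Xs j x.
Proof.
  have [[w [a [b c]]] h] := len_spec x; rewrite pw_words; split.
  - by move=> l; exists w; rewrite c.
  - by move=> [w' [h1 [h2 h3]]]; have := h w' h1 h2; lia.
Qed.

Lemma len1 : len one = 0.
Proof. by have : len one <= 0 by [apply/len_le]; lia. Qed.

Lemma lenM x y : len (x ** y) <= len x + len y.
Proof. by apply/len_le; apply: pw_add; apply/len_le. Qed.

Lemma lenV x : len (iv x) = len x.
Proof.
  have h : forall y, len (iv y) <= len y.
  { by move=> y; apply/len_le; apply: pw_inv; [exact: alphabet_symm|apply/len_le]. }
  by have := h x; have := h (iv x); rewrite invK; lia.
Qed.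

Lemma len_split x a b : len x <= a + b -> exists y z, len y <= a /\ len z <= b /\ x = y ** z.
Proof.
  move/len_le/pw_split => [y [z [p [q e]]]].
  by exists y, z; split; [apply/len_le|split; [apply/len_le|]].
Qed.

Lemma gen_all : gen_by Xs (fun _ : G => True).
Proof.
  split; first exact: alphabet_symm.
  move=> x; split=> // _; exists (len x); exact/len_le.
Qed.

Lemma ball_ex r : exists l : list G, NoDup l /\ forall x, In x l <-> len x <= r.
Proof.
  have [l h] := pw_fin _ Xs r.
  exists (nodup (fun x y => excluded_middle_informative (x = y)) l).
  split; first exact: NoDup_nodup.
  by move=> x; rewrite nodup_In h len_le.
Qed.

Definition ball r : list G := epsilon (inhabits [])
  (fun l => NoDup l /\ forall x, In x l <-> len x <= r).
Lemma ball_spec r : NoDup (ball r) /\ forall x, In x (ball r) <-> len x <= r.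
Proof. exact: (epsilon_spec _ _ (ball_ex r)). Qed.
Lemma ball_NoDup r : NoDup (ball r).
Proof. by case: (ball_spec r). Qed.
Lemma in_ball r x : In x (ball r) <-> len x <= r.
Proof. by case: (ball_spec r). Qed.
Definition vol r := length (ball r).

Lemma vol_pos r : 1 <= vol r.
Proof.
  rewrite /vol; have : In one (ball r) by apply/in_ball; rewrite len1; lia.
  by case: (ball r) => //= *; lia.
Qed.

Lemma NoDup_vol r (l : list G) : NoDup l -> (forall x, In x l -> len x <= r) -> length l <= vol r.
Proof. by move=> h1 h2; apply: NoDup_incl_length => // x /h2 /in_ball. Qed.

Lemma vol_mono r s : r <= s -> vol r <= vol s.
Proof. by move=> h; apply: NoDup_vol; [exact: ball_NoDup|move=> x /in_ball; lia]. Qed.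

(** The separation [R / b] is written without integer division. *)
Definition packing a b R N := forall l, Forall (fun x => len x <= a * R) l ->
  FOP (fun x y => R < b * len (iv x ** y)) l -> length l <= N.

Definition covering r s N := exists F, length F <= N /\
  forall x, len x <= r -> exists f, In f F /\ len (iv f ** x) <= s.

(** A maximal separated set is a net; a point that cannot be added is at distance [d] with
    [b * d <= R] from some member, which gives [d <= R / b] also for the integer quotient. *)
Lemma packing_covering a b R N : 1 <= b -> packing a b R N -> covering (a * R) (R / b) N.
Proof.
  move=> b1 h.
  have [n [[l [h1 [h2 h3]]] hm]] : exists n, (exists l, length l = n /\
      Forall (fun x => len x <= a * R) l /\ FOP (fun x y => R < b * len (iv x ** y)) l) /\
    forall m, (exists l, length l = m /\ Forall (fun x => len x <= a * R) l /\
      FOP (fun x y => R < b * len (iv x ** y)) l) -> m <= n.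
  { apply: (max_nat _ N).
    - by exists 0, []; split=> //; split; constructor.
    - by move=> n [l [<- [? ?]]]; apply: h. }
  exists l; split; first exact: h.
  move=> x hx; apply: NNPP => no.
  have : S n <= n; last lia.
  apply: hm; exists (x :: l); split; first by rewrite /= h1.
  split; constructor=> //; apply/Forall_forall => y iy.
  apply/Nat.nle_gt => hle; apply: no; exists y; split=> //.
  apply: Nat.div_le_lower_bound; first lia.
  have -> : iv y ** x = iv (iv x ** y) by gs.
  by rewrite lenV.
Qed.

Lemma covering_vol r s N : covering r s N -> vol r <= N * vol s.
Proof.
  move=> [F [hF h]].
  have : vol r <= length (map (fun p => fst p ** snd p) (list_prod F (ball s))).
  { apply: NoDup_incl_length; first exact: ball_NoDup.
    move=> x /in_ball /h [f [iF l]]; apply/in_map_iff; exists (f, iv f ** x).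
    split; first by rewrite /=; gs.
    by apply: in_prod => //; apply/in_ball. }
  rewrite length_map length_prod -/(vol s) => h'.
  by apply: (Nat.le_trans _ _ _ h'); apply: Nat.mul_le_mono_r.
Qed.

(** A word of length [(j + 2) * s] is cut into a prefix of length [2 * s] and a suffix of length
    [j * s]. Moving the prefix into the ball of radius [s] leaves a word of length [(j + 1) * s], to
    which induction applies. *)
Lemma covering_mul s N j : covering (2 * s) s N -> covering (S j * s) s (N ^ j).
Proof.
  move=> hc; have [F [hF h]] := hc.
  elim: j => [|j [F' [hF' h']]].
  - exists [one]; split=> //= x hx; exists one; split; [by left|gs; lia].
  - exists (map (fun p => fst p ** snd p) (list_prod F F')); split.
    + by rewrite length_map length_prod /=; apply: Nat.mul_le_mono.
    + move=> x hx.
      have [|y [z [hy [hz ->]]]] := len_split x (2 * s) (j * s); first by move: hx => /=; lia.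
      have [f [iF lf]] := h y hy.
      have [|f' [iF' lf']] := h' (iv f ** y ** z).
      { by apply: (Nat.le_trans _ _ _ (lenM _ _)) => /=; lia. }
      exists (f ** f'); split; last by move: lf'; gs.
      by apply/in_map_iff; exists (f, f'); split=> //; apply: in_prod.
Qed.

(** One scale suffices to exclude exponential growth: the covering gives
    [vol (S j * s) <= N ^ j * vol s] for all [j], while the assumed growth forces at least
    [(2 * N) ^ S j]. Dividing leaves [2 ^ j <= vol s] for every [j]. *)
Lemma growth_contra s s0 c N : 1 <= N -> covering (2 * s) s N -> 1 <= c -> c * s0 <= s -> 2 * N <= 2 ^ s0 ->
  ~ forall m, 2 ^ m <= vol (c * m).
Proof.
  move=> N1 hc c1 hs h2 hv.
  have : forall j, 2 ^ j <= vol s.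
  { move=> j.
    have a1 := hv (s0 * S j).
    have a2 : vol (c * (s0 * S j)) <= vol (S j * s) by apply: vol_mono; nia.
    have a3 := covering_vol _ _ _ (covering_mul s N j hc).
    have a4 : 2 ^ (s0 * S j) >= (2 * N) ^ S j by rewrite Nat.pow_mul_r; apply: Nat.pow_le_mono_l.
    rewrite Nat.pow_mul_l !Nat.pow_succ_r' in a4.
    have p : N ^ j <> 0 by apply: Nat.pow_nonzero; lia.
    have h : N ^ j * (2 * 2 ^ j * N) <= N ^ j * vol s by lia.
    have {}h : 2 * 2 ^ j * N <= vol s by apply/(Nat.mul_le_mono_pos_l _ _ (N ^ j)); lia.
    nia. }
  by move=> /(_ (vol s)); have := Nat.pow_gt_lin_r 2 (vol s); lia.
Qed.
End Length.

(** * Kernels of homomorphisms to the integers *)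

Lemma NoDup_map_inj (A B : Type) (f : A -> B) (l : list A) :
  (forall x y, In x l -> In y l -> f x = f y -> x = y) -> NoDup l -> NoDup (map f l).
Proof.
  elim: l => [|a l IH] h H /=; first by constructor.
  inversion H; subst; constructor.
  - move=> /in_map_iff [x [e i]]; apply: H2.
    by rewrite -(h x a) //; [right|left].
  - by apply: IH => // x y i j; apply: h; right.
Qed.

Lemma NoDup_list_prod (A B : Type) (l : list A) (l' : list B) :
  NoDup l -> NoDup l' -> NoDup (list_prod l l').
Proof.
  move=> h h'; elim: h => [|a l0 ni _ IH] /=; first by constructor.
  apply: NoDup_app => //.
  - by apply: NoDup_map_inj => // x y _ _ [].
  - by move=> [u v] /in_map_iff [y [[<- _] _]] /in_prod_iff [].
Qed.

Lemma length_codes m c : length (codes m c) = c ^ m.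
Proof. by elim: m => [|m IH] //=; rewrite length_map length_prod length_seq IH. Qed.

Lemma NoDup_codes m c : NoDup (codes m c).
Proof.
  elim: m => [|m IH] /=; first by constructor => //; constructor.
  apply: NoDup_map_inj; first by move=> [a b] [a' b'] _ _ /= [-> ->].
  by apply: NoDup_list_prod => //; exact: seq_NoDup.
Qed.

Lemma in_codes_S m c l : In l (codes (S m) c) <->
  exists a b, a < c /\ In b (codes m c) /\ l = a :: b.
Proof.
  rewrite /= in_map_iff; split.
  - by move=> [[a b] [<- /in_prod_iff [/in_seq [_ ?] ?]]]; exists a, b.
  - move=> [a [b [? [? ->]]]]; exists (a, b); split=> //; apply: in_prod => //.
    by apply/in_seq; lia.
Qed.

Section Powers.
Variable G : Group.
Implicit Types x y : G.

Fixpoint gpow x n : G := match n with 0 => one | S n' => x ** gpow x n' end.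
Definition zpow x (z : Z) : G :=
  match z with Z0 => one | Zpos p => gpow x (Pos.to_nat p) | Zneg p => gpow (iv x) (Pos.to_nat p) end.

Lemma gpow_add x m n : gpow x (m + n) = gpow x m ** gpow x n.
Proof. by elim: m => [|m IH] /=; [gs|rewrite IH; gs]. Qed.

Lemma zpow_of_nat x n : zpow x (Z.of_nat n) = gpow x n.
Proof. by case: n => [|n] //; rewrite /zpow /Z.of_nat SuccNat2Pos.id_succ. Qed.

Lemma zpow_opp_nat x n : zpow x (- Z.of_nat n) = gpow (iv x) n.
Proof. by case: n => [|n] //; rewrite /zpow /Z.of_nat /Z.opp SuccNat2Pos.id_succ. Qed.

Lemma zpow_succ x z : zpow x (Z.succ z) = x ** zpow x z.
Proof.
  case: (Z_le_gt_dec 0 z) => h.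
  - by rewrite -(Z2Nat.id z) // -Nat2Z.inj_succ !zpow_of_nat.
  - have -> : z = (- Z.of_nat (S (Z.to_nat (- Z.succ z))))%Z by lia.
    have -> : Z.succ (- Z.of_nat (S (Z.to_nat (- Z.succ z)))) = (- Z.of_nat (Z.to_nat (- Z.succ z)))%Z by lia.
    by rewrite !zpow_opp_nat /=; gs.
Qed.

Lemma zpow_pred x z : zpow x (Z.pred z) = iv x ** zpow x z.
Proof. by rewrite -{2}(Z.succ_pred z) zpow_succ; gs. Qed.

Lemma zpow_add x a z : zpow x (a + z) = zpow x a ** zpow x z.
Proof.
  elim/Z.peano_ind: a => [|a IH|a IH]; first by rewrite Z.add_0_l /=; gs.
  - by rewrite Z.add_succ_l !zpow_succ IH; gs.
  - by rewrite Z.add_pred_l !zpow_pred IH; gs.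
Qed.

Lemma zpow1 x : zpow x 1 = x.
Proof. by rewrite /zpow /=; gs. Qed.

Lemma zpow_opp x z : zpow x (- z) = iv (zpow x z).
Proof.
  apply: (cancel_l _ (zpow x z)); rewrite -zpow_add Z.add_opp_diag_r; gs. by [].
Qed.

Lemma zpow_mul x a z : zpow (zpow x a) z = zpow x (a * z).
Proof.
  elim/Z.peano_ind: z => [|w IH|w IH]; first by rewrite Z.mul_0_r.
  - by rewrite zpow_succ IH Z.mul_succ_r Z.add_comm zpow_add.
  - by rewrite zpow_pred IH Z.mul_pred_r -Z.add_opp_l zpow_add zpow_opp.
Qed.

Lemma zpow_inv x z : zpow (iv x) z = zpow x (- z).
Proof.
  elim/Z.peano_ind: z => [|y IH|y IH] //.
  - by rewrite Z.opp_succ zpow_succ zpow_pred IH.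
  - by rewrite Z.opp_pred zpow_succ zpow_pred IH; gs.
Qed.

Lemma sg_zpow H x z : is_subgroup G H -> H x -> H (zpow x z).
Proof.
  move=> sH Hx; elim/Z.peano_ind: z => [|y IH|y IH]; first exact: sg1.
  - by rewrite zpow_succ; apply: sgM.
  - by rewrite zpow_pred; apply: sgM => //; apply: sgV.
Qed.

Definition homZ (H : G -> Prop) (phi : G -> Z) :=
  forall x y, H x -> H y -> phi (x ** y) = (phi x + phi y)%Z.

Lemma homZ1 H phi : is_subgroup G H -> homZ H phi -> phi one = 0%Z.
Proof. by move=> sH h; have := h one one (sg1 _ _ sH) (sg1 _ _ sH); gs; lia. Qed.

Lemma homZV H phi x : is_subgroup G H -> homZ H phi -> H x -> phi (iv x) = (- phi x)%Z.
Proof.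
  move=> sH h Hx; have e := h x (iv x) Hx (sgV _ _ _ sH Hx); gsin e; move: e.
  by rewrite (homZ1 H) //; lia.
Qed.

Lemma homZ_zpow H phi x z : is_subgroup G H -> homZ H phi -> H x -> phi (zpow x z) = (z * phi x)%Z.
Proof.
  move=> sH h Hx; elim/Z.peano_ind: z => [|y IH|y IH]; first exact: (homZ1 H).
  - rewrite zpow_succ h //; [rewrite IH /Z.succ; ring|exact: sg_zpow].
  - by rewrite zpow_pred h; [rewrite (homZV H) // IH /Z.pred; ring|apply: sgV|apply: sg_zpow].
Qed.

Lemma ker_sg H phi : is_subgroup G H -> homZ H phi ->
  is_subgroup G (fun x => H x /\ phi x = 0%Z).
Proof.
  move=> sH h; split; [|split].
  - by split; [exact: sg1|exact: (homZ1 H)].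
  - by move=> x y [? e] [? e']; split; [exact: sgM|rewrite h // e e'].
  - by move=> x [? e]; split; [exact: sgV|rewrite (homZV H) // e].
Qed.

Lemma gen_sg (F : G -> Prop) : is_subgroup G (gen_subgroup G F).
Proof. by split; [|split] => *; [apply: gs_one|apply: gs_mul|apply: gs_inv]. Qed.

Lemma gen_least (F H : G -> Prop) : is_subgroup G H -> sub F H -> sub (gen_subgroup G F) H.
Proof.
  move=> sH h x; elim=> {x} [|x /h //|x y _ ? _ ?|x _ ?]; [exact: sg1|exact: sgM|exact: sgV].
Qed.

Lemma gen_fg (F : list G) : fg (gen_subgroup G (fun x => In x F)).
Proof.
  exists (alphabet G F); apply: gen_by_intro; [exact: gen_sg|exact: alphabet_symm| |].
  - move=> s /(@in_app_or _ _ _ _) [h|/in_map_iff [t [<- h]]]; first exact: gs_in.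
    by apply: gs_inv; apply: gs_in.
  - have sA := alphabet_symm G F.
    apply: gen_least.
    + split; [|split]; first by exists 0.
      * by move=> x y [j p] [k q]; exists (j + k); apply: pw_add.
      * by move=> x [j p]; exists j; apply: pw_inv.
    + by move=> x i; exists 1; apply: pw_gen; apply/in_or_app; left.
Qed.

Lemma gen_conj (F F' : G -> Prop) c : (forall x, F x -> gen_subgroup G F' (c ** x ** iv c)) ->
  forall x, gen_subgroup G F x -> gen_subgroup G F' (c ** x ** iv c).
Proof.
  move=> h; apply: gen_least => //; split; [|split].
  - by gs; apply: gs_one.
  - by move=> x y a b; have := gs_mul _ _ _ _ a b; gs.
  - by move=> x a; have := gs_inv _ _ _ a; gs.
Qed.
End Powers.
Arguments gpow {G}. Arguments zpow {G}. Arguments homZ {G}.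

(** * Milnor's argument: kernels of homomorphisms to Z under subexponential growth *)

Section Milnor.
Variables (G : Group) (X : list G).
Hypothesis HX : generates G X.
Notation len := (word_norm G X).
Hypothesis subexp : forall c, 1 <= c -> ~ forall m, 2 ^ m <= vol G X (c * m).

Definition cj (t k : G) (z : Z) : G := zpow t z ** k ** zpow t (- z).

Lemma cj_shift t k z w : zpow t w ** cj t k z ** iv (zpow t w) = cj t k (w + z).
Proof. by rewrite /cj !zpow_opp zpow_add; gs. Qed.

Lemma cj0 t k : cj t k 0 = k.
Proof. by rewrite /cj /=; gs. Qed.

Fixpoint milnor_word (t k : G) (l : list nat) : G :=
  match l with [] => one | e :: l' => gpow k e ** (t ** milnor_word t k l') end.

(** The [2 ^ m] products k^e1 t k^e2 t ... with exponents 0 or 1 have length linear in [m], so for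
    some [m] two of them coincide. At the first exponent where they differ, the equation writes [k]
    through conjugates of [k] by positive powers of [t]. *)
Lemma milnor_rel (t k : G) :
  exists p, gen_subgroup G (fun x => exists z, (1 <= z <= Z.of_nat p)%Z /\ x = cj t k z) k.
Proof.
  set W := milnor_word t k.
  have [m hm] : exists m, ~ 2 ^ m <= vol G X ((len k + len t + 1) * m).
  { by apply: not_all_ex_not; apply: subexp; lia. }
  have [l [l' [il [il' [ne e]]]]] : exists l l', In l (codes m 2) /\ In l' (codes m 2) /\ l <> l' /\ W l = W l'.
  { apply: NNPP => no; apply: hm.
    rewrite -length_codes -(length_map W); apply: NoDup_vol => //.
    - apply: NoDup_map_inj; last exact: NoDup_codes.
      by move=> l l' i i' e; apply: NNPP => ne; apply: no; exists l, l'.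
    - move=> x /in_map_iff [l [<- i]] {no}.
      elim: m l i => [|m IH] l; first by case=> // <-; rewrite /W /= len1 //; lia.
      move=> /in_codes_S [a [b [ha [/IH hb ->]]]].
      have h1 : len (gpow k a) <= len k.
      { by case: a ha => [|[|a]] ha /=; [rewrite len1 //|gs|]; lia. }
      have h2 := lenM _ _ HX (gpow k a) (t ** W b); have h3 := lenM _ _ HX t (W b).
      have -> : W (a :: b) = gpow k a ** (t ** W b) by [].
      rewrite Nat.mul_succ_r; lia. }
  (* Once its total power of [t] is divided out, [t] times a word is a product of conjugates
     [cj t k z] with [1 <= z <= n]. *)
  have inB : forall n l, In l (codes n 2) -> gen_subgroup G
      (fun x => exists z, (1 <= z <= Z.of_nat n)%Z /\ x = cj t k z) (t ** W l ** zpow t (- Z.of_nat (S n))).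
  { elim=> [|n IH] l0.
    - case=> // <-; rewrite zpow_opp zpow_of_nat /W /=; gs; exact: gs_one.
    - move=> /in_codes_S [a [b [ha [hb ->]]]].
      have := IH _ hb.
      have -> : zpow t (- Z.of_nat (S (S n))) = zpow t (- Z.of_nat (S n)) ** iv t.
      { by rewrite !zpow_opp !zpow_of_nat (gpow_add _ t 1 (S n)) /=; gs. }
      move=> h.
      have := gen_conj _ (fun x => exists z, (1 <= z <= Z.of_nat n)%Z /\ x = cj t k z)
           (fun x => exists z, (1 <= z <= Z.of_nat (S n))%Z /\ x = cj t k z) t _ _ h.
      have h1 : gen_subgroup G (fun x => exists z, (1 <= z <= Z.of_nat (S n))%Z /\ x = cj t k z)
            (t ** gpow k a ** iv t).
      { case: a ha => [|[|a]] ha; last lia.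
        - by rewrite /=; gs; exact: gs_one.
        - apply: gs_in; exists 1%Z; split; first lia.
          by rewrite /cj zpow_opp zpow1 /=; gs. }
      have -> : W (a :: b) = gpow k a ** (t ** W b) by [].
      move=> h2; have := gs_mul _ _ _ _ h1 (h2 _); gs; apply.
      move=> x [z [hz ->]]; apply: gs_in; exists (1 + z)%Z; split; first lia.
      by rewrite -cj_shift zpow1. }
  exists m.
  elim: m l l' il il' ne e {hm} => [|m IH] l l'; first by move=> [<-|[]] // [<-|[]].
  move=> /in_codes_S [a [b [ha [hb ->]]]] /in_codes_S [a' [b' [ha' [hb' ->]]]] ne e.
  have mono : forall x, gen_subgroup G (fun x => exists z, (1 <= z <= Z.of_nat m)%Z /\ x = cj t k z) x ->
     gen_subgroup G (fun x => exists z, (1 <= z <= Z.of_nat (S m))%Z /\ x = cj t k z) x.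
  { apply: gen_least; first exact: gen_sg.
    by move=> x [z [? ->]]; apply: gs_in; exists z; split; [lia|]. }
  have hbb := gs_mul _ _ _ _ (inB _ _ hb') (gs_inv _ _ _ (inB _ _ hb)).
  have hbb' := gs_mul _ _ _ _ (inB _ _ hb) (gs_inv _ _ _ (inB _ _ hb')).
  gsin hbb; gsin hbb'.
  have eW : forall a b, W (a :: b) = gpow k a ** (t ** W b) by [].
  rewrite !{}eW in e.
  case: a ha ne e => [|[|a]] ha ne e; last lia; case: a' ha' ne e => [|[|a']] ha' ne e; try lia; move: e => /=; gs => e.
  - apply: mono; apply: (IH b b') => //; last exact: (cancel_l _ _ _ _ e).
    by move=> h; apply: ne; rewrite h.
  - apply: mono; have ek : t ** (W b ** (iv (W b') ** iv t)) = k by rewrite !gassoc e; gs.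
    by rewrite ek in hbb'.
  - apply: mono; have ek : t ** (W b' ** (iv (W b) ** iv t)) = k by rewrite !gassoc -e; gs.
    by rewrite ek in hbb.
  - apply: mono; apply: (IH b b') => //; last exact: (cancel_l _ _ _ _ (cancel_l _ _ _ _ e)).
    by move=> h; apply: ne; rewrite h.
Qed.

(** The relation for [t] expresses a conjugate through those of larger exponent, the relation for
    [iv t] through those of smaller exponent. The window from [-q] to [p] therefore generates all
    conjugates, by induction in both directions. *)
Lemma milnor_all (t k : G) : exists F : list G, (forall f, In f F -> exists z, f = cj t k z) /\
  forall z, gen_subgroup G (fun x => In x F) (cj t k z).
Proof.
  have [p hp] := milnor_rel t k; have [q hq] := milnor_rel (iv t) k.
  exists (map (fun i => cj t k (Z.of_nat i - Z.of_nat q)) (seq 0 (p + q + 1))).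
  set F := map _ _.
  have inF : forall z, (- Z.of_nat q <= z <= Z.of_nat p)%Z -> In (cj t k z) F.
  { move=> z hz; apply/in_map_iff; exists (Z.to_nat (z + Z.of_nat q)); split.
    - by f_equal; lia.
    - by apply/in_seq; lia. }
  have up : forall z, (- Z.of_nat q <= z)%Z -> gen_subgroup G (fun x => In x F) (cj t k z).
  { apply: Zlt_lower_bound_ind => z IH hz.
    case: (Z_le_gt_dec z (Z.of_nat p)) => hzp; first by apply: gs_in; apply: inF.
    rewrite -(Z.add_0_r z) -cj_shift cj0; apply: gen_conj hq.
    move=> x [w [hw ->]].
    have -> : cj (iv t) k w = cj t k (- w) by rewrite /cj !zpow_inv.
    by rewrite cj_shift; apply: IH; lia. }
  have down : forall z, (- Z.of_nat p <= z)%Z -> gen_subgroup G (fun x => In x F) (cj t k (- z)).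
  { apply: Zlt_lower_bound_ind => z IH hz.
    case: (Z_le_gt_dec z (Z.of_nat q)) => hzp; first by apply: gs_in; apply: inF; lia.
    rewrite -(Z.add_0_r (- z)) -cj_shift cj0; apply: gen_conj hp.
    move=> x [w [hw ->]]; rewrite cj_shift.
    by have -> : (- z + w = - (z - w))%Z by [lia]; apply: IH; lia. }
  split; first by move=> f /in_map_iff [i [<- _]]; eexists.
  move=> z; case: (Z_le_gt_dec 0 z) => h; first by apply: up; lia.
  by rewrite -(Z.opp_involutive z); apply: down; lia.
Qed.

(** Let [t] realise the least positive value of [phi]. Each generator is a power of [t] times a
    kernel element [kk y], so the kernel is generated by the conjugates of the [kk y] by powers of
    [t]; finitely many suffice by [milnor_all]. *)
Lemma kernel_fg (L : G -> Prop) (phi : G -> Z) : fg L -> homZ L phi -> fg (fun x => L x /\ phi x = 0%Z).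
Proof.
  move=> [Y gY] hphi; have sL := gen_by_sg _ _ _ gY.
  case: (classic (exists x, L x /\ phi x <> 0%Z)) => [[x0 [Lx0 nx0]]|no]; last first.
  { exists Y; apply: gen_by_intro; [exact: ker_sg|by case: gY| |].
    - move=> s iY; have Ls := gen_by_in _ _ _ _ gY iY; split=> //.
      by apply: NNPP => h; apply: no; exists s.
    - by move=> x [Lx _]; apply gY. }
  have [n [[n0 [t [Lt et]]] hmin]] := min_nat (fun n => 0 < n /\ exists t, L t /\ phi t = Z.of_nat n)
    ltac:(exists (Z.to_nat (Z.abs (phi x0))); split; [lia|];
          case: (Z_le_gt_dec 0 (phi x0)) => h; [exists x0; split; [done|lia]|
            exists (iv x0); split; [exact: sgV|rewrite (homZV _ L) //; lia]]).
  set e := Z.of_nat n in et.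
  have dv : forall x, L x -> phi x = (e * (phi x / e))%Z.
  { move=> x Lx; have := Z.div_mod (phi x) e; have := Z.mod_pos_bound (phi x) e.
    move=> h1 h2; case: (Z.eq_dec (phi x mod e) 0) => h; first lia.
    exfalso; have : n <= Z.to_nat (phi x mod e); last lia.
    apply: hmin; split; first lia.
    exists (x ** zpow t (- (phi x / e))); split; first by apply: sgM => //; apply: sg_zpow.
    rewrite hphi //; last exact: sg_zpow.
    by rewrite (homZ_zpow _ L) // et; lia. }
  pose kk y := zpow t (- (phi y / e)) ** y.
  have kkL : forall y, L y -> L (kk y) /\ phi (kk y) = 0%Z.
  { move=> y Ly; split; first by apply: sgM => //; apply: sg_zpow.
    rewrite hphi //; last exact: sg_zpow.
    by rewrite (homZ_zpow _ L) // et; have := dv y Ly; lia. }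
  have cjL : forall k z, L k /\ phi k = 0%Z -> L (cj t k z) /\ phi (cj t k z) = 0%Z.
  { move=> k z [Lk ek]; have L1 := sg_zpow _ _ t z sL Lt; have L2 := sg_zpow _ _ t (- z) sL Lt.
    split; first by apply: sgM => //; apply: sgM.
    rewrite /cj !hphi //; last exact: sgM.
    by rewrite !(homZ_zpow _ L) // ek; lia. }
  have [F [hF0 hF2]] : exists F : list G,
     (forall f, In f F -> exists y z, In y Y /\ f = cj t (kk y) z) /\
     forall y z, In y Y -> gen_subgroup G (fun x => In x F) (cj t (kk y) z).
  { elim: Y {gY} => [|y l [F [h1 h2]]]; first by exists [].
    have [F' [h1' h2']] := milnor_all t (kk y).
    exists (F' ++ F); split.
    - move=> f /(@in_app_or _ _ _ _) [/h1' [z ->]|/h1 [y' [z [i ->]]]].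
      + by exists y, z; split; [left|].
      + by exists y', z; split; [right|].
    - move=> y' z [<-|i].
      + apply: (gen_least _ (fun x => In x F') _ (gen_sg _ _) _ _ (h2' z)).
        by move=> x ix; apply: gs_in; apply/in_or_app; left.
      + apply: (gen_least _ (fun x => In x F) _ (gen_sg _ _) _ _ (h2 y' z i)).
        by move=> x ix; apply: gs_in; apply/in_or_app; right. }
  have hF1 : forall f, In f F -> L f /\ phi f = 0%Z.
  { move=> f /hF0 [y [z [i ->]]]; apply: cjL; apply: kkL; exact: (gen_by_in _ _ _ _ gY i). }
  have E : (fun x => L x /\ phi x = 0%Z) = gen_subgroup G (fun x => In x F).
  { apply: functional_extensionality => x; apply: propositional_extensionality; split; last first.
    - by apply: (gen_least _ _ (fun x => L x /\ phi x = 0%Z)); [exact: ker_sg|exact: hF1].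
    - move=> [Lx ex]; have [j p] := proj1 (proj2 gY x) Lx.
      have : exists b z, gen_subgroup G (fun x => In x F) b /\ x = b ** zpow t z.
      { elim: j x p {Lx ex} => [|j IH] x /=.
        - by move=> ->; exists one, 0%Z; split; [exact: gs_one|gs].
        - move=> [/IH //|[s [y [iY [/IH [b [z [hb ->]]] ->]]]]].
          exists (cj t (kk s) (phi s / e) ** (zpow t (phi s / e) ** b ** iv (zpow t (phi s / e)))),
             (phi s / e + z)%Z; split.
          + apply: gs_mul; first exact: hF2.
            have hc : forall w y, gen_subgroup G (fun x => In x F) y ->
               gen_subgroup G (fun x => In x F) (zpow t w ** y ** iv (zpow t w)).
            { move=> w; apply: gen_conj => f /hF0 [y' [z' [i' ->]]].
              by rewrite cj_shift; apply: hF2. }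
            by apply: hc.
          + by rewrite /cj /kk !zpow_opp zpow_add; gs. }
      move=> [b [z [hb eb]]].
      have [Lb pb] : L b /\ phi b = 0%Z.
      { by apply: (gen_least _ (fun x => In x F) _ (ker_sg _ _ _ sL hphi) _ _ hb). }
      have : (z * e = 0)%Z.
      { by rewrite -ex eb hphi //; [rewrite pb (homZ_zpow _ L) // et|exact: sg_zpow]. }
      move=> hz; have {}hz : z = 0%Z by nia.
      by rewrite eb hz /=; gs. }
  rewrite E; exact: gen_fg.
Qed.
End Milnor.

Lemma code_exists (A : Type) (P : A -> nat -> Prop) c (l : list A) :
  (forall t, In t l -> exists j, j < c /\ P t j) ->
  exists k, In k (codes (length l) c) /\ Forall2 P l k.
Proof.
  elim: l => [|t l IH] h; first by exists []; split; [left|constructor].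
  have [|k [ik hk]] := IH; first by move=> t' i; apply: h; right.
  have [j [lj pj]] := h t (or_introl eq_refl).
  exists (j :: k); split; last by constructor.
  by apply/in_codes_S; exists j, k.
Qed.

Lemma Forall2_in (A : Type) (P P' : A -> nat -> Prop) l k t : Forall2 P l k -> Forall2 P' l k ->
  In t l -> exists j, P t j /\ P' t j.
Proof.
  move=> h; elim: h t => [|x j l' k' p _ IH] t h' //; inversion h'; subst.
  by case=> [<-|i]; [exists j|apply: IH].
Qed.

Lemma FOP_eq (A : Type) (R : A -> A -> Prop) l x y : (forall x y, R x y -> R y x) ->
  FOP (fun x y => ~ R x y) l -> In x l -> In y l -> R x y -> x = y.
Proof.
  move=> sym; elim=> [|a l' h _ IH] //= [<-|i] [<-|j] // r.
  - by move/Forall_forall: h => /(_ y j).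
  - by move/Forall_forall: h => /(_ x i) []; apply: sym.
  - exact: IH.
Qed.

Lemma FOP_le1 (A : Type) (R : A -> A -> Prop) l :
  (forall x y, In x l -> In y l -> ~ R x y) -> FOP R l -> length l <= 1.
Proof.
  case: l => [|a [|b l]] h H /=; try lia.
  inversion H; subst; case: (h a b); [by left|by right; left|exact: Forall_inv H2].
Qed.

(** * Invariant series with finite and infinite cyclic steps *)

Section Chains.
Variable G : Group.
Implicit Types (H K L D : G -> Prop) (x y z : G).

Lemma fi_distinct H K : is_subgroup G K -> fi H K -> exists l, (forall t, In t l -> H t) /\
  FOP (fun x y => ~ K (iv x ** y)) l /\ forall x, H x -> exists t, In t l /\ K (iv t ** x).
Proof.
  move=> sK [l0 [_ hl0]].
  have [n [[l [h1 [h2 h3]]] hm]] : exists n, (exists l, length l = n /\ (forall t, In t l -> H t) /\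
      FOP (fun x y => ~ K (iv x ** y)) l) /\
    forall m, (exists l, length l = m /\ (forall t, In t l -> H t) /\
      FOP (fun x y => ~ K (iv x ** y)) l) -> m <= n.
  { apply: (max_nat _ (1 * length l0)); first by exists 0, []; split=> //; split=> //; constructor.
    move=> n [l [<- [h1 h2]]].
    apply: (count_classes _ _ _ (fun t x => K (iv t ** x)) _ _ _ _ _ h2).
    - by move=> x /h1 /hl0.
    - move=> v l' _ _ /Forall_forall F; apply: FOP_le1 => x y ix iy; apply.
      by have := sgM _ _ _ _ sK (sgV _ _ _ sK (F x ix)) (F y iy); gs. }
  exists l; split=> //; split=> // x Hx; apply: NNPP => no.
  have : S n <= n; last lia.
  apply: hm; exists (x :: l); split; first by rewrite /= h1.
  split; first by move=> t [<-|/h2].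
  constructor=> //; apply/Forall_forall => t it k; apply: no; exists t; split=> //.
  exact: sgVM.
Qed.

Lemma fi_power H K x : is_subgroup G H -> is_subgroup G K -> fi H K -> H x ->
  exists n, 0 < n /\ K (gpow x n).
Proof.
  move=> sH sK [l [_ hl]] Hx.
  apply: NNPP => no.
  have : length (seq 0 (S (length l))) <= 1 * length l; last by rewrite length_seq; lia.
  apply: (count_classes _ _ (fun i j => i <> j) (fun t i => K (iv t ** gpow x i))).
  - by move=> i _; apply: hl; rewrite -zpow_of_nat; apply: sg_zpow.
  - move=> v l' _ _ /Forall_forall F; apply: FOP_le1 => a b ia ib ne.
    have h : K (iv (gpow x a) ** gpow x b).
    { by have := sgM _ _ _ _ sK (sgV _ _ _ sK (F a ia)) (F b ib); gs. }
    case: (Nat.lt_ge_cases a b) => c.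
    + case: no; exists (b - a); split; first lia.
      by move: h; rewrite {1}(_ : b = a + (b - a)); [|lia]; rewrite gpow_add; gs.
    + case: no; exists (a - b); split; first lia.
      have := sgV _ _ _ sK h; rewrite {1}(_ : a = b + (a - b)); [|lia]; rewrite gpow_add; gs.
      by [].
  - by apply/NoDup_FOP; exact: seq_NoDup.
Qed.

Definition normal_by D K := forall g x, D g -> K x -> K (g ** x ** iv g).

Lemma normal_by_V D K g x : is_subgroup G D -> normal_by D K -> D g -> K x -> K (iv g ** x ** g).
Proof. by move=> sD h Dg Kx; have := h _ _ (sgV _ _ _ sD Dg) Kx; gs. Qed.

(** A [D]-invariant series from [K] down to [L] whose steps have finite index
    or infinite cyclic quotients, [h] of them infinite. *)
Inductive chain D : (G -> Prop) -> (G -> Prop) -> nat -> Prop :=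
| chain_nil L : is_subgroup G L -> normal_by D L -> chain D L L 0
| chain_fin K K' L h : is_subgroup G K -> normal_by D K -> fi K K' -> sub K' K ->
    chain D K' L h -> chain D K L h
| chain_Z K K' phi L h : is_subgroup G K -> normal_by D K -> homZ K phi ->
    (forall g x, D g -> K x -> phi (g ** x ** iv g) = phi x) ->
    (exists x, K x /\ phi x <> 0%Z) -> (forall x, K' x <-> K x /\ phi x = 0%Z) ->
    chain D K' L h -> chain D K L (S h).

Lemma chain_props D K L h : chain D K L h ->
  is_subgroup G K /\ normal_by D K /\ is_subgroup G L /\ normal_by D L /\ sub L K.
Proof.
  elim=> {K L h} [L sL nL|K K' L h sK nK f s _ [? [? [? [? i]]]]|K K' phi L h sK nK _ _ _ e _ [? [? [? [? i]]]]];
    do 4 (split; first by []) => //.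
  - by move=> x /i /s.
  - by move=> x /i /e [].
Qed.

Lemma chain_append_fin D K L L' h : chain D K L h -> is_subgroup G L' -> normal_by D L' ->
  fi L L' -> sub L' L -> chain D K L' h.
Proof.
  elim=> {K L h} [L sL nL|K K' L h sK nK f s _ IH|K K' phi L h sK nK hp inv nz e _ IH] sL' nL' f' s'.
  - by apply: (chain_fin _ _ L') => //; apply: chain_nil.
  - by apply: (chain_fin _ _ K') => //; apply: IH.
  - by apply: (chain_Z _ _ K' phi) => //; apply: IH.
Qed.

Lemma chain_append_Z D K L L' phi h : chain D K L h -> is_subgroup G L' -> normal_by D L' ->
  homZ L phi -> (forall g x, D g -> L x -> phi (g ** x ** iv g) = phi x) ->
  (exists x, L x /\ phi x <> 0%Z) -> (forall x, L' x <-> L x /\ phi x = 0%Z) -> chain D K L' (S h).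
Proof.
  elim=> {K L h} [L sL nL|K K' L h sK nK f s _ IH|K K' psi L h sK nK hp inv nz e _ IH] sL' nL' hphi inv' nz' e'.
  - by apply: (chain_Z _ _ L' phi) => //; apply: chain_nil.
  - by apply: (chain_fin _ _ K') => //; apply: IH.
  - by apply: (chain_Z _ _ K' psi) => //; apply: IH.
Qed.

(** Every term is intersected with [D']. In a cyclic step the homomorphism stays nonzero because a
    positive power of a witness lies in [D']. *)
Lemma chain_restrict D D' K L h : chain D K L h -> is_subgroup G D -> is_subgroup G D' -> sub D' D ->
  fi D D' -> sub K D -> chain D' (fun x => K x /\ D' x) (fun x => L x /\ D' x) h.
Proof.
  move=> c sD sD' s f.
  have nrm : forall M, normal_by D M -> normal_by D' (fun x => M x /\ D' x).
  { move=> M nK g x Dg [Kx Dx]; split; first by apply: nK => //; apply: s.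
    by apply: sgM => //; [apply: sgM|apply: sgV]. }
  elim: c => {K L h} [L sL nL|K K' L h sK nK f' s' c IH|K K' phi L h sK nK hp inv [x [Kx nz]] e c IH] KD.
  - by apply: chain_nil; [apply: sg_and|apply: nrm].
  - have [sK' _] := chain_props _ _ _ _ c.
    apply: (chain_fin _ _ (fun x => K' x /\ D' x)); [exact: sg_and|exact: nrm| | |].
    + have := fi_restrict _ K (fun x => K x /\ D' x) K' (sg_and _ _ _ sK sD') sK' (fun x h => proj1 h) f'.
      by apply: fi_mono => x [[]].
    + by move=> x [/s'].
    + by apply: IH => x /s' /KD.
  - apply: (chain_Z _ _ (fun x => K' x /\ D' x) phi); [exact: sg_and|exact: nrm| | | | |].
    + by move=> a b [? _] [? _]; apply: hp.
    + by move=> g y Dg [Ky _]; apply: inv => //; apply: s.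
    + have [n [n0 hn]] := fi_power D D' x sD sD' f (KD _ Kx).
      exists (gpow x n); rewrite -zpow_of_nat in hn *; split; first by split=> //; apply: sg_zpow.
      by rewrite (homZ_zpow _ K) //; nia.
    + by move=> y; rewrite e; tauto.
    + by apply: IH => y /e [/KD].
Qed.

Lemma homZ_min L phi : is_subgroup G L -> homZ L phi -> (exists x, L x /\ phi x <> 0%Z) ->
  exists e t, (0 < e)%Z /\ L t /\ phi t = e /\ forall x, L x -> (phi x = e * (phi x / e))%Z.
Proof.
  move=> sL hphi [x0 [Lx0 nx0]].
  have [n [[n0 [t [Lt et]]] hmin]] := min_nat (fun n => 0 < n /\ exists t, L t /\ phi t = Z.of_nat n)
    ltac:(exists (Z.to_nat (Z.abs (phi x0))); split; [lia|];
          case: (Z_le_gt_dec 0 (phi x0)) => h; [exists x0; split; [done|lia]|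
            exists (iv x0); split; [exact: sgV|rewrite (homZV _ L) //; lia]]).
  exists (Z.of_nat n), t; split; first lia; split=> //; split=> // x Lx.
  set e := Z.of_nat n in et *.
  have := Z.div_mod (phi x) e; have := Z.mod_pos_bound (phi x) e.
  move=> h1 h2; case: (Z.eq_dec (phi x mod e) 0) => h; first lia.
  exfalso; have : n <= Z.to_nat (phi x mod e); last lia.
  apply: hmin; split; first lia.
  exists (x ** zpow t (- (phi x / e))); split; first by apply: sgM => //; apply: sg_zpow.
  rewrite hphi //; last exact: sg_zpow.
  by rewrite (homZ_zpow _ L) // et; lia.
Qed.

Definition in_dbl g (A E : list G) z := exists a a' e, In a A /\ In a' A /\ In e E /\
  z = (iv g ** a ** g) ** a' ** e.

(** The sets [A^g A E]; in an infinite cyclic layer the fibre of [A] over [j]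
    contributes to the fibres over [2j] and [2j + e]. *)
Lemma chain_doubling D K L h : is_subgroup G D -> sub K D -> chain D K L h ->
  exists E, (forall e, In e E -> K e) /\ forall g A, D g -> NoDup A -> (forall a, In a A -> K a) ->
    exists Z, NoDup Z /\ 2 ^ h * length A <= length Z /\ forall z, In z Z -> in_dbl g A E z.
Proof.
  move=> sD KD c.
  elim: c KD => {K L h} [L sL nL|K K' L h sK nK f s c IH|K K' phi L h sK nK hp inv nz e0 c IH] KD.
  - exists [one]; split; first by move=> e [<-|[]]; apply: sg1.
    move=> g [|a A] Dg nd hA; first by exists []; split; [constructor|split].
    exists (map (fun x => (iv g ** a ** g) ** x) (a :: A)); split; [|split].
    + by apply: NoDup_map_inj => // x y _ _ /cancel_l.
    + by rewrite length_map /=; lia.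
    + move=> z /in_map_iff [x [<- ix]]; exists a, x, one; split; first by left.
      by split=> //; split; [left|gs].
  - have [sK' [nK' _]] := chain_props _ _ _ _ c.
    have [|E [hE IHE]] := IH; first by move=> x /s /KD.
    have [l [lK [ld lc]]] := fi_distinct _ _ sK' f.
    exists (map (fun p => fst p ** snd p) (list_prod E l)); split.
    { by move=> e /in_map_iff [[u v] [<- /in_prod_iff [/hE /s ? /lK ?]]]; apply: sgM. }
    move=> g A Dg nd hA.
    (* Finite step: only the fullest coset of [K'] is kept; the loss is made up by multiplying with
       all representatives in [l] at the end. *)
    have [t [it At]] : exists t, In t l /\
       length A <= length (cfilter (fun x => K' (iv t ** x)) A) * length l.
    { have [n [[t [it et]] hm]] : exists n, (exists t, In t l /\ length (cfilter (fun x => K' (iv t ** x)) A) = n) /\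
         forall m, (exists t, In t l /\ length (cfilter (fun x => K' (iv t ** x)) A) = m) -> m <= n.
      { apply: (max_nat _ (length A)).
        - have [t [it _]] := lc one (sg1 _ _ sK); by eexists; exists t.
        - move=> n [t [_ <-]]; apply: NoDup_incl_length; first exact: NoDup_filter.
          by move=> x /in_cfilter []. }
      exists t; split=> //; rewrite et.
      apply: (count_classes _ _ (fun x y => x <> y) (fun t x => K' (iv t ** x))).
      - by move=> x /hA /lc.
      - move=> v l' iv inc F nd'; apply: Nat.le_trans (hm _ (ex_intro _ v (conj iv eq_refl))).
        apply: NoDup_incl_length; first exact/NoDup_FOP.
        by move=> x ix; apply/in_cfilter; split; [apply: inc|move/Forall_forall: F; apply].
      - exact/NoDup_FOP. }
    set At' := cfilter _ A in At.
    have Dt : D t by apply: KD; apply: lK.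
    (* Moving the kept part of [A] into [K'] by [iv t] changes the conjugating element from [g] to
       [g ** t]; this is why the statement carries an arbitrary [g]. *)
    have [|||Z [ndZ [lZ hZ]]] := IHE (g ** t) (map (fun x => iv t ** x) At').
    + exact: sgM.
    + by apply: NoDup_map_inj; [move=> x y _ _ /cancel_l|apply: NoDup_filter].
    + by move=> a /in_map_iff [x [<- /in_cfilter []]].
    + have ZK' : forall z, In z Z -> K' z.
      { move=> z /hZ [a [a' [e [/in_map_iff [x [<- /in_cfilter [_ kx]]] [/in_map_iff [y [<- /in_cfilter [_ ky]]] [/hE ke ->]]]]]].
        apply: sgM => //; apply: sgM => //; apply: (normal_by_V D) => //; exact: sgM. }
      exists (map (fun p => (iv g ** t ** g) ** t ** fst p ** snd p) (list_prod Z l)); split; [|split].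
      * apply: NoDup_map_inj.
        -- move=> [z u] [z' u'] /in_prod_iff [iz iu] /in_prod_iff [iz' iu'] /=; gs => e.
           move/cancel_l/cancel_l/cancel_l/cancel_l: e => e.
           have eu' : u' = iv z' ** (z ** u) by rewrite e; gs.
           have eu : u = u'.
           { apply: (FOP_eq _ (fun x y => K' (iv x ** y)) l) => //.
             - by move=> x y; apply: sgVM.
             - have -> : iv u ** u' = iv u ** (iv z' ** z) ** u by rewrite eu'; gs.
               apply: (normal_by_V D) => //; first by apply: KD; apply: lK.
               by apply: sgM => //; [apply: sgV => //|]; apply: ZK'. }
           by rewrite -eu in e *; rewrite (cancel_r _ _ _ _ e).
        -- apply: NoDup_list_prod => //; apply/NoDup_FOP.
           apply: FOP_impl ld => x y _ _ h1 h2; apply: h1; rewrite h2; gs; exact: sg1.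
      * rewrite length_map length_prod; rewrite length_map in lZ; nia.
      * move=> z /in_map_iff [[z0 u] [<- /in_prod_iff [/= /hZ h0 iu]]].
        move: h0 => [a [a' [e [/in_map_iff [x [<- /in_cfilter [ix _]]] [/in_map_iff [y [<- /in_cfilter [iy _]]] [ie ->]]]]]].
        exists x, y, (e ** u); split=> //; split=> //; split; last by gs.
        by apply/in_map_iff; exists (e, u); split=> //; apply: in_prod.
  - have [sK' [nK' _]] := chain_props _ _ _ _ c.
    have K'K : sub K' K by move=> x /e0 [].
    have [|E [hE IHE]] := IH; first by move=> x /K'K /KD.
    have [e [t [ep [Kt [et dv]]]]] := homZ_min _ _ sK hp nz.
    exists (E ++ map (fun x => x ** t) E); split.
    { move=> x /(@in_app_or _ _ _ _) [/hE /K'K //|/in_map_iff [y [<- /hE /K'K Ky]]]; exact: sgM. }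
    move=> g A Dg nd hA.
    have pc : forall x, K x -> phi (iv g ** x ** g) = phi x.
    { by move=> x Kx; have := inv _ _ (sgV _ _ _ sD Dg) Kx; gs. }
    have nc : forall x, K x -> K (iv g ** x ** g) by move=> x; apply: (normal_by_V D).
    (* Induction on the size of [A], removing one fibre of [phi] at a time. Recording the values
       that [phi] can take on [Z] keeps the contributions of different fibres disjoint. *)
    have : exists Z, NoDup Z /\ 2 ^ S h * length A <= length Z /\ forall z, In z Z ->
      in_dbl g A (E ++ map (fun x => x ** t) E) z /\
      exists a, In a A /\ (phi z = 2 * phi a \/ phi z = 2 * phi a + e)%Z.
    { remember (length A) as n eqn:En.
      elim/(well_founded_induction lt_wf): n A En nd hA => n IHn A En nd hA.
      case: A En nd hA => [|a0 A0] En nd hA.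
      { by exists []; split; [constructor|rewrite En /=; split; [lia|]]. }
      set A := a0 :: A0 in En nd hA *.
      set A1 := cfilter (fun x => phi x = phi a0) A.
      set A2 := cfilter (fun x => ~ phi x = phi a0) A.
      have eA : n = length A1 + length A2.
      { rewrite En /A1 /A2; clear; elim: A => [|a l IHl] //=.
        rewrite /cfilter /= cbN; case: (cb (phi a = phi a0)) => /=; rewrite IHl /cfilter; lia. }
      have i1 : 0 < length A1.
      { have : In a0 A1 by apply/in_cfilter; split; [left|].
        by case: (A1) => //= *; lia. }
      have [||||Z2 [nd2 [l2 h2]]] := IHn (length A2) _ A2; [lia|by []|exact: NoDup_filter| |].
      { by move=> a /in_cfilter [/hA]. }
      have Ka0 : K a0 by apply: hA; left.
      have Da0 := KD _ Ka0.
      have [|||Z1 [nd1 [l1 h1]]] := IHE (g ** a0) (map (fun x => iv a0 ** x) A1).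
      + exact: sgM.
      + by apply: NoDup_map_inj; [move=> x y _ _ /cancel_l|apply: NoDup_filter].
      + move=> a /in_map_iff [x [<- /in_cfilter [/hA Kx ex]]]; apply/e0; split.
        * by apply: sgM => //; apply: sgV.
        * by rewrite hp //; [rewrite (homZV _ K) // ex; lia|apply: sgV].
      + have f1 : forall z, In z Z1 -> in_dbl g A (E ++ map (fun x => x ** t) E) (iv g ** a0 ** g ** a0 ** z) /\
            in_dbl g A (E ++ map (fun x => x ** t) E) (iv g ** a0 ** g ** a0 ** z ** t).
        { move=> z /h1 [a [a' [x [/in_map_iff [b [<- /in_cfilter [ib _]]] [/in_map_iff [b' [<- /in_cfilter [ib' _]]] [ix ->]]]]]].
          split.
          - exists b, b', x; split=> //; split=> //; split; last by gs.
            by apply/in_or_app; left.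
          - exists b, b', (x ** t); split=> //; split=> //; split; last by gs.
            by apply/in_or_app; right; apply/in_map_iff; exists x. }
        have g1 : forall z, In z Z1 -> K z /\ phi z = 0%Z.
        { move=> z /h1 [a [a' [x [/in_map_iff [b [<- /in_cfilter [ib eb]]] [/in_map_iff [b' [<- /in_cfilter [ib' eb']]] [/hE /e0 [Kx ex] ->]]]]]].
          have Kb := hA _ ib; have Kb' := hA _ ib'.
          have k0 := sgV _ _ _ sK Ka0.
          have k1 : K (iv a0 ** b) by apply: sgM.
          have k2 : K (iv a0 ** b') by apply: sgM.
          have Dga : D (g ** a0) by apply: sgM.
          have k3 : K (iv (g ** a0) ** (iv a0 ** b) ** (g ** a0)) by apply: (normal_by_V D).
          have ew : phi (iv (g ** a0) ** (iv a0 ** b) ** (g ** a0)) = phi (iv a0 ** b).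
          { by have := inv _ _ (sgV _ _ _ sD Dga) k1; gs. }
          move: k3 ew; set w := (iv (g ** a0) ** _ ** _) => k3 ew.
          split; first by apply: sgM => //; apply: sgM.
          rewrite hp //; last exact: sgM.
          by rewrite hp // ew !hp // (homZV _ K) // eb eb' ex; lia. }
        have kga := nc _ Ka0.
        have p1 : forall z, In z Z1 -> phi (iv g ** a0 ** g ** a0 ** z) = (2 * phi a0)%Z.
        { move=> z /g1 [Kz ez]; rewrite (hp _ z) //; last exact: sgM.
          by rewrite (hp _ a0) // pc // ez; lia. }
        have p2 : forall z, In z Z1 -> phi (iv g ** a0 ** g ** a0 ** z ** t) = (2 * phi a0 + e)%Z.
        { move=> z iz; have [Kz _] := g1 z iz; rewrite (hp _ t) //; first by rewrite p1 // et.
          by apply: sgM => //; apply: sgM. }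
        have p3 : forall z, In z Z2 -> phi z <> (2 * phi a0)%Z /\ phi z <> (2 * phi a0 + e)%Z.
        { move=> z /h2 [_ [a [/in_cfilter [ia na] hz]]].
          have d1 := dv _ (hA _ ia); have d2 := dv _ Ka0.
          move: d1 d2; set qa := (phi a / e)%Z; set q0 := (phi a0 / e)%Z => d1 d2.
          (* All values of [phi] are multiples of [e], so [2 * phi a] and [2 * phi a0 + e] differ by
             an odd multiple of [e]. *)
          have odd : forall q : Z, (e * (2 * q + 1) <> 0)%Z by move=> q /Z.mul_eq_0 []; lia.
          split; case: hz => -> hh; first by apply: na; lia.
          - by apply: (odd (qa - q0)%Z); lia.
          - by apply: (odd (q0 - qa)%Z); lia.
          - by apply: na; lia. }
        exists (Z2 ++ map (fun z => iv g ** a0 ** g ** a0 ** z) Z1 ++ map (fun z => iv g ** a0 ** g ** a0 ** z ** t) Z1).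
        split; [|split].
        * apply: NoDup_app => //.
          -- apply: NoDup_app.
             ++ by apply: NoDup_map_inj => // x y _ _ /cancel_l.
             ++ by apply: NoDup_map_inj => // x y _ _ /cancel_r /cancel_l.
             ++ by move=> x /in_map_iff [z [<- /p1 e1]] /in_map_iff [z' [ee /p2 e2]]; rewrite ee in e2; lia.
          -- move=> x /p3 [n1 n2] /(@in_app_or _ _ _ _) [/in_map_iff [z [ee /p1]]|/in_map_iff [z [ee /p2]]]; by rewrite ee.
        * rewrite !length_app !length_map; rewrite length_map in l1; rewrite eA.
          rewrite Nat.pow_succ_r' in l2 *; nia.
        * move=> z /(@in_app_or _ _ _ _) [/h2 [[a [a' [x [/in_cfilter [i _] [/in_cfilter [i' _] q]]]]] [b [/in_cfilter [ib _] hb]]]|].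
          -- split; first by exists a, a', x.
             by exists b.
          -- move=> /(@in_app_or _ _ _ _) [/in_map_iff [z0 [<- iz]]|/in_map_iff [z0 [<- iz]]].
             ++ split; first by case: (f1 _ iz).
                exists a0; split; [by left|left; exact: p1].
             ++ split; first by case: (f1 _ iz).
                exists a0; split; [by left|right; exact: p2]. }
    by move=> [Z [h1 [h2 h3]]]; exists Z; split=> //; split=> // z /h3 [].
Qed.

(** A series of length [c] from [K] down to the trivial group with [[K_i, A]] inside [K_(i+1)]. When
    [A] lies in [K] it bounds the nilpotency class of [A]. *)
Fixpoint central_layers (A K : G -> Prop) (c : nat) : Prop :=
  match c with
  | 0 => forall x, K x -> x = one
  | S c' => exists K', central_layers A K' c' /\
              is_subgroup G K' /\ forall x a, K x -> A a -> K' (commutator G x a)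
  end.

Lemma central_layers_mono A A' K c : sub A' A -> central_layers A K c -> central_layers A' K c.
Proof.
  move=> s; elim: c K => [|c IH] K //= [K' [/IH h [sK' h']]]; exists K'; split=> //; split=> // x a Kx /s.
  exact: h'.
Qed.

(** [D] permutes the finitely many cosets of [K'] in [K] by conjugation, and [A] is the kernel of
    this action. The code of [a] lists the coset to which each representative is sent. *)
Lemma acts_trivially_fi D K K' : is_subgroup G D -> is_subgroup G K' -> normal_by D K ->
  normal_by D K' -> sub K' K -> fi K K' ->
  exists A, is_subgroup G A /\ sub A D /\ fi D A /\ forall x a, K x -> A a -> K' (commutator G x a).
Proof.
  move=> sD sK' nK nK' s [l [lK lc]].
  set A := fun a => D a /\ forall x, K x -> K' (iv x ** (a ** x ** iv a)).
  have sA : is_subgroup G A.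
  { split; [|split].
    - by split=> [|x Kx]; [exact: sg1|gs; exact: sg1].
    - move=> a b [Da ha] [Db hb]; split=> [|x Kx]; first exact: sgM.
      by have := sgM _ _ _ _ sK' (hb x Kx) (ha _ (nK _ _ Db Kx)); gs.
    - move=> a [Da ha]; split=> [|x Kx]; first exact: sgV.
      have := sgV _ _ _ sK' (ha _ (nK _ _ (sgV _ _ _ sD Da) Kx)); gs; by []. }
  exists A; split=> //; split; first by move=> a [].
  split.
  - apply: (fi_class _ _ (codes (length l) (length l))
      (fun c a => Forall2 (fun t j => K' (iv (nth j l one) ** (a ** t ** iv a))) l c)).
    + move=> a Da; have [|c [? ?]] := code_exists _ (fun t j => K' (iv (nth j l one) ** (a ** t ** iv a))) (length l) l.
      * move=> t it; have [t' [it' k]] := lc _ (nK _ _ Da (lK _ it)).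
        have [j [lj ej]] := In_nth _ _ one it'.
        by exists j; rewrite ej.
      * by exists c.
    + move=> c a b Da Db Fa Fb; split; first by apply: sgM => //; apply: sgV.
      have ht : forall t, In t l -> K' (iv t ** (iv a ** b ** t ** iv (iv a ** b))).
      { move=> t it; have [j [h1 h2]] := Forall2_in _ _ _ _ _ _ Fa Fb it.
        have h3 := sgM _ _ _ _ sK' (sgV _ _ _ sK' h1) h2.
        have := nK' _ _ (sgV _ _ _ sD Da) h3; gs; by []. }
      have Dab : D (iv a ** b) by apply: sgM => //; apply: sgV.
      move=> x Kx; have [t [it k]] := lc _ Kx.
      have h1 := nK' _ _ Dab k.
      have h2 := sgM _ _ _ _ sK' (sgV _ _ _ sK' k) (sgM _ _ _ _ sK' (ht t it) h1).
      move: h2; gs; by [].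
  - move=> x a Kx Aa; have [_ h] := sgV _ _ _ sA Aa.
    by have := h x Kx; rewrite /commutator; gs.
Qed.

(** Finite steps are centralised by a finite index subgroup, cyclic steps by all of [D], because
    [phi] is invariant under conjugation. *)
Lemma chain_central D K L h : chain D K L h -> is_subgroup G D -> (forall x, L x -> x = one) ->
  exists A c, is_subgroup G A /\ sub A D /\ fi D A /\ central_layers A K c.
Proof.
  move=> c sD; elim: c => {K L h} [L sL nL|K K' L h sK nK f s c IH|K K' phi L h sK nK hp inv nz e0 c IH] hL.
  - by exists D, 0; do ! split=> //; exact: fi_refl.
  - have [A [n [sA [sAD [fA cA]]]]] := IH hL; have [sK' [nK' _]] := chain_props _ _ _ _ c.
    have [A' [sA' [sAD' [fA' cA']]]] := acts_trivially_fi _ _ _ sD sK' nK nK' s f.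
    exists (fun x => A x /\ A' x), (S n); split; first exact: sg_and.
    split; first by move=> x [/sAD].
    split; first exact: fi_and.
    exists K'; split; first by apply: central_layers_mono cA => x [].
    by split=> // x a Kx [_ /cA']; apply.
  - have [A [n [sA [sAD [fA cA]]]]] := IH hL; have [sK' [nK' _]] := chain_props _ _ _ _ c.
    exists A, (S n); do 3 (split; first by []) => //.
    exists K'; split=> //; split=> // x a Kx /sAD Da; apply/e0.
    have Da' := sgV _ _ _ sD Da.
    have -> : commutator G x a = iv x ** (iv a ** x ** iv (iv a)) by rewrite /commutator; gs.
    have Kc := nK _ _ Da' Kx; have Kx' := sgV _ _ _ sK Kx.
    split; first exact: sgM.
    by rewrite hp // (inv _ _ Da' Kx) (homZV _ K) //; lia.
Qed.

Lemma central_layers_nilpotent A K c k : central_layers A K c -> (forall x, lower_central G A (S k) x -> K x) ->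
  forall x, lower_central G A (S (k + c)) x -> x = one.
Proof.
  elim: c k K => [|c IH] k K /=; first by move=> h1 h2 x; rewrite Nat.add_0_r => /h2 /h1.
  move=> [K' [h1 [sK' h2]]] h3; rewrite -plus_n_Sm; apply: (IH (S k) K') => //.
  apply: (gen_least _ _ K' sK') => z [x [y [hx [Ay ->]]]].
  by apply: h2 => //; apply: h3.
Qed.

Lemma chain_virtually_nilpotent D L h : is_subgroup G D -> fi (fun _ => True) D -> chain D D L h ->
  fin L -> virtually_nilpotent G.
Proof.
  move=> sD fD c [l hl]; have [_ [nD [sL [nL s]]]] := chain_props _ _ _ _ c.
  have c1 : chain D D (fun x => x = one) h.
  { apply: (chain_append_fin _ _ L) => //.
    - split; [|split] => //; [by move=> x y -> ->; gs|by move=> x ->; gs].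
    - by move=> g x _ ->; gs.
    - apply: (fi_class _ _ l (fun t x => t = x)); first by move=> x /hl; exists x.
      by move=> t x y _ _ <- <-; gs.
    - by move=> x ->; exact: sg1. }
  have [A [n [sA [sAD [fA cA]]]]] := chain_central _ _ _ _ c1 sD (fun _ h => h).
  exists A; split=> //; split.
  - have [l' [_ h']] := fi_trans _ _ _ _ sA fD fA.
    by exists l' => g; apply: h'.
  - split=> //; exists (0 + n); exact: (central_layers_nilpotent _ _ _ 0 cA).
Qed.
End Chains.

(** Take for [A] the elements of [D] of length at most [b + R]. The translates of the enlarged set
    by representatives of the cosets of [D] are disjoint and lie in the ball of radius
    [2 * R + 4 * b], hence in that of radius [3 * R], which [N] balls of radius [R] cover. So
    [2 ^ h * vol R <= N * vol R]. *)
Lemma chain_bound (G : Group) (X : list G) (HX : generates G X) D L h N :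
  is_subgroup G D -> fi (fun _ => True) D -> chain G D D L h ->
  (forall R0, exists R, R0 <= R /\ packing G X 3 1 R N) -> 2 ^ h <= N.
Proof.
  move=> sD fD c hN.
  have [E [hE HE]] := chain_doubling _ _ _ _ _ sD (fun x h => h) c.
  have [l [_ [ld lc]]] := fi_distinct _ _ _ sD fD.
  pose len := word_norm G X.
  have bd : forall F : list G, exists b, forall x, In x F -> len x <= b.
  { elim=> [|a F [b hb]]; first by exists 0.
    exists (len a + b) => x [<-|/hb]; lia. }
  have [b hb] := bd (l ++ E).
  have [R [hR pk]] := hN (3 * b + b).
  set A := cfilter D (ball G X (b + R)).
  have ndA : NoDup A by apply: NoDup_filter; apply: ball_NoDup.
  have [Z [ndZ [lZ hZ]]] := HE one A (sg1 _ _ sD) ndA (fun a i => proj2 (proj1 (in_cfilter _ _ _) i)).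
  have h1 : vol G X R <= length A * length l.
  { apply: (count_classes _ _ (fun x y => x <> y) (fun t x => D (iv t ** x))).
    - by move=> x _; apply: lc.
    - move=> v l' iv' inc F nd.
      rewrite -(length_map (fun x => iv v ** x)); apply: NoDup_incl_length.
      + by apply: NoDup_map_inj; [move=> x y _ _ /cancel_l|apply/NoDup_FOP].
      + move=> y /in_map_iff [x [<- ix]]; apply/in_cfilter; split; last by move/Forall_forall: F; apply.
        apply/in_ball => //; have := lenM _ _ HX (iv v) x; rewrite lenV //.
        have : len v <= b by apply: hb; apply/in_or_app; left.
        by have := inc x ix; rewrite in_ball // /len; lia.
    - by apply/NoDup_FOP; apply: ball_NoDup. }
  have h2 : length (map (fun p => fst p ** snd p) (list_prod l Z)) <= vol G X (3 * R).
  { apply: NoDup_vol => //.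
    - apply: NoDup_map_inj.
      + move=> [t z] [t' z'] /in_prod_iff [it iz] /in_prod_iff [it' iz'] /= e.
        have DZ : forall z, In z Z -> D z.
        { move=> y /hZ [a [a' [x [/in_cfilter [_ da] [/in_cfilter [_ da'] [/hE dx ->]]]]]].
          by gs; apply: sgM => //; apply: sgM. }
        have et : t = t'.
        { apply: (FOP_eq _ (fun x y => D (iv x ** y)) l) => //; first by move=> x y; apply: sgVM.
          have -> : iv t ** t' = z ** iv z'.
          { apply: (cancel_l _ t); apply: (cancel_r _ z'); gs; by rewrite e. }
          apply: sgM => //; [exact: DZ|apply: sgV => //; exact: DZ]. }
        by rewrite -et in e *; rewrite (cancel_l _ _ _ _ e).
      + apply: NoDup_list_prod => //; apply/NoDup_FOP.
        apply: FOP_impl ld => x y _ _ q1 q2; apply: q1; rewrite q2; gs; exact: sg1.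
    - move=> x /in_map_iff [[t z] [<- /in_prod_iff [it /hZ]]] /=.
      move=> [a [a' [y [/in_cfilter [/in_ball ia _] [/in_cfilter [/in_ball ia' _] [iy ->]]]]]].
      have q1 : len t <= b by apply: hb; apply/in_or_app; left.
      have q2 : len y <= b by apply: hb; apply/in_or_app; right.
      have := ia HX; have := ia' HX; gs.
      have := lenM _ _ HX t (a ** (a' ** y)); have := lenM _ _ HX a (a' ** y); have := lenM _ _ HX a' y.
      rewrite /len in q1 q2; lia. }
  have h3 := covering_vol _ _ HX _ _ _ (packing_covering _ _ HX _ _ _ _ (le_n 1) pk).
  rewrite length_map length_prod in h2.
  rewrite Nat.div_1_r in h3.
  have h4 := vol_pos _ _ HX R.
  have : 2 ^ h * vol G X R <= N * vol G X R by nia.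
  by move=> h5; apply/(Nat.mul_le_mono_pos_r _ _ (vol G X R)).
Qed.

(** * Infinite abelianizations *)

Section Abelian.
Variable G : Group.
Implicit Types (H K L D B : G -> Prop) (x y z : G).

(** Some finite index subgroup [H1] of [H] has infinite abelianization. *)
Definition virt_inf_abelian H := exists H1 K, is_subgroup G H1 /\ sub H1 H /\ fi H H1 /\
  is_subgroup G K /\ sub K H1 /\ (forall x y, H1 x -> H1 y -> K (commutator G x y)) /\ ~ fi H1 K.

Lemma via_fi H H' : sub H' H -> fi H H' -> virt_inf_abelian H' -> virt_inf_abelian H.
Proof.
  move=> s f [H1 [K [s1 [i1 [f1 [sK [iK [cK nf]]]]]]]]; exists H1, K; split=> //.
  split; first by move=> x /i1 /s.
  by split=> //; apply: (fi_trans _ _ H').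
Qed.

Section Quotient.
Variables H K : G -> Prop.
Hypotheses (sH : is_subgroup G H) (sK : is_subgroup G K).
Hypothesis KH : sub K H.
Hypothesis cK : forall x y, H x -> H y -> K (commutator G x y).

Lemma above_normal B g u : is_subgroup G B -> sub K B -> sub B H -> H g -> B u -> B (g ** u ** iv g).
Proof.
  move=> sB KB BH Hg Bu; have h := KB _ (cK u (iv g) (BH _ Bu) (sgV _ _ _ sH Hg)).
  by have := sgM _ _ _ _ sB Bu h; rewrite /commutator; gs.
Qed.

Lemma gpow_mul_mod x y m : H x -> H y -> K (iv (gpow x m ** gpow y m) ** gpow (x ** y) m).
Proof.
  move=> Hx Hy; elim: m => [|m IH]; first by rewrite /=; gs; exact: sg1.
  have hp : forall z n, H z -> H (gpow z n) by move=> z n Hz; rewrite -zpow_of_nat; apply: sg_zpow.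
  have h1 := cK y (gpow x m) Hy (hp _ _ Hx).
  have h2 := above_normal K (iv (gpow y m)) _ sK (fun _ h => h) KH (sgV _ _ _ sH (hp _ m Hy)) h1.
  have := sgM _ _ _ _ sK h2 IH; rewrite /commutator /=; gs; by [].
Qed.

Definition adjoin a B x := exists m : Z, B (zpow a (- m) ** x).

Lemma adjoin_sg a B : is_subgroup G B -> sub K B -> sub B H -> H a -> is_subgroup G (adjoin a B).
Proof.
  move=> sB KB BH Ha; split; [|split].
  - by exists 0%Z => /=; gs; exact: sg1.
  - move=> x y [m hx] [n hy]; exists (m + n)%Z.
    have h := above_normal B (zpow a (- n)) _ sB KB BH (sg_zpow _ _ _ _ sH Ha) hx.
    have := sgM _ _ _ _ sB h hy; by rewrite !zpow_opp zpow_add; gs.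
  - move=> x [m hx]; exists (- m)%Z.
    have := above_normal B (zpow a m) _ sB KB BH (sg_zpow _ _ _ _ sH Ha) (sgV _ _ _ sB hx).
    by rewrite !zpow_opp; gs.
Qed.

(** This alternative stands in for the structure theorem of finitely generated abelian groups; it is
    carried along while the generators of [H] are adjoined to [K] one by one. *)
Definition small_or_hom B := fi B K \/ exists phi, homZ B phi /\ (forall k, K k -> phi k = 0%Z) /\
  exists x, B x /\ phi x <> 0%Z.

(** If a positive power of [a] lies in [B], finiteness is inherited, and a homomorphism is composed
    with the [m]-th power map, which is multiplicative modulo [K]. Otherwise the exponent of [a] is
    well defined modulo [B] and is the desired homomorphism. *)
Lemma adjoin_step a B : is_subgroup G B -> sub K B -> sub B H -> H a -> small_or_hom B ->
  small_or_hom (adjoin a B).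
Proof.
  move=> sB KB BH Ha hB.
  have sB' := adjoin_sg a B sB KB BH Ha.
  have BB' : sub B (adjoin a B) by move=> x Bx; exists 0%Z => /=; gs.
  have B'H : sub (adjoin a B) H.
  { move=> x [m /BH h]; have := sgM _ _ _ _ sH (sg_zpow _ _ a m sH Ha) h.
    by rewrite zpow_opp; gs. }
  case: (classic (exists m, 0 < m /\ B (gpow a m))) => [[m [m0 Bm]]|no].
  - case: hB => [f|[phi [hp [hk [x0 [Bx0 nx0]]]]]].
    + left; apply: (fi_trans _ _ B) => //.
      apply: (wfi_fi _ _ _ (map (gpow a) (seq 0 m))) => // x [z hz].
      set i := Z.to_nat (z mod Z.of_nat m).
      have zb := Z.mod_pos_bound z (Z.of_nat m).
      exists (gpow a i); split.
      * by apply/in_map_iff; exists i; split=> //; apply/in_seq; lia.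
      * have h1 := sg_zpow _ _ _ (z / Z.of_nat m)%Z sB Bm.
        rewrite -zpow_of_nat zpow_mul in h1; have := sgM _ _ _ _ sB h1 hz.
        rewrite -zpow_of_nat -zpow_opp gassoc -zpow_add.
        have -> : (Z.of_nat m * (z / Z.of_nat m) + - z)%Z = (- Z.of_nat i)%Z.
        { rewrite /i; have := Z.div_mod z (Z.of_nat m); lia. }
        by [].
    + right; exists (fun x => phi (gpow x m)).
      have inB : forall x, adjoin a B x -> B (gpow x m).
      { move=> x [z hz]; have Haz := sg_zpow _ _ a z sH Ha.
        have h := KB _ (gpow_mul_mod (zpow a z) (zpow a (- z) ** x) m Haz (BH _ hz)).
        have := sgM _ _ _ _ sB (sgM _ _ _ _ sB (sg_zpow _ _ _ z sB Bm) (sg_zpow _ _ _ (Z.of_nat m) sB hz)) h.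
        have -> : zpow a z ** (zpow a (- z) ** x) = x by rewrite zpow_opp; gs.
        have -> : zpow (gpow a m) z = gpow (zpow a z) m.
        { by rewrite -!zpow_of_nat !zpow_mul Z.mul_comm. }
        by rewrite zpow_of_nat; gs. }
      split; [|split].
      * move=> x y hx hy.
        have k := gpow_mul_mod x y m (B'H _ hx) (B'H _ hy).
        have := hp _ _ (sgM _ _ _ _ sB (inB _ hx) (inB _ hy)) (KB _ k).
        rewrite mulKr (hk _ k) => ->.
        by rewrite hp; [lia|exact: inB|exact: inB].
      * by move=> k Kk; rewrite -zpow_of_nat; apply: hk; apply: sg_zpow.
      * exists x0; split; first exact: BB'.
        by rewrite -zpow_of_nat (homZ_zpow _ B) //; nia.
  - right.
    have noz : forall m, B (zpow a m) -> m = 0%Z.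
    { move=> m Bm; apply: NNPP => nm; apply: no; exists (Z.to_nat (Z.abs m)); split; first lia.
      rewrite -zpow_of_nat Z2Nat.id; last lia.
      case: (Z_le_gt_dec 0 m) => c; first by rewrite Z.abs_eq.
      by rewrite Z.abs_neq; [rewrite zpow_opp; apply: sgV|lia]. }
    have uniq : forall m n x, B (zpow a (- m) ** x) -> B (zpow a (- n) ** x) -> m = n.
    { move=> m n x h1 h2; have := sgM _ _ _ _ sB h2 (sgV _ _ _ sB h1).
      have -> : zpow a (- n) ** x ** iv (zpow a (- m) ** x) = zpow a (m - n).
      { by rewrite -Z.add_opp_l zpow_add !zpow_opp; gs. }
      by move/noz; lia. }
    set phi := fun x => epsilon (inhabits 0%Z) (fun m => B (zpow a (- m) ** x)).
    have pe : forall m x, B (zpow a (- m) ** x) -> phi x = m.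
    { move=> m x h; apply: (uniq _ _ x) => //.
      exact: (epsilon_spec (inhabits 0%Z) (fun m => B (zpow a (- m) ** x)) (ex_intro _ m h)). }
    exists phi; split; [|split].
    + move=> x y [m hx] [n hy]; rewrite (pe _ _ hx) (pe _ _ hy); apply: pe.
      have h := above_normal B (zpow a (- n)) _ sB KB BH (sg_zpow _ _ _ _ sH Ha) hx.
      have := sgM _ _ _ _ sB h hy; by rewrite !zpow_opp zpow_add; gs.
    + by move=> k Kk; apply: pe => /=; gs; apply: KB.
    + exists a; split; first by exists 1%Z; rewrite zpow_opp zpow1; gs; exact: sg1.
      by rewrite (pe 1%Z) //; rewrite zpow_opp zpow1; gs; exact: sg1.
Qed.

Lemma abelian_quotient_hom : fg H -> ~ fi H K -> exists phi, homZ H phi /\ exists x, H x /\ phi x <> 0%Z.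
Proof.
  move=> [Y gY] nf.
  have [B [sB [KB [BH [YB hB]]]]] : exists B, is_subgroup G B /\ sub K B /\ sub B H /\
     (forall y, In y Y -> B y) /\ small_or_hom B.
  { have : forall y, In y Y -> H y by move=> y; apply: gen_by_in gY.
    elim: Y {gY} => [|a l IH] hl.
    - by exists K; do ! split=> //; left; apply: fi_refl.
    - have [|B [sB [KB [BH [YB hB]]]]] := IH; first by move=> y i; apply: hl; right.
      have Ha : H a by apply: hl; left.
      exists (adjoin a B); split; first exact: adjoin_sg.
      split; first by move=> k /KB Bk; exists 0%Z => /=; gs.
      split.
      { move=> x [m /BH h]; have := sgM _ _ _ _ sH (sg_zpow _ _ a m sH Ha) h.
        by rewrite zpow_opp; gs. }
      split; last exact: adjoin_step.
      move=> y [<-|/YB By]; first by exists 1%Z; rewrite zpow_opp zpow1; gs; exact: sg1.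
      by exists 0%Z => /=; gs. }
  have HB : sub H B by move=> x /(proj2 gY) [j p]; apply: (pw_sg _ Y j).
  case: hB => [f|[phi [hp [_ [x [Bx nx]]]]]].
  - by case: nf; apply: (fi_sub _ B).
  - exists phi; split; first by move=> x' y' /HB hx /HB hy; apply: hp.
    by exists x; split=> //; apply: BH.
Qed.
End Quotient.

Lemma via_hom H : fg H -> virt_inf_abelian H -> exists H1 phi, is_subgroup G H1 /\ sub H1 H /\ fi H H1 /\
  homZ H1 phi /\ exists x, H1 x /\ phi x <> 0%Z.
Proof.
  move=> fH [H1 [K [s1 [i1 [f1 [sK [iK [cK nf]]]]]]]].
  have [|phi [hp nz]] := abelian_quotient_hom H1 K s1 sK iK cK _ nf; first exact: (fg_fi _ H).
  by exists H1, phi.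
Qed.
End Abelian.
Arguments virt_inf_abelian {G}.

(** A conjugate of [H] is a coset stabiliser for the action of [L] twisted by [g], and this action
    is determined by its table on generators of [L] and coset representatives. Finitely many tables
    occur, so finitely many conjugates have to be intersected. *)
Lemma conj_core (G : Group) (D L H : G -> Prop) : is_subgroup G D -> is_subgroup G H -> fg L ->
  normal_by G D L -> sub H L -> fi L H ->
  exists K, is_subgroup G K /\ sub K H /\ fi L K /\ normal_by G D K.
Proof.
  move=> sD sH [Y gY] nL s f; have sL := gen_by_sg _ _ _ gY.
  have [l [lL lc]] := f.
  set K := fun x => L x /\ forall g, D g -> H (iv g ** x ** g).
  have nLV : forall g x, D g -> L x -> L (iv g ** x ** g) by move=> g x; apply: normal_by_V.
  have sK : is_subgroup G K.
  { split; [|split].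
    - split; first exact: sg1.
      by move=> g Dg; gs; exact: sg1.
    - move=> x y [Lx hx] [Ly hy]; split; first exact: sgM.
      by move=> g Dg; have := sgM _ _ _ _ sH (hx g Dg) (hy g Dg); gs.
    - move=> x [Lx hx]; split; first exact: sgV.
      by move=> g Dg; have := sgV _ _ _ sH (hx g Dg); gs. }
  exists K; split=> //; split; first by move=> x [_ /(_ one (sg1 _ _ sD))]; gs.
  split; last first.
  { move=> g x Dg [Lx hx]; split; first exact: nL.
    by move=> g' Dg'; have := hx _ (sgM _ _ _ _ sD (sgV _ _ _ sD Dg) Dg'); gs. }
  pose tab g k := In k (codes (length (list_prod Y l)) (length l)) /\
    Forall2 (fun p j => j < length l /\ H (iv (nth j l one) ** ((iv g ** fst p ** g) ** snd p)))
      (list_prod Y l) k.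
  have tabex : forall g, D g -> exists k, tab g k.
  { move=> g Dg; apply: code_exists => [[y t] /in_prod_iff [iy it]].
    have [|t' [it' kt]] := lc ((iv g ** y ** g) ** t).
    { apply: sgM => //; last exact: lL.
      by apply: nLV => //; apply: gen_by_in gY iy. }
    by have [j [lj ej]] := In_nth _ _ one it'; exists j; rewrite ej. }
  pose code g := epsilon (inhabits []) (tab g).
  have codeP : forall g, D g -> tab g (code g) by move=> g Dg; apply: epsilon_spec; apply: tabex.
  have [gl [gD gc]] := finite_image _ _ D code _ (fun g Dg => proj1 (codeP g Dg)).
  have same : forall a b x t, D a -> D b -> code a = code b -> L x -> In t l ->
     exists t', In t' l /\ H (iv t' ** (iv a ** x ** a ** t)) /\ H (iv t' ** (iv b ** x ** b ** t)).
  { move=> a b x t Da Db e /(proj2 gY) [j]; elim: j x t => [|j IH] x t /=.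
    - move=> -> it; have [t' [it' k]] := lc _ (lL _ it).
      by exists t'; gs.
    - move=> [/IH h it|[y [z [iy [/IH h ->]]]] it]; first exact: h.
      have [t1 [it1 [h1 h2]]] := h t it.
      have [_ Fa] := codeP a Da; have [_ Fb] := codeP b Db; rewrite -e in Fb.
      have [i [[li h3] [_ h4]]] := Forall2_in _ _ _ _ _ (y, t1) Fa Fb (in_prod _ _ _ _ iy it1).
      exists (nth i l one); split; first exact: nth_In.
      split.
      + by have := sgM _ _ _ _ sH h3 h1; rewrite /=; gs.
      + by have := sgM _ _ _ _ sH h4 h2; rewrite /=; gs. }
  (* [t0] represents the trivial coset, whose stabiliser under the twisted action is the conjugate
     in question. *)
  have [t0 [it0 Ht0]] := lc one (sg1 _ _ sL); gsin Ht0.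
  have {}Ht0 : H t0 by rewrite -(invK _ t0); apply: sgV.
  have same' : forall a b x, D a -> D b -> code a = code b -> L x -> H (iv a ** x ** a) -> H (iv b ** x ** b).
  { move=> a b x Da Db e Lx h; have [t' [_ [h1 h2]]] := same a b x t0 Da Db e Lx it0.
    have Ht' : H t'.
    { by have := sgM _ _ _ _ sH (sgM _ _ _ _ sH h Ht0) (sgV _ _ _ sH h1); gs. }
    by have := sgM _ _ _ _ sH (sgM _ _ _ _ sH Ht' h2) (sgV _ _ _ sH Ht0); gs. }
  have fone : forall g, D g -> is_subgroup G (fun x => H (iv g ** x ** g)) /\ fi L (fun x => H (iv g ** x ** g)).
  { move=> g Dg; have sg' : is_subgroup G (fun x => H (iv g ** x ** g)).
    { split; [|split].
      - by gs; exact: sg1.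
      - by move=> x y h1 h2; have := sgM _ _ _ _ sH h1 h2; gs.
      - by move=> x h; have := sgV _ _ _ sH h; gs. }
    split=> //; apply: (wfi_fi _ _ _ (map (fun t => g ** t ** iv g) l)) => // x Lx.
    have [t [it k]] := lc _ (nLV _ _ Dg Lx).
    exists (g ** t ** iv g); split; last by move: k; gs.
    by apply/in_map_iff; exists t. }
  have : is_subgroup G (fun x => L x /\ forall g, In g gl -> H (iv g ** x ** g)) /\
         fi L (fun x => L x /\ forall g, In g gl -> H (iv g ** x ** g)).
  { elim: gl gD {gc} => [|g gl IH] gD.
    - have -> : (fun x => L x /\ forall g, In g [] -> H (iv g ** x ** g)) = L.
      { by apply: functional_extensionality => x; apply: propositional_extensionality; split; [case|]. }
      by split=> //; apply: fi_refl.
    - have [|s1 f1] := IH; first by move=> a i; apply: gD; right.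
      have [s2 f2] := fone g (gD g (or_introl eq_refl)).
      have -> : (fun x => L x /\ forall g0, In g0 (g :: gl) -> H (iv g0 ** x ** g0)) =
        (fun x => H (iv g ** x ** g) /\ (L x /\ forall g, In g gl -> H (iv g ** x ** g))).
      { apply: functional_extensionality => x; apply: propositional_extensionality; split.
        - move=> [Lx h]; split; [by apply: h; left|split=> // a i; by apply: h; right].
        - by move=> [h [Lx h']]; split=> // a [<-|/h']. }
      by split; [apply: sg_and|apply: fi_and]. }
  move=> [_]; apply: fi_mono => x [Lx hx]; split=> // g Dg.
  have [b [ib e]] := gc g Dg.
  by apply: (same' b g) => //; [apply: gD|apply: hx].
Qed.

(** * Homomorphisms to Z with finite orbit, and prolongation of the series *)

Section FiniteOrbit.
Variables (G : Group) (X : list G).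
Hypothesis HX : generates G X.
Notation len := (word_norm G X).

Lemma len_list (F : list G) : exists b, forall x, In x F -> len x <= b.
Proof.
  elim: F => [|a F [b hb]]; first by exists 0.
  by exists (len a + b) => x [<-|/hb]; lia.
Qed.

Lemma homZ_bounded (K : G -> Prop) (phi : G -> Z) r : exists b, forall x, K x -> len x <= r -> Z.abs_nat (phi x) <= b.
Proof.
  have : exists b, forall x, In x (ball G X r) -> Z.abs_nat (phi x) <= b.
  { elim: (ball G X r) => [|a F [b hb]]; first by exists 0.
    by exists (Z.abs_nat (phi a) + b) => x [<-|/hb]; lia. }
  by move=> [b hb]; exists b => x _ lx; apply: hb; apply/in_ball.
Qed.

Definition bdd (K : G -> Prop) (phi : G -> Z) r b := forall x, K x -> len x <= r -> Z.abs_nat (phi x) <= b.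

(** If at each of the [N + 1] radii some homomorphism more than doubled its maximum, the points
    where this happens would be [R]-separated: an earlier point [y] within [R] of [x] would bound
    the value at [x] by [b + b]. That contradicts the packing bound. *)
Lemma tame_radius (K : G -> Prop) R N rho : is_subgroup G K -> packing G X 2 1 R N ->
  rho * (N + 1) <= R ->
  exists i, i <= N /\ forall phi b, homZ K phi -> bdd K phi (R + i * rho) b -> bdd K phi (R + (i + 1) * rho) (2 * b).
Proof.
  move=> sK pk hr; apply: NNPP => no.
  have bad : forall i, i <= N -> exists phi b x, homZ K phi /\ bdd K phi (R + i * rho) b /\ K x /\
     len x <= R + (i + 1) * rho /\ 2 * b < Z.abs_nat (phi x).
  { move=> i hi; apply: NNPP => no'; apply: no; exists i; split=> // phi b hp hb x Kx lx.
    by apply/Nat.nlt_ge => h; apply: no'; exists phi, b, x. }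
  have : forall n, n <= N + 1 -> exists l, length l = n /\ Forall (fun x => K x /\ len x <= R + n * rho) l /\
     FOP (fun x y => R < 1 * len (iv x ** y)) l.
  { elim=> [|n IH] hn; first by exists []; split=> //; split; constructor.
    have [|l [ll [lF lP]]] := IH; first lia.
    have [|phi [b [x [hp [hb [Kx [lx bx]]]]]]] := bad n; first lia.
    exists (x :: l); split; first by rewrite /= ll.
    split.
    - constructor; first by rewrite -(Nat.add_1_r n).
      by apply: Forall_impl lF => y [Ky ly]; split=> //=; lia.
    - constructor=> //; move/Forall_forall: lF => lF; apply/Forall_forall => y /lF [Ky ly].
      rewrite Nat.mul_1_l; apply/Nat.nle_gt => h.
      have h1 := hb y Ky ly.
      have h2 := hb (iv x ** y) (sgM _ _ _ _ sK (sgV _ _ _ sK Kx) Ky) ltac:(lia).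
      by rewrite hp // in h2; [rewrite (homZV _ K) // in h2; lia|apply: sgV]. }
  move=> /(_ (N + 1) (le_n _)) [l [ll [lF lP]]].
  have : length l <= N; last lia.
  apply: pk => //; apply: Forall_impl lF => x [_ h]; nia.
Qed.

(** Choose [phi] nonzero with least maximum [lam] on a ball of tame radius. Conjugates by short
    elements have maximum at most [2 * lam]; two of them congruent modulo 5 on generators differ by
    [5 * chi] with [chi] at most [4 * lam / 5 < lam], so [chi = 0] by minimality. Short words thus
    meet at most [5 ^ length Y] cosets of the stabiliser, which [coset_growth] turns into finite
    index. *)
Lemma finite_orbit (D K : G -> Prop) : fg D -> fg K -> normal_by G D K ->
  (exists N, forall R0, exists R, R0 <= R /\ packing G X 2 1 R N) ->
  (exists phi, homZ K phi /\ exists x, K x /\ phi x <> 0%Z) ->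
  exists D' phi, is_subgroup G D' /\ sub D' D /\ fi D D' /\ homZ K phi /\
    (forall g x, D' g -> K x -> phi (g ** x ** iv g) = phi x) /\ exists x, K x /\ phi x <> 0%Z.
Proof.
  move=> [Z0 gZ] [Y gY] nK [N hN] hex.
  have sD := gen_by_sg _ _ _ gZ; have sK := gen_by_sg _ _ _ gY.
  have nKV : forall g x, D g -> K x -> K (iv g ** x ** g) by move=> g x; apply: normal_by_V.
  have [c hc] := len_list (Z0 ++ Y).
  set M := 5 ^ length Y.
  have [R [hR pk]] := hN ((2 * (c * M) + c) * (N + 1)).
  (* Conjugation by a word of length at most [M] lengthens an element by at most [rho]. *)
  set rho := 2 * (c * M).
  have [|i [hi tame]] := tame_radius K R N rho sK pk; first by rewrite /rho; nia.
  set r := R + i * rho.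
  have hgen : forall phi, homZ K phi -> (forall y, In y Y -> phi y = 0%Z) -> forall x, K x -> phi x = 0%Z.
  { move=> phi hp h0 x /(proj2 gY) [j p].
    by apply: (proj2 (pw_sg _ Y j x _ (ker_sg _ K phi sK hp) _ p)) => s iY; split; [apply: gen_by_in gY iY|apply: h0]. }
  have [lam [[phi [hp [nz hl]]] hmin]] := min_nat
    (fun b => exists phi, homZ K phi /\ (exists x, K x /\ phi x <> 0%Z) /\ bdd K phi r b)
    ltac:(by move: hex => [phi [hp nz]]; have [b hb] := homZ_bounded K phi r; exists b, phi).
  have lam0 : 0 < lam.
  { case: lam hl {hmin} => [|lam] hl; last lia.
    exfalso; move: nz => [x [Kx]]; apply; apply: hgen => // y iY.
    have : Z.abs_nat (phi y) <= 0; last lia.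
    apply: hl; first exact: (gen_by_in _ _ _ _ gY).
    have : len y <= c by apply: hc; apply/in_or_app; right.
    by rewrite /r; nia. }
  pose ph g x := phi (iv g ** x ** g).
  have hph : forall g, D g -> homZ K (ph g).
  { move=> g Dg x y Kx Ky; rewrite /ph -hp; [|exact: nKV|exact: nKV].
    by f_equal; gs. }
  set D' := fun g => D g /\ forall x, K x -> phi (g ** x ** iv g) = phi x.
  have sD' : is_subgroup G D'.
  { split; [|split].
    - by split=> [|x Kx]; [exact: sg1|gs].
    - move=> g h [Dg hg] [Dh hh]; split=> [|x Kx]; first exact: sgM.
      by have := hg _ (nK _ _ Dh Kx); rewrite hh //; gs.
    - move=> g [Dg hg]; split=> [|x Kx]; first exact: sgV.
      by have := hg _ (nKV _ _ Dg Kx); gs. }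
  exists D', phi; split=> //; split; first by move=> g [].
  split; last by split=> //; split=> // g x [_ h]; exact: h.
  apply: (coset_growth _ Z0 _ _ M) => // l lM lF.
  have lD : forall g, In g l -> D g /\ len g <= c * M.
  { move=> g ig; move/Forall_forall: lM => /(_ g ig) p; split; first by apply: (proj2 (proj2 gZ g)); exists M.
    apply/len_le => //; apply: pw_pw p => s iZ; apply/len_le => //.
    by apply: hc; apply/in_or_app; left. }
  rewrite /M -length_codes.
  apply: (FOP_values _ _ (fun g => map (fun y => Z.to_nat (ph g y mod 5)) Y)).
  { move=> g _; rewrite -(length_map (fun y => Z.to_nat (ph g y mod 5)) Y); apply: in_codes.
    by apply/Forall_forall => j /in_map_iff [y [<- _]]; have := Z.mod_pos_bound (ph g y) 5; lia. }
  apply: FOP_impl lF => g h ig ih nD e; apply: nD.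
  have [Dg lg] := lD g ig; have [Dh lh] := lD h ih.
  have dv : forall x, K x -> ((ph g x - ph h x) mod 5 = 0)%Z.
  { move=> x /(proj2 gY) [j]; elim: j x => [|j IH] x /=.
    - by move=> ->; rewrite /ph; gs; rewrite Z.sub_diag.
    - move=> [/IH //|[s [y [iY [p ->]]]]].
      have Ky : K y by apply/(proj2 gY); exists j.
      have Ks : K s by apply: gen_by_in gY iY.
      rewrite !hph //.
      have e1 := IH y p.
      have e2 : (ph g s mod 5 = ph h s mod 5)%Z.
      { have := @ext_in_map _ _ _ _ _ e s iY.
        have := Z.mod_pos_bound (ph g s) 5; have := Z.mod_pos_bound (ph h s) 5; lia. }
      move: e1 e2; clear; move: (ph g s) (ph h s) (ph g y) (ph h y) => a b u v.
      by Z.to_euclidean_division_equations; lia. }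
  pose chi x := ((ph g x - ph h x) / 5)%Z.
  have chi5 : forall x, K x -> (ph g x - ph h x = 5 * chi x)%Z.
  { move=> x Kx; have := dv x Kx; have := Z.div_mod (ph g x - ph h x) 5; rewrite -/(chi x); lia. }
  have hchi : homZ K chi.
  { move=> x y Kx Ky; have := chi5 _ (sgM _ _ _ _ sK Kx Ky); have := chi5 x Kx; have := chi5 y Ky.
    by rewrite !hph //; lia. }
  have bph : forall a x, D a -> len a <= c * M -> K x -> len x <= r -> Z.abs_nat (ph a x) <= 2 * lam.
  { move=> a x Da la Kx lx; apply: (tame phi lam hp hl); first exact: nKV.
    have := lenM _ _ HX (iv a ** x) a; have := lenM _ _ HX (iv a) x; rewrite lenV //.
    by rewrite /r /rho in lx *; nia. }
  have chi0 : forall x, K x -> chi x = 0%Z.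
  { apply: NNPP => no; have : lam <= 4 * lam / 5.
    { apply: hmin; exists chi; split=> //; split.
      - by apply: NNPP => no'; apply: no => x Kx; apply: NNPP => nx; apply: no'; exists x.
      - move=> x Kx lx; apply: Nat.div_le_lower_bound; first lia.
        by have := bph g x Dg lg Kx lx; have := bph h x Dh lh Kx lx; have := chi5 x Kx; lia. }
    by move=> q; have := Nat.div_mod (4 * lam) 5; lia. }
  split; first by apply: sgM => //; apply: sgV.
  move=> x Kx; have Kh := nK _ _ Dh Kx.
  have := chi5 _ Kh; rewrite chi0 // /ph; gs; lia.
Qed.

(** [L] is shrunk to [K] and [D] to [D'] until [phi] becomes [D']-invariant, at the cost of finite
    steps only. The new bottom term is the kernel of [phi]; its finite generation allows the
    construction to be repeated. *)
Lemma chain_extend D L h : is_subgroup G D -> fi (fun _ => True) D -> chain G D D L h -> fg L ->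
  virt_inf_abelian L ->
  (exists N, forall R0, exists R, R0 <= R /\ packing G X 2 1 R N) ->
  (forall c, 1 <= c -> ~ forall m, 2 ^ m <= vol G X (c * m)) ->
  exists D' L', is_subgroup G D' /\ fi (fun _ => True) D' /\ chain G D' D' L' (S h) /\ fg L'.
Proof.
  move=> sD fD c fL via pk gr.
  have [_ [nD [sL [nL LD]]]] := chain_props _ _ _ _ _ c.
  have [H [phi0 [sH [HL [fH [hp0 [x0 [Hx0 nx0]]]]]]]] := via_hom _ _ fL via.
  have [K [sK [KH [fK nK]]]] := conj_core _ _ _ _ sD sH fL nL HL fH.
  have KL : sub K L by move=> x /KH /HL.
  have fgK : fg K by apply: (fg_fi _ L).
  have fgT : fg (fun _ : G => True) by exists (alphabet G X); apply: gen_all.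
  have fgD : fg D by apply: (fg_fi _ (fun _ => True)).
  have fHK : fi H K by apply: (fi_sub _ L).
  have [D' [phi [sD' [D'D [fD' [hp [inv nz]]]]]]] : exists D' phi, is_subgroup G D' /\ sub D' D /\ fi D D' /\ homZ K phi /\
    (forall g x, D' g -> K x -> phi (g ** x ** iv g) = phi x) /\ exists x, K x /\ phi x <> 0%Z.
  { apply: finite_orbit => //; exists phi0; split; first by move=> x y /KH hx /KH hy; apply: hp0.
    have [n [n0 hn]] := fi_power _ H K x0 sH sK fHK Hx0.
    exists (gpow x0 n); split=> //; rewrite -zpow_of_nat (homZ_zpow _ H) //; nia. }
  have fGD' : fi (fun _ => True) D' by apply: (fi_trans _ _ D).
  have sT : is_subgroup G (fun _ => True) by [].
  have c1 := chain_restrict _ _ _ _ _ _ c sD sD' D'D fD' (fun _ h => h).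
  have eD : (fun x => D x /\ D' x) = D'.
  { apply: functional_extensionality => x; apply: propositional_extensionality; split; first by case.
    by move=> hx; split=> //; apply: D'D. }
  rewrite eD in c1.
  have fKD : fi K (fun x => K x /\ D' x) by apply: fi_and => //; [exact: fi_refl|exact: (fi_sub _ (fun _ => True))].
  have sKD : is_subgroup G (fun x => K x /\ D' x) by apply: sg_and.
  have nKD : normal_by G D' (fun x => K x /\ D' x).
  { move=> g x Dg [Kx Dx]; split; first by apply: nK => //; apply: D'D.
    by apply: sgM => //; [apply: sgM|apply: sgV]. }
  have hpD : homZ (fun x => K x /\ D' x) phi by move=> x y [? _] [? _]; apply: hp.
  exists D', (fun x => (K x /\ D' x) /\ phi x = 0%Z); split=> //; split=> //; split.
  - apply: (chain_append_Z _ _ _ (fun x => K x /\ D' x) _ phi) => //.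
    + apply: (chain_append_fin _ _ _ (fun x => L x /\ D' x)) => //.
      * have sLD : is_subgroup G (fun x => L x /\ D' x) by apply: sg_and.
        have fLK : fi (fun x => L x /\ D' x) K by apply: (fi_sub _ L) => // x [].
        have := fi_and _ _ _ _ sK sD' fLK (fi_sub _ (fun _ => True) _ _ sD' (fun _ _ => I) fGD').
        by [].
      * by move=> x [/KL].
    + exact: ker_sg.
    + move=> g x Dg [KDx ex]; split; first exact: nKD.
      by rewrite inv //; case: KDx.
    + by move=> g x Dg [Kx _]; apply: inv.
    + move: nz => [x [Kx nx]]; have [n [n0 hn]] := fi_power _ K _ x sK sKD fKD Kx.
      by exists (gpow x n); split=> //; rewrite -zpow_of_nat (homZ_zpow _ K) //; nia.
  - apply: (kernel_fg _ _ HX gr) => //.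
    by apply: (fg_fi _ K) => // x [].
Qed.
End FiniteOrbit.

Open Scope R_scope.

(** * Finite sums and orthogonal representations *)

Section Sums.
Variable A : Type.
Implicit Types (l : list A) (f g : A -> R).

Fixpoint lsum l f : R := match l with [] => 0 | a :: l' => f a + lsum l' f end.

Lemma lsum_ext l f g : (forall a, In a l -> f a = g a) -> lsum l f = lsum l g.
Proof.
  elim: l => [|a l IH] h //=; rewrite h; [|by left].
  by rewrite IH // => b ib; apply: h; right.
Qed.

Lemma lsum_add l f g : lsum l (fun a => f a + g a) = lsum l f + lsum l g.
Proof. elim: l => [|a l IH] /=; lra. Qed.

Lemma lsum_sub l f g : lsum l (fun a => f a - g a) = lsum l f - lsum l g.
Proof. elim: l => [|a l IH] /=; lra. Qed.

Lemma lsum_scal l c f : lsum l (fun a => c * f a) = c * lsum l f.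
Proof. elim: l => [|a l IH] /=; lra. Qed.

Lemma lsum_le l f g : (forall a, In a l -> f a <= g a) -> lsum l f <= lsum l g.
Proof.
  elim: l => [|a l IH] h /=; first lra.
  have h1 := h a (or_introl eq_refl).
  have h2 : lsum l f <= lsum l g by apply: IH => b ib; apply: h; right.
  lra.
Qed.

Lemma lsum_0 l : lsum l (fun _ => 0) = 0.
Proof. elim: l => [|a l IH] /=; lra. Qed.

Lemma lsum_nonneg l f : (forall a, In a l -> 0 <= f a) -> 0 <= lsum l f.
Proof. by move=> h; rewrite -(lsum_0 l); apply: lsum_le. Qed.

Lemma lsum_const l c : lsum l (fun _ => c) = INR (length l) * c.
Proof. elim: l => [|a l IH]; [rewrite /=; lra|rewrite [length _]/= S_INR /= IH; lra]. Qed.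

Lemma lsum_app l l' f : lsum (l ++ l') f = lsum l f + lsum l' f.
Proof. elim: l => [|a l IH] /=; lra. Qed.

Lemma lsum_term l f a : In a l -> (forall b, In b l -> 0 <= f b) -> f a <= lsum l f.
Proof.
  elim: l => [|b l IH] //= [->|i] h.
  - have : 0 <= lsum l f by apply: lsum_nonneg => c ic; apply: h; right.
    lra.
  - have h1 : 0 <= f b by apply: h; left.
    have h2 : f a <= lsum l f by apply: IH => // c ic; apply: h; right.
    lra.
Qed.

Lemma lsum_CS l f g : (lsum l (fun a => f a * g a)) ^ 2 <= lsum l (fun a => f a ^ 2) * lsum l (fun a => g a ^ 2).
Proof.
  have h : forall t, 0 <= lsum l (fun a => f a ^ 2) + 2 * t * lsum l (fun a => f a * g a) + t ^ 2 * lsum l (fun a => g a ^ 2).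
  { move=> t; have -> : lsum l (fun a => f a ^ 2) + 2 * t * lsum l (fun a => f a * g a) + t ^ 2 * lsum l (fun a => g a ^ 2)
      = lsum l (fun a => (f a + t * g a) ^ 2).
    { elim: l => [|a l IH]; cbn [lsum]; [ring|rewrite -IH; ring]. }
    by apply: lsum_nonneg => a _; exact: pow2_ge_0. }
  move: h; have : 0 <= lsum l (fun a => g a ^ 2) by apply: lsum_nonneg => a _; exact: pow2_ge_0.
  move: (lsum l (fun a => f a ^ 2)) (lsum l (fun a => f a * g a)) (lsum l (fun a => g a ^ 2)) => a b c c0 h.
  case: (Req_dec c 0) => cz.
  - subst c; have b0 : b = 0.
    { apply: NNPP => nb; have := h (- (a + 1) / (2 * b)).
      have -> : 2 * (- (a + 1) / (2 * b)) * b = - (a + 1) by field.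
      lra. }
    by rewrite b0; nra.
  - have := h (- b / c).
    have -> : a + 2 * (- b / c) * b + (- b / c) ^ 2 * c = (a * c - b ^ 2) / c by field.
    move=> h1; have : 0 <= (a * c - b ^ 2) / c * c by apply: Rmult_le_pos.
    have -> : (a * c - b ^ 2) / c * c = a * c - b ^ 2 by field.
    lra.
Qed.
End Sums.
Arguments lsum {A}.
Notation sm k := (lsum (seq 0 k)).

Lemma lsum_swap (A B : Type) (l : list A) (l' : list B) (f : A -> B -> R) :
  lsum l (fun a => lsum l' (fun b => f a b)) = lsum l' (fun b => lsum l (fun a => f a b)).
Proof. by elim: l => [|a l IH] /=; [rewrite lsum_0|rewrite IH lsum_add]. Qed.

Lemma lsum_map (A B : Type) (h : A -> B) (l : list A) (f : B -> R) : lsum (map h l) f = lsum l (fun a => f (h a)).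
Proof. by elim: l => [|a l IH] //=; rewrite IH. Qed.

Lemma lsum_prod (A B : Type) (l : list A) (l' : list B) (f : A -> B -> R) :
  lsum (list_prod l l') (fun p => f (fst p) (snd p)) = lsum l (fun a => lsum l' (fun b => f a b)).
Proof. by elim: l => [|a l IH] //=; rewrite lsum_app lsum_map IH. Qed.

Definition dl (i j : nat) : R := if Nat.eqb i j then 1 else 0.

Lemma dl_sym i j : dl i j = dl j i.
Proof. by rewrite /dl Nat.eqb_sym. Qed.

Lemma sm_dl k i f : (i < k)%nat -> sm k (fun j => dl i j * f j) = f i.
Proof.
  have : forall s, (s <= i < s + k)%nat -> lsum (seq s k) (fun j => dl i j * f j) = f i.
  { elim: k => [|k IH] s h; first lia.
    rewrite /= /dl; case: (Nat.eq_dec i s) => e.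
    - rewrite e Nat.eqb_refl (lsum_ext _ _ _ (fun _ => 0)); first by rewrite lsum_0; lra.
      move=> a /in_seq ia; have -> : Nat.eqb s a = false by apply/Nat.eqb_neq; lia.
      lra.
    - have -> : Nat.eqb i s = false by apply/Nat.eqb_neq; lia.
      by rewrite -/(dl i) IH; [lra|lia]. }
  by move=> h hk; apply: h; lia.
Qed.

(** Gaussian elimination: a vector of [V] with nonzero entry at [i] serves as pivot and the others
    are reduced by it. Spanning is expressed dually, through the linear forms that vanish on [s]. *)
Lemma finite_span (I : Type) (idx : list I) (V : (I -> R) -> Prop) :
  exists s, (forall f, In f s -> V f) /\
   forall a : I -> R, (forall f, In f s -> lsum idx (fun i => a i * f i) = 0) ->
     forall f, V f -> lsum idx (fun i => a i * f i) = 0.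
Proof.
  elim: idx V => [|i idx IH] V; first by exists [].
  case: (classic (exists f0, V f0 /\ f0 i <> 0)) => [[f0 [V0 n0]]|no]; last first.
  { have [s [h1 h2]] := IH V; exists s; split=> // a ha f Vf.
    have z : forall f, V f -> f i = 0 by move=> g Vg; apply: NNPP => n; apply: no; exists g.
    have e : lsum idx (fun i => a i * f i) = 0.
    { apply: h2 => // g ig; have := ha g ig; rewrite /= (z g); [lra|exact: h1]. }
    by rewrite /= e (z f Vf); ring. }
  have [s' [h1 h2]] := IH (fun g => exists f, V f /\ forall j, g j = f j - f i / f0 i * f0 j).
  have [s [hs1 hs2]] : exists s, (forall f, In f s -> V f) /\ forall g, In g s' -> exists f, In f s /\
     forall j, g j = f j - f i / f0 i * f0 j.
  { elim: s' h1 {h2} => [|g s' IHs] h1; first by exists [].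
    have [|s [a b]] := IHs; first by move=> g' ig; apply: h1; right.
    have [f [Vf e]] := h1 g (or_introl eq_refl).
    exists (f :: s); split; first by move=> f' [<-|/a].
    move=> g' [<-|/b [f' [i1 e1]]]; [exists f; split=> //; by left|exists f'; split=> //; by right]. }
  exists (f0 :: s); split; first by move=> f [<-|/hs1].
  move=> a ha.
  have key : forall f, lsum idx (fun j => a j * (f j - f i / f0 i * f0 j)) = lsum (i :: idx) (fun j => a j * f j).
  { move=> f; have /= e0 := ha f0 (or_introl eq_refl).
    rewrite (lsum_ext _ _ _ (fun j => a j * f j - f i / f0 i * (a j * f0 j))); last by move=> j _; ring.
    rewrite lsum_sub lsum_scal /=.
    have -> : lsum idx (fun j => a j * f0 j) = - (a i * f0 i) by lra.
    by field. }
  move=> f Vf; rewrite -key; apply: (h2 a); last by exists f.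
  move=> g /hs2 [f' [i1 e1]].
  rewrite (lsum_ext _ _ _ (fun j => a j * (f' j - f' i / f0 i * f0 j))); last by move=> j _; rewrite e1.
  by rewrite key; apply: ha; right.
Qed.

(** * Finite dimensional orthogonal representations and Hilbert-Schmidt distances *)

Section OrthRep.
Variables (W : Group) (H : W -> Prop) (k : nat) (M : W -> nat -> nat -> R).
Hypothesis sH : is_subgroup W H.

Definition orthrep := (forall i j, (i < k)%nat -> (j < k)%nat -> M one i j = dl i j) /\
  (forall x y i j, H x -> H y -> (i < k)%nat -> (j < k)%nat ->
     M (x ** y) i j = sm k (fun l => M x i l * M y l j)) /\
  (forall x i j, H x -> (i < k)%nat -> (j < k)%nat -> M (iv x) i j = M x j i).

Hypothesis rep : orthrep.
Notation ms f := (sm k (fun i => sm k (fun j => f i j))).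

(** Squared Hilbert-Schmidt distances. *)
Definition hs x := ms (fun i j => (M x i j - dl i j) ^ 2).
Definition hsd x y := ms (fun i j => (M x i j - M y i j) ^ 2).

Lemma ms_ext (f g : nat -> nat -> R) : (forall i j, (i < k)%nat -> (j < k)%nat -> f i j = g i j) -> ms f = ms g.
Proof.
  move=> h; apply: lsum_ext => i /in_seq hi; apply: lsum_ext => j /in_seq hj.
  apply: h; lia.
Qed.

Lemma ms_le (f g : nat -> nat -> R) : (forall i j, (i < k)%nat -> (j < k)%nat -> f i j <= g i j) -> ms f <= ms g.
Proof.
  move=> h; apply: lsum_le => i /in_seq hi; apply: lsum_le => j /in_seq hj.
  apply: h; lia.
Qed.

Lemma ms_nonneg (f : nat -> nat -> R) : (forall i j, (i < k)%nat -> (j < k)%nat -> 0 <= f i j) -> 0 <= ms f.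
Proof.
  move=> h; apply: lsum_nonneg => i /in_seq hi; apply: lsum_nonneg => j /in_seq hj.
  apply: h; lia.
Qed.

Lemma ms_term (f : nat -> nat -> R) i j : (forall i j, 0 <= f i j) -> (i < k)%nat -> (j < k)%nat -> f i j <= ms f.
Proof.
  move=> h hi hj; apply: (Rle_trans _ (sm k (fun j => f i j))).
  - by apply: (lsum_term _ _ (fun j => f i j)) => //; apply/in_seq; lia.
  - apply: (lsum_term _ _ (fun i => sm k (fun j => f i j))); first by apply/in_seq; lia.
    by move=> i' _; apply: lsum_nonneg.
Qed.

Lemma ms_sq (f g : nat -> nat -> R) : ms (fun i j => (f i j - g i j) ^ 2) =
  ms (fun i j => f i j * f i j) - 2 * ms (fun i j => f i j * g i j) + ms (fun i j => g i j * g i j).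
Proof.
  rewrite -lsum_scal -lsum_sub -lsum_add; apply: lsum_ext => i _.
  rewrite -lsum_scal -lsum_sub -lsum_add; apply: lsum_ext => j _; ring.
Qed.

Definition tr x := sm k (fun i => M x i i).

Lemma ms_tr x y : H x -> H y -> ms (fun i j => M x i j * M y i j) = tr (iv x ** y).
Proof.
  move=> Hx Hy; case: rep => [r1 [r2 r3]].
  have Hx' : H (iv x) by apply: sgV.
  rewrite lsum_swap; apply: lsum_ext => j /in_seq hj.
  rewrite r2 //; try lia.
  apply: lsum_ext => i /in_seq hi; rewrite r3 //; lia.
Qed.

Lemma ms_dl x : ms (fun i j => M x i j * dl i j) = tr x.
Proof.
  apply: lsum_ext => i /in_seq hi.
  rewrite (lsum_ext _ _ _ (fun j => dl i j * M x i j)); last by move=> j _; ring.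
  by rewrite sm_dl //; lia.
Qed.

Lemma tr_one : tr one = INR k.
Proof.
  case: rep => [r1 _]; rewrite /tr (lsum_ext _ _ _ (fun _ => 1)).
  - by rewrite lsum_const length_seq; lra.
  - by move=> i /in_seq hi; rewrite r1; try lia; rewrite /dl Nat.eqb_refl.
Qed.

Lemma ms_dl_dl : ms (fun i j => dl i j * dl i j) = INR k.
Proof.
  rewrite (lsum_ext _ _ _ (fun _ => 1)); first by rewrite lsum_const length_seq; lra.
  by move=> i /in_seq hi; rewrite sm_dl; [rewrite /dl Nat.eqb_refl|lia].
Qed.

Lemma hs_tr x : H x -> hs x = 2 * INR k - 2 * tr x.
Proof.
  move=> Hx; rewrite /hs ms_sq ms_tr // ms_dl ms_dl_dl; gs; rewrite tr_one; ring.
Qed.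

Lemma hsd_hs x y : H x -> H y -> hsd x y = hs (iv x ** y).
Proof.
  move=> Hx Hy; rewrite hs_tr; last by apply: sgM => //; apply: sgV.
  rewrite /hsd ms_sq !ms_tr //; gs; rewrite tr_one; ring.
Qed.

Lemma hs_nonneg x : 0 <= hs x.
Proof. by apply: ms_nonneg => i j _ _; exact: pow2_ge_0. Qed.

Definition meq x y := forall i j, (i < k)%nat -> (j < k)%nat -> M x i j = M y i j.

Lemma hs0 x : H x -> hs x = 0 <-> meq x one.
Proof.
  move=> Hx; case: rep => [r1 _]; split.
  - move=> e i j hi hj; rewrite r1 //.
    have := ms_term (fun i j => (M x i j - dl i j) ^ 2) i j (fun _ _ => pow2_ge_0 _) hi hj.
    by rewrite -/(hs x) e; nra.
  - move=> h; rewrite /hs (ms_ext _ (fun _ _ => 0)); first by rewrite (lsum_ext _ _ _ (fun _ => 0)) ?lsum_0 // => i _; rewrite lsum_0.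
    by move=> i j hi hj; rewrite h // r1 //; ring.
Qed.

Lemma meq_mul x x' y y' : H x -> H x' -> H y -> H y' -> meq x x' -> meq y y' -> meq (x ** y) (x' ** y').
Proof.
  case: rep => [_ [r2 _]] h1 h2 h3 h4 e e' i j hi hj; rewrite !r2 //.
  by apply: lsum_ext => l /in_seq hl; rewrite e ?e' //; lia.
Qed.

Lemma hs_tri x y : H x -> H y -> hs (iv x ** y) <= 2 * hs x + 2 * hs y.
Proof.
  move=> Hx Hy; rewrite -hsd_hs // /hs -!lsum_scal -lsum_add.
  apply: lsum_le => i _; rewrite -!lsum_scal -lsum_add; apply: lsum_le => j _.
  have := pow2_ge_0 (M x i j - dl i j + (M y i j - dl i j)); nra.
Qed.

Lemma ms_CS (a b : nat -> nat -> R) :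
  ms (fun i j => (sm k (fun l => a i l * b l j)) ^ 2) <= ms (fun i j => a i j ^ 2) * ms (fun i j => b i j ^ 2).
Proof.
  apply: (Rle_trans _ (ms (fun i j => sm k (fun l => a i l ^ 2) * sm k (fun l => b l j ^ 2)))).
  - by apply: ms_le => i j _ _; apply: lsum_CS.
  - right; rewrite (lsum_ext _ _ _ (fun i => ms (fun i j => b i j ^ 2) * sm k (fun l => a i l ^ 2))).
    + by rewrite lsum_scal; ring.
    + by move=> i _; rewrite lsum_scal lsum_swap; ring.
Qed.

Lemma mul_sub_one x y i j : H x -> H y -> (i < k)%nat -> (j < k)%nat ->
  sm k (fun l => (M x i l - dl i l) * (M y l j - dl l j)) = M (x ** y) i j - M x i j - M y i j + dl i j.
Proof.
  case: rep => [_ [r2 _]] Hx Hy hi hj; rewrite r2 //.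
  rewrite (lsum_ext _ _ _ (fun l => M x i l * M y l j - (dl j l * M x i l + dl i l * M y l j) + dl i l * dl l j)).
  - by rewrite lsum_add lsum_sub lsum_add !sm_dl //; ring.
  - by move=> l _; rewrite (dl_sym j l); ring.
Qed.

(** By invariance the commutator is as far from 1 as [x y] is from [y x], and [x y - y x = (x - 1)(y
    - 1) - (y - 1)(x - 1)]; Cauchy-Schwarz bounds both products. *)
Lemma hs_comm x y : H x -> H y -> hs (commutator W x y) <= 4 * hs x * hs y.
Proof.
  move=> Hx Hy.
  have e : commutator W x y = iv (y ** x) ** (x ** y) by rewrite /commutator; gs.
  rewrite e -hsd_hs; [|exact: sgM|exact: sgM].
  have h1 := ms_CS (fun i j => M x i j - dl i j) (fun i j => M y i j - dl i j).
  have h2 := ms_CS (fun i j => M y i j - dl i j) (fun i j => M x i j - dl i j).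
  rewrite -/(hs x) -/(hs y) in h1 h2.
  set A := ms (fun i j => (sm k (fun l => (M x i l - dl i l) * (M y l j - dl l j))) ^ 2) in h1.
  set B := ms (fun i j => (sm k (fun l => (M y i l - dl i l) * (M x l j - dl l j))) ^ 2) in h2.
  have : hsd (y ** x) (x ** y) <= 2 * A + 2 * B; last lra.
  rewrite /A /B -!lsum_scal -lsum_add; apply: lsum_le => i /in_seq hi.
  rewrite -!lsum_scal -lsum_add; apply: lsum_le => j /in_seq hj.
  rewrite !mul_sub_one //; try lia.
  move: (M (x ** y) i j) (M (y ** x) i j) (M x i j) (M y i j) (dl i j) => a b c d e'.
  have := pow2_ge_0 ((a - c - d + e') + (b - d - c + e')); nra.
Qed.

Lemma M_bound x i j : H x -> (i < k)%nat -> (j < k)%nat -> -1 <= M x i j <= 1.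
Proof.
  move=> Hx hi hj; case: rep => [r1 [r2 r3]].
  have e : sm k (fun l => M x i l * M (iv x) l i) = 1.
  { by rewrite -r2 //; [gs; rewrite r1 // /dl Nat.eqb_refl|exact: sgV]. }
  have : M x i j * M (iv x) j i <= 1.
  { rewrite -e; apply: (lsum_term _ _ (fun l => M x i l * M (iv x) l i)); first by apply/in_seq; lia.
    by move=> l /in_seq hl; rewrite r3 //; [nra|lia]. }
  by rewrite r3 //; nra.
Qed.

(** Entries lie between -1 and 1; rounding each of them at precision [1 / m] leaves finitely many
    codes. *)
Lemma orth_net eps : 0 < eps -> exists (T : Type) (V : list T) (code : W -> T),
  (forall x, H x -> In (code x) V) /\ forall x y, H x -> H y -> code x = code y -> hsd x y <= eps.
Proof.
  move=> he.
  have [m [m0 hm]] : exists m : nat, (0 < m)%nat /\ INR k * INR k * (1 / INR m) ^ 2 <= eps.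
  { have [n [h1 h2]] := archimed_cor1 (eps / (INR k * INR k + 1)) ltac:(apply: Rdiv_lt_0_compat => //; have := pos_INR k; nra).
    exists n; split=> //; have pn : 0 < INR n by apply: lt_0_INR.
    have n1 : 1 <= INR n by apply: (le_INR 1).
    have k0 := pos_INR k.
    have : / INR n * (INR k * INR k + 1) < eps.
    { have := Rmult_lt_compat_r (INR k * INR k + 1) _ _ ltac:(nra) h1.
      have -> : eps / (INR k * INR k + 1) * (INR k * INR k + 1) = eps by field; nra.
      by []. }
    have i0 : 0 < / INR n by apply: Rinv_0_lt_compat.
    have i1 : / INR n <= 1 by rewrite -Rinv_1; apply: Rinv_le_contravar; lra.
    have -> : 1 / INR n = / INR n by field; lra.
    nra. }
  have pm : 0 < INR m by apply: lt_0_INR.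
  set idx := list_prod (seq 0 k) (seq 0 k).
  exists (list nat), (codes (length idx) (2 * m + 2)),
    (fun x => map (fun p => Z.to_nat (up ((M x (fst p) (snd p) + 1) * INR m))) idx).
  have bnd : forall x p, H x -> In p idx -> (0 <= up ((M x (fst p) (snd p) + 1) * INR m) < Z.of_nat (2 * m + 2))%Z.
  { move=> x [i j] Hx /in_prod_iff [/in_seq hi /in_seq hj] /=.
    have b := M_bound x i j Hx ltac:(lia) ltac:(lia).
    have [a1 a2] := archimed ((M x i j + 1) * INR m).
    split.
    - have : (-1 < up ((M x i j + 1) * INR m))%Z; last lia.
      by apply: lt_IZR; nra.
    - apply: lt_IZR; rewrite -INR_IZR_INZ.
      have -> : INR (2 * m + 2) = 2 * INR m + 2 by rewrite plus_INR mult_INR /=; ring.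
      nra. }
  split.
  - move=> x Hx; rewrite -(length_map (fun p => Z.to_nat (up ((M x (fst p) (snd p) + 1) * INR m))) idx).
    apply: in_codes; apply/Forall_forall => n /in_map_iff [p [<- ip]].
    have := bnd x p Hx ip; lia.
  - move=> x y Hx Hy e; apply: Rle_trans hm.
    apply: (Rle_trans _ (ms (fun _ _ => (1 / INR m) ^ 2))); last first.
    { right; rewrite (lsum_ext _ _ _ (fun _ => INR k * (1 / INR m) ^ 2)); last by move=> i _; rewrite lsum_const length_seq.
      by rewrite lsum_const length_seq; ring. }
    apply: ms_le => i j hi hj.
    have ip : In (i, j) idx by apply: in_prod; apply/in_seq; lia.
    have := @ext_in_map _ _ _ _ _ e (i, j) ip => /= e1.
    have /= b1 := bnd x _ Hx ip; have /= b2 := bnd y _ Hy ip.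
    have {}e1 : up ((M x i j + 1) * INR m) = up ((M y i j + 1) * INR m) by lia.
    have := archimed ((M x i j + 1) * INR m); have := archimed ((M y i j + 1) * INR m); rewrite e1 => u1 u2.
    have d1 : -1 <= (M x i j - M y i j) * INR m <= 1 by lra.
    have : -(1 / INR m) <= M x i j - M y i j <= 1 / INR m; last nra.
    have -> : M x i j - M y i j = (M x i j - M y i j) * INR m * (1 / INR m) by field; lra.
    have i0 : 0 < 1 / INR m by apply: Rdiv_lt_0_compat; lra.
    nra.
Qed.
End OrthRep.

Lemma not_fi_many (G : Group) (H K : G -> Prop) : is_subgroup G K -> ~ fi H K ->
  forall n : nat, exists l, length l = n /\ (forall x, In x l -> H x) /\ FOP (fun x y => ~ K (iv x ** y)) l.
Proof.
  move=> sK nf; elim=> [|n [l [ll [lH lF]]]]; first by exists []; split=> //; split=> //; constructor.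
  apply: NNPP => no; apply: nf; apply: (wfi_fi _ _ _ l) => // x Hx.
  apply: NNPP => no'; apply: no; exists (x :: l); split; first by rewrite /= ll.
  split; first by move=> y [<-|/lH].
  constructor=> //; apply/Forall_forall => y iy k; apply: no'; exists y; split=> //.
  exact: sgVM.
Qed.

Lemma fi_conj (G : Group) (H K : G -> Prop) g : is_subgroup G H -> is_subgroup G K -> H g -> fi H K ->
  fi H (fun x => K (iv g ** x ** g)).
Proof.
  move=> sH sK Hg [l [_ lc]].
  have sg' : is_subgroup G (fun x => K (iv g ** x ** g)).
  { split; [|split].
    - by gs; exact: sg1.
    - by move=> x y h1 h2; have := sgM _ _ _ _ sK h1 h2; gs.
    - by move=> x h; have := sgV _ _ _ sK h; gs. }
  apply: (wfi_fi _ _ _ (map (fun t => g ** t ** iv g) l)) => // x Hx.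
  have [|t [it k]] := lc (iv g ** x ** g).
  { by apply: sgM => //; apply: sgM => //; apply: sgV. }
  exists (g ** t ** iv g); split; last by move: k; gs.
  by apply/in_map_iff; exists t.
Qed.

Lemma sg_comm (G : Group) (H : G -> Prop) x y : is_subgroup G H -> H x -> H y -> H (commutator G x y).
Proof.
  move=> sH Hx Hy; rewrite /commutator; apply: sgM => //; last exact: sgM.
  by apply: sgM => //; apply: sgV.
Qed.

(** * Finiteness of the image of an orthogonal representation *)

Section Compact.
Variables (G : Group) (H : G -> Prop) (k : nat) (M : G -> nat -> nat -> R).
Hypothesis sH : is_subgroup G H.
Hypothesis rep : orthrep G H k M.
Notation "x ~~ y" := (meq G k M x y) (at level 70).
Notation mm := (meq_mul _ _ _ _ rep).

Lemma meq_refl x : x ~~ x. Proof. by []. Qed.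
Lemma meq_sym x y : x ~~ y -> y ~~ x. Proof. by move=> h i j hi hj; rewrite h. Qed.
Lemma meq_trans y x z : x ~~ y -> y ~~ z -> x ~~ z.
Proof. by move=> h h' i j hi hj; rewrite h // h'. Qed.
Lemma meq_l z x y : H z -> H x -> H y -> x ~~ y -> z ** x ~~ z ** y.
Proof. by move=> *; apply: mm. Qed.
Lemma meq_r z x y : H z -> H x -> H y -> x ~~ y -> x ** z ~~ y ** z.
Proof. by move=> *; apply: mm. Qed.

Definition cent x y := H y /\ x ** y ~~ y ** x.

Ltac sgt := repeat first [assumption | apply: sg1 | apply: sgM | apply: sgV].

Lemma meq_comm x y : H x -> H y -> x ** y ~~ y ** x <-> hs G k M (commutator G x y) = 0.
Proof.
  move=> Hx Hy; rewrite (hs0 _ H) //; last by rewrite /commutator; sgt.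
  have e : commutator G x y = iv (y ** x) ** (x ** y) by rewrite /commutator; gs.
  rewrite e; split=> h.
  - have := meq_l (iv (y ** x)) _ _ _ _ _ h; gs; apply; sgt.
  - have := meq_l (y ** x) _ _ _ _ _ h; gs; apply; sgt.
Qed.

Lemma cent_sg x : H x -> is_subgroup G (cent x).
Proof.
  move=> Hx; split; [|split].
  - split; [sgt|gs; exact: meq_refl].
  - move=> y z [Hy hy] [Hz hz]; split; first by sgt.
    apply: (meq_trans (y ** x ** z)); first by rewrite gassoc; apply: meq_r; sgt.
    by rewrite -!gassoc; apply: meq_l; sgt.
  - move=> y [Hy hy]; split; first by sgt.
    have h := meq_l (iv y) _ _ _ _ _ (meq_r (iv y) _ _ _ _ _ (meq_sym _ _ hy)).
    by move: h; gs; apply; sgt.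
Qed.

(** The preimage of the FC-centre of the image: elements with finitely many conjugates modulo the
    kernel. *)
Definition fc x := H x /\ fi H (cent x).

Lemma fc_sg : is_subgroup G fc.
Proof.
  split; [|split].
  - split; first by sgt.
    apply: (fi_mono _ _ H); last exact: fi_refl.
    by move=> x Hx; split=> //; gs; exact: meq_refl.
  - move=> x y [Hx fx] [Hy fy]; split; first by sgt.
    apply: (fi_mono _ _ (fun z => cent x z /\ cent y z)); last by apply: fi_and => //; apply: cent_sg.
    move=> z [[Hz hx] [_ hy]]; split=> //.
    apply: (meq_trans (x ** z ** y)); first by rewrite -!gassoc; apply: meq_l; sgt.
    by rewrite gassoc; apply: meq_r; sgt.
  - move=> x [Hx fx]; split; first by sgt.
    apply: fi_mono fx => y [Hy hy]; split=> //.
    have h := meq_l (iv x) _ _ _ _ _ (meq_r (iv x) _ _ _ _ _ (meq_sym _ _ hy)).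
    by move: h; gs; apply; sgt.
Qed.

Lemma fc_conj g x : H g -> fc x -> fc (iv g ** x ** g).
Proof.
  move=> Hg [Hx fx]; split; first by sgt.
  have h := fi_conj _ _ _ (iv g) sH (cent_sg x Hx) (sgV _ _ _ sH Hg) fx.
  apply: fi_mono h => y; gs => [[Hy hy]].
  have e : y = iv g ** (g ** (y ** iv g)) ** g by gs.
  have Hy' : H y by rewrite e; sgt.
  split=> //.
  have h1 := meq_l (iv g) _ _ _ _ _ (meq_r g _ _ _ _ _ hy).
  move: h1; gs; apply; sgt.
Qed.

Definition centfc y := H y /\ forall f, fc f -> f ** y ~~ y ** f.

Lemma centfc_cent y f : centfc y -> fc f -> cent f y.
Proof. by move=> [Hy h] hf; split=> //; apply: h. Qed.

Lemma centfc_sg : is_subgroup G centfc.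
Proof.
  split; [|split].
  - by split=> [|f [Hf _]]; [sgt|gs; exact: meq_refl].
  - move=> x y hx hy; split; first by case: hx; case: hy => *; sgt.
    by move=> f hf; case: (sgM _ _ _ _ (cent_sg f (proj1 hf)) (centfc_cent _ _ hx hf) (centfc_cent _ _ hy hf)).
  - move=> x hx; split; first by case: hx => *; sgt.
    by move=> f hf; case: (sgV _ _ _ (cent_sg f (proj1 hf)) (centfc_cent _ _ hx hf)).
Qed.

(** Commuting with the finite conjugacy elements is a system of linear
    equations, so it only has to be tested on a finite spanning subset. *)
Lemma centfc_fi : fi H centfc.
Proof.
  set idx := list_prod (seq 0 k) (seq 0 k).
  have [s [hs1 hs2]] := finite_span _ idx (fun v => exists f, fc f /\ forall p, v p = M f (fst p) (snd p)).
  have [l [l1 l2]] : exists l, (forall f, In f l -> fc f) /\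
     forall v, In v s -> exists f, In f l /\ forall p, v p = M f (fst p) (snd p).
  { elim: s hs1 {hs2} => [|v s IH] h; first by exists [].
    have [|l [a b]] := IH; first by move=> w iw; apply: h; right.
    have [f [hf e]] := h v (or_introl eq_refl).
    exists (f :: l); split; first by move=> f' [<-|/a].
    move=> w [<-|/b [f' [i e']]]; [exists f; split=> //; by left|exists f'; split=> //; by right]. }
  have r2 := proj1 (proj2 rep).
  have key : forall y, H y -> (forall f, In f l -> cent f y) -> centfc y.
  { move=> y Hy hy; split=> // f hf i j hi hj.
    pose a (p : nat * nat) := dl (fst p) i * M y (snd p) j - dl (snd p) j * M y i (fst p).
    have val : forall f, H f -> lsum idx (fun p => a p * M f (fst p) (snd p)) = M (f ** y) i j - M (y ** f) i j.
    { move=> f' Hf'; rewrite /a !r2 //.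
      rewrite (lsum_prod _ _ _ _ (fun p q => (dl p i * M y q j - dl q j * M y i p) * M f' p q)).
      rewrite (lsum_ext _ _ _ (fun p => dl i p * sm k (fun q => M f' p q * M y q j) -
                  sm k (fun q => dl j q * (M y i p * M f' p q)))).
      - rewrite lsum_sub sm_dl //; f_equal; apply: lsum_ext => p _; by rewrite sm_dl.
      - move=> p _; rewrite -lsum_scal -lsum_sub; apply: lsum_ext => q _.
        by rewrite (dl_sym p i) (dl_sym q j); ring. }
    have := hs2 a _ (fun p => M f (fst p) (snd p)) (ex_intro _ f (conj hf (fun _ => eq_refl))).
    rewrite val; last by case: hf.
    move=> h; have : M (f ** y) i j - M (y ** f) i j = 0; last lra.
    apply: h => v iv'; have [f' [il e]] := l2 v iv'.
    rewrite (lsum_ext _ _ _ (fun p => a p * M f' (fst p) (snd p))); last by move=> p _; rewrite e.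
    rewrite val; last by case: (l1 _ il).
    by case: (hy _ il) => _ ->; [ring| |]. }
  have : fi H (fun y => H y /\ forall f, In f l -> cent f y) /\ is_subgroup G (fun y => H y /\ forall f, In f l -> cent f y).
  { elim: l l1 {l2 key} => [|f l IH] l1.
    - have -> : (fun y => H y /\ forall f, In f [] -> cent f y) = H.
      { by apply: functional_extensionality => x; apply: propositional_extensionality; split; [case|]. }
      by split=> //; apply: fi_refl.
    - have [|f1 s1] := IH; first by move=> f' i; apply: l1; right.
      have [Hf ff] := l1 f (or_introl eq_refl).
      have -> : (fun y => H y /\ forall f0, In f0 (f :: l) -> cent f0 y) =
        (fun y => cent f y /\ (H y /\ forall f, In f l -> cent f y)).
      { apply: functional_extensionality => x; apply: propositional_extensionality; split.
        - move=> [Lx h]; split; [by apply: h; left|split=> // a i; by apply: h; right].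
        - by move=> [h [Lx h']]; split=> // a [<-|/h']. }
      have s2 := cent_sg f Hf.
      by split; [apply: fi_and|apply: sg_and]. }
  by move=> [h _]; apply: fi_mono h => y [Hy hy]; apply: key.
Qed.

Lemma kernel_sg : is_subgroup G (fun x => H x /\ hs G k M x = 0).
Proof.
  have h : forall x, H x -> hs G k M x = 0 <-> x ~~ one by move=> x Hx; apply: (hs0 _ H).
  split; [|split].
  - by split; [exact: sg1|exact: (proj2 (h _ (sg1 _ _ sH)) (meq_refl _))].
  - move=> x y [Hx hx] [Hy hy]; have Hxy : H (x ** y) by sgt.
    split=> //; apply: (proj2 (h _ Hxy)).
    have := mm x one y one Hx (sg1 _ _ sH) Hy (sg1 _ _ sH) (proj1 (h _ Hx) hx) (proj1 (h _ Hy) hy); gs; by [].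
  - move=> x [Hx hx]; have Hx' : H (iv x) by sgt.
    split=> //; apply: (proj2 (h _ Hx')).
    have := meq_l (iv x) _ _ Hx' (sg1 _ _ sH) Hx (meq_sym _ _ (proj1 (h _ Hx) hx)); gs; by [].
Qed.

Variable X : list G.
Hypothesis HX : generates G X.
Notation len := (word_norm G X).

(** A Bieberbach-Jordan argument with packing in place of discreteness. Let [g] have least [hs]
    among the elements of [centfc] outside [fc] of length at most [R]. For [x] near 1 the commutator
    [[g, x]] is much closer to 1 than [g], so two such commutators within distance [R] differ by an
    element of [fc]. Inequivalent ones are [R]-separated in a ball of radius [6 * R], hence
    boundedly many. *)
Lemma orth_near_commuting : fg H ->
  (exists N, forall R0, exists R, (R0 <= R)%nat /\ packing G X 6 1 R N) ->
  ~ fi H (fun x => fc x /\ centfc x) ->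
  exists g, centfc g /\ ~ fc g /\ fi H (fun u => centfc u /\ fc (commutator G g u)).
Proof.
  move=> [Y gY] [N hN] nf.
  have sF := fc_sg; have sC := centfc_sg.
  have CH : sub centfc H by move=> x [].
  have nfC : ~ fi centfc (fun x => fc x /\ centfc x).
  { move=> h; apply: nf; apply: (fi_trans _ _ centfc) => //; [exact: sg_and|exact: centfc_fi]. }
  (* With 1/32, [hs_comm] bounds the commutators by [hs g / 8], and [hs_tri] the quotient of two of
     them by [hs g / 2], strictly below the minimum. *)
  have [T [V [code [cV cd]]]] := orth_net _ H k M sH rep (1 / 32) ltac:(lra).
  have [lC [_ lCc]] := centfc_fi.
  have [c hc] := len_list _ X Y.
  (* A bound for the number of cosets: [N] for each pair of a cell of the net and a coset of
     [centfc]. *)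
  set K' := (N * length (list_prod V lC))%nat.
  have [g0 [Cg0 [nFg0 hg0]]] : exists g0, centfc g0 /\ ~ fc g0 /\ hs G k M g0 <= 1 / 32.
  { have [l [ll [lC' lF]]] := not_fi_many _ _ _ (sg_and _ _ _ sF sC) nfC (S (length V)).
    apply: NNPP => no; have : (length l <= length V)%nat; last lia.
    apply: (FOP_values _ _ code); first by move=> x /lC' /CH; apply: cV.
    apply: FOP_impl lF => x y ix iy n e; apply: no; exists (iv x ** y).
    have Cx := lC' _ ix; have Cy := lC' _ iy.
    have Cxy : centfc (iv x ** y) by apply: sgM => //; apply: sgV.
    split=> //; split; first by move=> h; apply: n.
    by rewrite -(hsd_hs _ H) //; [apply: cd => //|..]; apply: CH. }
  have [R [hR pk]] := hN (c * K' + len g0)%nat.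
  have [g [Cg [nFg [lg [hg gmin]]]]] : exists g, centfc g /\ ~ fc g /\ (len g <= R)%nat /\ hs G k M g <= 1 / 32 /\
     forall x, centfc x -> (len x <= R)%nat -> hs G k M x < hs G k M g -> fc x.
  { have : forall l, exists g, centfc g /\ ~ fc g /\ (len g <= R)%nat /\ hs G k M g <= 1 / 32 /\
     forall x, In x l -> centfc x -> (len x <= R)%nat -> hs G k M x < hs G k M g -> fc x.
    { elim=> [|y l [g [h1 [h2 [h3 [h4 h5]]]]]].
      - by exists g0; split=> //; split=> //; split=> //; lia.
      - case: (classic (centfc y /\ (len y <= R)%nat /\ hs G k M y < hs G k M g /\ ~ fc y)) => [[a1 [a2 [a3 a4]]]|no].
        + exists y; split=> //; split=> //; split=> //; split; first lra.
          move=> x [<-|ix] Cx lx hx; first lra.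
          by apply: h5 => //; lra.
        + exists g; split=> //; split=> //; split=> //; split=> // x [<-|ix] Cx lx hx; last exact: (h5 x).
          by apply: NNPP => n; apply: no. }
    move=> /(_ (ball G X R)) [g [h1 [h2 [h3 [h4 h5]]]]]; exists g; do 4 (split; first by []) => //.
    by move=> x Cx lx; apply: h5 => //; apply/in_ball. }
  have Hg := CH _ Cg.
  have hg0' : 0 < hs G k M g.
  { have := hs_nonneg _ k M g => h; case: (Req_dec (hs G k M g) 0) => e; last lra.
    case: nFg; split=> //; apply: (fi_mono _ _ H); last exact: fi_refl.
    move=> x Hx; split=> //; have e' : g ~~ one by apply/(hs0 _ H).
    apply: (meq_trans x).
    - have := meq_r x _ _ _ _ _ e'; gs; apply; sgt.
    - apply: meq_sym; have := meq_l x _ _ _ _ _ e'; gs; apply; sgt. }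
  exists g; split=> //; split=> //.
  set D := fun u => centfc u /\ fc (commutator G g u).
  have sD : is_subgroup G D.
  { split; [|split].
    - split; first exact: sg1.
      by rewrite /commutator; gs; exact: sg1.
    - move=> u v [Cu Fu] [Cv Fv]; split; first exact: sgM.
      have := sgM _ _ _ _ sF Fv (fc_conj v _ (CH _ Cv) Fu).
      by rewrite /commutator; gs.
    - move=> u [Cu Fu]; split; first exact: sgV.
      have := fc_conj (iv u) _ (sgV _ _ _ sH (CH _ Cu)) (sgV _ _ _ sF Fu).
      by rewrite /commutator; gs. }
  apply: (coset_growth _ Y _ _ K') => // l lp lF.
  have lH : forall y, In y l -> H y /\ (len y <= R)%nat.
  { move=> y iy; move/Forall_forall: lp => /(_ y iy) p; split; first by apply gY; exists K'.
    have : (len y <= c * K')%nat; last lia.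
    by apply/len_le => //; apply: pw_pw p => s iY; apply/len_le => //; apply: hc. }
  apply: (count_classes _ _ _ (fun v y => code y = fst v /\ centfc (iv (snd v) ** y))); last exact: lF.
  { move=> y iy; have [Hy _] := lH y iy; have [t [it kt]] := lCc y Hy.
    by exists (code y, t); split=> //; apply: in_prod => //; apply: cV. }
  move=> [v t] l' _ inc F lF' /=.
  case: l' inc F lF' => [|a l'] inc F lF'; first by rewrite /=; lia.
  move: lF' F inc; set l1 := a :: l' => lF' F inc.
  have h1 : forall y, In y l1 -> H y /\ (len y <= R)%nat /\ code y = v /\ centfc (iv t ** y).
  { move=> y iy; have [? ?] := lH y (inc y iy); move/Forall_forall: F => /(_ y iy) [? ?].
    by split=> //; split=> //; split. }
  have ia : In a l1 by left.
  (* Quotients by a fixed member of the class lie in [centfc], are near 1 and have length at most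
     [2 * R], so their commutators with [g] have length at most [6 * R]. *)
  pose xx y := iv y ** a.
  have hx : forall y, In y l1 -> centfc (xx y) /\ hs G k M (xx y) <= 1 / 32 /\ (len (xx y) <= 2 * R)%nat.
  { move=> y iy; have [Hy [ly [cy ky]]] := h1 y iy; have [Ha [la [ca ka]]] := h1 a ia.
    split; last split.
    - by have := sgM _ _ _ _ sC (sgV _ _ _ sC ky) ka; rewrite /xx; gs.
    - by rewrite /xx -(hsd_hs _ H) //; apply: cd => //; rewrite cy ca.
    - by have := lenM _ _ HX (iv y) a; rewrite lenV // /xx; lia. }
  rewrite -(length_map (fun y => commutator G g (xx y))); apply: pk.
  - apply/Forall_forall => z /in_map_iff [y [<- iy]]; have [_ [_ lx]] := hx y iy.
    rewrite /commutator.
    have := lenM _ _ HX (iv g ** iv (xx y)) (g ** xx y); have := lenM _ _ HX (iv g) (iv (xx y)); have := lenM _ _ HX g (xx y).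
    by rewrite !lenV //; lia.
  - apply/FOP_map; apply: FOP_impl lF' => b b' ib ib' nD.
    apply/Nat.nle_gt => hl; apply: nD.
    have [Cx [sx lx]] := hx b ib; have [Cx' [sx' lx']] := hx b' ib'.
    have Hx := CH _ Cx; have Hx' := CH _ Cx'.
    have Cc : forall u, centfc u -> centfc (commutator G g u).
    { move=> u Cu; rewrite /commutator; apply: sgM => //; last exact: sgM.
      by apply: sgM => //; apply: sgV. }
    have e1 := hs_comm _ H k M sH rep g (xx b) Hg Hx; have e2 := hs_comm _ H k M sH rep g (xx b') Hg Hx'.
    have e3 := hs_tri _ H k M sH rep (commutator G g (xx b)) (commutator G g (xx b')) (CH _ (Cc _ Cx)) (CH _ (Cc _ Cx')).
    have Fz : fc (iv (commutator G g (xx b)) ** commutator G g (xx b')).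
    { apply: gmin.
      - by apply: sgM => //; [apply: sgV => //|]; apply: Cc.
      - by lia.
      - by nra. }
    have Fc := fc_conj (iv (xx b)) _ (sgV _ _ _ sH Hx) Fz.
    have Du : D (iv (xx b ** iv (xx b'))).
    { split; first by apply: sgV => //; apply: sgM => //; apply: sgV.
      move: Fc; rewrite /commutator; gs; by []. }
    by have := sgV _ _ _ sD Du; rewrite /xx; gs.
Qed.

(** If [fc] and [centfc] meet in finite index, the intersection has abelian image, which must be
    finite. Otherwise take [g] and [D] from [orth_near_commuting]: conjugating [g] by [u ** v] gives
    [g [g, v] [g, u]] modulo the kernel, symmetric in [u] and [v]. So [D] modulo the centraliser of
    [g] is abelian, and infinite since [g] is outside [fc]. *)
Lemma orth_kernel_fi : fg H ->
  (exists N, forall R0, exists R, (R0 <= R)%nat /\ packing G X 6 1 R N) ->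
  ~ virt_inf_abelian H -> fi H (fun x => H x /\ hs G k M x = 0).
Proof.
  move=> fH hN nv.
  have sF := fc_sg; have sC := centfc_sg; have s0 := kernel_sg.
  have CH : sub centfc H by move=> x [].
  have sFC := sg_and _ _ _ sF sC.
  case: (classic (fi H (fun x => fc x /\ centfc x))) => f1.
  - apply: NNPP => nf; apply: nv.
    exists (fun x => fc x /\ centfc x), (fun x => (fc x /\ centfc x) /\ (H x /\ hs G k M x = 0)).
    split=> //; split; first by move=> x [_ /CH].
    split=> //; split; first exact: sg_and.
    split; first by move=> x [].
    split.
    + move=> x y FCx FCy; have [Fx Cx] := FCx; have [Fy Cy] := FCy; have Hx := CH _ Cx; have Hy := CH _ Cy.
      split; first exact: (sg_comm _ _ _ _ sFC FCx FCy).
      split; first exact: sg_comm.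
      by apply/meq_comm => //; case: Cy => _; apply.
    + move=> h; apply: nf; apply: (fi_mono _ _ (fun x => (fc x /\ centfc x) /\ (H x /\ hs G k M x = 0))); first by move=> x [].
      by apply: (fi_trans _ _ _ _ _ f1 h); apply: sg_and.
  - case: nv; have [g [Cg [nFg fD]]] := orth_near_commuting fH hN f1.
    have Hg := CH _ Cg.
    set D := fun u => centfc u /\ fc (commutator G g u) in fD *.
    have sD : is_subgroup G D.
    { split; [|split].
      - split; first exact: sg1.
        by rewrite /commutator; gs; exact: sg1.
      - move=> u v [Cu Fu] [Cv Fv]; split; first exact: sgM.
        have := sgM _ _ _ _ sF Fv (fc_conj v _ (CH _ Cv) Fu).
        by rewrite /commutator; gs.
      - move=> u [Cu Fu]; split; first exact: sgV.
        have := fc_conj (iv u) _ (sgV _ _ _ sH (CH _ Cu)) (sgV _ _ _ sF Fu).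
        by rewrite /commutator; gs. }
    have sg' := cent_sg g Hg.
    exists D, (fun u => D u /\ cent g u); split=> //; split; first by move=> x [/CH].
    split=> //; split; first exact: sg_and.
    split; first by move=> x [].
    split; last first.
    { move=> h; apply: nFg; split=> //.
      apply: (fi_mono _ _ (fun u => D u /\ cent g u)); first by move=> x [].
      by apply: (fi_trans _ _ _ _ _ fD h); apply: sg_and. }
    have key : forall u v, D u -> D v -> cent g (u ** v ** iv u ** iv v).
    { move=> u v [Cu Fu] [Cv Fv]; have Hu := CH _ Cu; have Hv := CH _ Cv.
      have cj : forall u v, D u -> D v -> iv (u ** v) ** g ** (u ** v) ~~ g ** commutator G g v ** commutator G g u.
      { move=> {Cu Fu Cv Fv Hu Hv}u {}v [Cu Fu] [Cv Fv]; have Hu := CH _ Cu; have Hv := CH _ Cv.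
        have [_ h] := centfc_cent _ _ Cv Fu.
        have [Hc _] := Fu.
        have h1 := meq_l (iv v ** g) _ _ _ _ _ h.
        have -> : iv (u ** v) ** g ** (u ** v) = iv v ** g ** (commutator G g u ** v) by rewrite /commutator; gs.
        have -> : g ** commutator G g v ** commutator G g u = iv v ** g ** (v ** commutator G g u) by rewrite /commutator; gs.
        by apply: h1; sgt. }
      have Ccv : centfc (commutator G g v) by apply: sg_comm.
      have [_ h] := centfc_cent _ _ Ccv Fu; have [Hcu _] := Fu; have [Hcv _] := Fv.
      have h1 := meq_l g _ _ _ _ _ h.
      have h2 : iv (u ** v) ** g ** (u ** v) ~~ iv (v ** u) ** g ** (v ** u).
      { apply: (meq_trans _ _ _ (cj u v _ _)) => //; apply: meq_sym.
        apply: (meq_trans _ _ _ (cj v u _ _)) => //.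
        rewrite (assocr _ g (commutator G g u)) (assocr _ g (commutator G g v)); apply: h1; sgt. }
      have h3 := meq_l (u ** v) _ _ _ _ _ (meq_r (iv (v ** u)) _ _ _ _ _ h2).
      split; first by sgt.
      move: h3; gs; apply; sgt. }
    move=> u v Du Dv; split; first exact: sg_comm.
    by have := key (iv u) (iv v) (sgV _ _ _ sD Du) (sgV _ _ _ sD Dv); rewrite /commutator; gs.
Qed.
End Compact.

(** * Ultrafilters *)

Section Ultrafilter.
Variable om : (nat -> Prop) -> R.
Hypothesis U : nonprincipal_ultrafilter om.

Definition ae (P : nat -> Prop) := om P = 1.

Lemma om_ext P Q : (forall n, P n <-> Q n) -> om P = om Q.
Proof.
  move=> h; f_equal; apply: functional_extensionality => n.
  exact: propositional_extensionality.
Qed.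

Lemma ae_mono (P Q : nat -> Prop) : (forall n, P n -> Q n) -> ae P -> ae Q.
Proof.
  case: U => [u1 [u2 _]] h hP.
  have := u2 P (fun n => Q n /\ ~ P n) ltac:(by tauto).
  rewrite -(om_ext Q (fun n => P n \/ (Q n /\ ~ P n))).
  - rewrite hP /ae => e; case: (u1 Q) => e1 //; case: (u1 (fun n => Q n /\ ~ P n)) => e2; lra.
  - move=> n; have := h n; have := classic (P n); tauto.
Qed.

Lemma ae_not P : ~ ae P -> ae (fun n => ~ P n).
Proof.
  case: U => [u1 [u2 [u3 _]]] h.
  have := u2 P (fun n => ~ P n) ltac:(by tauto).
  rewrite -(om_ext (fun _ => True) (fun n => P n \/ ~ P n)) ?u3; last by move=> n; have := classic (P n); tauto.
  case: (u1 P) => e; last by case: h.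
  by rewrite e /ae; lra.
Qed.

Lemma ae_and P Q : ae P -> ae Q -> ae (fun n => P n /\ Q n).
Proof.
  case: U => [u1 [u2 _]] hP hQ; apply: NNPP => no.
  have h1 := ae_not _ no.
  have e0 := u2 (fun n => P n /\ Q n) (fun n => P n /\ ~ Q n) ltac:(by tauto).
  rewrite -(om_ext P (fun n => (P n /\ Q n) \/ (P n /\ ~ Q n))) in e0; last by move=> n; have := classic (Q n); tauto.
  have e1 := u2 Q (fun n => P n /\ ~ Q n) ltac:(by tauto).
  have e2 : om (fun n => P n /\ Q n) = 0 by case: (u1 (fun n => P n /\ Q n)).
  case: (u1 (fun n => Q n \/ P n /\ ~ Q n)) => e3; rewrite /ae in hP hQ; lra.
Qed.

Lemma ae_all (P : nat -> Prop) : (forall n, P n) -> ae P.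
Proof. by move=> h; case: U => [_ [_ [u3 _]]]; apply: ae_mono u3. Qed.

Lemma ae_false : ~ ae (fun _ => False).
Proof.
  case: U => [_ [_ [_ u4]]] h; rewrite /ae u4 in h; first lra.
  by exists 0%nat.
Qed.

Lemma ae_ex P : ae P -> exists n, P n.
Proof.
  move=> h; apply: NNPP => no; apply: ae_false; apply: ae_mono h => n Pn.
  by apply: no; exists n.
Qed.

Lemma ae_ge n0 : ae (fun n => (n0 <= n)%nat).
Proof.
  case: U => [u1 [u2 [u3 u4]]]; apply: NNPP => no.
  have h := ae_not _ no; rewrite /ae u4 in h; first lra.
  by exists n0 => i; lia.
Qed.

Lemma ae_list (T : Type) (l : list T) (P : T -> nat -> Prop) :
  (forall x, In x l -> ae (P x)) -> ae (fun n => forall x, In x l -> P x n).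
Proof.
  elim: l => [|a l IH] h; first by apply: ae_all.
  have h1 := h a (or_introl eq_refl).
  have h2 : ae (fun n => forall x, In x l -> P x n) by apply: IH => x i; apply: h; right.
  by apply: ae_mono (ae_and _ _ h1 h2) => n [p q] x [<-|/q].
Qed.

Lemma ae_lt (P : nat -> nat -> Prop) k : (forall i, (i < k)%nat -> ae (P i)) ->
  ae (fun n => forall i, (i < k)%nat -> P i n).
Proof.
  move=> h; have := ae_list _ (seq 0 k) P => h'.
  apply: ae_mono (h' _) => [n hn i hi|i /in_seq hi]; [apply: hn; apply/in_seq; lia|apply: h; lia].
Qed.

Lemma ae_choose (T : Type) (l : list T) (P : T -> nat -> Prop) :
  ae (fun n => exists x, In x l /\ P x n) -> exists x, In x l /\ ae (P x).
Proof.
  move=> h; apply: NNPP => no; apply: ae_false.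
  have h' := ae_list _ l (fun x n => ~ P x n).
  apply: ae_mono (ae_and _ _ h (h' _)) => [n [[x [i p]] q]|x i]; first exact: (q x).
  by apply: ae_not => p; apply: no; exists x.
Qed.

(** At level [n] the chosen [u n] satisfies as long an initial segment of the conditions as
    possible, with index at most [n]; the cap makes a longest segment exist. *)
Lemma saturation (T : Type) (t0 : T) (Q : nat -> nat -> T -> Prop) :
  (forall j, ae (fun n => exists u, forall i, (i <= j)%nat -> Q i n u)) ->
  exists u : nat -> T, forall j, ae (fun n => Q j n (u n)).
Proof.
  move=> h.
  pose good n j u := (j <= n)%nat /\ forall i, (i <= j)%nat -> Q i n u.
  pose top n j := (exists u, good n j u) /\ forall j', (exists u, good n j' u) -> (j' <= j)%nat.
  exists (fun n => epsilon (inhabits t0) (fun u => exists j, top n j /\ good n j u)) => j.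
  apply: ae_mono (ae_and _ _ (h j) (ae_ge j)) => n [[u hu] hn].
  have [J [[u' hJ] mJ]] : exists J, top n J.
  { apply: (max_nat _ n); first by exists j, u.
    by move=> m [u' []]. }
  have := epsilon_spec (inhabits t0) (fun u => exists j, top n j /\ good n j u)
    (ex_intro _ u' (ex_intro _ J (conj (conj (ex_intro _ u' hJ) mJ) hJ))).
  move=> [J' [[_ mJ'] [_ g]]]; apply: g; apply: mJ'; by exists u.
Qed.

Notation ulim := (ulim om).

Lemma ulim_eq r a b : ulim r a -> ulim r b -> a = b.
Proof.
  move=> ha hb; apply: NNPP => ne.
  have e : 0 < Rabs (a - b) / 2 by have := Rabs_pos_lt (a - b); lra.
  have [n [h1 h2]] := ae_ex _ (ae_and _ _ (ha _ e) (hb _ e)).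
  move: h1 h2; rewrite /Rabs; do ! case: Rcase_abs => ?; lra.
Qed.

(** The limit is the supremum of the [x] with [x <= r n] almost everywhere. *)
Lemma ulim_ex r C : ae (fun n => Rabs (r n) <= C) -> exists L, ulim r L.
Proof.
  move=> hC.
  have [L [up least]] := completeness (fun x => ae (fun n => x <= r n))
    ltac:(exists C => x hx; have [n [h1 h2]] := ae_ex _ (ae_and _ _ hC hx);
          have := Rle_abs (r n); lra)
    ltac:(exists (- C); apply: ae_mono hC => n; rewrite /Rabs; case: Rcase_abs; lra).
  exists L => eps he.
  have h1 : ae (fun n => L - eps < r n).
  { apply: NNPP => no; have : L <= L - eps; last lra.
    apply: least => x hx; apply: NNPP => hh; apply: no; apply: ae_mono hx => n; lra. }
  have h2 : ae (fun n => r n < L + eps).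
  { apply: NNPP => no; have : L + eps <= L; last lra.
    by apply: up; apply: ae_mono (ae_not _ no) => n; lra. }
  apply: ae_mono (ae_and _ _ h1 h2) => n [a b].
  by rewrite /Rabs; case: Rcase_abs; lra.
Qed.

Lemma ulim_add r s a b : ulim r a -> ulim s b -> ulim (fun n => r n + s n) (a + b).
Proof.
  move=> ha hb eps he; have e2 : 0 < eps / 2 by lra.
  apply: ae_mono (ae_and _ _ (ha _ e2) (hb _ e2)) => n [h1 h2].
  move: h1 h2; rewrite /Rabs; do ! case: Rcase_abs => ?; lra.
Qed.

Lemma ulim_scal c r a : ulim r a -> ulim (fun n => c * r n) (c * a).
Proof.
  move=> ha eps he.
  have pc : 0 < Rabs c + 1 by have := Rabs_pos c; lra.
  have e2 : 0 < eps / (Rabs c + 1) by apply: Rdiv_lt_0_compat.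
  apply: ae_mono (ha _ e2) => n h.
  have -> : c * r n - c * a = c * (r n - a) by ring.
  rewrite Rabs_mult.
  have h1 : Rabs (r n - a) * (Rabs c + 1) < eps.
  { have -> : eps = eps / (Rabs c + 1) * (Rabs c + 1) by field; lra.
    exact: Rmult_lt_compat_r. }
  have := Rabs_pos (r n - a); have := Rabs_pos c; nra.
Qed.

Lemma ulim_le r s a b : ulim r a -> ulim s b -> ae (fun n => r n <= s n) -> a <= b.
Proof.
  move=> ha hb h; apply: Rnot_lt_le => l.
  have e : 0 < (a - b) / 2 by lra.
  have [n [[h1 h2] h3]] := ae_ex _ (ae_and _ _ (ae_and _ _ (ha _ e) (hb _ e)) h).
  move: h1 h2; rewrite /Rabs; do ! case: Rcase_abs => ?; lra.
Qed.

Lemma ulim_const c : ulim (fun _ => c) c.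
Proof. by move=> eps he; apply: ae_all => n; rewrite Rminus_diag Rabs_R0. Qed.

Lemma ulim_near r s a : ulim r a -> (forall eps, 0 < eps -> ae (fun n => Rabs (s n - r n) < eps)) -> ulim s a.
Proof.
  move=> ha h eps he; have e2 : 0 < eps / 2 by lra.
  apply: ae_mono (ae_and _ _ (ha _ e2) (h _ e2)) => n [h1 h2].
  move: h1 h2; rewrite /Rabs; do ! case: Rcase_abs => ?; lra.
Qed.

Lemma ulim_ext r s a : ae (fun n => r n = s n) -> ulim r a -> ulim s a.
Proof.
  move=> h ha; apply: (ulim_near r) => // eps he; apply: ae_mono h => n ->.
  by rewrite Rminus_diag Rabs_R0.
Qed.

Lemma ulim_lt r a c : ulim r a -> a < c -> ae (fun n => r n < c).
Proof.
  move=> ha h; apply: ae_mono (ha (c - a) ltac:(lra)) => n.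
  rewrite /Rabs; case: Rcase_abs => ?; lra.
Qed.

Lemma ulim_gt r a c : ulim r a -> c < a -> ae (fun n => c < r n).
Proof.
  move=> ha h; apply: ae_mono (ha (a - c) ltac:(lra)) => n.
  rewrite /Rabs; case: Rcase_abs => ?; lra.
Qed.
End Ultrafilter.

(** * Spectral theory in a pre-Hilbert space *)

Lemma sm_S k f : sm (S k) f = sm k f + f k.
Proof. by rewrite seq_S lsum_app /=; ring. Qed.

Section PreHilbert.
Variables (E : Type) (zero : E) (add : E -> E -> E) (scal : R -> E -> E) (ip : E -> E -> R).
Hypothesis ipC : forall u v, ip u v = ip v u.
Hypothesis ipD : forall u v w, ip (add u v) w = ip u w + ip v w.
Hypothesis ipZ : forall c u w, ip (scal c u) w = c * ip u w.
Hypothesis ip0 : forall w, ip zero w = 0.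
Hypothesis ip_pos : forall u, 0 <= ip u u.

Lemma ipDr u v w : ip w (add u v) = ip w u + ip w v.
Proof. by rewrite ipC ipD !(ipC w). Qed.
Lemma ipZr c u w : ip w (scal c u) = c * ip w u.
Proof. by rewrite ipC ipZ (ipC w). Qed.

Lemma quad_nonneg a b c : (forall t, 0 <= a + 2 * t * b + t ^ 2 * c) -> b ^ 2 <= a * c.
Proof.
  move=> h; case: (Req_dec c 0) => cz.
  - subst c; case: (Req_dec b 0) => b0; first by rewrite b0; lra.
    have := h (- (a + 1) / (2 * b)).
    have -> : 2 * (- (a + 1) / (2 * b)) * b = - (a + 1) by field.
    lra.
  - have c0 : 0 <= c.
    { apply: Rnot_lt_le => cn.
      have := h (1 + (Rabs a + 2 * Rabs b) / - c).
      set q := (Rabs a + 2 * Rabs b) / - c.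
      have e : q * - c = Rabs a + 2 * Rabs b by rewrite /q; field; lra.
      have q0 : 0 <= q.
      { apply: Rmult_le_pos; first by have := Rabs_pos a; have := Rabs_pos b; lra.
        by left; apply: Rinv_0_lt_compat; lra. }
      have h1 := Rle_abs a; have h2 := Rle_abs b.
      have h3 : 2 * (1 + q) * b <= 2 * (1 + q) * Rabs b by nra.
      have := Rabs_pos a; have := Rabs_pos b; nra. }
    have := h (- b / c).
    have -> : a + 2 * (- b / c) * b + (- b / c) ^ 2 * c = (a * c - b ^ 2) / c by field.
    move=> h1; have : 0 <= (a * c - b ^ 2) / c * c by apply: Rmult_le_pos.
    have -> : (a * c - b ^ 2) / c * c = a * c - b ^ 2 by field.
    lra.
Qed.

Lemma ip_CS u v : ip u v ^ 2 <= ip u u * ip v v.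
Proof.
  apply: quad_nonneg => t.
  have := ip_pos (add u (scal t v)); rewrite !ipD !ipZ !ipDr !ipZr (ipC v u); nra.
Qed.

Lemma null_ip u v : ip u u = 0 -> ip u v = 0.
Proof. by move=> e; have := ip_CS u v; rewrite e; nra. Qed.

Fixpoint lc (k : nat) (c : nat -> R) (v : nat -> E) : E :=
  match k with 0%nat => zero | S k' => add (lc k' c v) (scal (c k') (v k')) end.

Lemma ip_lc k c v w : ip (lc k c v) w = sm k (fun i => c i * ip (v i) w).
Proof. by elim: k => [|k IH] //=; rewrite ?ip0 // ipD ipZ IH -sm_S. Qed.

Definition ortho k (v : nat -> E) := forall i j, (i < k)%nat -> (j < k)%nat -> ip (v i) (v j) = dl i j.
Definition perp k (v : nat -> E) u := forall i, (i < k)%nat -> ip u (v i) = 0.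
Definition rest k v u := add u (scal (-1) (lc k (fun i => ip u (v i)) v)).

Lemma ip_rest k v u w : ip (rest k v u) w = ip u w - sm k (fun i => ip u (v i) * ip (v i) w).
Proof. by rewrite /rest ipD ipZ ip_lc; ring. Qed.

Lemma rest_perp k v u : ortho k v -> perp k v (rest k v u).
Proof.
  move=> o i hi; rewrite ip_rest (lsum_ext _ _ _ (fun j => dl i j * ip u (v j))).
  - by rewrite sm_dl //; ring.
  - by move=> j /in_seq hj; rewrite o //; [rewrite dl_sym; ring|lia].
Qed.

Lemma perp_ip_rest k v u w : perp k v w -> ip (rest k v u) w = ip u w.
Proof.
  move=> p; rewrite ip_rest (lsum_ext _ _ _ (fun _ => 0)); first by rewrite lsum_0; ring.
  by move=> i /in_seq hi; rewrite (ipC (v i)) p; [ring|lia].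
Qed.

Lemma rest_sq k v u : ortho k v -> ip (rest k v u) (rest k v u) = ip u (rest k v u).
Proof. by move=> o; apply: perp_ip_rest; apply: rest_perp. Qed.

Lemma rest_pyth k v u : ortho k v -> ip (rest k v u) (rest k v u) = ip u u - sm k (fun i => ip u (v i) ^ 2).
Proof.
  move=> o; rewrite rest_sq // ipC ip_rest; f_equal; apply: lsum_ext => i _.
  by rewrite (ipC (v i)); ring.
Qed.

Lemma bessel k v u : ortho k v -> sm k (fun i => ip u (v i) ^ 2) <= ip u u.
Proof. by move=> o; have := ip_pos (rest k v u); rewrite rest_pyth //; lra. Qed.

Variable T : E -> E.
Hypothesis Tsym : forall u w, ip (T u) w = ip u (T w).

(** The form may be degenerate, so the eigenvector equation is required only after pairing with
    every [w]. *)
Definition eigen k (v : nat -> E) (l : nat -> R) := ortho k v /\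
  forall i w, (i < k)%nat -> ip (T (v i)) w = l i * ip (v i) w.

(** The substitute for compactness of [T]: above a positive level the quadratic form has a unit
    maximiser on the orthogonal complement of finitely many vectors. *)
Definition attains := forall k v tau, ortho k v -> 0 < tau ->
  (exists u, perp k v u /\ tau * ip u u < ip (T u) u) ->
  exists u, ip u u = 1 /\ perp k v u /\ tau < ip (T u) u /\
    forall w, perp k v w -> ip (T w) w <= ip (T u) u * ip w w.

(** First variation along [u + t w] for [w] orthogonal to [v]. For general [w] the projection is
    removed; this changes nothing because [T u] is orthogonal to the earlier eigenvectors. *)
Lemma max_eigen k v l u : eigen k v l -> ip u u = 1 -> perp k v u ->
  (forall w, perp k v w -> ip (T w) w <= ip (T u) u * ip w w) ->
  forall w, ip (T u) w = ip (T u) u * ip u w.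
Proof.
  move=> [o e] u1 pu hm.
  have key : forall w, perp k v w -> ip (T u) w = ip (T u) u * ip u w.
  { move=> w pw.
    have h : forall t, 0 <= 0 + 2 * t * (ip (T u) u * ip u w - ip (T u) w) + t ^ 2 * (ip (T u) u * ip w w - ip (T w) w).
    { move=> t; have := hm (add u (scal t w)).
      have -> : ip (T (add u (scal t w))) (add u (scal t w)) = ip (T u) u + 2 * t * ip (T u) w + t ^ 2 * ip (T w) w.
      { rewrite Tsym ipD ipZ -!Tsym !ipDr !ipZr (Tsym w u) (ipC w); ring. }
      rewrite !ipD !ipZ !ipDr !ipZr (ipC w u) u1 => h.
      have : perp k v (add u (scal t w)) by move=> i hi; rewrite ipD ipZ pu // pw //; ring.
      move=> /h; lra. }
    have := quad_nonneg _ _ _ h; nra. }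
  move=> w; have := key (rest k v w) (rest_perp k v w o).
  have -> : ip (T u) (rest k v w) = ip (T u) w.
  { rewrite ipC ip_rest (lsum_ext _ _ _ (fun _ => 0)); first by rewrite lsum_0 (ipC w); ring.
    move=> i /in_seq hi; have -> : ip (v i) (T u) = 0; last ring.
    by rewrite -Tsym e; [rewrite ipC pu; [ring|lia]|lia]. }
  by rewrite (ipC u (rest k v w)) perp_ip_rest // (ipC w).
Qed.

(** Eigenvectors with eigenvalue above [tau] are added greedily; the trace bound allows at most
    [C / tau] of them. *)
Lemma spectral C tau : attains -> 0 < tau ->
  (forall k v, ortho k v -> sm k (fun i => ip (T (v i)) (v i)) <= C) ->
  exists k v l, eigen k v l /\ (forall i, (i < k)%nat -> tau < l i) /\
    forall u, perp k v u -> ip (T u) u <= tau * ip u u.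
Proof.
  move=> at' ht trace.
  pose P k := exists v l, eigen k v l /\ forall i, (i < k)%nat -> tau < l i.
  have bound : forall k, P k -> (k <= Z.to_nat (up (C / tau)))%nat.
  { move=> k [v [l [[o e] hl]]].
    have h : INR k * tau <= C.
    { apply: Rle_trans (trace k v o); rewrite -{1}(length_seq k 0) -lsum_const.
      apply: lsum_le => i /in_seq hi; rewrite e; last lia.
      by rewrite o /dl ?Nat.eqb_refl; try lia; have := hl i; lra || (move=> hl'; have := hl' ltac:(lia); lra). }
    have : INR k < IZR (up (C / tau)).
    { have [a _] := archimed (C / tau); apply: Rle_lt_trans a.
      apply: (Rmult_le_reg_r tau) => //.
      have -> : C / tau * tau = C by field; lra.
      by []. }
    by rewrite INR_IZR_INZ => /lt_IZR; lia. }
  have [k [[v [l [eg hl]]] hm]] := max_nat P _ ltac:(by exists 0%nat, (fun _ => zero), (fun _ => 0); do ! split; move=> *; lia) bound.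
  exists k, v, l; split=> //; split=> // u pu; apply: Rnot_lt_le => hu.
  have [u1 [n1 [p1 [t1 m1]]]] := at' k v tau (proj1 eg) ht (ex_intro _ u (conj pu hu)).
  have e1 := max_eigen k v l u1 eg n1 p1 m1.
  case: eg => [o e].
  have : (S k <= k)%nat; last lia.
  apply: hm; exists (fun i => if Nat.eqb i k then u1 else v i), (fun i => if Nat.eqb i k then ip (T u1) u1 else l i).
  split; first split.
  - move=> i j hi hj; case: (Nat.eqb_spec i k) => ik; case: (Nat.eqb_spec j k) => jk.
    + by rewrite n1 /dl ik jk Nat.eqb_refl.
    + rewrite p1; last lia.
      by rewrite /dl; case: (Nat.eqb_spec i j) => //; lia.
    + rewrite ipC p1; last lia.
      by rewrite /dl; case: (Nat.eqb_spec i j) => //; lia.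
    + by apply: o; lia.
  - move=> i w hi; case: (Nat.eqb_spec i k) => ik; first exact: e1.
    by apply: e; lia.
  - by move=> i hi; case: (Nat.eqb_spec i k) => ik //; apply: hl; lia.
Qed.

(** [u = A v_i - proj (A v_i)] satisfies [<Tu, u> = l_i |u|^2], which exceeds
    [tau |u|^2] unless [u] is null. *)
Lemma eigen_invariant k v l tau A : eigen k v l -> (forall i, (i < k)%nat -> tau < l i) ->
  (forall u, perp k v u -> ip (T u) u <= tau * ip u u) ->
  (forall u w, ip (A u) (A w) = ip u w) ->
  (forall u w z, ip (A (add u w)) z = ip (A u) z + ip (A w) z) ->
  (forall c u z, ip (A (scal c u)) z = c * ip (A u) z) ->
  (forall u w, ip (T (A u)) w = ip (A (T u)) w) ->
  forall i w, (i < k)%nat -> ip (A (v i)) w = sm k (fun j => ip (A (v i)) (v j) * ip (v j) w).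
Proof.
  move=> [o e] hl hp iso AD AZ com i w hi.
  have e1 : forall w, ip (T (A (v i))) w = l i * ip (A (v i)) w.
  { move=> w'; rewrite com.
    set z := add (T (v i)) (scal (- l i) (v i)).
    have nz : ip z z = 0 by rewrite /z ipD ipZ e //; ring.
    have := null_ip (A z) w' ltac:(by rewrite iso).
    by rewrite /z AD AZ; lra. }
  set u := rest k v (A (v i)).
  have pu : perp k v u by apply: rest_perp.
  have h : ip (T u) u = l i * ip u u.
  { rewrite {1}/u Tsym ip_rest -Tsym e1 (lsum_ext _ _ _ (fun _ => 0)).
    - by rewrite lsum_0 /u rest_sq //; ring.
    - move=> j /in_seq hj; rewrite -Tsym e; last lia.
      by rewrite (ipC (v j)) pu; [ring|lia]. }
  have := hp u pu; rewrite h => h1; have h2 := ip_pos u; have h3 := hl i hi.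
  have u0 : ip u u = 0 by nra.
  by have := null_ip u w u0; rewrite /u ip_rest; lra.
Qed.

Section Rep.
Variables (W : Group) (H : W -> Prop) (act : W -> E -> E).
Hypothesis sH : is_subgroup W H.
Hypothesis act1 : forall u w, ip (act one u) w = ip u w.
Hypothesis actM : forall x y u w, ip (act (x ** y) u) w = ip (act x (act y u)) w.
Hypothesis actI : forall x u w, ip (act x u) (act x w) = ip u w.
Hypothesis actD : forall x u w z, ip (act x (add u w)) z = ip (act x u) z + ip (act x w) z.
Hypothesis actZ : forall x c u z, ip (act x (scal c u)) z = c * ip (act x u) z.

Lemma act_adj x u w : ip (act x u) w = ip u (act (iv x) w).
Proof.
  have h : ip (act x (act (iv x) w)) (act x u) = ip w (act x u).
  { by rewrite -actM; gs; rewrite act1. }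
  by rewrite ipC -h actI ipC.
Qed.

Definition mat (v : nat -> E) (x : W) i j := ip (act x (v j)) (v i).

Lemma mat_orthrep k v : ortho k v ->
  (forall x i w, H x -> (i < k)%nat -> ip (act x (v i)) w = sm k (fun j => ip (act x (v i)) (v j) * ip (v j) w)) ->
  orthrep W H k (mat v).
Proof.
  move=> o inv; split; [|split].
  - by move=> i j hi hj; rewrite /mat act1 o // dl_sym.
  - move=> x y i j Hx Hy hi hj; rewrite /mat actM act_adj inv //; apply: lsum_ext => l _.
    by rewrite (act_adj x); ring.
  - by move=> x i j Hx hi hj; rewrite /mat act_adj invK ipC.
Qed.
End Rep.
End PreHilbert.

(** * Finitely supported functions on a group *)

Section FiniteSupport.
Variable G : Group.
Implicit Types (f g : G -> R) (l : list G).

Definition covers l f := NoDup l /\ forall x, f x <> 0 -> In x l.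
Definition fs f := exists l, covers l f.
Definition gsum f := lsum (epsilon (inhabits []) (fun l => covers l f)) f.

Lemma lsum_same l l' f : NoDup l -> NoDup l' -> (forall x, f x <> 0 -> (In x l <-> In x l')) ->
  lsum l f = lsum l' f.
Proof.
  move=> nd; elim: nd l' => [|a l0 na _ IH] l' nd' h.
  - rewrite (lsum_ext _ l' f (fun _ => 0)) ?lsum_0 // => x i.
    by apply: NNPP => n; case/(h x n): i.
  - case: (classic (In a l')) => ia.
    + have [l1 [l2 e]] := in_split _ _ ia; subst l'.
      have n12 := NoDup_remove_1 _ _ _ nd'; have na12 := NoDup_remove_2 _ _ _ nd'.
      rewrite /= (IH (l1 ++ l2)) //; first by rewrite !lsum_app /=; lra.
      move=> x nx; have := h x nx; rewrite /= !in_app_iff /= => hx.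
      have [e|ne] := classic (a = x); last by tauto.
      by subst x; rewrite in_app_iff in na12; tauto.
    + have fa : f a = 0.
      { by apply: NNPP => n; apply: ia; apply/(h a n); left. }
      rewrite /= fa (IH l') //; first lra.
      move=> x nx; have := h x nx => /= <-; split; first by right.
      by case=> // e; subst x.
Qed.

Lemma gsum_list l f : covers l f -> gsum f = lsum l f.
Proof.
  move=> c; have [nd h] := epsilon_spec (inhabits []) (fun l => covers l f) (ex_intro _ l c).
  case: c => nd' h'; apply: lsum_same => // x nx; split=> _; [exact: h'|exact: h].
Qed.

Definition dec_nodup (l : list G) := nodup (fun x y => excluded_middle_informative (x = y)) l.

Lemma fs_list l f : (forall x, f x <> 0 -> In x l) -> fs f.
Proof.
  move=> h; exists (dec_nodup l); split; first exact: NoDup_nodup.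
  by move=> x /h; rewrite nodup_In.
Qed.

Lemma covers2 f g : fs f -> fs g -> exists l, covers l f /\ covers l g.
Proof.
  move=> [l [nd h]] [l' [nd' h']]; exists (dec_nodup (l ++ l')).
  by split; split; try exact: NoDup_nodup; move=> x nx; rewrite nodup_In in_app_iff; [left; apply: h|right; apply: h'].
Qed.

Lemma covers_sub l f g : covers l f -> (forall x, f x = 0 -> g x = 0) -> covers l g.
Proof. by move=> [nd h] e; split=> // x nx; apply: h => z; apply: nx; apply: e. Qed.

Lemma fs_sub f g : fs f -> (forall x, f x = 0 -> g x = 0) -> fs g.
Proof. by move=> [l c] e; exists l; apply: covers_sub e. Qed.

Lemma fs_add f g : fs f -> fs g -> fs (fun x => f x + g x).
Proof.
  move=> hf hg; have [l [[nd h] [_ h']]] := covers2 f g hf hg; exists l; split=> // x nx.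
  case: (Req_dec (f x) 0) => e; last exact: h.
  by apply: h' => e'; apply: nx; rewrite e e'; ring.
Qed.

Lemma fs_scal c f : fs f -> fs (fun x => c * f x).
Proof. by move=> h; apply: fs_sub h _ => x ->; ring. Qed.

Lemma fs_mul f g : fs f -> fs (fun x => f x * g x).
Proof. by move=> h; apply: fs_sub h _ => x ->; ring. Qed.

Lemma fs_shift y f : fs f -> fs (fun x => f (y ** x)).
Proof.
  move=> [l [_ h]]; apply: (fs_list (map (fun x => iv y ** x) l)) => x /h i.
  by apply/in_map_iff; exists (y ** x); split=> //; gs.
Qed.

Lemma gsum_ext f g : (forall x, f x = g x) -> gsum f = gsum g.
Proof. by move=> h; f_equal; apply: functional_extensionality. Qed.

Lemma gsum_add f g : fs f -> fs g -> gsum (fun x => f x + g x) = gsum f + gsum g.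
Proof.
  move=> hf hg; have [l [c c']] := covers2 f g hf hg.
  rewrite (gsum_list l f) // (gsum_list l g) // (gsum_list l); first exact: lsum_add.
  case: c => nd h; case: c' => _ h'; split=> // x nx.
  case: (Req_dec (f x) 0) => e; last exact: h.
  by apply: h' => e'; apply: nx; rewrite e e'; ring.
Qed.

Lemma gsum_scal c f : fs f -> gsum (fun x => c * f x) = c * gsum f.
Proof.
  move=> [l cv]; rewrite (gsum_list l f) // (gsum_list l) ?lsum_scal //.
  by apply: covers_sub cv _ => x ->; ring.
Qed.

Lemma gsum_le f g : fs f -> fs g -> (forall x, f x <= g x) -> gsum f <= gsum g.
Proof.
  move=> hf hg h; have [l [c c']] := covers2 f g hf hg.
  by rewrite (gsum_list l f) // (gsum_list l g) //; apply: lsum_le.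
Qed.

Lemma gsum_nonneg f : (forall x, 0 <= f x) -> 0 <= gsum f.
Proof. by move=> h; apply: lsum_nonneg. Qed.

Lemma gsum_CS f g : fs f -> fs g -> gsum (fun x => f x * g x) ^ 2 <= gsum (fun x => f x ^ 2) * gsum (fun x => g x ^ 2).
Proof.
  move=> hf hg; have [l [c c']] := covers2 f g hf hg.
  have c1 : covers l (fun x => f x * g x) by apply: covers_sub c _ => x ->; ring.
  have c2 : covers l (fun x => f x ^ 2) by apply: covers_sub c _ => x ->; ring.
  have c3 : covers l (fun x => g x ^ 2) by apply: covers_sub c' _ => x ->; ring.
  by rewrite (gsum_list l _ c1) (gsum_list l _ c2) (gsum_list l _ c3); apply: lsum_CS.
Qed.

Lemma gsum_shift y f : fs f -> gsum (fun x => f (y ** x)) = gsum f.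
Proof.
  move=> [l [nd h]]; rewrite (gsum_list l f) // (gsum_list (map (fun x => iv y ** x) l)).
  - by rewrite lsum_map; apply: lsum_ext => x _; gs.
  - split; first by apply: NoDup_map_inj => // a b _ _ /cancel_l.
    by move=> x /h i; apply/in_map_iff; exists (y ** x); split=> //; gs.
Qed.

Lemma gsum_swap (F : G -> G -> R) l l' : (forall x y, F x y <> 0 -> In x l /\ In y l') ->
  gsum (fun x => gsum (fun y => F x y)) = gsum (fun y => gsum (fun x => F x y)).
Proof.
  move=> h; set d := dec_nodup l; set d' := dec_nodup l'.
  have cy : forall x, covers d' (F x).
  { by move=> x; split; [exact: NoDup_nodup|move=> y /h [_]; rewrite nodup_In]. }
  have cx : forall y, covers d (fun x => F x y).
  { by move=> y; split; [exact: NoDup_nodup|move=> x /h []; rewrite nodup_In]. }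
  have e1 : (fun x => gsum (fun y => F x y)) = (fun x => lsum d' (F x)).
  { by apply: functional_extensionality => x; apply: gsum_list. }
  have e2 : (fun y => gsum (fun x => F x y)) = (fun y => lsum d (fun x => F x y)).
  { by apply: functional_extensionality => y; apply: gsum_list. }
  rewrite e1 e2 (gsum_list d) ?(gsum_list d'); first exact: lsum_swap.
  - split; first exact: NoDup_nodup.
    move=> y ny; apply: NNPP => ni; apply: ny; rewrite -(lsum_0 _ d); apply: lsum_ext => x _.
    by apply: NNPP => n; apply: ni; rewrite nodup_In; case: (h _ _ n).
  - split; first exact: NoDup_nodup.
    move=> x nx; apply: NNPP => ni; apply: nx; rewrite -(lsum_0 _ d'); apply: lsum_ext => y _.
    by apply: NNPP => n; apply: ni; rewrite nodup_In; case: (h _ _ n).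
Qed.
End FiniteSupport.
Arguments fs {G}. Arguments gsum {G}. Arguments covers {G}.

(** * Lipschitz regularization *)

Section Regularization.
Variable G : Group.
Variable Y : list G.
Hypothesis sY : symm Y.

(** The least function above [h] that is [c]-Lipschitz for left multiplication
    by [Y]. *)
Definition reg (c : R) (h : G -> R) (z : G) : R :=
  epsilon (inhabits 0) (is_lub (fun v => exists j s, pw Y j s /\ v = h (iv s ** z) - c * INR j)).

Variables (c B : R) (h : G -> R).
Hypothesis c0 : 0 <= c.
Hypothesis hB : forall z, h z <= B.

Lemma reg_lub z : is_lub (fun v => exists j s, pw Y j s /\ v = h (iv s ** z) - c * INR j) (reg c h z).
Proof.
  apply: epsilon_spec.
  have [L HL] := completeness (fun v => exists j s, pw Y j s /\ v = h (iv s ** z) - c * INR j)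
    ltac:(exists B => v [j [s [_ ->]]]; have := hB (iv s ** z); have := pos_INR j; nra)
    ltac:(by exists (h (iv one ** z) - c * INR 0), 0%nat, one).
  by exists L.
Qed.

Lemma reg_ge z j s : pw Y j s -> h (iv s ** z) - c * INR j <= reg c h z.
Proof. by move=> p; apply: (proj1 (reg_lub z)); exists j, s. Qed.

Lemma reg_le z b : (forall j s, pw Y j s -> h (iv s ** z) - c * INR j <= b) -> reg c h z <= b.
Proof. by move=> hb; apply: (proj2 (reg_lub z)) => v [j [s [p ->]]]; apply: hb. Qed.

Lemma reg_ge0 z : h z <= reg c h z.
Proof. have := reg_ge z 0 one eq_refl; gs; rewrite /=; lra. Qed.

Lemma reg_shift z j s : pw Y j s -> reg c h z <= reg c h (s ** z) + c * INR j.
Proof.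
  move=> p; apply: reg_le => i t q.
  have := reg_ge (s ** z) (j + i) (s ** t) (pw_add _ _ _ _ _ _ p q).
  by rewrite plus_INR; gs; lra.
Qed.

Lemma reg_lip z j s : pw Y j s -> Rabs (reg c h (s ** z) - reg c h z) <= c * INR j.
Proof.
  move=> p; have h1 := reg_shift z j s p.
  have h2 := reg_shift (s ** z) j (iv s) (pw_inv _ _ _ _ sY p); gsin h2.
  by rewrite /Rabs; case: Rcase_abs; lra.
Qed.
End Regularization.

(** * One scale: inner product, tent function and averaging operator *)

Section Level.
Variables (G : Group) (X : list G).
Hypothesis HX : generates G X.
Notation len := (word_norm G X).
Notation vl := (vol G X).
Variable R0 : nat.
Hypothesis R1 : (1 <= R0)%nat.
Notation N := (INR (vl R0)).

Lemma N_pos : 0 < N.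
Proof. by apply: lt_0_INR; have := vol_pos _ _ HX R0; lia. Qed.
Lemma R_pos : 0 < INR R0.
Proof. by apply: lt_0_INR. Qed.
Hint Resolve N_pos R_pos : core.

Definition supp_in r (f : G -> R) := forall z, f z <> 0 -> (len z <= r)%nat.

Lemma supp_covers r f : supp_in r f -> covers (ball G X r) f.
Proof. by move=> h; split; [exact: ball_NoDup|move=> x /h l; apply/in_ball]. Qed.
Lemma supp_fs r f : supp_in r f -> fs f.
Proof. by move=> /supp_covers h; eexists; exact: h. Qed.

Lemma gsum_bound r f c : supp_in r f -> (forall z, f z <= c) -> gsum f <= INR (vl r) * c.
Proof.
  move=> s h; rewrite (gsum_list _ _ _ (supp_covers _ _ s)) /vol -lsum_const.
  by apply: lsum_le.
Qed.

Definition ipn (f g : G -> R) := gsum (fun z => f z * g z) / N.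

Lemma ipnC f g : ipn f g = ipn g f.
Proof. by rewrite /ipn; f_equal; apply: gsum_ext => z; ring. Qed.

Lemma ipnD f g h : fs f -> fs g -> ipn (fun z => f z + g z) h = ipn f h + ipn g h.
Proof.
  move=> hf hg; rewrite /ipn -Rdiv_plus_distr -gsum_add; [|exact: fs_mul|exact: fs_mul].
  by f_equal; apply: gsum_ext => z; ring.
Qed.

Lemma ipnZ c f h : fs f -> ipn (fun z => c * f z) h = c * ipn f h.
Proof.
  move=> hf; rewrite /ipn (gsum_ext _ _ (fun z => c * (f z * h z))); last by move=> z; ring.
  by rewrite gsum_scal; [rewrite /Rdiv; ring|exact: fs_mul].
Qed.

Lemma ipn_zero : ipn (fun _ => 0) (fun _ => 0) = 0.
Proof.
  rewrite /ipn (gsum_list _ []); first by rewrite /=; field; have := N_pos; lra.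
  by split; [constructor|move=> x; rewrite Rmult_0_l].
Qed.

Lemma ipn_pos f : 0 <= ipn f f.
Proof.
  apply: Rmult_le_pos; first by apply: gsum_nonneg => x; nra.
  by left; apply: Rinv_0_lt_compat.
Qed.

Lemma ipn_CS f g : fs f -> fs g -> ipn f g ^ 2 <= ipn f f * ipn g g.
Proof.
  move=> hf hg; have := gsum_CS _ f g hf hg => h; rewrite /ipn.
  have e : forall f : G -> R, gsum (fun x => f x ^ 2) = gsum (fun x => f x * f x) by move=> f'; apply: gsum_ext => x; ring.
  rewrite !e in h.
  have -> : (gsum (fun z => f z * g z) / N) ^ 2 = gsum (fun z => f z * g z) ^ 2 * / (N * N) by field; have := N_pos; lra.
  have -> : gsum (fun z => f z * f z) / N * (gsum (fun z => g z * g z) / N) =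
     gsum (fun z => f z * f z) * gsum (fun z => g z * g z) * / (N * N) by field; have := N_pos; lra.
  apply: Rmult_le_compat_r => //; left; apply: Rinv_0_lt_compat; have := N_pos; nra.
Qed.

Definition lam (y : G) (f : G -> R) z := f (iv y ** z).

Lemma fs_lam y f : fs f -> fs (lam y f).
Proof. exact: fs_shift. Qed.

Lemma supp_lam y f r s : (len y <= s)%nat -> supp_in r f -> supp_in (s + r) (lam y f).
Proof.
  move=> ly h z /h l; have := lenM _ _ HX y (iv y ** z); gs; lia.
Qed.

Lemma ipn_lam y f g : fs f -> ipn (lam y f) (lam y g) = ipn f g.
Proof. by move=> hf; rewrite /ipn; f_equal; apply: (gsum_shift _ (iv y) (fun z => f z * g z)); apply: fs_mul. Qed.

Lemma ipn_upper r f c : supp_in r f -> 0 <= c -> (forall z, Rabs (f z) <= c) -> ipn f f <= c ^ 2 * (INR (vl r) / N).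
Proof.
  move=> s c0 h; have b := gsum_bound r (fun z => f z * f z) (c ^ 2) ltac:(move=> z nz; apply: s => e; apply: nz; rewrite e; ring).
  rewrite /ipn.
  have -> : c ^ 2 * (INR (vl r) / N) = INR (vl r) * c ^ 2 / N by rewrite /Rdiv; ring.
  apply: Rmult_le_compat_r; first by left; apply: Rinv_0_lt_compat.
  apply: b => z.
  have := h z; have := Rabs_pos (f z); have : f z * f z = Rabs (f z) * Rabs (f z) by rewrite -Rabs_mult Rabs_pos_eq //; nra.
  move=> ->; nra.
Qed.

Lemma ipn_lower r f c z0 : fs f -> 0 <= c -> (forall b, (len b <= r)%nat -> c <= Rabs (f (z0 ** b))) ->
  c ^ 2 * (INR (vl r) / N) <= ipn f f.
Proof.
  move=> hf c0 h; rewrite /ipn -(gsum_shift _ z0 (fun z => f z * f z)); last exact: fs_mul.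
  have -> : c ^ 2 * (INR (vl r) / N) = INR (vl r) * c ^ 2 / N by rewrite /Rdiv; ring.
  apply: Rmult_le_compat_r; first by left; apply: Rinv_0_lt_compat.
  pose g z := match excluded_middle_informative (len z <= r)%nat with left _ => c ^ 2 | right _ => 0 end.
  have sg : supp_in r g by move=> z; rewrite /g; case: excluded_middle_informative.
  apply: (Rle_trans _ (gsum g)).
  - rewrite (gsum_list _ _ _ (supp_covers _ _ sg)) /vol -lsum_const; apply: lsum_le => z /in_ball lz.
    by rewrite /g; case: excluded_middle_informative => // q; [lra|case: q; exact: lz].
  - apply: gsum_le; [exact: supp_fs sg|exact: (fs_shift _ _ (fun z => f z * f z) (fs_mul _ _ _ hf))|].
    move=> z; rewrite /g; case: excluded_middle_informative => q; last by nra.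
    have := h z q; have : f (z0 ** z) * f (z0 ** z) = Rabs (f (z0 ** z)) * Rabs (f (z0 ** z)) by rewrite -Rabs_mult Rabs_pos_eq //; nra.
    move=> ->; have := Rabs_pos (f (z0 ** z)); nra.
Qed.

Definition f0 z := Rmax 0 (1 - INR (len z) / INR R0).

Lemma f0_range z : 0 <= f0 z <= 1.
Proof.
  rewrite /f0; have : 0 <= INR (len z) / INR R0.
  { by apply: Rmult_le_pos; [exact: pos_INR|left; apply: Rinv_0_lt_compat]. }
  by rewrite /Rmax; case: Rle_dec; lra.
Qed.

Lemma f0_supp : supp_in R0 f0.
Proof.
  move=> z h; apply/Nat.nlt_ge => l; apply: h; rewrite /f0 Rmax_left //.
  have : 1 <= INR (len z) / INR R0; last lra.
  apply: (Rmult_le_reg_r (INR R0)) => //.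
  have -> : INR (len z) / INR R0 * INR R0 = INR (len z) by field; have := R_pos; lra.
  by rewrite Rmult_1_l; apply: le_INR; lia.
Qed.

Lemma f0_len z w d : (len z <= len w + d)%nat -> (len w <= len z + d)%nat -> Rabs (f0 z - f0 w) <= INR d / INR R0.
Proof.
  move=> /le_INR h1 /le_INR h2; rewrite !plus_INR in h1 h2.
  have i0 : 0 < / INR R0 by apply: Rinv_0_lt_compat.
  have : Rabs (INR (len z) / INR R0 - INR (len w) / INR R0) <= INR d / INR R0.
  { rewrite /Rdiv -Rmult_minus_distr_r Rabs_mult (Rabs_pos_eq (/ _)); last lra.
    apply: Rmult_le_compat_r; first lra.
    by rewrite /Rabs; case: Rcase_abs; lra. }
  rewrite /f0 /Rmax /Rabs; do ! case: Rcase_abs => ?; do ! case: Rle_dec => ?; lra.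
Qed.

Lemma f0_right z b : Rabs (f0 (z ** b) - f0 z) <= INR (len b) / INR R0.
Proof.
  apply: f0_len; first by have := lenM _ _ HX z b; lia.
  by have := lenM _ _ HX (z ** b) (iv b); rewrite lenV //; gs; lia.
Qed.

Lemma f0_left z b : Rabs (f0 (b ** z) - f0 z) <= INR (len b) / INR R0.
Proof.
  apply: f0_len; first by have := lenM _ _ HX b z; lia.
  by have := lenM _ _ HX (iv b) (b ** z); rewrite lenV //; gs; lia.
Qed.

Lemma f0_fs : fs f0.
Proof. exact: supp_fs f0_supp. Qed.

Lemma f0_norm : ipn f0 f0 <= 1.
Proof.
  have := ipn_upper R0 f0 1 f0_supp ltac:(lra) ltac:(by move=> z; have := f0_range z => h; rewrite Rabs_pos_eq; lra).
  have -> : 1 ^ 2 * (N / N) = 1 by field; have := N_pos; lra.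
  by [].
Qed.

Section Operator.
Variable Y : list G.
Hypothesis sY : symm Y.
Variable m : nat.
Hypothesis m1 : (1 <= m)%nat.
Hypothesis Ym : forall s, pw Y m s -> (len s <= R0)%nat.
Variable a : nat.

Definition ind z : R := match excluded_middle_informative (len z <= a * R0)%nat with left _ => 1 | right _ => 0 end.
(** A cutoff equal to 1 on the ball of radius [a * R0] and changing by at most [1 / m] per letter of
    [Y]. Words of length [m] in [Y] stay within [R0], so it vanishes beyond [(a + 1) * R0]. *)
Definition psi := reg G Y (1 / INR m) ind.

Lemma ind_range z : 0 <= ind z <= 1.
Proof. by rewrite /ind; case: excluded_middle_informative; lra. Qed.
Lemma m_pos : 0 < INR m.
Proof. by apply: lt_0_INR. Qed.
Lemma im_pos : 0 <= 1 / INR m.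
Proof. by apply: Rmult_le_pos; [lra|left; apply: Rinv_0_lt_compat; exact: m_pos]. Qed.

Lemma psi_lip z j s : pw Y j s -> Rabs (psi (s ** z) - psi z) <= INR j / INR m.
Proof.
  move=> p; have := reg_lip _ _ sY (1 / INR m) 1 ind im_pos (fun z => proj2 (ind_range z)) z j s p.
  by rewrite /psi /Rdiv; rewrite Rmult_1_l Rmult_comm.
Qed.

Lemma psi_range z : 0 <= psi z <= 1.
Proof.
  split.
  - have := reg_ge0 _ Y (1 / INR m) 1 ind im_pos (fun z => proj2 (ind_range z)) z.
    by have := ind_range z; rewrite /psi; lra.
  - apply: (reg_le _ Y (1 / INR m) 1 ind im_pos (fun z => proj2 (ind_range z))) => j s _.
    have := ind_range (iv s ** z); have := im_pos; have := pos_INR j; nra.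
Qed.

Lemma psi_one z : (len z <= a * R0)%nat -> psi z = 1.
Proof.
  move=> l; have := reg_ge0 _ Y (1 / INR m) 1 ind im_pos (fun z => proj2 (ind_range z)) z.
  by have := psi_range z; rewrite /psi {3}/ind; case: excluded_middle_informative => // q; lra.
Qed.

Lemma psi_supp : supp_in ((a + 1) * R0) psi.
Proof.
  move=> z nz; apply/Nat.nlt_ge => l; apply: nz.
  suff : psi z <= 0 by have := psi_range z; lra.
  apply: (reg_le _ Y (1 / INR m) 1 ind im_pos (fun z => proj2 (ind_range z))) => j s p.
  have ip := im_pos; have jp := pos_INR j.
  case: (Nat.le_gt_cases j m) => c.
  - have ls := Ym s (pw_mono _ _ _ _ _ c p).
    have : ind (iv s ** z) = 0; last by move=> ->; nra.
    rewrite /ind; case: excluded_middle_informative => // q; exfalso.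
    by have := lenM _ _ HX s (iv s ** z); gs; lia.
  - have := ind_range (iv s ** z) => h.
    have : 1 <= 1 / INR m * INR j; last lra.
    have : INR m <= INR j by apply: le_INR; lia.
    have -> : 1 = 1 / INR m * INR m by field; have := m_pos; lra.
    have -> : 1 / INR m * INR m / INR m = 1 / INR m by field; have := m_pos; lra.
    by move=> ?; apply: Rmult_le_compat_l.
Qed.

Lemma psi_fs : fs psi.
Proof. exact: supp_fs psi_supp. Qed.

Definition coef u y := ipn (lam y f0) u.
(** [top] is the average, with weight [psi], of the rank one operators of the
    translates of [f0]: the weight varies slowly along [Y] on the left, whence
    approximate commutation with left translations, and [f0] varies slowly on
    the right, whence compactness.  [tform] is its quadratic form. *)
Definition top u z := gsum (fun y => psi y * coef u y * f0 (iv y ** z)) / N.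
Definition tform u w := gsum (fun y => psi y * coef u y * coef w y) / N.
Definition kap := INR (vl ((a + 1) * R0)) / N.

Lemma kap_pos : 0 <= kap.
Proof. by apply: Rmult_le_pos; [exact: pos_INR|left; apply: Rinv_0_lt_compat]. Qed.

Lemma top_supp u : supp_in ((a + 2) * R0) (top u).
Proof.
  move=> z nz; apply/Nat.nlt_ge => l; apply: nz.
  rewrite /top (gsum_ext _ _ (fun _ => 0)).
  - rewrite (gsum_list _ [] (fun _ => 0)); first by rewrite /=; field; have := N_pos; lra.
    by split; [constructor|].
  - move=> y; case: (Req_dec (psi y) 0) => e; first by rewrite e; ring.
    case: (Req_dec (f0 (iv y ** z)) 0) => e'; first by rewrite e'; ring.
    have := psi_supp y e; have := f0_supp _ e'; have := lenM _ _ HX y (iv y ** z); gs; lia.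
Qed.

Lemma top_fs u : fs (top u).
Proof. exact: supp_fs (top_supp u). Qed.

Lemma ipn_top u w : fs w -> ipn (top u) w = tform u w.
Proof.
  move=> [l [_ hl]]; rewrite /ipn /top /tform; f_equal.
  have fsy : forall z, fs (fun y => psi y * coef u y * f0 (iv y ** z)).
  { by move=> z; apply: fs_mul; apply: fs_mul; exact: psi_fs. }
  rewrite (gsum_ext _ _ (fun z => gsum (fun y => psi y * coef u y * f0 (iv y ** z) * (w z / N)))); last first.
  { move=> z.
    have -> : gsum (fun y => psi y * coef u y * f0 (iv y ** z) * (w z / N)) =
              w z / N * gsum (fun y => psi y * coef u y * f0 (iv y ** z)).
    { by rewrite -gsum_scal //; apply: gsum_ext => y; ring. }
    by rewrite /Rdiv; ring. }
  rewrite (gsum_swap _ _ l (ball G X ((a + 1) * R0))).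
  - apply: gsum_ext => y; rewrite {3}/coef /ipn.
    rewrite (gsum_ext _ _ (fun z => psi y * coef u y / N * (lam y f0 z * w z))); last by move=> z; rewrite /lam /Rdiv; ring.
    rewrite gsum_scal; first by rewrite /Rdiv; ring.
    by apply: fs_mul; apply: fs_lam; exact: f0_fs.
  - move=> z y n; split.
    + by apply: hl => e; apply: n; rewrite e /Rdiv; ring.
    + by apply/in_ball => //; apply: psi_supp => e; apply: n; rewrite e; ring.
Qed.

Lemma coef_sq u y : fs u -> coef u y ^ 2 <= ipn u u.
Proof.
  move=> hu; have h := ipn_CS (lam y f0) u (fs_lam _ _ f0_fs) hu.
  rewrite ipn_lam in h; last exact: f0_fs.
  have := f0_norm; have := ipn_pos u; have := ipn_pos f0; rewrite /coef; nra.
Qed.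

Lemma div_le x y : x <= y -> x / N <= y / N.
Proof. by move=> h; apply: Rmult_le_compat_r => //; left; apply: Rinv_0_lt_compat. Qed.

Lemma tform_le u C : fs u -> (forall y, coef u y ^ 2 <= C) -> tform u u <= kap * C.
Proof.
  move=> hu h; have -> : kap * C = INR (vl ((a + 1) * R0)) * C / N by rewrite /kap /Rdiv; ring.
  apply: div_le; apply: gsum_bound.
  - by move=> y n; apply: psi_supp => e; apply: n; rewrite e; ring.
  - move=> y; have := h y; have := psi_range y; have := pow2_ge_0 (coef u y) => h1 h2 h3.
    have -> : psi y * coef u y * coef u y = psi y * coef u y ^ 2 by ring.
    nra.
Qed.

Lemma tform_pos u : 0 <= tform u u.
Proof.
  apply: Rmult_le_pos; last by left; apply: Rinv_0_lt_compat.
  apply: gsum_nonneg => y; have := psi_range y; have := pow2_ge_0 (coef u y); nra.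
Qed.

Lemma tformC u w : tform u w = tform w u.
Proof. by rewrite /tform; f_equal; apply: gsum_ext => y; ring. Qed.

Lemma tform_CS u w : tform u w ^ 2 <= tform u u * tform w w.
Proof.
  pose p y := sqrt (psi y).
  have sp : forall y, p y * p y = psi y by move=> y; apply: sqrt_sqrt; have := psi_range y; lra.
  have fp : fs p.
  { apply: (fs_sub _ psi); first exact: psi_fs.
    by move=> y e; rewrite /p e sqrt_0. }
  have h := gsum_CS _ (fun y => p y * coef u y) (fun y => p y * coef w y) (fs_mul _ _ _ fp) (fs_mul _ _ _ fp).
  rewrite (gsum_ext _ _ (fun y => psi y * coef u y * coef w y)) in h; last by move=> y; rewrite -sp; ring.
  rewrite (gsum_ext _ (fun y => (p y * coef u y) ^ 2) (fun y => psi y * coef u y * coef u y)) in h; last by move=> y; rewrite -sp; ring.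
  rewrite (gsum_ext _ (fun y => (p y * coef w y) ^ 2) (fun y => psi y * coef w y * coef w y)) in h; last by move=> y; rewrite -sp; ring.
  rewrite /tform.
  set A := gsum _ in h *; set B := gsum _ in h *; set C := gsum _ in h *.
  have -> : (A / N) ^ 2 = A ^ 2 * / (N * N) by field; have := N_pos; lra.
  have -> : B / N * (C / N) = B * C * / (N * N) by field; have := N_pos; lra.
  by apply: Rmult_le_compat_r => //; left; apply: Rinv_0_lt_compat; have := N_pos; nra.
Qed.

(** [ipn (top u) (top u)] equals [tform u (top u)], so Cauchy-Schwarz for [tform] bounds its square
    by [kap * ipn u u] times [kap * ipn (top u) (top u)]. *)
Lemma top_norm u : fs u -> ipn (top u) (top u) <= kap ^ 2 * ipn u u.
Proof.
  move=> hu; have e := ipn_top u (top u) (top_fs u).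
  have h := tform_CS u (top u).
  have h1 := tform_le u _ hu (fun y => coef_sq u y hu).
  have h2 := tform_le _ _ (top_fs u) (fun y => coef_sq _ y (top_fs u)).
  rewrite -e in h; move: h h1 h2; have := ipn_pos u; have := ipn_pos (top u); have := kap_pos.
  have := tform_pos u; have := tform_pos (top u).
  move: (ipn (top u) (top u)) (ipn u u) (tform u u) (tform (top u) (top u)) => t q p r p0 r0 k0 t0 q0 h h1 h2.
  case: (Req_dec t 0) => tz; first by rewrite tz; nra.
  have : t * t <= (kap * q) * (kap * t) by nra.
  move=> h3; have : t * t <= (kap ^ 2 * q) * t by lra.
  by move/(Rmult_le_reg_r t); apply; lra.
Qed.

Lemma top_sup u B z : fs u -> 0 <= B -> ipn u u <= B ^ 2 -> Rabs (top u z) <= kap * B.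
Proof.
  move=> hu B0 hB.
  have cb : forall y, - B <= coef u y <= B by move=> y; have := coef_sq u y hu; nra.
  have sp : forall c, supp_in ((a + 1) * R0) (fun y => c * (psi y * coef u y * f0 (iv y ** z))).
  { by move=> c y n; apply: psi_supp => e; apply: n; rewrite e; ring. }
  have e : kap * B = INR (vl ((a + 1) * R0)) * B / N by rewrite /kap /Rdiv; ring.
  have up : forall c, -1 <= c <= 1 -> c * top u z <= kap * B.
  { move=> c hc; rewrite e /top.
    have -> : c * (gsum (fun y => psi y * coef u y * f0 (iv y ** z)) / N) =
       gsum (fun y => c * (psi y * coef u y * f0 (iv y ** z))) / N.
    { rewrite gsum_scal; first by rewrite /Rdiv; ring.
      by apply: fs_mul; apply: fs_mul; exact: psi_fs. }
    apply: div_le; apply: gsum_bound => // y.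
    have := cb y; have := psi_range y; have := f0_range (iv y ** z).
    move: (psi y) (coef u y) (f0 (iv y ** z)) => p q r hr hp hq.
    have h1 : -B <= c * q <= B by nra.
    have h2 : 0 <= p * r <= 1 by nra.
    have -> : c * (p * q * r) = (p * r) * (c * q) by ring.
    nra. }
  have := up 1 ltac:(lra); have := up (-1) ltac:(lra).
  by rewrite /Rabs; case: Rcase_abs; lra.
Qed.

(** The variable [z] enters [top u] only through the tent, which is Lipschitz on the right. This
    regularity, independent of that of [u], later upgrades L2 estimates to uniform ones. *)
Lemma top_right u B z b : fs u -> 0 <= B -> ipn u u <= B ^ 2 ->
  Rabs (top u (z ** b) - top u z) <= kap * B * (INR (len b) / INR R0).
Proof.
  move=> hu B0 hB.
  have cb : forall y, - B <= coef u y <= B by move=> y; have := coef_sq u y hu; nra.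
  set d := INR (len b) / INR R0.
  have d0 : 0 <= d by apply: Rmult_le_pos; [exact: pos_INR|left; apply: Rinv_0_lt_compat].
  have e : kap * B * d = INR (vl ((a + 1) * R0)) * (B * d) / N by rewrite /kap /Rdiv; ring.
  have fsy : forall z, fs (fun y => psi y * coef u y * f0 (iv y ** z)).
  { by move=> z'; apply: fs_mul; apply: fs_mul; exact: psi_fs. }
  have up : forall c, -1 <= c <= 1 -> c * (top u (z ** b) - top u z) <= kap * B * d.
  { move=> c hc; rewrite e /top.
    have -> : c * (gsum (fun y => psi y * coef u y * f0 (iv y ** (z ** b))) / N - gsum (fun y => psi y * coef u y * f0 (iv y ** z)) / N) =
       gsum (fun y => c * (psi y * coef u y * f0 (iv y ** (z ** b))) + - c * (psi y * coef u y * f0 (iv y ** z))) / N.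
    { rewrite gsum_add; [|exact: fs_scal|exact: fs_scal].
      by rewrite !gsum_scal //; rewrite /Rdiv; ring. }
    apply: div_le; apply: gsum_bound.
    - by move=> y n; apply: psi_supp => e'; apply: n; rewrite e'; ring.
    - move=> y; have := cb y; have := psi_range y; have := f0_right (iv y ** z) b; rewrite -/d gassoc.
      move: (psi y) (coef u y) (f0 (iv y ** z ** b)) (f0 (iv y ** z)) => p q r s hr hp hq.
      have h0 : - d <= r - s <= d by move: hr; rewrite /Rabs; case: Rcase_abs; lra.
      have h1 : -B <= c * q <= B by nra.
      have h2 : - d <= p * (r - s) <= d by nra.
      have -> : c * (p * q * r) + - c * (p * q * s) = (c * q) * (p * (r - s)) by ring.
      nra. }
  have := up 1 ltac:(lra); have := up (-1) ltac:(lra).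
  by rewrite /Rabs; case: Rcase_abs; lra.
Qed.

Lemma coef_lam u x y : fs u -> coef (lam x u) (x ** y) = coef u y.
Proof.
  move=> hu; rewrite /coef -(ipn_lam x (lam y f0) u); last exact: (fs_lam _ _ f0_fs).
  by f_equal; apply: functional_extensionality => z; rewrite /lam; gs.
Qed.

(** Substituting [x ** y] for [y] reduces the difference to the variation of [psi] under [x], at
    most [j / m], summed over the two balls on which [psi] or its shift is nonzero. *)
Lemma top_commute x j u w : fs u -> fs w -> pw Y j x ->
  Rabs (ipn (top (lam x u)) w - ipn (lam x (top u)) w) <=
    INR j / INR m * (kap * (ipn u u + ipn w w)).
Proof.
  move=> hu hw p.
  set w' := lam (iv x) w; have hw' : fs w' by apply: fs_lam.
  have e1 : ipn (top (lam x u)) w = gsum (fun y => psi (x ** y) * coef u y * coef w' y) / N.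
  { rewrite ipn_top // /tform; f_equal.
    rewrite -(gsum_shift _ x); last by apply: fs_mul; apply: fs_mul; exact: psi_fs.
    apply: gsum_ext => y; rewrite coef_lam //; f_equal.
    by rewrite -(coef_lam w (iv x) (x ** y)) // mulKl. }
  have e2 : ipn (lam x (top u)) w = gsum (fun y => psi y * coef u y * coef w' y) / N.
  { have -> : w = lam x w' by apply: functional_extensionality => z; rewrite /w' /lam; gs.
    by rewrite ipn_lam ?ipn_top //; exact: top_fs. }
  have ew : ipn w' w' = ipn w w by apply: ipn_lam.
  set Q := INR j / INR m.
  have Q0 : 0 <= Q by apply: Rmult_le_pos; [exact: pos_INR|left; apply: Rinv_0_lt_compat; exact: m_pos].
  have f1 : fs (fun y => psi (x ** y)) by apply: fs_shift; exact: psi_fs.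
  set S := ipn u u + ipn w w.
  have S0 : 0 <= S by have := ipn_pos u; have := ipn_pos w; rewrite /S; lra.
  pose V := INR (vl ((a + 1) * R0)).
  have Vb : forall (f : G -> R) r, (forall y, f y <> 0 -> (len y <= r)%nat) -> fs f by move=> f r h; apply: (supp_fs r).
  pose i1 y := match excluded_middle_informative (len y <= (a + 1) * R0)%nat with left _ => 1 | right _ => 0 end.
  have si1 : supp_in ((a + 1) * R0) i1 by move=> y; rewrite /i1; case: excluded_middle_informative.
  have gi1 : gsum i1 <= V.
  { have := gsum_bound _ i1 1 si1; rewrite Rmult_1_r; apply => z.
    by rewrite /i1; case: excluded_middle_informative; lra. }
  have gi1' : gsum (fun y => i1 (x ** y)) <= V by rewrite gsum_shift //; exact: supp_fs si1.
  have i1n : forall y, 0 <= i1 y by move=> y; rewrite /i1; case: excluded_middle_informative; lra.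
  have i1p : forall y, psi y <> 0 -> i1 y = 1.
  { by move=> y /psi_supp h; rewrite /i1; case: excluded_middle_informative => // q; case: q. }
  have bound : forall c, -1 <= c <= 1 -> c * (ipn (top (lam x u)) w - ipn (lam x (top u)) w) <= Q * (kap * S).
  { move=> c hc; rewrite e1 e2.
    have -> : Q * (kap * S) = (Q * S / 2) * (2 * V) / N by rewrite /kap -/V; field; have := N_pos; lra.
    have fa : fs (fun y => psi (x ** y) * coef u y * coef w' y) by apply: fs_mul; apply: fs_mul.
    have fb : fs (fun y => psi y * coef u y * coef w' y) by apply: fs_mul; apply: fs_mul; exact: psi_fs.
    have -> : c * (gsum (fun y => psi (x ** y) * coef u y * coef w' y) / N - gsum (fun y => psi y * coef u y * coef w' y) / N) =
      gsum (fun y => c * (psi (x ** y) * coef u y * coef w' y) + - c * (psi y * coef u y * coef w' y)) / N.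
    { rewrite gsum_add; [|exact: fs_scal|exact: fs_scal].
      by rewrite !gsum_scal //; rewrite /Rdiv; ring. }
    apply: div_le; apply: (Rle_trans _ (gsum (fun y => Q * S / 2 * (i1 (x ** y) + i1 y)))).
    - have fi : fs (fun y => i1 (x ** y) + i1 y).
      { by apply: fs_add; [apply: fs_shift|]; exact: supp_fs si1. }
      apply: gsum_le; [by apply: fs_add; apply: fs_scal|exact: fs_scal|].
      move=> y; have c1 := coef_sq u y hu; have c2 := coef_sq w' y hw'; rewrite ew in c2.
      have := psi_lip y j x p; rewrite -/Q => hQ.
      have hi : psi (x ** y) - psi y = 0 \/ 1 <= i1 (x ** y) + i1 y.
      { case: (Req_dec (psi (x ** y)) 0) => e; last by right; rewrite i1p //; have := i1n y; lra.
        case: (Req_dec (psi y) 0) => e'; last by right; rewrite (i1p y) //; have := i1n (x ** y); lra.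
        by left; lra. }
      have n1 := i1n y; have n2 := i1n (x ** y).
      have -> : c * (psi (x ** y) * coef u y * coef w' y) + - c * (psi y * coef u y * coef w' y) =
         (psi (x ** y) - psi y) * (c * (coef u y * coef w' y)) by ring.
      have cc : - (S / 2) <= c * (coef u y * coef w' y) <= S / 2.
      { have q1 := pow2_ge_0 (coef u y - coef w' y); have q2 := pow2_ge_0 (coef u y + coef w' y).
        have : - (S / 2) <= coef u y * coef w' y <= S / 2 by rewrite /S; split; nra.
        nra. }
      have QS : 0 <= Q * S by apply: Rmult_le_pos.
      case: hi => hi; first by rewrite hi Rmult_0_l; apply: Rmult_le_pos; lra.
      have hd : - Q <= psi (x ** y) - psi y <= Q by move: hQ; rewrite /Rabs; case: Rcase_abs; lra.
      move: (psi (x ** y) - psi y) (c * (coef u y * coef w' y)) (i1 (x ** y) + i1 y) hd cc hi => d e i hd cc hi.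
      have : d * e <= Q * (S / 2) by nra.
      have : Q * (S / 2) * 1 <= Q * (S / 2) * i by apply: Rmult_le_compat_l => //; lra.
      lra.
    - rewrite gsum_scal; last by apply: fs_add; [apply: fs_shift|]; exact: supp_fs si1.
      rewrite gsum_add; [|by apply: fs_shift; exact: supp_fs si1|exact: supp_fs si1].
      apply: Rmult_le_compat_l; last lra.
      have : 0 <= Q * S by apply: Rmult_le_pos.
      lra. }
  have := bound 1 ltac:(lra); have := bound (-1) ltac:(lra).
  by rewrite /Rabs; case: Rcase_abs; lra.
Qed.
End Operator.
End Level.
Arguments lam {G}.

Lemma INR_div r b : (1 <= b)%nat -> INR (r / b) * INR b <= INR r.
Proof.
  by move=> hb; rewrite -mult_INR; apply: le_INR; have := Nat.Div0.mul_div_le r b; lia.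
Qed.

Lemma abs_le_sq x c : 0 <= c -> x ^ 2 <= c ^ 2 -> Rabs x <= c.
Proof. by move=> c0 h; rewrite /Rabs; case: Rcase_abs => ?; nra. Qed.

(** * One scale: displacements *)

Section LevelMore.
Variables (G : Group) (X : list G).
Hypothesis HX : generates G X.
Notation len := (word_norm G X).
Notation vol := (vol G X).
Variable R0 : nat.
Hypothesis R1 : (1 <= R0)%nat.
Notation N := (INR (vol R0)).
Notation ipR := (ipn G X R0).
Notation fR := (f0 G X R0).

Definition mv x (f : G -> R) z := lam x f z + -1 * f z.

Lemma fs_mv x f : fs f -> fs (mv x f).
Proof. by move=> h; apply: fs_add; [exact: fs_lam|exact: fs_scal]. Qed.

Lemma ipnDr f g h : fs f -> fs g -> ipR h (fun z => f z + g z) = ipR h f + ipR h g.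
Proof. by move=> hf hg; rewrite ipnC ipnD // !(ipnC _ _ _ h). Qed.
Lemma ipnZr c f h : fs f -> ipR h (fun z => c * f z) = c * ipR h f.
Proof. by move=> hf; rewrite ipnC ipnZ // (ipnC _ _ _ h). Qed.

Lemma ipn_mv x f g : fs f -> ipR (mv x f) g = ipR (lam x f) g - ipR f g.
Proof.
  move=> hf; rewrite /mv ipnD; [|exact: fs_lam|exact: fs_scal].
  by rewrite ipnZ //; ring.
Qed.

Lemma nrm_add2 f g : fs f -> fs g ->
  ipR (fun z => f z + g z) (fun z => f z + g z) <= 2 * ipR f f + 2 * ipR g g.
Proof.
  move=> hf hg; have fg : fs (fun z => f z + -1 * g z) by apply: fs_add => //; apply: fs_scal.
  have := ipn_pos G X HX R0 R1 (fun z => f z + -1 * g z).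
  have fg' : fs (fun z => -1 * g z) by apply: fs_scal.
  have fa : fs (fun z => f z + g z) by apply: fs_add.
  rewrite !(ipnD G X R0) // !ipnDr // !(ipnZ G X R0) // !ipnZr //.
  by rewrite (ipnC _ _ _ g f); lra.
Qed.

Lemma nrm_mv x f : fs f -> ipR (mv x f) (mv x f) <= 4 * ipR f f.
Proof.
  move=> hf; have hl : fs (lam x f) by apply: fs_lam.
  have := nrm_add2 (lam x f) (fun z => -1 * f z) hl (fs_scal _ _ _ hf).
  by rewrite -/(mv x f) ipn_lam // ipnZ // ipnZr //; lra.
Qed.

Lemma fs_sum k (c : nat -> R) f : (forall i, fs (f i)) -> fs (fun z : G => lsum (seq 0 k) (fun i => c i * f i z)).
Proof.
  move=> hf; elim: (seq 0 k) => [|i l IH] /=; first by exists []; split; [constructor|].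
  by apply: fs_add => //; apply: fs_scal.
Qed.

Lemma nrm_lin k (c : nat -> R) f : (forall i, fs (f i)) ->
  ipR (fun z => lsum (seq 0 k) (fun i => c i * f i z)) (fun z => lsum (seq 0 k) (fun i => c i * f i z)) <=
  lsum (seq 0 k) (fun i => c i ^ 2) * lsum (seq 0 k) (fun i => ipR (f i) (f i)).
Proof.
  move=> hf; set C := lsum _ (fun i => c i ^ 2).
  have e : forall l, fs (fun z => lsum l (fun i => f i z ^ 2)) /\ lsum l (fun i => ipR (f i) (f i)) = gsum (fun z => lsum l (fun i => f i z ^ 2)) / N.
  { elim=> [|i l [IH1 IH2]] /=.
    - have c0 : covers [] (fun _ : G => 0) by split; [constructor|].
      by split; [exists []|rewrite (gsum_list _ _ _ c0) /Rdiv /=; ring].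
    - have f2 : fs (fun z => f i z ^ 2) by apply: (fs_sub _ (f i)) => // x ->; ring.
      split; first exact: fs_add.
      rewrite IH2 gsum_add // Rdiv_plus_distr; f_equal; rewrite /ipn; f_equal.
      by apply: gsum_ext => z; ring. }
  have [fl ->] := e (seq 0 k).
  have -> : C * (gsum (fun z => lsum (seq 0 k) (fun i => f i z ^ 2)) / N) = gsum (fun z => C * lsum (seq 0 k) (fun i => f i z ^ 2)) / N.
  { by rewrite gsum_scal // /Rdiv; ring. }
  apply: Rmult_le_compat_r; first by left; apply: Rinv_0_lt_compat; exact: (N_pos G X HX R0 R1).
  apply: gsum_le.
  - by apply: fs_mul; apply: fs_sum.
  - exact: fs_scal.
  - move=> z; have := lsum_CS _ (seq 0 k) c (fun i => f i z); rewrite -/C /=; lra.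
Qed.

Lemma ipn_abs_le f g a b : fs f -> fs g -> 0 <= a -> 0 <= b -> ipR f f <= a ^ 2 -> ipR g g <= b ^ 2 -> Rabs (ipR f g) <= a * b.
Proof.
  move=> hf hg a0 b0 ha hb; apply: abs_le_sq; first exact: Rmult_le_pos.
  have h := ipn_CS G X HX R0 R1 f g hf hg.
  rewrite Rpow_mult_distr; apply: (Rle_trans _ _ _ h).
  by apply: Rmult_le_compat => //; apply: ipn_pos.
Qed.

Lemma Rp : 0 < INR R0.
Proof. exact: R_pos. Qed.

Lemma frac_le r b : (1 <= b)%nat -> (r <= R0 / b)%nat -> INR r / INR R0 <= / INR b.
Proof.
  move=> hb /le_INR h; have h2 := INR_div R0 b hb; have p := Rp.
  have bp : 0 < INR b by apply: lt_0_INR.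
  apply: (Rmult_le_reg_r (INR R0 * INR b)); first exact: Rmult_lt_0_compat.
  have -> : INR r / INR R0 * (INR R0 * INR b) = INR r * INR b by field; lra.
  have -> : / INR b * (INR R0 * INR b) = INR R0 by field; lra.
  nra.
Qed.

(** On the ball of radius [R0 / 4] the tent is at least 3/4, while [iv x] carries this ball to a
    place where it is at most 1/2. *)
Lemma f0_moves x : (R0 <= len x + R0 / 4)%nat -> (1 / 4) ^ 2 * (INR (vol (R0 / 4)) / N) <= ipR (mv x fR) (mv x fR).
Proof.
  move=> hx; apply: (ipn_lower G X HX R0 R1 _ _ _ one); first by apply: fs_mv; exact: f0_fs.
  - lra.
  - move=> b hb; rewrite gidl /mv /lam.
    have p := Rp.
    have h1 : INR (len b) / INR R0 <= 1 / 4 by have := frac_le (len b) 4 ltac:(lia) hb; rewrite /=; lra.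
    have h2 : 3 / 4 <= fR b.
    { by rewrite /f0; have := Rmax_r 0 (1 - INR (len b) / INR R0); lra. }
    have h3 : fR (iv x ** b) <= 1 / 2.
    { rewrite /f0; apply: Rmax_lub; first lra.
      suff : 1 / 2 <= INR (len (iv x ** b)) / INR R0 by lra.
      apply: (Rmult_le_reg_r (INR R0)) => //.
      have -> : INR (len (iv x ** b)) / INR R0 * INR R0 = INR (len (iv x ** b)) by field; lra.
      have l : (R0 <= len (iv x ** b) + 2 * (R0 / 4))%nat.
      { have := lenM _ _ HX x (iv x ** b); have := lenM _ _ HX (x ** (iv x ** b)) (iv b).
        rewrite lenV //; gs; have := lenM _ _ HX b (iv (iv x ** b)); rewrite lenV //; gs; lia. }
      have := INR_div R0 4 ltac:(lia); move/le_INR: l; rewrite plus_INR mult_INR /=; lra. }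
    by rewrite Rabs_left1; lra.
Qed.

Lemma f0_moves_le b z : (1 <= b)%nat -> (len z <= R0 / b)%nat ->
  ipR (mv z fR) (mv z fR) <= (/ INR b) ^ 2 * (INR (vol (2 * R0)) / N).
Proof.
  move=> hb hz; have bp : 0 < / INR b by apply: Rinv_0_lt_compat; apply: lt_0_INR.
  apply: ipn_upper => //; last first.
  - move=> w; rewrite /mv /lam.
    have := f0_left G X HX R0 R1 w (iv z); rewrite lenV //.
    have := frac_le (len z) b hb hz.
    have -> : fR (iv z ** w) + -1 * fR w = fR (iv z ** w) - fR w by ring.
    lra.
  - lra.
  - move=> w nz; have lz : (len z <= R0)%nat.
    { by apply: (Nat.le_trans _ _ _ hz); apply: Nat.Div0.div_le_upper_bound; nia. }
    case: (Req_dec (fR w) 0) => e.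
    + have : lam z fR w <> 0 by move=> e'; apply: nz; rewrite /mv e e'; ring.
      by move/(supp_lam G X HX R0 R1 z fR R0 R0 lz (f0_supp G X R0 R1)); lia.
    + by have := f0_supp G X R0 R1 w e; lia.
Qed.

(** A value above [eta] at [z0] persists above [eta / 2] on the points [z0 ** c] with
    [len c <= R0 / b]. Used contrapositively: small in L2 implies uniformly small. *)
Lemma moved_sup w L b eta z0 : fs w -> 0 < eta -> (1 <= b)%nat -> 0 <= L -> L * / INR b <= eta / 2 ->
  (forall z c, Rabs (w (z ** c) - w z) <= L * (INR (len c) / INR R0)) -> eta < Rabs (w z0) ->
  (eta / 2) ^ 2 * (INR (vol (R0 / b)) / N) <= ipR w w.
Proof.
  move=> fw e0 hb L0 hL lip hz; apply: (ipn_lower G X HX R0 R1 _ _ _ z0) => //; first lra.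
  move=> c hc; have h1 := lip z0 c; have h2 := frac_le (len c) b hb hc.
  have : L * (INR (len c) / INR R0) <= L * / INR b by apply: Rmult_le_compat_l.
  by move: h1 hz; rewrite /Rabs; do ! case: Rcase_abs => ?; lra.
Qed.

Section Op.
Variable Y : list G.
Variable m : nat.
Hypothesis m1 : (1 <= m)%nat.
Hypothesis Ym : forall s, pw Y m s -> (len s <= R0)%nat.
Notation coef := (coef G X R0).
Notation tfR a := (tform G X R0 Y m a).
Notation psi a := (psi G X R0 Y m a).

Lemma tform_lower a r c u : (r <= a * R0)%nat -> 0 <= c -> (forall y, (len y <= r)%nat -> c <= Rabs (coef u y)) ->
  c ^ 2 * (INR (vol r) / N) <= tfR a u u.
Proof.
  move=> hr c0 h; pose p y := sqrt (psi a y).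
  have sp : forall y, p y * p y = psi a y by move=> y; apply: sqrt_sqrt; have := psi_range G X R0 Y m m1 a y; lra.
  have fp : fs p.
  { apply: (fs_sub _ (psi a)); first exact: psi_fs.
    by move=> y e; rewrite /p e sqrt_0. }
  have -> : tfR a u u = ipR (fun y => p y * coef u y) (fun y => p y * coef u y).
  { by rewrite /tform /ipn; f_equal; apply: gsum_ext => y; rewrite -sp; ring. }
  apply: (ipn_lower G X HX R0 R1 _ _ _ one) => //; first exact: fs_mul.
  by move=> b hb; rewrite gidl /p psi_one //; [rewrite sqrt_1 Rmult_1_l; exact: h|lia].
Qed.

(** The narrow window, shifted by [y], is supported in the ball of radius [(2 * b + 2) * R0], where
    the wide window equals 1. *)
Lemma tform_translate b y u : fs u -> (len y <= 2 * b * R0)%nat ->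
  tfR 1 (lam y u) (lam y u) <= tfR (2 * b + 2) u u.
Proof.
  move=> hu ly; apply: Rmult_le_compat_r; first by left; apply: Rinv_0_lt_compat; exact: (N_pos G X HX R0 R1).
  have fp : forall a, fs (psi a) by move=> a; apply: psi_fs.
  rewrite -(gsum_shift _ y); last by apply: fs_mul; apply: fs_mul.
  apply: gsum_le.
  - by apply: fs_mul; apply: fs_mul; apply: (fs_shift _ y (psi 1)).
  - by apply: fs_mul; apply: fs_mul.
  - move=> z; rewrite coef_lam //; move: (coef u z) => q; rewrite !Rmult_assoc; apply: Rmult_le_compat_r; first exact: (Rle_0_sqr q).
    case: (Req_dec (psi 1 (y ** z)) 0) => e.
    + by rewrite e; have := psi_range G X R0 Y m m1 (2 * b + 2) z; lra.
    + have s := psi_supp G X HX R0 R1 Y m m1 Ym 1 _ e.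
      rewrite (psi_one G X R0 Y m m1 (2 * b + 2) z); first by have := psi_range G X R0 Y m m1 1 (y ** z); lra.
      by have := lenM _ _ HX (iv y) (y ** z); rewrite lenV //; gs; lia.
Qed.
End Op.

(** The slope [(2 * B + 1) / Q] makes a word of length [Q] or more pay at least [2 * B + 1], beyond
    the oscillation of [vs]; shorter words raise the value by at most [eta]. *)
Lemma reg_close (Y : list G) vs B eta Q z : 0 <= B -> 0 <= eta -> (1 <= Q)%nat ->
  (forall z, Rabs (vs z) <= B) ->
  (forall s z, pw Y Q s -> Rabs (vs (iv s ** z) - vs z) <= eta) ->
  vs z <= reg G Y ((2 * B + 1) / INR Q) vs z <= vs z + eta.
Proof.
  move=> B0 e0 hQ hB hs; have Qp : 0 < INR Q by apply: lt_0_INR.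
  have c0 : 0 <= (2 * B + 1) / INR Q by apply: Rmult_le_pos; [lra|left; apply: Rinv_0_lt_compat].
  have ub : forall z, vs z <= B by move=> z'; have := hB z'; have := Rle_abs (vs z'); lra.
  split; first exact: (reg_ge0 G Y _ B vs c0 ub).
  apply: (reg_le G Y _ B vs c0 ub) => j s p; have jp := pos_INR j.
  case: (Nat.le_gt_cases j Q) => c.
  - have := hs s z (pw_mono _ _ _ _ _ c p); have := Rle_abs (vs (iv s ** z) - vs z); nra.
  - have : INR Q <= INR j by apply: le_INR; lia.
    move=> /(Rmult_le_compat_l _ _ _ c0).
    have -> : (2 * B + 1) / INR Q * INR Q = 2 * B + 1 by field; lra.
    have := ub (iv s ** z); have := hB z; have := Rle_abs (- vs z); rewrite Rabs_Ropp; lra.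
Qed.
End LevelMore.
Arguments mv {G}.

(** Among the [p] blocks of length [m] along a word from 1 to [x], one carries at least the average
    drop. *)
Lemma telescope (G : Group) (Y : list G) (F : G -> R) m c p x : (1 <= p)%nat -> pw Y (p * m) x ->
  INR p * c <= F one - F x -> exists y g, pw Y (p * m) y /\ pw Y m g /\ c <= F y - F (y ** g).
Proof.
  elim: p x => [|p IH] x h1 hx hc; first lia.
  have e : (S p * m = p * m + m)%nat by lia.
  rewrite e in hx; have [x' [g [h2 [h3 ex]]]] := pw_split _ _ _ _ _ hx.
  case: (Rle_lt_dec c (F x' - F (x' ** g))) => hl.
  - by exists x', g; split=> //; apply: pw_mono h2; lia.
  - rewrite S_INR ex in hc; case: p h2 IH {h1 hx e} hc => [|p] h2 IH hc.
    + by move: h2 hl hc => /= -> ; rewrite gidl; lra.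
    + have [y [g' [q1 [q2 q3]]]] := IH x' ltac:(lia) h2 ltac:(lra).
      by exists y, g'; split=> //; apply: pw_mono q1; lia.
Qed.

(** * One scale: the regularized eigenvector *)

Section LevelGradient.
Variables (G : Group) (X : list G).
Hypothesis HX : generates G X.
Notation len := (word_norm G X).
Notation vol := (vol G X).
Variable R0 : nat.
Hypothesis R1 : (1 <= R0)%nat.
Notation N := (INR (vol R0)).
Notation ipn := (ipn G X R0).
Variables (vs v0 : G -> R) (B : R).
Hypothesis B0 : 0 <= B.
Hypothesis fvs : fs vs.
Hypothesis fv0 : fs v0.
Notation er := (fun z => vs z + -1 * v0 z).

Lemma fs_er : fs er.
Proof. by apply: fs_add => //; apply: fs_scal. Qed.

(** The displacement of [v0] is small in L2; [vs] is L2-close to [v0] and Lipschitz on the right, so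
    by [moved_sup] its displacement is uniformly small. *)
Lemma level_close eta b kap s z : 0 < eta -> (1 <= b)%nat -> 2 * B * / INR b <= eta / 2 ->
  (forall z c, Rabs (vs (z ** c) - vs z) <= B * (INR (len c) / INR R0)) ->
  kap <= (eta / 2) ^ 2 * (INR (vol (R0 / b)) / N) -> 0 < kap ->
  ipn (mv s v0) (mv s v0) <= kap / 4 -> ipn er er <= kap / 32 ->
  Rabs (vs (iv s ** z) - vs z) <= eta.
Proof.
  move=> he hb hB lip hk k0 h1 h2; apply: Rnot_lt_le => big.
  have e : mv s vs = (fun z => mv s v0 z + mv s er z).
  { by apply: functional_extensionality => w; rewrite /mv /lam; ring. }
  have fe := fs_er.
  have h3 : ipn (mv s vs) (mv s vs) <= 2 * (kap / 4) + 8 * (kap / 32).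
  { rewrite e; have a1 := nrm_add2 G X HX R0 R1 (mv s v0) (mv s er) (fs_mv G s _ fv0) (fs_mv G s _ fe).
    have a2 := nrm_mv G X HX R0 R1 s er fe; lra. }
  have big' : eta < Rabs (mv s vs z).
  { by rewrite /mv /lam; have -> : vs (iv s ** z) + -1 * vs z = vs (iv s ** z) - vs z by ring. }
  have := moved_sup G X HX R0 R1 (mv s vs) (2 * B) b eta z (fs_mv G s _ fvs) he hb ltac:(lra) hB _ big'.
  have lip' : forall z c, Rabs (mv s vs (z ** c) - mv s vs z) <= 2 * B * (INR (len c) / INR R0).
  { move=> w c; rewrite /mv /lam gassoc.
    have := lip (iv s ** w) c; have := lip w c.
    by rewrite /Rabs; do ! case: Rcase_abs => ?; lra. }
  move=> /(_ lip'); lra.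
Qed.

Section Gain.
Variables (Y1 : list G) (b Q : nat) (eta th : R).
Hypothesis Q1 : (1 <= Q)%nat.
Hypothesis hb : forall s, pw Y1 Q s -> (len s <= b * R0)%nat.
Hypothesis e0 : 0 <= eta.
Hypothesis th0 : 0 < th.
Hypothesis svs : supp_in G X (3 * R0) vs.
Hypothesis hB : forall z, Rabs (vs z) <= B.
Hypothesis close : forall s z, pw Y1 Q s -> Rabs (vs (iv s ** z) - vs z) <= eta.
Notation fb := (reg G Y1 ((2 * B + 1) / INR Q) vs).

Lemma fb_close z : vs z <= fb z <= vs z + eta.
Proof. exact: reg_close. Qed.

Lemma fb_supp : supp_in G X ((b + 3) * R0) fb.
Proof.
  have Qp : 0 < INR Q by apply: lt_0_INR.
  have c0 : 0 <= (2 * B + 1) / INR Q by apply: Rmult_le_pos; [lra|left; apply: Rinv_0_lt_compat].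
  have ub : forall z, vs z <= B by move=> z'; have := hB z'; have := Rle_abs (vs z'); lra.
  have vz : forall z, (3 * R0 < len z)%nat -> vs z = 0.
  { by move=> z l; apply: NNPP => n; have := svs z n; lia. }
  move=> z nz; apply/Nat.nlt_ge => l; apply: nz; apply: Rle_antisym.
  - apply: (reg_le G Y1 _ B vs c0 ub) => j s p; have jp := pos_INR j.
    case: (Nat.le_gt_cases j Q) => c.
    + have ls := hb s (pw_mono _ _ _ _ _ c p).
      rewrite vz; first by have := Rmult_le_pos _ _ c0 jp; lra.
      by have := lenM _ _ HX s (iv s ** z); gs; lia.
    + have : INR Q <= INR j by apply: le_INR; lia.
      move=> /(Rmult_le_compat_l _ _ _ c0).
      have -> : (2 * B + 1) / INR Q * INR Q = 2 * B + 1 by field; lra.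
      have := ub (iv s ** z); lra.
  - by have := fb_close z; rewrite vz; [lra|lia].
Qed.

(** For [v0] paired with itself the gain is half of [ipn (mv x v0) (mv x v0)], more than [th / 2].
    Replacing [v0] by [fb] in one slot costs at most [th / 4], since [fb] is uniformly within [eta]
    of [vs] and [vs] is L2-close to [v0]. *)
Lemma fb_gain x : th < ipn (mv x v0) (mv x v0) -> ipn v0 v0 <= 2 ^ 2 -> ipn er er <= th ^ 2 / 2048 ->
  eta ^ 2 * (INR (vol ((b + 3) * R0)) / N) * 2 <= th ^ 2 / 1024 ->
  th / 4 <= ipn fb v0 - ipn (lam x fb) v0.
Proof.
  move=> hx hv he hC.
  have fe := fs_er; have ffb : fs fb by apply: supp_fs fb_supp.
  pose r z := fb z + -1 * vs z.
  have fr : fs r by apply: fs_add => //; apply: fs_scal.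
  pose g z := er z + r z.
  have fg : fs g by apply: fs_add.
  have nr : ipn r r <= eta ^ 2 * (INR (vol ((b + 3) * R0)) / N).
  { apply: ipn_upper => //.
    - move=> z nz; case: (Req_dec (fb z) 0) => e; last exact: fb_supp.
      case: (Req_dec (vs z) 0) => e'; first by case: nz; rewrite /r e e'; ring.
      by have := svs z e'; nia.
    - by move=> z; have := fb_close z; rewrite /r => h; rewrite Rabs_pos_eq; lra. }
  have ng : ipn g g <= th ^ 2 / 512 by have := nrm_add2 G X HX R0 R1 er r fe fr; rewrite -/g; lra.
  have efb : fb = (fun z => v0 z + g z) by apply: functional_extensionality => z; rewrite /g /r; ring.
  have i1 : ipn (mv x v0) (mv x v0) = 2 * ipn v0 v0 - 2 * ipn (lam x v0) v0.
  { have fl : fs (lam x v0) by apply: fs_lam.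
    rewrite (ipn_mv G X R0 x v0 _ fv0) !(ipnC _ _ _ _ (mv x v0)) !(ipn_mv G X R0 x v0 _ fv0) ipn_lam // (ipnC _ _ _ v0 (lam x v0)); ring. }
  have -> : ipn fb v0 - ipn (lam x fb) v0 = (ipn v0 v0 - ipn (lam x v0) v0) - ipn (mv x g) v0.
  { have -> : lam x fb = (fun z => lam x v0 z + lam x g z) by rewrite efb.
    have f1 : fs (lam x v0) by apply: fs_lam.
    have f2 : fs (lam x g) by apply: fs_lam.
    rewrite {1}efb (ipnD G X R0 v0 g) // (ipnD G X R0 (lam x v0) (lam x g)) //.
    by rewrite (ipn_mv G X R0 x g) //; ring. }
  have nm : ipn (mv x g) (mv x g) <= (th / 8) ^ 2 by have := nrm_mv G X HX R0 R1 x g fg; nra.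
  have := ipn_abs_le G X HX R0 R1 (mv x g) v0 (th / 8) 2 (fs_mv G x _ fg) fv0 ltac:(lra) ltac:(lra) nm hv.
  have := Rle_abs (ipn (mv x g) v0); lra.
Qed.
End Gain.
End LevelGradient.

(** * Orthogonal groups have no small subgroups *)

Fixpoint dbl (W : Group) (j : nat) (x : W) : W :=
  match j with 0%nat => x | S j' => dbl W j' x ** dbl W j' x end.

Lemma pw_dbl (G : Group) (Y : list G) i j x : pw Y j x -> pw Y (2 ^ i * j) (dbl G i x).
Proof.
  move=> h; elim: i => [|i IH]; first by rewrite /= Nat.add_0_r.
  have -> : (2 ^ S i * j = 2 ^ i * j + 2 ^ i * j)%nat by rewrite /=; lia.
  exact: pw_add.
Qed.

Section NoSmallSubgroups.
Variables (W : Group) (H : W -> Prop) (k : nat) (M : W -> nat -> nat -> R).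
Hypothesis sH : is_subgroup W H.
Hypothesis rep : orthrep W H k M.

(** Uses [x ^ 2 - 1 = 2 (x - 1) + (x - 1) ^ 2] and [(2 a + c) ^ 2 >= 3 a ^ 2 - 3 c ^ 2] entrywise;
    for [hs x <= 1/4] the factor [3 - 3/4] exceeds 2. *)
Lemma hs_square x : H x -> hs W k M x <= 1 / 4 -> 2 * hs W k M x <= hs W k M (x ** x).
Proof.
  move=> hx small.
  have c := ms_CS k (fun i j => M x i j - dl i j) (fun i j => M x i j - dl i j).
  rewrite -!/(hs W k M x) in c.
  have key : 3 * hs W k M x - 3 * (hs W k M x * hs W k M x) <= hs W k M (x ** x).
  { apply: (Rle_trans _ (3 * hs W k M x - 3 * sm k (fun i => sm k (fun j =>
       (sm k (fun l => (M x i l - dl i l) * (M x l j - dl l j))) ^ 2)))); first lra.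
    rewrite /hs -!lsum_scal -lsum_sub; apply: lsum_le => i /in_seq hi.
    rewrite -!lsum_scal -lsum_sub; apply: lsum_le => j /in_seq hj.
    rewrite (mul_sub_one W H k M rep x x i j) //; try lia.
    have := pow2_ge_0 ((M x i j - dl i j) + 2 * (M (x ** x) i j - M x i j - M x i j + dl i j)); nra. }
  have := hs_nonneg W k M x; nra.
Qed.

Lemma no_small_subgroups x : H x -> (forall j, hs W k M (dbl W j x) <= 1 / 4) -> hs W k M x = 0.
Proof.
  move=> hx h; have hd : forall j, H (dbl W j x) by elim=> [|j IH] //=; apply: (sgM _ _ _ _ sH).
  have g : forall j, INR j * hs W k M x <= hs W k M (dbl W j x) /\ hs W k M x <= hs W k M (dbl W j x).
  { elim=> [|j [IH1 IH2]]; first by rewrite /=; have := hs_nonneg W k M x; lra.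
    have := hs_square _ (hd j) (h j); have := hs_nonneg W k M x; rewrite S_INR /=; nra. }
  apply: NNPP => n0; have p : 0 < hs W k M x by have := hs_nonneg W k M x; lra.
  have [j [h1 h2]] := archimed_cor1 _ p.
  have j0 := lt_0_INR _ h2; have [g1 _] := g j; have := h j.
  have : / INR j * INR j < hs W k M x * INR j by apply: Rmult_lt_compat_r.
  rewrite Rinv_l; lra.
Qed.
End NoSmallSubgroups.

Lemma choice_fun (A : Type) (P : nat -> A -> Prop) : (forall n, exists y, P n y) -> exists f, forall n, P n (f n).
Proof.
  move=> h; exists (fun n => proj1_sig (constructive_indefinite_description _ (h n))) => n.
  exact: proj2_sig.
Qed.

(** * The ultraproduct *)

(** Sequences that agree almost everywhere are not identified; only the form [ip] sees the
    ultrafilter. *)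
Definition seq_group (G : Group) : Group.
Proof.
  refine (Build_Group (nat -> G) (fun x y n => x n ** y n) (fun _ => one) (fun x n => iv (x n)) _ _ _) => *;
    by apply: functional_extensionality => n; gs.
Defined.

Definition cst (G : Group) (g : G) : seq_group G := fun _ => g.

Section Hilbert.
Variables (G : Group) (X : list G).
Hypothesis HX : generates G X.
Notation len := (word_norm G X).
Notation vol := (vol G X).
Variable om : (nat -> Prop) -> R.
Hypothesis U : nonprincipal_ultrafilter om.
Notation ae := (ae om).
Notation ulim := (ulim om).
Variable Rn : nat -> nat.
Hypothesis R1 : forall n, (1 <= Rn n)%nat.
Hypothesis R_inf : forall r, ae (fun n => (r <= Rn n)%nat).
Hypothesis pk : forall a b, (1 <= b)%nat -> exists N, ae (fun n => packing G X a b (Rn n) N).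
Notation W := (seq_group G).
Notation ipn n := (ipn G X (Rn n)).
Notation nrm n f := (ipn n f f).

Lemma vol_ratio a : exists C, 0 <= C /\ ae (fun n => INR (vol (a * Rn n)) / INR (vol (Rn n)) <= C).
Proof.
  have [N hN] := pk a 1 (le_n _); exists (INR N); split; first exact: pos_INR.
  apply: (ae_mono _ U _ _ _ hN) => n h.
  have := covering_vol _ _ HX _ _ _ (packing_covering _ _ HX _ _ _ _ (le_n 1) h).
  rewrite Nat.div_1_r => /le_INR; rewrite mult_INR => hh.
  have p := N_pos _ _ HX (Rn n) (R1 n).
  apply: (Rmult_le_reg_r (INR (vol (Rn n)))) => //.
  by rewrite /Rdiv Rmult_assoc Rinv_l; lra.
Qed.

Lemma vol_ratio_low b : (1 <= b)%nat -> exists c, 0 < c /\ ae (fun n => c <= INR (vol (Rn n / b)) / INR (vol (Rn n))).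
Proof.
  move=> hb; have [N hN] := pk 1 b hb; exists (/ (INR N + 1)).
  have N1 : 0 < INR N + 1 by have := pos_INR N; lra.
  split; first exact: Rinv_0_lt_compat.
  apply: (ae_mono _ U _ _ _ hN) => n h.
  have := covering_vol _ _ HX _ _ _ (packing_covering _ _ HX _ _ _ _ hb h).
  rewrite Nat.mul_1_l => /le_INR; rewrite mult_INR => hh.
  have p := N_pos _ _ HX (Rn n) (R1 n); have p' := pos_INR (vol (Rn n / b)).
  apply: (Rmult_le_reg_r (INR (vol (Rn n)) * (INR N + 1))); first exact: Rmult_lt_0_compat.
  have -> : / (INR N + 1) * (INR (vol (Rn n)) * (INR N + 1)) = INR (vol (Rn n)) by field; lra.
  have -> : INR (vol (Rn n / b)) / INR (vol (Rn n)) * (INR (vol (Rn n)) * (INR N + 1)) = INR (vol (Rn n / b)) * (INR N + 1) by field; lra.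
  nra.
Qed.

Record hseq := { hv : nat -> G -> R; hfs : forall n, fs (hv n);
  hbd : exists C, ae (fun n => nrm n (hv n) <= C) }.

Definition ip u v := epsilon (inhabits 0) (fun L => ulim (fun n => ipn n (hv u n) (hv v n)) L).

Lemma ipn_abs n f g : fs f -> fs g -> Rabs (ipn n f g) <= (nrm n f + nrm n g) / 2.
Proof.
  move=> hf hg; have h := ipn_CS _ _ HX (Rn n) (R1 n) f g hf hg.
  have := ipn_pos _ _ HX (Rn n) (R1 n) f; have := ipn_pos _ _ HX (Rn n) (R1 n) g.
  move: h; move: (ipn n f g) (nrm n f) (nrm n g) => a b c h b0 c0.
  have := pow2_ge_0 (b - c); rewrite /Rabs; case: Rcase_abs => ? ?; nra.
Qed.

Lemma ip_lim u v : ulim (fun n => ipn n (hv u n) (hv v n)) (ip u v).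
Proof.
  apply: epsilon_spec; have [C hC] := hbd u; have [C' hC'] := hbd v.
  apply: (ulim_ex _ U _ ((C + C') / 2)).
  apply: (ae_mono _ U _ _ _ (ae_and _ U _ _ hC hC')) => n [h h'].
  by have := ipn_abs n _ _ (hfs u n) (hfs v n); lra.
Qed.

Lemma ip_val u v L : ulim (fun n => ipn n (hv u n) (hv v n)) L -> ip u v = L.
Proof. exact: (ulim_eq _ U _ _ _ (ip_lim u v)). Qed.

Lemma hbd_add f g : (forall n, fs (f n)) -> (forall n, fs (g n)) -> (exists C, ae (fun n => nrm n (f n) <= C)) ->
  (exists C, ae (fun n => nrm n (g n) <= C)) -> exists C, ae (fun n => nrm n (fun z => f n z + g n z) <= C).
Proof.
  move=> hf hg [C hC] [C' hC']; exists (2 * C + 2 * C').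
  apply: (ae_mono _ U _ _ _ (ae_and _ U _ _ hC hC')) => n [h h'].
  have fa : fs (fun z => f n z + g n z) by apply: fs_add.
  rewrite ipnD // !(ipnC _ _ _ _ (fun z => f n z + g n z)) !ipnD //.
  have := ipn_abs n _ _ (hf n) (hg n); rewrite (ipnC _ _ _ (g n)); move: h h'.
  by have := Rle_abs (ipn n (f n) (g n)); lra.
Qed.

Definition hadd (u v : hseq) : hseq :=
  {| hv := fun n z => hv u n z + hv v n z; hfs := fun n => fs_add _ _ _ (hfs u n) (hfs v n);
     hbd := hbd_add _ _ (hfs u) (hfs v) (hbd u) (hbd v) |}.

Lemma hbd_scal c f : (forall n, fs (f n)) -> (exists C, ae (fun n => nrm n (f n) <= C)) ->
  exists C, ae (fun n => nrm n (fun z => c * f n z) <= C).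
Proof.
  move=> hf [C hC]; exists (c ^ 2 * C); apply: (ae_mono _ U _ _ _ hC) => n h.
  rewrite ipnZ // ipnC ipnZ //; have := pow2_ge_0 c; nra.
Qed.

Definition hscal c (u : hseq) : hseq :=
  {| hv := fun n z => c * hv u n z; hfs := fun n => fs_scal _ c _ (hfs u n);
     hbd := hbd_scal c _ (hfs u) (hbd u) |}.

Lemma fs_zero : fs (fun _ : G => 0).
Proof. by exists []; split; [constructor|]. Qed.

Lemma nrm_zero n : nrm n (fun _ => 0) = 0.
Proof. exact: ipn_zero. Qed.

Definition hzero : hseq :=
  {| hv := fun _ _ => 0; hfs := fun _ => fs_zero;
     hbd := ex_intro _ 0 (ae_all _ U (fun n => nrm n (fun _ => 0) <= 0) (fun n => Req_le _ _ (nrm_zero n))) |}.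

Lemma hbd_act (x : W) f : (forall n, fs (f n)) -> (exists C, ae (fun n => nrm n (f n) <= C)) ->
  exists C, ae (fun n => nrm n (lam (x n) (f n)) <= C).
Proof. by move=> hf [C hC]; exists C; apply: (ae_mono _ U _ _ _ hC) => n; rewrite ipn_lam. Qed.

Definition hact (x : W) (u : hseq) : hseq :=
  {| hv := fun n => lam (x n) (hv u n); hfs := fun n => fs_lam _ (x n) _ (hfs u n);
     hbd := hbd_act x _ (hfs u) (hbd u) |}.

Lemma ipC u v : ip u v = ip v u.
Proof.
  apply: ip_val; apply: (ulim_ext _ U _ _ _ _ (ip_lim v u)); apply: ae_all => // n; exact: ipnC.
Qed.

Lemma ipD u v w : ip (hadd u v) w = ip u w + ip v w.
Proof.
  apply: ip_val; apply: (ulim_ext _ U _ _ _ _ (ulim_add _ U _ _ _ _ (ip_lim u w) (ip_lim v w))).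
  by apply: ae_all => // n; rewrite ipnD //; apply: hfs.
Qed.

Lemma ipZ c u w : ip (hscal c u) w = c * ip u w.
Proof.
  apply: ip_val; apply: (ulim_ext _ U _ _ _ _ (ulim_scal _ U c _ _ (ip_lim u w))).
  by apply: ae_all => // n; rewrite ipnZ //; apply: hfs.
Qed.

Lemma ip0 w : ip hzero w = 0.
Proof.
  apply: ip_val; apply: (ulim_ext _ U _ _ _ _ (ulim_const _ U 0)); apply: ae_all => // n.
  have -> : hv hzero n = (fun z => 0 * hv w n z) by apply: functional_extensionality => z /=; ring.
  by rewrite ipnZ; [ring|exact: hfs].
Qed.

Lemma ip_pos u : 0 <= ip u u.
Proof.
  apply: (ulim_le _ U _ _ _ _ (ulim_const _ U 0) (ip_lim u u)).
  by apply: ae_all => // n; exact: ipn_pos.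
Qed.

Lemma act1 u w : ip (hact one u) w = ip u w.
Proof.
  apply: ip_val; apply: (ulim_ext _ U _ _ _ _ (ip_lim u w)); apply: ae_all => // n /=.
  by f_equal; apply: functional_extensionality => z; rewrite /lam; gs.
Qed.

Lemma actM (x y : W) u w : ip (hact (x ** y) u) w = ip (hact x (hact y u)) w.
Proof.
  apply: ip_val; apply: (ulim_ext _ U _ _ _ _ (ip_lim (hact x (hact y u)) w)); apply: ae_all => // n /=.
  by f_equal; apply: functional_extensionality => z; rewrite /lam; gs.
Qed.

Lemma actI x u w : ip (hact x u) (hact x w) = ip u w.
Proof.
  apply: ip_val; apply: (ulim_ext _ U _ _ _ _ (ip_lim u w)); apply: ae_all => // n /=.
  by rewrite ipn_lam //; exact: hfs.
Qed.

Lemma actD x u w z : ip (hact x (hadd u w)) z = ip (hact x u) z + ip (hact x w) z.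
Proof. by rewrite -ipD; apply: ip_val; apply: (ulim_ext _ U _ _ _ _ (ip_lim (hadd (hact x u) (hact x w)) z)); apply: ae_all. Qed.

Lemma actZ x c u z : ip (hact x (hscal c u)) z = c * ip (hact x u) z.
Proof. by rewrite -ipZ; apply: ip_val; apply: (ulim_ext _ U _ _ _ _ (ip_lim (hscal c (hact x u)) z)); apply: ae_all. Qed.

(** * The averaging operator in the ultraproduct and its spectral subspaces *)

Section Generators.
Variable Y : list G.
Hypothesis sY : symm Y.
Variable M : nat -> nat.
Hypothesis M1 : forall n, (1 <= M n)%nat.
Hypothesis YM : forall n s, pw Y (M n) s -> (len s <= Rn n)%nat.
Hypothesis M_inf : forall q, ae (fun n => (q <= M n)%nat).
Section Operators.
Variable a : nat.

Notation kapn n := (kap G X (Rn n) a).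
Notation tformn n := (tform G X (Rn n) Y (M n) a).

Lemma kap_bound : exists C, 0 <= C /\ ae (fun n => kapn n <= C).
Proof. exact: (vol_ratio (a + 1)). Qed.

Definition topn n := top G X (Rn n) Y (M n) a.

Lemma topn_fs n u : fs (topn n u).
Proof. by apply: top_fs => //; apply: YM. Qed.

Lemma hbd_top f : (forall n, fs (f n)) -> (exists C, ae (fun n => nrm n (f n) <= C)) ->
  exists C, ae (fun n => nrm n (topn n (f n)) <= C).
Proof.
  move=> hf [C hC]; have [K [K0 hK]] := kap_bound; exists (K ^ 2 * C).
  apply: (ae_mono _ U _ _ _ (ae_and _ U _ _ hC hK)) => n [h1 h2].
  have h := top_norm _ _ HX (Rn n) (R1 n) Y (M n) (M1 n) (YM n) a _ (hf n).
  have k0 := kap_pos _ _ HX (Rn n) (R1 n) a; have p := ipn_pos _ _ HX (Rn n) (R1 n) (f n).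
  apply: (Rle_trans _ _ _ h); apply: Rmult_le_compat => //; first exact: pow2_ge_0.
  nra.
Qed.

Definition htop (u : hseq) : hseq :=
  {| hv := fun n => topn n (hv u n); hfs := fun n => topn_fs n _;
     hbd := hbd_top _ (hfs u) (hbd u) |}.

Lemma htop_tform u w : ulim (fun n => tformn n (hv u n) (hv w n)) (ip (htop u) w).
Proof.
  apply: (ulim_ext _ U _ _ _ _ (ip_lim (htop u) w)); apply: ae_all => // n.
  by apply: ipn_top => //; [exact: YM|exact: hfs].
Qed.

Lemma Tsym u w : ip (htop u) w = ip u (htop w).
Proof.
  rewrite (ipC u); apply: ip_val.
  apply: (ulim_ext _ U _ _ _ _ (ip_lim (htop w) u)); apply: ae_all => // n /=.
  rewrite /topn !ipn_top //; try exact: hfs; try exact: YM.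
  exact: tformC.
Qed.

Lemma ip_top_bound : exists C, forall u, ip (htop u) u <= C * ip u u.
Proof.
  have [K [K0 hK]] := kap_bound; exists K => u.
  apply: (ulim_le _ U _ _ _ _ (htop_tform u u) (ulim_scal _ U K _ _ (ip_lim u u))).
  apply: (ae_mono _ U _ _ _ hK) => n h.
  have := tform_le _ _ HX (Rn n) (R1 n) Y (M n) (M1 n) (YM n) a (hv u n) _ (hfs u n)
     (fun y => coef_sq _ _ HX (Rn n) (R1 n) (hv u n) y (hfs u n)).
  have := ipn_pos _ _ HX (Rn n) (R1 n) (hv u n); nra.
Qed.

Notation perp := (perp hseq ip).
Notation ortho := (ortho hseq ip).
Lemma ip_scal2 c u w : ip w (hscal c u) = c * ip w u.
Proof. by rewrite ipC ipZ (ipC u). Qed.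

Lemma top_scal c u w : ip (htop (hscal c u)) w = c * ip (htop u) w.
Proof. by rewrite Tsym ipZ -Tsym. Qed.

(** Near-maximisers exist for every tolerance [/ (INR j + 1)]. Their defining inequalities are
    countably many conditions on level [n], so saturation yields one vector satisfying all of them,
    and it attains the supremum [L]. *)
Lemma htop_attains : attains hseq ip htop.
Proof.
  move=> k v tau o ht [u0 [p0 h0]].
  have [C hC] := ip_top_bound.
  pose V x := exists u, perp k v u /\ ip u u = 1 /\ x = ip (htop u) u.
  have norm1 : forall u, 0 < ip u u -> perp k v u -> exists u', perp k v u' /\ ip u' u' = 1 /\ ip (htop u') u' = ip (htop u) u / ip u u.
  { move=> u hu pu; set s := / sqrt (ip u u).
    have sq : s * s = / ip u u.
    { rewrite /s -Rinv_mult sqrt_sqrt //; lra. }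
    exists (hscal s u); split; first by move=> i hi; rewrite ipZ pu //; ring.
    split.
    - rewrite ipZ ip_scal2 -Rmult_assoc sq Rinv_l //; lra.
    - by rewrite top_scal ip_scal2 -Rmult_assoc sq /Rdiv; ring. }
  have hu0 : 0 < ip u0 u0.
  { have := ip_pos u0 => h; case: (Req_dec (ip u0 u0) 0) => e; last lra.
    by have := hC u0; rewrite e; rewrite e in h0; lra. }
  have [u1 [p1 [n1 e1]]] := norm1 u0 hu0 p0.
  have t1 : tau < ip (htop u1) u1.
  { rewrite e1; apply: (Rmult_lt_reg_r (ip u0 u0)) => //.
    by rewrite /Rdiv Rmult_assoc Rinv_l; lra. }
  have [L [up least]] := completeness V ltac:(exists C => x [u [pu [nu ->]]]; have := hC u; rewrite nu; lra)
     ltac:(by exists (ip (htop u1) u1), u1).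
  have apx : forall j : nat, exists u, perp k v u /\ ip u u = 1 /\ L - / (INR j + 1) < ip (htop u) u.
  { move=> j; have jp : 0 < / (INR j + 1) by apply: Rinv_0_lt_compat; have := pos_INR j; lra.
    apply: NNPP => no; have : L <= L - / (INR j + 1); last lra.
    apply: least => x [u [pu [nu ->]]]; apply: Rnot_lt_le => h; apply: no; by exists u. }
  pose Q j n (f : G -> R) := fs f /\
    Rabs (nrm n f - 1) < / (INR j + 1) /\
    (forall i, (i < k)%nat -> Rabs (ipn n f (hv (v i) n)) < / (INR j + 1)) /\
    L - / (INR j + 1) < tformn n f f.
  have hQ : forall j, ae (fun n => exists f, forall i, (i <= j)%nat -> Q i n f).
  { move=> j; have [u [pu [nu lu]]] := apx j.
    have jp : 0 < / (INR j + 1) by apply: Rinv_0_lt_compat; have := pos_INR j; lra.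
    have q1 := ip_lim u u _ jp; rewrite nu in q1.
    have q2 := ae_lt _ U (fun i n => Rabs (ipn n (hv u n) (hv (v i) n) - 0) < / (INR j + 1)) k
      ltac:(by move=> i hi; have := ip_lim u (v i) _ jp; rewrite pu).
    have q3 := ulim_gt _ U _ _ _ (htop_tform u u) lu.
    apply: (ae_mono _ U _ _ _ (ae_and _ U _ _ q1 (ae_and _ U _ _ q2 q3))) => n [a1 [a2 a3]].
    exists (hv u n) => i hi; split; first exact: hfs.
    have ij : / (INR j + 1) <= / (INR i + 1).
    { by apply: Rinv_le_contravar; have := pos_INR i; have := le_INR _ _ hi; lra. }
    split; first by rewrite /=; lra.
    split; last by rewrite /=; lra.
    by move=> i' hi'; have := a2 i' hi'; rewrite Rminus_0_r /=; lra. }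
  have [f1 hf1] := saturation _ U _ (fun _ => 0) Q hQ.
  (* Saturation controls almost every level only; elsewhere the zero function provides the finite
     support required at all levels. *)
  pose f n := match excluded_middle_informative (fs (f1 n)) with left _ => f1 n | right _ => fun _ => 0 end.
  have ff : forall n, fs (f n) by move=> n; rewrite /f; case: excluded_middle_informative => // _; exact: fs_zero.
  have hf : forall j, ae (fun n => Q j n (f n)).
  { move=> j; apply: (ae_mono _ U _ _ _ (hf1 j)) => n q; rewrite /f; case: excluded_middle_informative => // no.
    by case: no; case: q. }
  have small : forall eps, 0 < eps -> exists j : nat, / (INR j + 1) < eps.
  { move=> eps he; have [j [h1 h2]] := archimed_cor1 eps he; exists j.
    apply: Rlt_trans h1; apply: Rinv_lt_contravar; [|lra].
    by apply: Rmult_lt_0_compat; have := lt_0_INR _ h2; lra. }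
  have bf : exists C, ae (fun n => nrm n (f n) <= C).
  { exists 2; apply: (ae_mono _ U _ _ _ (hf 0%nat)) => n [_ [h _]].
    have e : / (INR 0 + 1) = 1 by rewrite /= Rplus_0_l Rinv_1.
    by rewrite e in h; have := Rle_abs (nrm n (f n) - 1); lra. }
  set u := {| hv := fun n => f n; hfs := fun n => ff n; hbd := bf |}.
  have nu : ip u u = 1.
  { apply: ip_val => eps he; have [j hj] := small eps he.
    by apply: (ae_mono _ U _ _ _ (hf j)) => n [_ [h _]]; rewrite /=; lra. }
  have pu : perp k v u.
  { move=> i hi; apply: ip_val => eps he; have [j hj] := small eps he.
    by apply: (ae_mono _ U _ _ _ (hf j)) => n [_ [_ [h _]]]; have := h i hi; rewrite Rminus_0_r /=; lra. }
  have lu : L <= ip (htop u) u.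
  { apply: Rnot_lt_le => h; have [j hj] := small (L - ip (htop u) u) ltac:(lra).
    have : L - / (INR j + 1) <= ip (htop u) u; last lra.
    apply: (ulim_le _ U _ _ _ _ (ulim_const _ U _) (htop_tform u u)).
    by apply: (ae_mono _ U _ _ _ (hf j)) => n [_ [_ [_ h']]]; rewrite /=; lra. }
  exists u; split=> //; split=> //; split.
  - by have : ip (htop u1) u1 <= L; [apply: up; exists u1|lra].
  - move=> w pw'; case: (Req_dec (ip w w) 0) => e; first by have := hC w; rewrite e; lra.
    have hw : 0 < ip w w by have := ip_pos w; lra.
    have [w' [q1 [q2 q3]]] := norm1 w hw pw'.
    have : ip (htop w') w' <= L by apply: up; exists w'.
    rewrite q3 => h; have : ip (htop w) w / ip w w * ip w w <= ip (htop u) u * ip w w by apply: Rmult_le_compat_r; lra.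
    by rewrite /Rdiv Rmult_assoc Rinv_l; lra.
Qed.

Lemma f0_hbd : exists C, ae (fun n => nrm n (f0 G X (Rn n)) <= C).
Proof. by exists 1; apply: ae_all => // n; apply: f0_norm. Qed.

(** Bessel's inequality for the tent translated by a worst [y n] at each level: in the limit the sum
    is at most 1, so it cannot stay above 2. Uniformity in [y] is what the trace bound needs. *)
Lemma bessel_f0 k v : ortho k v -> ae (fun n => forall y, sm k (fun i => coef G X (Rn n) (hv (v i) n) y ^ 2) <= 2).
Proof.
  move=> o; apply: NNPP => no; have h := ae_not _ U _ no.
  pose y n := epsilon (inhabits one) (fun y => ~ sm k (fun i => coef G X (Rn n) (hv (v i) n) y ^ 2) <= 2).
  have hy : ae (fun n => 2 <= sm k (fun i => coef G X (Rn n) (hv (v i) n) (y n) ^ 2)).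
  { apply: (ae_mono _ U _ _ _ h) => n hn.
    have : ~ sm k (fun i => coef G X (Rn n) (hv (v i) n) (y n) ^ 2) <= 2; last lra.
    apply: (epsilon_spec (inhabits one) (fun y => ~ sm k (fun i => coef G X (Rn n) (hv (v i) n) y ^ 2) <= 2)).
    by apply: NNPP => no'; apply: hn => z; apply: NNPP => nz; apply: no'; exists z. }
  set F := {| hv := fun n => f0 G X (Rn n); hfs := fun n => f0_fs _ _ HX (Rn n) (R1 n); hbd := f0_hbd |}.
  set u := hact y F.
  have b := bessel _ _ _ _ _ ipC ipD ipZ ip0 ip_pos k v u o.
  have u1 : ip u u <= 1.
  { rewrite /u actI; apply: (ulim_le _ U _ _ _ _ (ip_lim F F) (ulim_const _ U 1)).
    by apply: ae_all => // n; apply: f0_norm. }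
  have lim : forall k, ulim (fun n => sm k (fun i => coef G X (Rn n) (hv (v i) n) (y n) ^ 2)) (sm k (fun i => ip u (v i) ^ 2)).
  { elim=> [|k' IH]; first exact: ulim_const.
    rewrite sm_S; apply: (ulim_ext _ U (fun n => sm k' (fun i => coef G X (Rn n) (hv (v i) n) (y n) ^ 2) + coef G X (Rn n) (hv (v k') n) (y n) ^ 2)).
    - by apply: ae_all => // n; rewrite sm_S.
    - apply: ulim_add => //.
      have l := ip_lim u (v k').
      move=> eps he.
      set A := Rabs (ip u (v k')) + 1.
      have A1 : 1 <= A by have := Rabs_pos (ip u (v k')); rewrite /A; lra.
      have e2 : 0 < Rmin 1 (eps / (2 * A)) by apply: Rmin_pos; [lra|apply: Rdiv_lt_0_compat; lra].
      apply: (ae_mono _ U _ _ _ (l _ e2)) => n.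
      rewrite -/(coef G X (Rn n) (hv (v k') n) (y n)).
      change (ipn n (hv u n) (hv (v k') n)) with (coef G X (Rn n) (hv (v k') n) (y n)).
      move: (coef G X (Rn n) (hv (v k') n) (y n)) => c hc.
      have -> : c ^ 2 - ip u (v k') ^ 2 = (c - ip u (v k')) * (c + ip u (v k')) by ring.
      rewrite Rabs_mult.
      have h1 := Rmin_l 1 (eps / (2 * A)); have h2 := Rmin_r 1 (eps / (2 * A)).
      have h3 : Rabs (c + ip u (v k')) <= 2 * A.
      { have -> : c + ip u (v k') = (c - ip u (v k')) + 2 * ip u (v k') by ring.
        apply: Rle_trans (Rabs_triang _ _) _; rewrite Rabs_mult (Rabs_pos_eq 2); last lra.
        by rewrite /A; lra. }
      have e3 : eps = eps / (2 * A) * (2 * A) by field; lra.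
      have := Rabs_pos (c - ip u (v k')); have := Rabs_pos (c + ip u (v k')).
      rewrite e3; move: (Rabs (c - ip u (v k'))) (Rabs (c + ip u (v k'))) hc h3 => p q hc h3 q0 p0.
      apply: (Rle_lt_trans _ (p * (2 * A))); first by apply: Rmult_le_compat_l.
      by apply: Rmult_lt_compat_r; lra. }
  have : 2 <= sm k (fun i => ip u (v i) ^ 2); last lra.
  exact: (ulim_le _ U _ _ _ _ (ulim_const _ U 2) (lim k) hy).
Qed.

(** The trace is a [psi]-weighted average of Bessel sums, each at most 2, hence at most twice the
    bound on [kap], whatever the number of vectors. *)
Lemma htop_trace : exists C, forall k v, ortho k v -> sm k (fun i => ip (htop (v i)) (v i)) <= C.
Proof.
  have [K [K0 hK]] := kap_bound; exists (K * 2) => k v o.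
  have lim : forall k, ulim (fun n => sm k (fun i => tformn n (hv (v i) n) (hv (v i) n))) (sm k (fun i => ip (htop (v i)) (v i))).
  { elim=> [|k' IH]; first exact: ulim_const.
    rewrite sm_S; apply: (ulim_ext _ U (fun n => sm k' (fun i => tformn n (hv (v i) n) (hv (v i) n)) + tformn n (hv (v k') n) (hv (v k') n))).
    - by apply: ae_all => // n; rewrite sm_S.
    - by apply: ulim_add => //; exact: htop_tform. }
  apply: (ulim_le _ U _ _ _ _ (lim k) (ulim_const _ U _)).
  apply: (ae_mono _ U _ _ _ (ae_and _ U _ _ hK (bessel_f0 k v o))) => n [hk hb].
  set P := psi G X (Rn n) Y (M n) a.
  have fP : fs P by apply: psi_fs => //; exact: YM.
  have e : sm k (fun i => tformn n (hv (v i) n) (hv (v i) n)) =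
    gsum (fun y => P y * sm k (fun i => coef G X (Rn n) (hv (v i) n) y ^ 2)) / INR (vol (Rn n)).
  { elim: k {o hb} => [|k IH].
    - rewrite /= (gsum_list _ []); first by rewrite /Rdiv /=; ring.
      by split; [constructor|move=> x; rewrite Rmult_0_r].
    - rewrite sm_S IH /tform -/P -Rdiv_plus_distr -gsum_add; [|exact: fs_mul|by apply: fs_mul; apply: fs_mul].
      f_equal; apply: gsum_ext => y; rewrite sm_S; ring. }
  rewrite e.
  have h := gsum_bound _ _ HX ((a + 1) * Rn n) (fun y => P y * sm k (fun i => coef G X (Rn n) (hv (v i) n) y ^ 2)) 2.
  have p := N_pos _ _ HX (Rn n) (R1 n).
  apply: (Rle_trans _ (kapn n * 2)); last by apply: Rmult_le_compat_r; lra.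
  have -> : kapn n * 2 = INR (vol ((a + 1) * Rn n)) * 2 / INR (vol (Rn n)) by rewrite /kap /Rdiv; ring.
  apply: Rmult_le_compat_r; first by left; apply: Rinv_0_lt_compat.
  apply: h.
  - by move=> y ny; apply: (psi_supp _ _ HX (Rn n) (R1 n) Y (M n) (M1 n) (YM n) a) => e'; apply: ny; rewrite /P e'; ring.
  - move=> y; have := psi_range G X (Rn n) Y (M n) (M1 n) a y; rewrite -/P; have := hb y.
    have : 0 <= sm k (fun i => coef G X (Rn n) (hv (v i) n) y ^ 2) by apply: lsum_nonneg => i _; exact: pow2_ge_0.
    nra.
Qed.

Lemma htop_spectral tau : 0 < tau -> exists k v l, eigen hseq ip htop k v l /\
  (forall i, (i < k)%nat -> tau < l i) /\ forall u, perp k v u -> ip (htop u) u <= tau * ip u u.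
Proof.
  move=> ht; have [C hC] := htop_trace.
  exact: (spectral hseq hzero hadd hscal ip ipC ipD ipZ ip0 htop Tsym C tau htop_attains ht hC).
Qed.

(** Sequences of words of length [o(M)] in [Y]; they commute with [htop]. *)
Definition Theta (x : W) := forall eps, 0 < eps -> ae (fun n => exists j, pw Y j (x n) /\ INR j <= eps * INR (M n)).

Lemma Theta_sg : is_subgroup W Theta.
Proof.
  split; [|split].
  - move=> eps he; apply: ae_all => // n; exists 0%nat; split=> //=.
    by have := pos_INR (M n); nra.
  - move=> x y hx hy eps he; have e2 : 0 < eps / 2 by lra.
    apply: (ae_mono _ U _ _ _ (ae_and _ U _ _ (hx _ e2) (hy _ e2))) => n [[j [p hj]] [i [q hi]]].
    by exists (j + i)%nat; split; [apply: pw_add|rewrite plus_INR; lra].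
  - move=> x hx eps he; apply: (ae_mono _ U _ _ _ (hx _ he)) => n [j [p hj]].
    by exists j; split=> //; apply: pw_inv.
Qed.

Lemma Theta_cst j g : pw Y j g -> Theta (cst G g).
Proof.
  move=> p eps he.
  have [q hq] := archimed_cor1 (eps / (INR j + 1)) ltac:(apply: Rdiv_lt_0_compat => //; have := pos_INR j; lra).
  apply: (ae_mono _ U _ _ _ (M_inf q)) => n hn; exists j; split=> //.
  have jp := pos_INR j; case: hq => h1 h2.
  have q0 := lt_0_INR _ h2; have := le_INR _ _ hn => hM.
  have h3 : / INR q * (INR q * (INR j + 1)) < eps / (INR j + 1) * (INR q * (INR j + 1)).
  { by apply: Rmult_lt_compat_r => //; apply: Rmult_lt_0_compat; lra. }
  have e1 : / INR q * (INR q * (INR j + 1)) = INR j + 1 by field; lra.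
  have e2 : eps / (INR j + 1) * (INR q * (INR j + 1)) = eps * INR q by field; lra.
  rewrite e1 e2 in h3; nra.
Qed.

Lemma Theta_commute x u w : Theta x -> ip (htop (hact x u)) w = ip (hact x (htop u)) w.
Proof.
  move=> hx; apply: ip_val.
  apply: (ulim_near _ U _ _ _ (ip_lim (hact x (htop u)) w)) => eps he.
  have [K [K0 hK]] := kap_bound; have [C hC] := hbd u; have [C' hC'] := hbd w.
  set B := K * (Rabs C + Rabs C') + 1.
  have B1 : 1 <= B by have := Rabs_pos C; have := Rabs_pos C'; rewrite /B; nra.
  have e2 : 0 < eps / (2 * B) by apply: Rdiv_lt_0_compat; lra.
  apply: (ae_mono _ U _ _ _ (ae_and _ U _ _ (hx _ e2) (ae_and _ U _ _ hK (ae_and _ U _ _ hC hC')))) => n [[j [p hj]] [hk [hc hc']]].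
  have h := top_commute _ _ HX (Rn n) (R1 n) Y sY (M n) (M1 n) (YM n) a (x n) j (hv u n) (hv w n) (hfs u n) (hfs w n) p.
  apply: (Rle_lt_trans _ _ _ h).
  have p1 := ipn_pos _ _ HX (Rn n) (R1 n) (hv u n); have p2 := ipn_pos _ _ HX (Rn n) (R1 n) (hv w n).
  have k0 := kap_pos _ _ HX (Rn n) (R1 n) a.
  have Mp : 0 < INR (M n) by apply: lt_0_INR; exact: M1.
  have jm : INR j / INR (M n) <= eps / (2 * B).
  { apply: (Rmult_le_reg_r (INR (M n))) => //.
    by rewrite /Rdiv Rmult_assoc Rinv_l; lra. }
  have j0 : 0 <= INR j / INR (M n) by apply: Rmult_le_pos; [exact: pos_INR|left; exact: Rinv_0_lt_compat].
  have hB : kapn n * (nrm n (hv u n) + nrm n (hv w n)) <= B.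
  { have c1 := Rle_abs C; have c2 := Rle_abs C'; rewrite /B.
    have : kapn n * (nrm n (hv u n) + nrm n (hv w n)) <= K * (Rabs C + Rabs C') by apply: Rmult_le_compat; lra.
    lra. }
  have q0 : 0 <= kapn n * (nrm n (hv u n) + nrm n (hv w n)) by apply: Rmult_le_pos; lra.
  apply: (Rle_lt_trans _ (eps / (2 * B) * B)); first by apply: Rmult_le_compat.
  have -> : eps / (2 * B) * B = eps / 2 by field; lra.
  lra.
Qed.

Lemma Theta_rep k v l tau : eigen hseq ip htop k v l -> (forall i, (i < k)%nat -> tau < l i) ->
  (forall u, perp k v u -> ip (htop u) u <= tau * ip u u) ->
  orthrep W Theta k (mat hseq ip W hact v) /\
  forall x i w, Theta x -> (i < k)%nat -> ip (hact x (v i)) w = sm k (fun j => ip (hact x (v i)) (v j) * ip (v j) w).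
Proof.
  move=> eg hl hp.
  have inv : forall x i w, Theta x -> (i < k)%nat -> ip (hact x (v i)) w = sm k (fun j => ip (hact x (v i)) (v j) * ip (v j) w).
  { move=> x i w hx hi.
    apply: (eigen_invariant hseq hzero hadd hscal ip ipC ipD ipZ ip0 ip_pos htop Tsym k v l tau (hact x) eg hl hp) => //.
    - exact: actI.
    - exact: actD.
    - exact: actZ.
    - by move=> u w'; apply: Theta_commute. }
  split=> //; apply: (mat_orthrep hseq ip ipC W Theta hact act1 actM actI k v (proj1 eg) inv).
Qed.
End Operators.
Notation perp := (perp hseq ip).
Notation ortho := (ortho hseq ip).
Notation rest := (rest hseq hzero hadd hscal ip).
Notation lc := (lc hseq hzero hadd hscal).
Notation rho := (mat hseq ip W hact).
Notation tformn a n := (tform G X (Rn n) Y (M n) a).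
Notation f0 n := (f0 G X (Rn n)).
Hint Resolve ipC ipD ipZ ip0 ip_pos : core.

Definition hF : hseq := Build_hseq (fun n => f0 n) (fun n => f0_fs G X HX (Rn n) (R1 n))
  (f0_hbd).

Lemma hF_le1 : ip hF hF <= 1.
Proof.
  apply: (ulim_le _ U _ _ _ _ (ip_lim hF hF) (ulim_const _ U 1)).
  by apply: ae_all => // n; apply: f0_norm.
Qed.

Definition hmv x u := hadd (hact x u) (hscal (-1) u).

Lemma ip_hmv x u w : ip (hmv x u) w = ip (hact x u) w - ip u w.
Proof. by rewrite /hmv ipD ipZ; ring. Qed.

Lemma ip_hmv_sq x u : ip (hmv x u) (hmv x u) = 2 * ip u u - 2 * ip (hact x u) u.
Proof.
  rewrite ip_hmv !(ipC _ (hmv x u)) !ip_hmv actI // (ipC u (hact x u)); ring.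
Qed.

Lemma hv_lc k c v n z : hv (lc k c v) n z = sm k (fun i => c i * hv (v i) n z).
Proof. by elim: k => [|k IH] //; rewrite sm_S -IH. Qed.

(** The part [u] of the tent outside the subspace satisfies [ip hF u = ip u u]. Were this above
    [eps], the coefficients of [u] at all translations of length at most [R / b] would be at least
    [eps / 2], forcing the form of [htop 1] at [u] up to [(eps / 2) ^ 2 * cb], twice the chosen
    [tau]. *)
Lemma capture eps : 0 < eps -> exists tau, 0 < tau /\ forall k v, ortho k v ->
  (forall u, perp k v u -> ip (htop 1 u) u <= tau * ip u u) -> ip (rest k v hF) (rest k v hF) <= eps.
Proof.
  move=> he; have [C2 [C20 hC2]] := vol_ratio 2.
  have [b [hb1 hb2]] := archimed_cor1 ((eps / 4) ^ 2 / (2 * C2 + 1)) ltac:(apply: Rdiv_lt_0_compat; [nra|lra]).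
  have b1 : (1 <= b)%nat by lia.
  have [cb [cb0 hcb]] := vol_ratio_low b b1.
  have bp : 0 < / INR b by apply: Rinv_0_lt_compat; apply: lt_0_INR.
  have bl : / INR b <= 1 by rewrite -Rinv_1; apply: Rinv_le_contravar; [lra|apply: (le_INR 1)].
  have hb : (/ INR b) ^ 2 * C2 * 2 <= (eps / 4) ^ 2.
  { have : / INR b * (2 * C2 + 1) <= (eps / 4) ^ 2 / (2 * C2 + 1) * (2 * C2 + 1) by apply: Rmult_le_compat_r; lra.
    have -> : (eps / 4) ^ 2 / (2 * C2 + 1) * (2 * C2 + 1) = (eps / 4) ^ 2 by field; lra.
    nra. }
  have tp : 0 < (eps / 2) ^ 2 * cb by apply: Rmult_lt_0_compat => //; apply: pow_lt; lra.
  exists ((eps / 2) ^ 2 * cb / 2); split; first lra.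
  move=> k v o h; apply: Rnot_lt_le => big.
  set u := rest k v hF in big *.
  have pu : perp k v u by apply: rest_perp.
  have a1 : ip u u <= 1.
  { rewrite /u rest_pyth //; have := hF_le1.
    have : 0 <= sm k (fun i => ip hF (v i) ^ 2) by apply: lsum_nonneg => i _; exact: pow2_ge_0.
    lra. }
  have a2 : ip u u = ip hF u by apply: rest_sq.
  have q1 := ulim_gt _ U _ _ _ (ip_lim hF u) (ltac:(lra) : 3 / 4 * eps < ip hF u).
  have q2 := ulim_lt _ U _ _ _ (ip_lim u u) (ltac:(lra) : ip u u < 2).
  have low : (eps / 2) ^ 2 * cb <= ip (htop 1 u) u.
  { apply: (ulim_le _ U _ _ _ _ (ulim_const _ U _) (htop_tform 1 u u)).
    apply: (ae_mono _ U _ _ _ (ae_and _ U _ _ (ae_and _ U _ _ q1 q2) (ae_and _ U _ _ hC2 hcb))) => n [[h1 h2] [h3 h4]].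
    apply: (Rle_trans _ ((eps / 2) ^ 2 * (INR (vol (Rn n / b)) / INR (vol (Rn n))))).
    { by apply: Rmult_le_compat_l => //; exact: pow2_ge_0. }
    apply: tform_lower => //; [exact: YM| |lra|].
    - by rewrite Nat.mul_1_l; apply: Nat.Div0.div_le_upper_bound; nia.
    - move=> y hy; have fu := hfs u n; have ff := f0_fs G X HX (Rn n) (R1 n).
      have e : coef G X (Rn n) (hv u n) y = ipn n (mv y (f0 n)) (hv u n) + ipn n (f0 n) (hv u n).
      { by rewrite ipn_mv // /coef; ring. }
      have sm1 : Rabs (ipn n (mv y (f0 n)) (hv u n)) <= eps / 4.
      { apply: abs_le_sq; first lra.
        have c := ipn_CS G X HX (Rn n) (R1 n) _ _ (fs_mv G y _ ff) fu.
        have c2 := f0_moves_le G X HX (Rn n) (R1 n) b y b1 hy.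
        apply: (Rle_trans _ _ _ c); apply: Rle_trans hb.
        apply: Rmult_le_compat; try exact: ipn_pos; last lra.
        apply: (Rle_trans _ _ _ c2); apply: Rmult_le_compat_l => //; exact: pow2_ge_0. }
      rewrite e; move: sm1 h1; rewrite /=; move: (ipn n (mv y (f0 n)) (hv u n)) (ipn n (f0 n) (hv u n)) => x1 x2.
      by rewrite /Rabs; do ! case: Rcase_abs => ?; lra. }
  by have := h u pu; move: tp low a1; move: ((eps / 2) ^ 2 * cb) => t; nra.
Qed.

(** The value of [hs] before the limit. Unlike [hs] it can be used for words of length comparable to
    [M n], which need not lie in [Theta]. *)
Definition Dn k (v : nat -> hseq) n x := sm k (fun i => nrm n (mv x (hv (v i) n))).

Lemma Dn_one k v n : Dn k v n one = 0.
Proof.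
  rewrite /Dn (lsum_ext _ _ _ (fun _ => 0)) ?lsum_0 // => i _.
  have -> : mv one (hv (v i) n) = (fun _ => 0) by apply: functional_extensionality => z; rewrite /mv /lam; gs; ring.
  exact: (nrm_zero n).
Qed.

(** The tent is a combination of the [v i] with coefficients of square sum at most 1, plus a small
    remainder. The set of good levels is independent of [x], so the estimate reaches words outside
    [Theta]. *)
Lemma small_move k v gam : ortho k v -> 0 < gam -> ip (rest k v hF) (rest k v hF) <= gam / 64 ->
  ae (fun n => forall x, Dn k v n x <= gam / 4 -> nrm n (mv x (f0 n)) < gam).
Proof.
  move=> o g0 h; set u := rest k v hF in h *.
  have q := ulim_lt _ U _ _ _ (ip_lim u u) (ltac:(lra) : ip u u < gam / 32).
  have b : sm k (fun i => ip hF (v i) ^ 2) <= 1.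
  { apply: Rle_trans hF_le1; exact: (bessel hseq hzero hadd hscal ip ipC ipD ipZ ip0 ip_pos k v hF o). }
  apply: (ae_mono _ U _ _ _ q) => n hu x hx.
  set c := fun i => ip hF (v i) in b *.
  have e : mv x (f0 n) = (fun z => sm k (fun i => c i * mv x (hv (v i) n) z) + mv x (hv u n) z).
  { apply: functional_extensionality => z.
    have eu : forall z, hv u n z = f0 n z + -1 * sm k (fun i => c i * hv (v i) n z).
    { by move=> z'; rewrite -(hv_lc k c v n z'). }
    rewrite /mv /lam !eu.
    rewrite (lsum_ext _ _ _ (fun i => c i * hv (v i) n (iv x ** z) - c i * hv (v i) n z)); last by move=> i _; ring.
    by rewrite lsum_sub; ring. }
  rewrite e.
  have fv : forall i, fs (mv x (hv (v i) n)) by move=> i; apply: fs_mv; exact: hfs.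
  have h1 := nrm_add2 G X HX (Rn n) (R1 n) _ _ (fs_sum G k c _ fv) (fs_mv G x _ (hfs u n)).
  have h2 := nrm_lin G X HX (Rn n) (R1 n) k c _ fv.
  have h3 := nrm_mv G X HX (Rn n) (R1 n) x _ (hfs u n).
  apply: (Rle_lt_trans _ _ _ h1).
  have h4 : sm k (fun i => c i ^ 2) * Dn k v n x <= 1 * (gam / 4).
  { apply: Rmult_le_compat => //; apply: lsum_nonneg => i _; [exact: pow2_ge_0|exact: ipn_pos]. }
  have h5 : 4 * nrm n (hv u n) < 4 * (gam / 32) by apply: Rmult_lt_compat_l; lra.
  rewrite -/(Dn k v n x) in h2; lra.
Qed.

(** * Words that almost fix a spectral subspace *)

Section Rep.
Variables (k : nat) (v : nat -> hseq).
Hypothesis o : ortho k v.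
Hypothesis rep : orthrep W Theta k (rho v).
Let sT := Theta_sg.

Lemma Dn_lim x : Theta x -> ulim (fun n => Dn k v n (x n)) (hs W k (rho v) x).
Proof.
  move=> hx; rewrite (hs_tr W Theta k (rho v) sT rep) //.
  have -> : 2 * INR k - 2 * tr W k (rho v) x = sm k (fun i => ip (hmv x (v i)) (hmv x (v i))).
  { rewrite (lsum_ext _ _ _ (fun i => 2 - 2 * rho v x i i)).
    - by rewrite lsum_sub lsum_const length_seq lsum_scal -/(tr W k (rho v) x); ring.
    - by move=> i /in_seq hi; rewrite ip_hmv_sq o; [rewrite /dl Nat.eqb_refl /mat; ring|lia|lia]. }
  rewrite /Dn; elim: {1 2}k => [|k' IH]; first exact: ulim_const.
  rewrite sm_S; apply: (ulim_ext _ U (fun n => sm k' (fun i => nrm n (mv (x n) (hv (v i) n))) + nrm n (mv (x n) (hv (v k') n)))).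
  - by apply: ae_all => // n; rewrite sm_S.
  - by apply: ulim_add => //; exact: (ip_lim (hmv x (v k')) (hmv x (v k'))).
Qed.

(** Otherwise saturation gives words of length [o(q n)], forming an element of [Theta], that move
    [v] by at least [th], while each of their [2 ^ j]-th powers is still a word of length at most
    [q n] and moves [v] by at most 1/4. No nontrivial orthogonal matrix does this. *)
Lemma small_powers (Y1 : list G) (b : nat) (q : nat -> nat) th :
  (forall j x, pw Y1 j x -> pw Y (b * j) x) -> (forall n, (q n <= M n)%nat) ->
  ae (fun n => forall x, pw Y1 (q n) x -> Dn k v n x <= 1 / 4) -> 0 < th ->
  exists K, (1 <= K)%nat /\ ae (fun n => forall x, pw Y1 (q n / K) x -> Dn k v n x <= th).
Proof.
  move=> hb hseq hsmall ht; apply: NNPP => no.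
  pose Q j n x := pw Y1 (q n / S j) x /\ th < Dn k v n x.
  have hQ : forall j, ae (fun n => exists x, forall i, (i <= j)%nat -> Q i n x).
  { move=> j.
    have h : ae (fun n => ~ forall x, pw Y1 (q n / S j) x -> Dn k v n x <= th).
    { by apply: ae_not => // h; apply: no; exists (S j); split; [lia|]. }
    apply: (ae_mono _ U _ _ _ h) => n hn.
    apply: NNPP => no'; apply: hn => x hx; apply: Rnot_lt_le => hl; apply: no'.
    exists x => i hi; split=> //; apply: pw_mono hx.
    by apply: Nat.div_le_compat_l; lia. }
  have [x hx] := saturation _ U _ one Q hQ.
  have qp : forall j n, pw Y1 (q n / S j) (x n) -> (S j * (q n / S j) <= q n)%nat.
  { by move=> j n _; have := Nat.Div0.mul_div_le (q n) (S j); lia. }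
  have tx : Theta x.
  { move=> eps he.
    have [j [h1 h2]] := archimed_cor1 (eps / (INR b + 1)) ltac:(apply: Rdiv_lt_0_compat => //; have := pos_INR b; lra).
    case: j h1 h2 => [|j] h1 h2; first lia.
    apply: (ae_mono _ U _ _ _ (hx j)) => n [p _]; exists (b * (q n / S j))%nat; split; first exact: hb.
    have h3 := INR_div (q n) (S j) ltac:(lia); have h4 := le_INR _ _ (hseq n).
    rewrite mult_INR; have bp := pos_INR b; have jp := lt_0_INR _ h2; have mp := pos_INR (M n).
    apply: (Rmult_le_reg_r (INR (S j))) => //.
    have h5 : / INR (S j) * (INR (S j) * (INR b + 1)) < eps / (INR b + 1) * (INR (S j) * (INR b + 1)).
    { by apply: Rmult_lt_compat_r => //; apply: Rmult_lt_0_compat; lra. }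
    have e1 : / INR (S j) * (INR (S j) * (INR b + 1)) = INR b + 1 by field; lra.
    have e2 : eps / (INR b + 1) * (INR (S j) * (INR b + 1)) = eps * INR (S j) by field; lra.
    rewrite e1 e2 in h5.
    have h6 : INR b * (INR (q n / S j) * INR (S j)) <= INR b * INR (M n) by apply: Rmult_le_compat_l; lra.
    nra. }
  have big : th <= hs W k (rho v) x.
  { apply: (ulim_le _ U _ _ _ _ (ulim_const _ U th) (Dn_lim x tx)).
    by apply: (ae_mono _ U _ _ _ (hx 0%nat)) => n [_ h]; lra. }
  have : hs W k (rho v) x = 0; last lra.
  apply: (no_small_subgroups W Theta k (rho v) sT rep x tx) => j.
  have td : Theta (dbl W j x) by elim: j => [|j IH] //=; apply: (sgM _ _ _ _ sT).
  apply: (ulim_le _ U _ _ _ _ (Dn_lim _ td) (ulim_const _ U (1 / 4))).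
  (* Condition number [2 ^ j - 1] concerns words of length [q n / 2 ^ j]. *)
  apply: (ae_mono _ U _ _ _ (ae_and _ U _ _ hsmall (hx (2 ^ j - 1)%nat))) => n [h [p _]]; apply: h.
  have -> : dbl W j x n = dbl G j (x n) by elim: (j) => [|i IH] //=; rewrite IH.
  apply: (pw_mono _ _ _ _ _ _ (pw_dbl _ _ j _ _ p)).
  have e : S (2 ^ j - 1) = (2 ^ j)%nat by have := Nat.pow_nonzero 2 j; lia.
  by rewrite e; have := Nat.Div0.mul_div_le (q n) (2 ^ j); lia.
Qed.
End Rep.

(** * A slowly varying function with a definite total gain *)

Section Gradient.
Variable Gam : G -> Prop.
Hypothesis gY : gen_by Y Gam.
Hypothesis Mv : forall n, exists s, pw Y (S (M n)) s /\ (Rn n < len s)%nat.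
Hypothesis nVA : ~ virt_inf_abelian Gam.
Let sG := gen_by_sg _ _ _ gY.

Lemma pk_ex a : exists N, forall R0, exists R, (R0 <= R)%nat /\ packing G X a 1 R N.
Proof.
  have [N hN] := pk a 1 (le_n 1); exists N => R0.
  by have [n [h1 h2]] := ae_ex _ U _ (ae_and _ U _ _ (R_inf R0) hN); exists (Rn n).
Qed.

Lemma Theta_gam x : Gam x -> Theta (cst G x).
Proof. by move=> /(proj2 gY x) [j p]; apply: Theta_cst p. Qed.

Section FixedKernel.
Variables (k : nat) (v : nat -> hseq).
Hypothesis rep : orthrep W Theta k (rho v).

Lemma cst_rep Gam' : (forall x, Gam' x -> Gam x) -> orthrep G Gam' k (fun x => rho v (cst G x)).
Proof.
  move=> sub'; case: rep => [r1 [r2 r3]]; split; [|split].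
  - exact: r1.
  - move=> x y i j hx hy hi hj.
    by apply: (r2 (cst G x) (cst G y)) => //; apply: Theta_gam; apply: sub'.
  - move=> x i j hx hi hj.
    by apply: (r3 (cst G x)) => //; apply: Theta_gam; apply: sub'.
Qed.

Definition ker_rep (Gam' : G -> Prop) (x : G) := Gam' x /\ hs W k (rho v) (cst G x) = 0.

Lemma ker_rep_fi Gam' : is_subgroup G Gam' -> (forall x, Gam' x -> Gam x) -> fi Gam Gam' ->
  is_subgroup G (ker_rep Gam') /\ fi Gam' (ker_rep Gam').
Proof.
  move=> s' sub' f'; have r := cst_rep _ sub'; split.
  - exact: (kernel_sg G Gam' k _ s' r).
  - apply: (orth_kernel_fi G Gam' k _ s' r X HX).
    + by apply: (fg_fi _ _ _ _ s' sub' f'); exists Y.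
    + exact: pk_ex.
    + by move=> h; apply: nVA; apply: (via_fi _ _ _ sub' f' h).
Qed.
End FixedKernel.

Lemma pw_uniform (l : list G) : (forall s, In s l -> Gam s) -> exists b, forall s, In s l -> pw Y b s.
Proof.
  elim: l => [|a l IH] h; first by exists 0%nat.
  have [b hb] := IH (fun s i => h s (or_intror i)).
  have [j hj] := proj1 (proj2 gY a) (h a (or_introl eq_refl)).
  by exists (b + j)%nat => s [<-|/hb p]; [apply: pw_mono hj|apply: pw_mono p]; lia.
Qed.

Lemma len_pw b : forall n s, pw Y (b * M n) s -> (len s <= b * Rn n)%nat.
Proof.
  elim: b => [|b IH] n s; first by move=> /= ->; rewrite len1.
  move=> h; have [y [z [h1 [h2 ->]]]] := pw_split _ _ (M n) (b * M n) _ h.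
  by have := lenM _ _ HX y z; have := YM n y h1; have := IH n z h2; rewrite /=; lia.
Qed.

(** A finite index subgroup of [Gam] carries, in the ultraproduct, a
    left-Lipschitz function [fb] whose total variation along a path of
    generators is bounded below when tested against a fixed eigenvector. *)
Lemma gradient : exists Gam1 Y1 b,
  (is_subgroup G Gam1 /\ (forall x, Gam1 x -> Gam x) /\ fi Gam Gam1 /\ gen_by Y1 Gam1 /\
   forall j x, pw Y1 j x -> pw Y (b * j) x) /\
  exists v l0, (0 < l0 /\ (forall w, ip (htop 1 v) w = l0 * ip v w) /\ ip v v = 1) /\
  exists (fb : nat -> G -> R) (Q : nat -> nat) C gam K,
  (forall n, fs (fb n)) /\ 0 < gam /\ 0 <= C /\ (1 <= K)%nat /\ (forall c, ae (fun n => (c <= Q n)%nat)) /\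
  ae (fun n => (K * Q n <= M n)%nat /\ supp_in G X ((b + 3) * Rn n) (fb n) /\
    (forall z j s, pw Y1 j s -> Rabs (fb n (s ** z) - fb n z) * INR (Q n) <= C * INR j) /\
    exists x, pw Y1 (2 * K * Q n) x /\ gam <= ipn n (fb n) (hv v n) - ipn n (lam x (fb n)) (hv v n)).
Proof.
  have [c4 [c40 hc4]] := vol_ratio_low 4 ltac:(lia).
  (* The least displacement of the tent by an element of length about [Rn n], as given by
     [f0_moves]. *)
  pose g0 := (1 / 4) ^ 2 * c4.
  have g00 : 0 < g0 by rewrite /g0; lra.
  have [tau [tau0 hcap]] := capture (g0 / 64) ltac:(lra).
  have [k [v [l [eg [hl hp]]]]] := htop_spectral 1 tau tau0.
  have o := proj1 eg.
  have [rep _] := Theta_rep 1 k v l tau eg hl hp.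
  have [s1 f1] := ker_rep_fi k v rep Gam sG (fun x h => h) (fi_refl _ _ sG).
  set Gam1 := ker_rep k v Gam in s1 f1.
  have sub1 : forall x, Gam1 x -> Gam x by move=> x [].
  have [Y1 [T [g1 hT]]] := schreier _ _ _ _ gY s1 sub1 f1.
  have [b hb] := pw_uniform Y1 (fun s i => sub1 s (gen_by_in _ _ _ _ g1 i)).
  have pb : forall j x, pw Y1 j x -> pw Y (b * j) x by move=> j x; apply: pw_pw.
  exists Gam1, Y1, b; split=> //.
  have [d hd] := len_list G X T.
  have sm1 := small_move k v g0 o g00 (hcap k v o hp).
  pose th0 := Rmin (1 / 4) (g0 / 4).
  have t0p : 0 < th0 by apply: Rmin_pos; lra.
  have t0a : th0 <= 1 / 4 by apply: Rmin_l.
  have t0b : th0 <= g0 / 4 by apply: Rmin_r.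
  pose good n := (forall x, Dn k v n x <= g0 / 4 -> nrm n (mv x (f0 n)) < g0) /\
    (d <= Rn n / 4)%nat /\ c4 <= INR (vol (Rn n / 4)) / INR (vol (Rn n)).
  have agood : ae good.
  { apply: (ae_and _ U _ _ sm1); apply: (ae_and _ U) => //.
    apply: (ae_mono _ U _ _ _ (R_inf (4 * d)%nat)) => n h.
    by apply: Nat.div_le_lower_bound; lia. }
  (* Some word of length [M n + 1] in [Y] leaves the ball of radius [Rn n]. Up to a transversal
     element of length at most [d] it is a word of the same length bound in [Y1], which displaces
     the tent by [g0] and so cannot almost fix all the [v i]. *)
  have bnd : forall n q', good n -> (forall x, pw Y1 q' x -> Dn k v n x <= th0) -> (q' <= M n)%nat.
  { move=> n q' [ga [gb gc]] hseq'; apply/Nat.nlt_ge => hlt.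
    have [s [hs1 hs2]] := Mv n; have [t [x1 [it [px ex]]]] := hT _ _ hs1.
    have lt := hd t it.
    have l1 : (Rn n <= len x1 + Rn n / 4)%nat by have := lenM _ _ HX t x1; rewrite -ex; lia.
    have m1 := f0_moves G X HX (Rn n) (R1 n) x1 l1.
    have m2 : Dn k v n x1 <= g0 / 4 by have := hseq' x1 (pw_mono _ _ _ _ _ hlt px); lra.
    have := ga x1 m2; rewrite /g0; lra. }
  (* [q n] is the largest length up to which words in [Y1] almost fix the [v i]; at bad levels only
     [q n <= M n] is asked. *)
  pose mx n qn := (qn <= M n)%nat /\ (good n -> (forall x, pw Y1 qn x -> Dn k v n x <= th0) /\
        forall q', (forall x, pw Y1 q' x -> Dn k v n x <= th0) -> (q' <= qn)%nat).
  have [q hseq] : exists q, forall n, mx n (q n).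
  { apply: (choice_fun _ mx) => n; case: (classic (good n)) => hg; last by exists 0%nat; split=> //; lia.
    have [q [h1 h2]] := max_nat (fun q => forall x, pw Y1 q x -> Dn k v n x <= th0) (M n)
      ltac:(by exists 0%nat => x /= ->; rewrite Dn_one; lra) (fun q' => bnd n q' hg).
    by exists q; split; [exact: bnd|]. }
  (* Each element of [Gam1] fixes the [v i] in the limit, and there are finitely many words of
     length at most [c]. *)
  have q_inf : forall c, ae (fun n => (c <= q n)%nat).
  { move=> c; have [L hL] := pw_fin _ Y1 c.
    have h : ae (fun n => forall x, In x L -> Dn k v n x <= th0).
    { apply: (ae_list _ U) => x /hL px.
      have [gx hx] : Gam1 x by apply/(proj2 g1); exists c.
      have lim := Dn_lim k v o rep (cst G x) (Theta_gam x gx).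
      by apply: (ae_mono _ U _ _ _ (ulim_lt _ U _ _ th0 lim _)); [move=> n; rewrite /cst; lra|rewrite hx]. }
    apply: (ae_mono _ U _ _ _ (ae_and _ U _ _ agood h)) => n [hg hn].
    by apply: (proj2 (proj2 (hseq n) hg)) => x /hL; exact: hn. }
  pose th := th0 / INR (S k).
  have kp : 0 < INR (S k) by apply: lt_0_INR; lia.
  have thp : 0 < th by apply: Rdiv_lt_0_compat.
  have viol : ae (fun n => exists i, In i (seq 0 k) /\ exists x, pw Y1 (S (q n)) x /\ th < nrm n (mv x (hv (v i) n))).
  { apply: (ae_mono _ U _ _ _ agood) => n hg; have [h1 h2] := proj2 (hseq n) hg.
    have [x [px hx]] : exists x, pw Y1 (S (q n)) x /\ th0 < Dn k v n x.
    { apply: NNPP => no; have : (S (q n) <= q n)%nat; last lia.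
      by apply: h2 => x px; apply: Rnot_lt_le => hx; apply: no; exists x. }
    apply: NNPP => no; have : Dn k v n x <= th0; last lra.
    apply: (Rle_trans _ (INR k * th)).
    - rewrite -{2}(length_seq k 0) -lsum_const; apply: lsum_le => i hi.
      by apply: Rnot_lt_le => hi'; apply: no; exists i; split=> //; exists x.
    - rewrite /th; apply: (Rle_trans _ (INR (S k) * (th0 / INR (S k)))); last by apply: Req_le; field; lra.
      by apply: Rmult_le_compat_r; [rewrite -/th; lra|rewrite S_INR; lra]. }
  (* The vector moved by a word of length [q n + 1] varies with [n], but it is one of [k]; a single
     index serves almost everywhere. *)
  have [i0 [/in_seq hi0 av]] := ae_choose _ U _ _ _ viol.
  set v0 := v i0 in av.
  have l0p : 0 < l i0 by have := hl i0; lra || (move=> hl'; have := hl' ltac:(lia); lra).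
  have eig : forall w, ip (htop 1 v0) w = l i0 * ip v0 w by move=> w; apply: (proj2 eg); lia.
  have v01 : ip v0 v0 = 1 by rewrite /v0 o /dl ?Nat.eqb_refl //; lia.
  exists v0, (l i0); split=> //.
  have [Ka [Ka0 hKa]] := kap_bound 1.
  pose B := 2 * Ka / l i0.
  have B0 : 0 <= B by apply: Rmult_le_pos; [lra|left; apply: Rinv_0_lt_compat].
  (* [vs] equals [v0] up to a null vector, but its levels are values of the operator, hence bounded
     and Lipschitz on the right. *)
  pose vs := hscal (/ l i0) (htop 1 v0).
  pose e := hadd vs (hscal (-1) v0).
  have ee : ip e e = 0.
  { have : forall w, ip e w = 0; last by apply.
    by move=> w; rewrite /e ipD ipZ /vs ipZ eig; field; lra. }
  have [C3 [C30 hC3]] := vol_ratio (b + 3).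
  pose eta := sqrt (th ^ 2 / 1024 / (2 * C3 + 1)).
  have th2 : 0 < th ^ 2 / 1024 by have := pow_lt th 2 thp; lra.
  have eta0 : 0 < eta by apply: sqrt_lt_R0; apply: Rdiv_lt_0_compat; lra.
  have eta2 : eta ^ 2 * C3 * 2 <= th ^ 2 / 1024.
  { have e2 : eta ^ 2 * (2 * C3 + 1) = th ^ 2 / 1024.
    { rewrite /eta -Rsqr_pow2 Rsqr_sqrt; first by field; lra.
      by left; apply: Rdiv_lt_0_compat; lra. }
    have := pow2_ge_0 eta; lra. }
  have [b2 [hb21 hb22]] := archimed_cor1 (eta / 2 / (2 * B + 1)) ltac:(apply: Rdiv_lt_0_compat; lra).
  have b21 : (1 <= b2)%nat by lia.
  have hb2 : 2 * B * / INR b2 <= eta / 2.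
  { have ib : 0 < / INR b2 by apply: Rinv_0_lt_compat; apply: lt_0_INR.
    have : / INR b2 * (2 * B + 1) <= eta / 2 / (2 * B + 1) * (2 * B + 1) by apply: Rmult_le_compat_r; lra.
    have -> : eta / 2 / (2 * B + 1) * (2 * B + 1) = eta / 2 by field; lra.
    lra. }
  have [c2 [c20 hc2]] := vol_ratio_low b2 b21.
  pose kap := (eta / 2) ^ 2 * c2.
  have kap0 : 0 < kap by apply: Rmult_lt_0_compat => //; apply: pow_lt; lra.
  have [K [K1 hK]] := small_powers k v o rep Y1 b q (kap / 4) pb (fun n => proj1 (hseq n))
    ltac:(apply: (ae_mono _ U _ _ _ agood) => n hg x px; have := proj1 (proj2 (hseq n) hg) x px; lra) ltac:(lra).
  (* Division by [K] makes displacements as small as [level_close] demands, while the moving word of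
     length [q n + 1] still has length at most [2 * K * Q n]. *)
  pose Q n := (q n / K)%nat.
  pose rg n := reg G Y1 ((2 * B + 1) / INR (Q n)) (hv vs n).
  pose fb n := match excluded_middle_informative (fs (rg n)) with left _ => rg n | right _ => fun _ => 0 end.
  exists fb, Q, (2 * B + 1), (th / 4), K.
  split; first by move=> n; rewrite /fb; case: excluded_middle_informative => // _; exists []; split; [constructor|].
  split; first lra.
  split; first lra.
  split=> //.
  split.
  { move=> c; apply: (ae_mono _ U _ _ _ (q_inf (K * c)%nat)) => n h.
    by apply: Nat.div_le_lower_bound; lia. }
  have a1 := ulim_lt _ U _ _ _ (ip_lim v0 v0) (ltac:(lra) : ip v0 v0 < 2 ^ 2).
  have a2 := ulim_lt _ U _ _ _ (ip_lim e e) (ltac:(lra) : ip e e < kap / 32).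
  have a3 := ulim_lt _ U _ _ _ (ip_lim e e) (ltac:(lra) : ip e e < th ^ 2 / 2048).
  have a4 := q_inf K.
  have allA := ae_and _ U _ _ (ae_and _ U _ _ (ae_and _ U _ _ a1 a2) (ae_and _ U _ _ a3 a4))
    (ae_and _ U _ _ (ae_and _ U _ _ hKa hC3) (ae_and _ U _ _ hc2 (ae_and _ U _ _ hK av))).
  apply: (ae_mono _ U _ _ _ allA) => n [[[h1 h2] [h3 h4]] [[h5 h6] [h7 [h8 [x [px hx]]]]]] {allA a1 a2 a3 a4 viol av}.
  have Q1 : (1 <= Q n)%nat by apply: Nat.div_le_lower_bound; lia.
  have KQ : (K * Q n <= q n)%nat by have := Nat.Div0.mul_div_le (q n) K.
  have KQ2 : (q n < K * S (Q n))%nat by apply: Nat.mul_succ_div_gt; lia.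
  have qM := proj1 (hseq n).
  have Qp : 0 < INR (Q n) by apply: lt_0_INR.
  have il0 : 0 < / l i0 by apply: Rinv_0_lt_compat.
  have fv0 := hfs v0 n; have fvs := hfs vs n.
  have supB : forall z, Rabs (hv vs n z) <= B.
  { move=> z; have := top_sup G X HX (Rn n) (R1 n) Y (M n) (M1 n) (YM n) 1 (hv v0 n) 2 z fv0 ltac:(lra) ltac:(lra).
    have -> : hv vs n z = / l i0 * top G X (Rn n) Y (M n) 1 (hv v0 n) z by [].
    rewrite Rabs_mult (Rabs_pos_eq (/ _)); last lra.
    move=> ht; have -> : B = / l i0 * (Ka * 2) by rewrite /B; field; lra.
    apply: Rmult_le_compat_l; [lra|nra]. }
  have lipB : forall z c, Rabs (hv vs n (z ** c) - hv vs n z) <= B * (INR (len c) / INR (Rn n)).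
  { move=> z c; have := top_right G X HX (Rn n) (R1 n) Y (M n) (M1 n) (YM n) 1 (hv v0 n) 2 z c fv0 ltac:(lra) ltac:(lra).
    have -> : hv vs n (z ** c) - hv vs n z = / l i0 * (top G X (Rn n) Y (M n) 1 (hv v0 n) (z ** c) - top G X (Rn n) Y (M n) 1 (hv v0 n) z).
    { rewrite /vs /= /topn; ring. }
    rewrite Rabs_mult (Rabs_pos_eq (/ _)); last lra.
    have rp : 0 <= INR (len c) / INR (Rn n).
    { by apply: Rmult_le_pos; [exact: pos_INR|left; apply: Rinv_0_lt_compat; apply: lt_0_INR; have := R1 n; lia]. }
    move=> ht; have -> : B * (INR (len c) / INR (Rn n)) = / l i0 * (Ka * 2 * (INR (len c) / INR (Rn n))) by rewrite /B /Rdiv; ring.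
    apply: Rmult_le_compat_l; first lra.
    apply: (Rle_trans _ _ _ ht); apply: Rmult_le_compat_r => //; lra. }
  have close : forall s z, pw Y1 (Q n) s -> Rabs (hv vs n (iv s ** z) - hv vs n z) <= eta.
  { move=> s z ps.
    apply: (level_close G X HX (Rn n) (R1 n) (hv vs n) (hv v0 n) B B0 fvs fv0 eta b2 kap s z) => //.
    - by rewrite /kap; apply: Rmult_le_compat_l => //; exact: pow2_ge_0.
    - apply: Rle_trans (h8 s ps).
      apply: (lsum_term _ (seq 0 k) (fun i => nrm n (mv s (hv (v i) n))) i0); first by apply/in_seq; lia.
      by move=> i _; exact: ipn_pos.
    - by left; exact: h2. }
  have hbQ : forall s, pw Y1 (Q n) s -> (len s <= b * Rn n)%nat.
  { move=> s ps; apply: len_pw; apply: pb; apply: pw_mono ps; nia. }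
  have svs : supp_in G X (3 * Rn n) (hv vs n).
  { move=> z nz; apply: (top_supp G X HX (Rn n) (R1 n) Y (M n) (M1 n) (YM n) 1 (hv v0 n)) => ez; apply: nz.
    by rewrite /vs /= /topn ez; ring. }
  have srg := fb_supp G X HX (Rn n) (R1 n) (hv vs n) B B0 Y1 b (Q n) eta Q1 hbQ (Rlt_le _ _ eta0) svs supB close.
  have efb : fb n = rg n.
  { by rewrite /fb; case: excluded_middle_informative => // no; case: no; apply: supp_fs srg. }
  rewrite efb; split; first lia.
  split=> //.
  split.
  - move=> z j s ps.
    have c0 : 0 <= (2 * B + 1) / INR (Q n) by apply: Rmult_le_pos; [lra|left; apply: Rinv_0_lt_compat].
    have ub : forall z, hv vs n z <= B by move=> z'; have := supB z'; have := Rle_abs (hv vs n z'); lra.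
    have := reg_lip G Y1 (proj1 g1) _ B (hv vs n) c0 ub z j s ps => hr.
    have -> : (2 * B + 1) * INR j = (2 * B + 1) / INR (Q n) * INR j * INR (Q n) by field; lra.
    by apply: Rmult_le_compat_r; [lra|exact: hr].
  - exists x; split; first by apply: pw_mono px; nia.
    apply: (fb_gain G X HX (Rn n) (R1 n) (hv vs n) (hv v0 n) B B0 fvs fv0 Y1 b (Q n) eta th) => //; try lra.
    + by left; exact: h3.
    + apply: Rle_trans eta2; apply: Rmult_le_compat_r; first lra.
      by apply: Rmult_le_compat_l => //; exact: pow2_ge_0.
Qed.
Lemma ae_choice (A : Type) (a0 : A) (P : nat -> A -> Prop) : ae (fun n => exists y, P n y) ->
  exists f, ae (fun n => P n (f n)).
Proof.
  move=> h; have [f hf] := saturation _ U A a0 (fun _ n u => P n u)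
    ltac:(by move=> j; apply: (ae_mono _ U _ _ _ h) => n [y p]; exists y).
  by exists f; exact: (hf 0%nat).
Qed.

Lemma twist k v : orthrep W Theta k (rho v) ->
  (forall x i w, Theta x -> (i < k)%nat -> ip (hact x (v i)) w = sm k (fun j => ip (hact x (v i)) (v j) * ip (v j) w)) ->
  forall x u i, Theta x -> (i < k)%nat -> ip (hact x u) (v i) = sm k (fun j => rho v x i j * ip u (v j)).
Proof.
  move=> [_ [_ r3]] inv x u i hx hi.
  have hx' : Theta (iv x) by apply: (sgV _ _ _ (Theta_sg)).
  rewrite (act_adj hseq ip ipC W hact (act1) (actM) (actI)).
  rewrite ipC inv //; apply: lsum_ext => j /in_seq hj.
  by rewrite (ipC (v j)) -r3 //; lia.
Qed.

(** The two forms [<T_1 u, u>] and [<T_a u, u>] compare across a bounded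
    translation, so an eigenvector of [T_1] is nearly captured by the spectral
    subspace of [T_a], uniformly over the translation. *)
Lemma capture_translate b k2 v2 tau2 v l0 (y : W) :
  0 < l0 -> (forall w, ip (htop 1 v) w = l0 * ip v w) -> ip v v = 1 -> 0 < tau2 -> ortho k2 v2 ->
  (forall u, perp k2 v2 u -> ip (htop (2 * b + 2) u) u <= tau2 * ip u u) ->
  ae (fun n => (len (y n) <= 2 * b * Rn n)%nat) ->
  let u := rest k2 v2 (hact (iv y) v) in ip u u <= tau2 / l0.
Proof.
  move=> l0p eig v1 t0 o hp hy u.
  have pu : perp k2 v2 u by apply: rest_perp.
  have e1 : ip u u = ip (hact y u) v.
  { rewrite /u rest_sq // -/u (act_adj hseq ip ipC W hact (act1) (actM) (actI) y u v).
    by rewrite ipC. }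
  pose Bf := fun u w => ip (htop 1 u) w.
  have BC : forall u w, Bf u w = Bf w u by move=> u' w'; rewrite /Bf Tsym ipC.
  have BD : forall u w z, Bf (hadd u w) z = Bf u z + Bf w z by move=> u' w' z; rewrite /Bf !Tsym ipD.
  have BZ : forall c u w, Bf (hscal c u) w = c * Bf u w by move=> c u' w'; rewrite /Bf !Tsym ipZ.
  have Bp : forall u, 0 <= Bf u u.
  { move=> u'; apply: (ulim_le _ U _ _ _ _ (ulim_const _ U 0) (htop_tform 1 u' u')).
    by apply: ae_all => // n; apply: tform_pos. }
  have cs := ip_CS hseq hadd hscal Bf BC BD BZ Bp (hact y u) v.
  have e2 : Bf (hact y u) v = l0 * ip u u by rewrite BC /Bf eig ipC -e1.
  have e3 : Bf v v = l0 by rewrite /Bf eig v1; ring.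
  have e4 : Bf (hact y u) (hact y u) <= tau2 * ip u u.
  { apply: Rle_trans (hp u pu).
    apply: (ulim_le _ U _ _ _ _ (htop_tform 1 (hact y u) (hact y u)) (htop_tform (2 * b + 2) u u)).
    apply: (ae_mono _ U _ _ _ hy) => n hn.
    by apply: tform_translate => //; [exact: YM|exact: hfs]. }
  rewrite e2 e3 in cs.
  have p := ip_pos u; move: cs e4; move: (Bf _ _) (ip u u) p => w a a0 cs e4.
  have ap : l0 * (l0 * a) * a <= l0 * tau2 * a by nra.
  case: (Req_dec a 0) => az; first by rewrite az; left; apply: Rdiv_lt_0_compat.
  have h : l0 * (l0 * a) <= l0 * tau2 by apply: (Rmult_le_reg_r a) => //; lra.
  apply: (Rmult_le_reg_l l0) => //; have -> : l0 * (tau2 / l0) = tau2 by field; lra.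
  exact: (Rmult_le_reg_l l0).
Qed.

(** * The cocycle and its finite dimensional shadow *)

Section Cocycle.
Variables (Gam1 : G -> Prop) (Y1 : list G) (b : nat).
Hypothesis s1 : is_subgroup G Gam1.
Hypothesis sub1 : forall x, Gam1 x -> Gam x.
Hypothesis f1 : fi Gam Gam1.
Hypothesis g1 : gen_by Y1 Gam1.
Hypothesis pb : forall j x, pw Y1 j x -> pw Y (b * j) x.
Variables (fb : nat -> G -> R) (Q : nat -> nat) (C C4 : R).
Hypothesis ffb : forall n, fs (fb n).
Hypothesis C0 : 0 <= C.
Hypothesis C40 : 0 <= C4.
Hypothesis hC4 : ae (fun n => INR (vol ((b + 4) * Rn n)) / INR (vol (Rn n)) <= C4).
Hypothesis sfb : ae (fun n => supp_in G X ((b + 3) * Rn n) (fb n)).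
Hypothesis lfb : ae (fun n => forall z j s, pw Y1 j s -> Rabs (fb n (s ** z) - fb n z) * INR (Q n) <= C * INR j).

(** The factor [INR (Q n)] compensates for the slope of order [1 / Q n] of [fb], so the values stay
    bounded for fixed [g]. *)
Definition ev g n z := INR (Q n) * (fb n z + -1 * lam g (fb n) z).

Lemma ev_fs g n : fs (ev g n).
Proof. by apply: fs_scal; apply: fs_add => //; apply: fs_scal; apply: fs_lam. Qed.

Lemma ev_norm j g : pw Y1 j g -> ae (fun n => nrm n (ev g n) <= (C * INR j) ^ 2 * C4).
Proof.
  move=> p.
  apply: (ae_mono _ U _ _ _ (ae_and _ U _ _ (ae_and _ U _ _ hC4 sfb) (ae_and _ U _ _ lfb (R_inf (len g))))) => n [[h1 h2] [h3 h4]].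
  have c0 : 0 <= C * INR j by apply: Rmult_le_pos => //; exact: pos_INR.
  apply: (Rle_trans _ ((C * INR j) ^ 2 * (INR (vol ((b + 4) * Rn n)) / INR (vol (Rn n))))); last first.
  { by apply: Rmult_le_compat_l => //; exact: pow2_ge_0. }
  apply: ipn_upper => //.
  - move=> z nz; case: (Req_dec (fb n z) 0) => e; last by have := h2 z e; nia.
    case: (Req_dec (lam g (fb n) z) 0) => e'; first by case: nz; rewrite /ev e e'; ring.
    by have := supp_lam G X HX (Rn n) (R1 n) g (fb n) _ _ h4 h2 z e'; lia.
  - move=> z; have := h3 z j (iv g) (pw_inv _ _ _ _ (proj1 g1) p).
    rewrite /ev Rabs_mult (Rabs_pos_eq (INR (Q n))); last exact: pos_INR.
    rewrite /lam -Rabs_Ropp.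
    have -> : - (fb n (iv g ** z) - fb n z) = fb n z + -1 * fb n (iv g ** z) by ring.
    by rewrite Rmult_comm.
Qed.

Lemma ev_bd g : Gam1 g -> exists B, ae (fun n => nrm n (ev g n) <= B).
Proof. by move=> /(proj2 g1 g) [j p]; eexists; exact: ev_norm p. Qed.

(** The cocycle; [hzero] is a junk value outside [Gam1]. *)
Definition he g : hseq := match excluded_middle_informative (Gam1 g) with
  | left h => Build_hseq (ev g) (ev_fs g) (ev_bd g h) | right _ => hzero end.

Lemma hv_he g n : Gam1 g -> hv (he g) n = ev g n.
Proof. by move=> h; rewrite /he; case: excluded_middle_informative. Qed.

(** The cocycle identity, from [fb - g h fb = (fb - g fb) + g (fb - h fb)]. *)
Lemma he_mul g h w : Gam1 g -> Gam1 h -> ip (he (g ** h)) w = ip (he g) w + ip (hact (cst G g) (he h)) w.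
Proof.
  move=> hg hh; have hgh : Gam1 (g ** h) by apply: (sgM _ _ _ _ s1).
  rewrite -ipD; apply: (ip_val).
  apply: (ulim_ext _ U _ _ _ _ (ip_lim (hadd (he g) (hact (cst G g) (he h))) w)).
  apply: ae_all => // n; f_equal; apply: functional_extensionality => z.
  have -> : hv (hadd (he g) (hact (cst G g) (he h))) n z = hv (he g) n z + lam g (hv (he h) n) z by [].
  by rewrite !hv_he // /ev /lam; gs; ring.
Qed.

Lemma he_norm j g : pw Y1 j g -> ip (he g) (he g) <= (C * INR j) ^ 2 * C4.
Proof.
  move=> p; have hg : Gam1 g by apply/(proj2 g1 g); exists j.
  apply: (ulim_le _ U _ _ _ _ (ip_lim (he g) (he g)) (ulim_const _ U _)).
  by apply: (ae_mono _ U _ _ _ (ev_norm j g p)) => n; rewrite hv_he.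
Qed.

(** A word of length [2 * K * Q n] is cut into blocks of length [m], one of which carries its share
    of [gam]; times [Q n] this share is proportional to [m]. Words of length at most [m] are
    finitely many, so the block [g] can be chosen constant and only its starting point [y n]
    varies. *)
Lemma block v gam K m : 0 < gam -> (1 <= K)%nat -> (1 <= m)%nat -> (forall c, ae (fun n => (c <= Q n)%nat)) ->
  ae (fun n => (K * Q n <= M n)%nat) ->
  ae (fun n => exists x, pw Y1 (2 * K * Q n) x /\ gam <= ipn n (fb n) (hv v n) - ipn n (lam x (fb n)) (hv v n)) ->
  exists g (y : W), pw Y1 m g /\ ae (fun n => (len (y n) <= 2 * (2 * b) * Rn n)%nat) /\
    gam / INR (2 * K + 1) * INR m <= ip (hact y (he g)) v.
Proof.
  move=> g0 K1 m1 Qinf hM hx.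
  have kp : 0 < INR (2 * K + 1) by apply: lt_0_INR; lia.
  have mp : 0 < INR m by apply: lt_0_INR.
  pose F n x := ipn n (lam x (fb n)) (hv v n).
  pose c := gam / INR (2 * K + 1) * INR m.
  have [L hL] := pw_fin _ Y1 m.
  have h : ae (fun n => exists g, In g L /\ exists y, (len y <= 2 * (2 * b) * Rn n)%nat /\ c <= INR (Q n) * (F n y - F n (y ** g))).
  { apply: (ae_mono _ U _ _ _ (ae_and _ U _ _ (ae_and _ U _ _ (Qinf m) hM) hx)) => n [[h1 h2] [x [px hg]]].
    (* Rounded up so that the blocks exhaust the word; as [m <= Q n] this costs at most one more
       [Q n], whence the constant [2 * K + 1]. *)
    pose p := S (2 * K * Q n / m).
    have p1 : (2 * K * Q n <= p * m)%nat by have := Nat.mul_succ_div_gt (2 * K * Q n) m ltac:(lia); rewrite /p; lia.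
    have p2 : (p * m <= (2 * K + 1) * Q n)%nat by have := Nat.Div0.mul_div_le (2 * K * Q n) m; rewrite /p; lia.
    have pp : 0 < INR p by apply: lt_0_INR; rewrite /p; lia.
    have e1 : lam one (fb n) = fb n by apply: functional_extensionality => z; rewrite /lam; gs.
    have e2 : INR p * (gam / INR p) = gam by field; lra.
    have hg' : INR p * (gam / INR p) <= F n one - F n x by rewrite e2 /F e1.
    have [y [g [py [pg hc]]]] := telescope G Y1 (F n) m (gam / INR p) p x (le_n_S _ _ (Nat.le_0_l _)) (pw_mono _ _ _ _ _ p1 px) hg'.
    exists g; split; first by apply/hL.
    exists y; split.
    - have p3 : (p * m <= 3 * M n)%nat by (have h3 : (Q n <= K * Q n)%nat by nia); nia.
      have := pw_mono _ _ _ _ _ (ltac:(nia) : (b * (p * m) <= (3 * b) * M n)%nat) (pb _ _ py).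
      by move=> /len_pw; lia.
    - apply: (Rle_trans _ (INR (Q n) * (gam / INR p))); last by apply: Rmult_le_compat_l => //; exact: pos_INR.
      move/le_INR: p2; rewrite !mult_INR => p2.
      apply: (Rmult_le_reg_r (INR p * INR (2 * K + 1))); first exact: Rmult_lt_0_compat.
      have -> : c * (INR p * INR (2 * K + 1)) = gam * (INR p * INR m) by rewrite /c; field; lra.
      have -> : INR (Q n) * (gam / INR p) * (INR p * INR (2 * K + 1)) = gam * (INR (2 * K + 1) * INR (Q n)) by field; lra.
      by apply: Rmult_le_compat_l; lra. }
  have [g [ig hg]] := ae_choose _ U _ _ _ h.
  have [y hy] := ae_choice G one _ hg.
  have pg : pw Y1 m g by apply/hL.
  have gg : Gam1 g by apply/(proj2 g1 g); exists m.
  exists g, y; split=> //; split; first by apply: (ae_mono _ U _ _ _ hy) => n [].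
  apply: (ulim_le _ U _ _ _ _ (ulim_const _ U _) (ip_lim (hact y (he g)) v)).
  apply: (ae_mono _ U _ _ _ hy) => n [_ hc]; apply: (Rle_trans _ _ _ hc); apply: Req_le.
  have -> : hv (hact y (he g)) n = (fun z => INR (Q n) * (lam (y n) (fb n) z + -1 * lam (y n ** g) (fb n) z)).
  { have -> : hv (hact y (he g)) n = lam (y n) (hv (he g) n) by [].
    by rewrite hv_he //; apply: functional_extensionality => z; rewrite /ev /lam; gs. }
  have fl : forall x, fs (lam x (fb n)) by move=> x; apply: fs_lam.
  rewrite ipnZ; last by apply: fs_add => //; apply: fs_scal.
  rewrite ipnD //; last exact: fs_scal.
  by rewrite ipnZ // /F; ring.
Qed.

(** On the kernel [Gam2] of the representation the coefficients [be] form a homomorphism to a real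
    vector space, whose kernel [KK] contains all commutators. By rigidity of [Gam], [KK] has finite
    index; but [be] is constant on its left cosets in [Gam1], hence bounded. *)
Lemma commutators_die k2 v2 : orthrep W Theta k2 (rho v2) ->
  (forall x i w, Theta x -> (i < k2)%nat -> ip (hact x (v2 i)) w = sm k2 (fun j => ip (hact x (v2 i)) (v2 j) * ip (v2 j) w)) ->
  (forall Bd, exists g, Gam1 g /\ Bd < sm k2 (fun i => ip (he g) (v2 i) ^ 2)) -> False.
Proof.
  move=> rep inv unb.
  have [s2 f2] := ker_rep_fi k2 v2 rep Gam1 s1 sub1 f1.
  set Gam2 := ker_rep k2 v2 Gam1 in s2 f2.
  have sub2 : forall x, Gam2 x -> Gam1 x by move=> x [].
  pose be g i := ip (he g) (v2 i).
  have coc : forall g h i, Gam1 g -> Gam1 h -> (i < k2)%nat ->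
    be (g ** h) i = be g i + sm k2 (fun j => rho v2 (cst G g) i j * be h j).
  { move=> g h i hg hh hi; rewrite /be he_mul // (twist k2 v2 rep inv) //.
    by apply: Theta_gam; apply: sub1. }
  have hom : forall g h i, Gam2 g -> Gam1 h -> (i < k2)%nat -> be (g ** h) i = be g i + be h i.
  { move=> g h i hg hh hi; rewrite coc //; last exact: sub2.
    f_equal; case: hg => hg1 hg2.
    have tg : Theta (cst G g) by apply: Theta_gam; apply: sub1.
    have mq := proj1 (hs0 W Theta k2 (rho v2) rep (cst G g) tg) hg2.
    rewrite (lsum_ext _ _ _ (fun j => dl i j * be h j)); first exact: sm_dl.
    by move=> j /in_seq hj; rewrite mq; [case: rep => r1 _; rewrite r1 //; lia| |lia]. }
  have hom1 : forall i, (i < k2)%nat -> be one i = 0.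
  { by move=> i hi; have := hom one one i (sg1 _ _ s2) (sg1 _ _ s1) hi; gs; lra. }
  have homV : forall g i, Gam2 g -> (i < k2)%nat -> be (iv g) i = - be g i.
  { move=> g i hg hi; have := hom g (iv g) i hg (sub2 _ (sgV _ _ _ s2 hg)) hi.
    by gs; rewrite hom1 //; lra. }
  pose KK g := Gam2 g /\ forall i, (i < k2)%nat -> be g i = 0.
  have sK : is_subgroup G KK.
  { split; [|split].
    - by split; [exact: (sg1 _ _ s2)|].
    - move=> x y [hx bx] [hy by']; split; first exact: (sgM _ _ _ _ s2).
      by move=> i hi; rewrite hom //; [rewrite bx // by' //; ring|exact: sub2].
    - move=> x [hx bx]; split; first exact: (sgV _ _ _ s2).
      by move=> i hi; rewrite homV // bx //; ring. }
  apply: nVA; apply: (via_fi _ _ _ sub1 f1).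
  exists Gam2, KK; split=> //; split=> //; split=> //; split=> //; split; first by move=> x [].
  split.
  - move=> x y hx hy.
    have hx' := sgV _ _ _ s2 hx; have hy' := sgV _ _ _ s2 hy.
    have hxy := sgM _ _ _ _ s2 hx hy; have hxy' := sgM _ _ _ _ s2 hx' hy'.
    split; first exact: (sgM _ _ _ _ s2).
    move=> i hi; rewrite /commutator hom //; last exact: sub2.
    rewrite !hom //; try exact: sub2.
    by rewrite !homV //; ring.
  - move=> fK; have [l [hl1 hl2]] := fi_trans _ _ _ _ sK f2 fK.
    have [Bd hBd] : exists Bd, forall t, In t l -> sm k2 (fun i => be t i ^ 2) <= Bd.
    { elim: (l) => [|t l' [Bd IH]]; first by exists 0.
      exists (Rmax (sm k2 (fun i => be t i ^ 2)) Bd) => t' [<-|i]; first exact: Rmax_l.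
      by apply: Rle_trans (IH _ i) (Rmax_r _ _). }
    have [g [hg big]] := unb Bd.
    have [t [it [kt bt]]] := hl2 g hg.
    have : sm k2 (fun i => be g i ^ 2) <= Bd; last by rewrite /be; lra.
    apply: Rle_trans (hBd t it); apply: Req_le; apply: lsum_ext => i /in_seq hi.
    have e : g = t ** (iv t ** g) by gs.
    rewrite {1}e coc; [|exact: hl1|exact: sub2|lia].
    rewrite (lsum_ext _ _ _ (fun _ => 0)); first by rewrite lsum_0 Rplus_0_r.
    by move=> j /in_seq hj; rewrite bt; [ring|lia].
Qed.
End Cocycle.

(** The translated cocycle pairs with [v] to at least [ga * m]. With the translation moved onto [v],
    the part outside the second spectral subspace contributes at most half, so the coefficients of
    the cocycle in that subspace are unbounded, against [commutators_die]. *)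
Lemma no_rigidity : False.
Proof.
  have [Gam1 [Y1 [b [[s1 [sub1 [f1 [g1 pb]]]] [v [l0 [[l0p [eig v1]] [fb [Q [C [gam [K [ffb [gp [C0 [K1 [Qinf hall]]]]]]]]]]]]]]]]] := gradient.
  have [C4 [C40 hC4]] := vol_ratio (b + 4).
  have sfb : ae (fun n => supp_in G X ((b + 3) * Rn n) (fb n)) by apply: (ae_mono _ U _ _ _ hall) => n [_ []].
  have lfb : ae (fun n => forall z j s, pw Y1 j s -> Rabs (fb n (s ** z) - fb n z) * INR (Q n) <= C * INR j).
  { by apply: (ae_mono _ U _ _ _ hall) => n [_ [_ []]]. }
  have hM : ae (fun n => (K * Q n <= M n)%nat) by apply: (ae_mono _ U _ _ _ hall) => n [].
  have hx : ae (fun n => exists x, pw Y1 (2 * K * Q n) x /\ gam <= ipn n (fb n) (hv v n) - ipn n (lam x (fb n)) (hv v n)).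
  { by apply: (ae_mono _ U _ _ _ hall) => n [_ [_ [_]]]. }
  pose E := he Gam1 Y1 b g1 fb Q C C4 ffb C0 hC4 sfb lfb.
  have kp : 0 < INR (2 * K + 1) by apply: lt_0_INR; lia.
  pose ga := gam / INR (2 * K + 1).
  have ga0 : 0 < ga by apply: Rdiv_lt_0_compat.
  pose D := C4 * C ^ 2 + 1.
  have D1 : 1 <= D by have := Rmult_le_pos _ _ C40 (pow2_ge_0 C); rewrite /D; lra.
  (* Chosen so that [tau2 / l0], the squared norm left over by [capture_translate], times the bound
     [(C * INR m) ^ 2 * C4] from [he_norm] is at most [(ga * INR m / 2) ^ 2]. *)
  pose tau2 := (ga / 2) ^ 2 * l0 / D.
  have t20 : 0 < tau2 by apply: Rdiv_lt_0_compat; [apply: Rmult_lt_0_compat => //; apply: pow_lt|]; lra.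
  have [k2 [v2 [l2 [eg2 [hl2 hp2]]]]] := htop_spectral (2 * (2 * b) + 2) tau2 t20.
  have o := proj1 eg2.
  have [rep inv] := Theta_rep _ k2 v2 l2 tau2 eg2 hl2 hp2.
  apply: (commutators_die Gam1 Y1 b s1 sub1 f1 g1 fb Q C C4 ffb C0 hC4 sfb lfb k2 v2 rep inv) => Bd.
  have low : forall m, (1 <= m)%nat -> exists g, Gam1 g /\ (ga * INR m / 2) ^ 2 <= sm k2 (fun i => ip (E g) (v2 i) ^ 2).
  { move=> m m1; have mp : 0 < INR m by apply: lt_0_INR.
    have [g [y [pg [hy hc]]]] := block Gam1 Y1 b g1 pb fb Q C C4 ffb C0 hC4 sfb lfb v gam K m gp K1 m1 Qinf hM hx.
    rewrite -/E -/ga in hc.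
    have gg : Gam1 g by apply/(proj2 g1 g); exists m.
    exists g; split=> //.
    have hu := capture_translate (2 * b) k2 v2 tau2 v l0 y l0p eig v1 t20 o hp2 hy.
    set x := hact (iv y) v; set u := rest k2 v2 x; rewrite -/x -/u in hu.
    have ex : ip (hact y (E g)) v = ip x (E g).
    { by rewrite (act_adj hseq ip ipC W hact (act1) (actM) (actI)) ipC. }
    have eu := ip_rest hseq hzero hadd hscal ip ipD ipZ ip0 k2 v2 x (E g); rewrite -/u in eu.
    have xx : ip x x = 1 by rewrite /x actI.
    have bs := bessel hseq hzero hadd hscal ip ipC ipD ipZ ip0 ip_pos k2 v2 x o; rewrite xx in bs.
    have cs := lsum_CS _ (seq 0 k2) (fun i => ip x (v2 i)) (fun i => ip (v2 i) (E g)).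
    have cu := ip_CS hseq hadd hscal ip ipC ipD ipZ ip_pos u (E g).
    have nE := he_norm Gam1 Y1 b g1 fb Q C C4 ffb C0 hC4 sfb lfb m g pg; rewrite -/E in nE.
    have -> : sm k2 (fun i => ip (E g) (v2 i) ^ 2) = sm k2 (fun i => ip (v2 i) (E g) ^ 2).
    { by apply: lsum_ext => i _; rewrite ipC. }
    have u2 : ip u (E g) <= ga * INR m / 2.
    { apply: Rle_trans (Rle_abs _) _; apply: abs_le_sq; first by have := Rmult_lt_0_compat _ _ ga0 mp; lra.
      apply: (Rle_trans _ _ _ cu).
      apply: (Rle_trans _ (tau2 / l0 * ((C * INR m) ^ 2 * C4))).
      { by apply: Rmult_le_compat => //; exact: ip_pos. }
      have -> : tau2 / l0 * ((C * INR m) ^ 2 * C4) = (ga * INR m / 2) ^ 2 * (C4 * C ^ 2 / D) by rewrite /tau2; field; lra.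
      rewrite -{2}(Rmult_1_r ((ga * INR m / 2) ^ 2)); apply: Rmult_le_compat_l; first exact: pow2_ge_0.
      apply: (Rmult_le_reg_r D); first lra.
      by rewrite /Rdiv Rmult_assoc Rinv_l; [rewrite /D; lra|lra]. }
    set s := sm k2 (fun i => ip (v2 i) (E g) ^ 2) in cs *.
    set p := sm k2 (fun i => ip x (v2 i) * ip (v2 i) (E g)) in cs eu.
    have pl : ga * INR m / 2 <= p by lra.
    have s0 : 0 <= s by apply: lsum_nonneg => i _; exact: pow2_ge_0.
    have h0 : 0 <= ga * INR m / 2 by have := Rmult_lt_0_compat _ _ ga0 mp; lra.
    apply: (Rle_trans _ (p ^ 2)); first by apply: pow_incr.
    apply: (Rle_trans _ _ _ cs).
    by rewrite -{2}(Rmult_1_l s); apply: Rmult_le_compat_r. }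
  have e0 : 0 < (ga / 2) ^ 2 by apply: pow_lt; lra.
  have [m [hm1 hm2]] := archimed_cor1 ((ga / 2) ^ 2 / (Rabs Bd + 1)) ltac:(apply: Rdiv_lt_0_compat => //; have := Rabs_pos Bd; lra).
  have [g [gg h]] := low m hm2; exists g; split=> //.
  have mp : 0 < INR m by apply: lt_0_INR.
  have m1 : 1 <= INR m by apply: (le_INR 1).
  apply: Rlt_le_trans h; apply: (Rle_lt_trans _ _ _ (Rle_abs Bd)).
  have bp := Rabs_pos Bd.
  have : / INR m * (INR m * (Rabs Bd + 1)) < (ga / 2) ^ 2 / (Rabs Bd + 1) * (INR m * (Rabs Bd + 1)).
  { by apply: Rmult_lt_compat_r => //; apply: Rmult_lt_0_compat; lra. }
  have -> : / INR m * (INR m * (Rabs Bd + 1)) = Rabs Bd + 1 by field; lra.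
  have -> : (ga / 2) ^ 2 / (Rabs Bd + 1) * (INR m * (Rabs Bd + 1)) = (ga / 2) ^ 2 * INR m by field; lra.
  have -> : (ga * INR m / 2) ^ 2 = (ga / 2) ^ 2 * INR m * INR m by field.
  move: ((ga / 2) ^ 2 * INR m) => t ht; nra.
Qed.
End Gradient. End Generators.
End Hilbert.

(** Word scale and radius are matched: [M n] is the largest length whose words in [Y] all stay in
    the ball of radius [R' n]. It exists because [Gam] is infinite, and it tends to infinity with
    the radius. *)
Lemma core (G : Group) (X : list G) (HX : generates G X) om (U : nonprincipal_ultrafilter om) (Rn : nat -> nat)
  (R_inf : forall r, ae om (fun n => (r <= Rn n)%nat))
  (pk : forall a b, (1 <= b)%nat -> exists N, ae om (fun n => packing G X a b (Rn n) N))
  (Gam : G -> Prop) : fg Gam -> ~ fin Gam -> virt_inf_abelian Gam.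
Proof.
  move=> [Y gY] nf; apply: NNPP => nVA.
  have [c hc] := len_list G X Y.
  have lenY : forall q s, pw Y q s -> (word_norm G X s <= q * c)%nat.
  { elim=> [|q IH] s /=; first by move=> ->; rewrite len1.
    case=> [/IH|[t [y [it [/IH h ->]]]]]; first lia.
    by have := lenM _ _ HX t y; have := hc t it; lia. }
  (* The maximum with 1 and [c] makes [R' n] and [M n] positive at every level; it agrees with
     [Rn n] almost everywhere. *)
  pose R' n := Nat.max 1 (Nat.max c (Rn n)).
  have R1 : forall n, (1 <= R' n)%nat by move=> n; rewrite /R'; lia.
  have Rc : forall n, (c <= R' n)%nat by move=> n; rewrite /R'; lia.
  have R_inf' : forall r, ae om (fun n => (r <= R' n)%nat).
  { by move=> r; apply: (ae_mono _ U _ _ _ (R_inf r)) => n; rewrite /R'; lia. }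
  have pk' : forall a b, (1 <= b)%nat -> exists N, ae om (fun n => packing G X a b (R' n) N).
  { move=> a b hb; have [N hN] := pk a b hb; exists N.
    apply: (ae_mono _ U _ _ _ (ae_and _ U _ _ hN (R_inf (1 + c)%nat))) => n [h1 h2].
    by have -> : R' n = Rn n by rewrite /R'; lia. }
  pose PM n m := (1 <= m)%nat /\ (forall s, pw Y m s -> (word_norm G X s <= R' n)%nat) /\
    exists s, pw Y (S m) s /\ (R' n < word_norm G X s)%nat.
  have [M hM] : exists M, forall n, PM n (M n).
  { apply: (choice_fun _ PM) => n.
    have [q hq] : exists q s, pw Y q s /\ (R' n < word_norm G X s)%nat.
    { apply: NNPP => no; apply: nf; exists (ball G X (R' n)) => x hx.
      have [j p] := proj1 (proj2 gY x) hx.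
      by apply/in_ball => //; apply/Nat.nlt_ge => l; apply: no; exists j, x. }
    have [q0 [[s [p0 l0]] hmin]] := min_nat (fun q => exists s, pw Y q s /\ (R' n < word_norm G X s)%nat) (ex_intro _ q hq).
    case: q0 p0 hmin => [|[|m]] p0 hmin; try by have := lenY _ _ p0; have := Rc n; lia.
    exists (S m); split; [lia|split; last by exists s].
    move=> t pt; apply/Nat.nlt_ge => lt.
    by have := hmin (S m) (ex_intro _ t (conj pt lt)); lia. }
  have M_inf : forall q, ae om (fun n => (q <= M n)%nat).
  { move=> q; apply: (ae_mono _ U _ _ _ (R_inf' (q * c)%nat)) => n hn.
    have [_ [_ [s [ps ls]]]] := hM n; apply/Nat.nlt_ge => lt.
    have := lenY q s (pw_mono _ _ _ _ _ lt ps); lia. }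
  exact: (no_rigidity G X HX om U R' R1 R_inf' pk' Y (proj1 gY) M (fun n => proj1 (hM n))
    (fun n => proj1 (proj2 (hM n))) M_inf Gam gY (fun n => proj2 (proj2 (hM n))) nVA).
Qed.

(** * From compact balls to packings *)

(** The ball of radius [a * R] is covered by [N ^ (3 * a)] balls of radius [R / 2], and a separated
    family inside one of them translates into the ball of radius [R]. The factor 3 absorbs the
    rounding of [R / 2]. *)
Lemma packing_mul (G : Group) (X : list G) (HX : generates G X) a b R N Nb : (2 <= R)%nat ->
  packing G X 1 2 R N -> packing G X 1 b R Nb -> packing G X a b R (Nb * N ^ (3 * a)).
Proof.
  move=> R2 h2 hb l hl sep.
  have [F0 [c1 c2]] := packing_covering _ _ HX 1 2 R N ltac:(lia) h2.
  have cov : covering G X (2 * (R / 2)) (R / 2) N.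
  { exists F0; split=> // x hx; apply: c2.
    by have := Nat.Div0.mul_div_le R 2; lia. }
  have [F [d1 d2]] := covering_mul _ _ HX (R / 2) N (3 * a) cov.
  apply: (Nat.le_trans _ (Nb * length F)); last by apply: Nat.mul_le_mono_l.
  move/Forall_forall: hl => hl.
  apply: (count_classes _ _ (fun x y => (R < b * word_norm G X (iv x ** y))%nat)
    (fun f x => (word_norm G X (iv f ** x) <= R / 2)%nat)) => //.
  - move=> x /hl hx; apply: d2.
    have e : (R <= 3 * (R / 2))%nat by have h3 : (1 <= R / 2)%nat by [apply: Nat.div_le_lower_bound; lia]; have := Nat.mul_succ_div_gt R 2; lia.
    nia.
  - move=> f l' _ _ /Forall_forall hf sep'.
    rewrite -(length_map (fun x => iv f ** x)); apply: hb.
    + apply/Forall_forall => y /in_map_iff [x [<- ix]].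
      by have := hf x ix; have := Nat.Div0.mul_div_le R 2; lia.
    + by apply/FOP_map; apply: FOP_impl sep' => x y _ _; gs.
Qed.

Section ConeToPacking.
Variables (G : Group) (X : list G).
Hypothesis HX : generates G X.
Notation len := (word_norm G X).
Variable om : (nat -> Prop) -> R.
Hypothesis U : nonprincipal_ultrafilter om.
Variable d : nat -> R.
Hypothesis hd : scaling_sequence om d.
Notation ae := (ae om).
Notation cdist := (cdist G X om d).
Notation cbounded := (cbounded G X om d).

Lemma d_pos n : 0 < d n.
Proof. exact: (proj1 hd). Qed.

Lemma ratio_pos n m : 0 <= INR m / d n.
Proof. by apply: Rmult_le_pos; [exact: pos_INR|left; apply: Rinv_0_lt_compat; exact: d_pos]. Qed.

Lemma cdist_bd u v B : ae (fun n => INR (len (iv (u n) ** v n)) <= B * d n) -> exists a, cdist u v a /\ a <= B.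
Proof.
  move=> h.
  have h' : ae (fun n => word_dist G X (u n) (v n) / d n <= B).
  { apply: (ae_mono _ U _ _ _ h) => n hn; apply: (Rmult_le_reg_r (d n)); first exact: d_pos.
    by rewrite /Rdiv Rmult_assoc Rinv_l ?Rmult_1_r //; have := d_pos n; lra. }
  have [a ha] := ulim_ex _ U (fun n => word_dist G X (u n) (v n) / d n) B
    ltac:(by apply: (ae_mono _ U _ _ _ h') => n; rewrite Rabs_pos_eq //; exact: ratio_pos).
  by exists a; split=> //; apply: (ulim_le _ U _ _ _ _ ha (ulim_const _ U B)).
Qed.

Lemma cdist_lt u v a B : cdist u v a -> a < B -> ae (fun n => INR (len (iv (u n) ** v n)) < B * d n).
Proof.
  move=> h l; apply: (ae_mono _ U _ _ _ (ulim_lt _ U _ _ _ h l)) => n hn.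
  have := Rmult_lt_compat_r _ _ _ (d_pos n) hn.
  by rewrite /Rdiv Rmult_assoc Rinv_l ?Rmult_1_r //; have := d_pos n; lra.
Qed.

Lemma cdist_sym u v a : cdist u v a -> cdist v u a.
Proof.
  apply: (ulim_ext _ U); apply: ae_all => // n; rewrite /word_dist.
  by do 2 f_equal; rewrite -(lenV _ _ HX (iv (u n) ** v n)); gs.
Qed.

Lemma cdist_refl u : cdist u u 0.
Proof.
  have e : (fun n => word_dist G X (u n) (u n) / d n) = (fun _ => 0).
  { apply: functional_extensionality => n; rewrite /word_dist ginvl len1 //= /Rdiv; ring. }
  rewrite /Defs.cdist e; exact: ulim_const.
Qed.

Lemma cdist_tri u v w a b : cdist u v a -> cdist v w b -> exists c, cdist u w c /\ c <= a + b.
Proof.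
  move=> ha hb; have h1 := cdist_lt u v a (a + 1) ha ltac:(lra); have h2 := cdist_lt v w b (b + 1) hb ltac:(lra).
  have tri : forall n, INR (len (iv (u n) ** w n)) <= INR (len (iv (u n) ** v n)) + INR (len (iv (v n) ** w n)).
  { move=> n; rewrite -plus_INR; apply: le_INR.
    by have := lenM _ _ HX (iv (u n) ** v n) (iv (v n) ** w n); gs. }
  have [c [hc _]] := cdist_bd u w (a + b + 2)
    ltac:(apply: (ae_mono _ U _ _ _ (ae_and _ U _ _ h1 h2)) => n [q1 q2]; have := tri n; lra).
  exists c; split=> //; apply: (ulim_le _ U _ _ _ _ hc (ulim_add _ U _ _ _ _ ha hb)).
  apply: ae_all => // n; rewrite /word_dist -Rdiv_plus_distr.
  by apply: Rmult_le_compat_r; [left; apply: Rinv_0_lt_compat; exact: d_pos|exact: tri].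
Qed.

Lemma cdist_uniq u v a b : cdist u v a -> cdist u v b -> a = b.
Proof. exact: (ulim_eq _ U). Qed.

Definition nbd (e : R) (w v : nat -> G) := exists a, cdist w v a /\ a < e.

Lemma nbd_open e w : cone_open G X om d (nbd e w).
Proof.
  move=> u _ [a [ha la]]; exists (e - a); split; first lra.
  move=> v _ [a' [ha' la']]; have [c [hc lc]] := cdist_tri _ _ _ _ _ ha ha'.
  by exists c; split=> //; lra.
Qed.

Variables (p : nat -> G) (r : R).
Hypothesis pb : cbounded p.
Hypothesis r0 : 0 < r.
Hypothesis cpt : cone_compact G X om d (cone_closed_ball G X om d p r).

(** The integer part of [r * d n]: [up] is the integer strictly above its argument, at distance at
    most 1. *)
Definition Rr n := Z.to_nat (up (r * d n) - 1).

Lemma Rr_spec n : INR (Rr n) <= r * d n < INR (Rr n) + 1.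
Proof.
  have h := Rmult_lt_0_compat _ _ r0 (d_pos n).
  have [a1 a2] := archimed (r * d n).
  have z : (0 <= up (r * d n) - 1)%Z.
  { have : (0 < up (r * d n))%Z by apply: lt_IZR; lra.
    lia. }
  by rewrite /Rr INR_IZR_INZ Z2Nat.id // minus_IZR; lra.
Qed.

Lemma Rr_inf c : ae (fun n => (c <= Rr n)%nat).
Proof.
  apply: (ae_mono _ U _ _ _ (proj2 hd ((INR c + 1) / r))) => n h.
  have [_ h2] := Rr_spec n.
  have : (INR c + 1) / r * r < d n * r by apply: Rmult_lt_compat_r.
  have -> : (INR c + 1) / r * r = INR c + 1 by field; lra.
  by move=> h3; apply: INR_le; lra.
Qed.

(** Finitely many open balls of radius [e / 2] cover the compact ball. Larger separated families at
    almost every level, translated to the centre [p], would give more points of the ball than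
    covering sets; two in one set are at distance below [e], whereas separation makes it at least
    [2 * e]. *)
Lemma cone_packing1 b : (1 <= b)%nat -> exists N, ae (fun n => packing G X 1 b (Rr n) N).
Proof.
  move=> hb; apply: NNPP => no.
  have bp : 0 < INR b by apply: lt_0_INR.
  pose e := r / (2 * INR b).
  have e0 : 0 < e by apply: Rdiv_lt_0_compat; lra.
  have [ub ne] := cpt.
  have [l hl] := ne (nat -> G) (nbd (e / 2)) (nbd_open (e / 2))
    ltac:(by move=> u _; exists u, 0; split; [exact: cdist_refl|lra]).
  pose P n (s : list G) := Forall (fun x => (len x <= 1 * Rr n)%nat) s /\
    FOP (fun x y => (Rr n < b * len (iv x ** y))%nat) s /\ (length l < length s)%nat.
  have [f hf] : exists f, ae (fun n => P n (f n)).
  { apply: (ae_choice om U (list G) []).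
    have h : ae (fun n => ~ packing G X 1 b (Rr n) (length l)).
    { by apply: ae_not => // h; apply: no; exists (length l). }
    apply: (ae_mono _ U _ _ _ h) => n hn; apply: NNPP => no'; apply: hn => s s1 s2.
    by apply/Nat.nlt_ge => lt; apply: no'; exists s. }
  pose u i n := p n ** nth i (f n) one.
  have uK : forall i, (i < S (length l))%nat -> cone_closed_ball G X om d p r (u i).
  { move=> i hi.
    have h1 : ae (fun n => INR (len (iv (p n) ** u i n)) <= r * d n).
    { apply: (ae_mono _ U _ _ _ hf) => n [s1 [_ s3]]; rewrite /u; gs.
      apply: (Rle_trans _ (INR (Rr n))); last by case: (Rr_spec n).
      apply: le_INR; rewrite -(Nat.mul_1_l (Rr n)); move/Forall_forall: s1; apply.
      by apply: nth_In; lia. }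
    have [a [ha la]] := cdist_bd p (u i) r h1.
    split; last by exists a.
    by case: pb => c hc; have [c' [hc' _]] := cdist_tri _ _ _ _ _ hc ha; exists c'. }
  have : (length (seq 0 (S (length l))) <= 1 * length l)%nat; last by rewrite length_seq; lia.
  apply: (count_classes _ _ lt (fun w i => nbd (e / 2) w (u i))).
  - by move=> i /in_seq hi; apply: hl; apply: uK; lia.
  - move=> w l' _ inc /Forall_forall F; apply: FOP_le1 => i j ii ij lij.
    have [a [ha la]] := F i ii; have [c [hc lc]] := F j ij.
    have hj : (j < S (length l))%nat by move: (inc j ij) => /in_seq; lia.
    have [c' [hc' lc']] := cdist_tri _ _ _ _ _ (cdist_sym _ _ _ ha) hc.
    have h1 := cdist_lt _ _ _ e hc' ltac:(lra).
    have [n [[q1 [_ [q2 q3]]] q4]] := ae_ex _ U _ (ae_and _ U _ _ (ae_and _ U _ _ h1 hf) (Rr_inf 1)).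
    have sep : (Rr n < b * len (iv (nth i (f n) one) ** nth j (f n) one))%nat.
    { have : forall (s : list G) i j, FOP (fun x y => (Rr n < b * len (iv x ** y))%nat) s -> (i < j)%nat -> (j < length s)%nat ->
        (Rr n < b * len (iv (nth i s one) ** nth j s one))%nat; last by apply=> //; lia.
      move=> s i' j' hs; elim: hs i' j' => [|x s' hx _ IH] [|i'] [|j'] /= h2 h3; try lia.
      - by move/Forall_forall: hx; apply; apply: nth_In; lia.
      - by apply: IH; lia. }
    move: q1; rewrite /u; gs => q1.
    move/le_INR: sep; rewrite S_INR mult_INR => sep.
    have [k1 k2] := Rr_spec n.
    have : INR b * (e * d n) = r * d n / 2 by rewrite /e; field; lra.
    have : INR b * INR (len (iv (nth i (f n) one) ** nth j (f n) one)) < INR b * (e * d n) by apply: Rmult_lt_compat_l.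
    have := Rmult_lt_0_compat _ _ r0 (d_pos n); lra.
  - elim: (S (length l)) 0%nat => [|m IH] s /=; constructor=> //.
    by apply/Forall_forall => j /in_seq; lia.
Qed.

Lemma cone_packing a b : (1 <= b)%nat -> exists N, ae (fun n => packing G X a b (Rr n) N).
Proof.
  move=> hb; have [Nb h1] := cone_packing1 b hb; have [N h2] := cone_packing1 2 ltac:(lia).
  exists (Nb * N ^ (3 * a))%nat.
  apply: (ae_mono _ U _ _ _ (ae_and _ U _ _ (ae_and _ U _ _ h1 h2) (Rr_inf 2))) => n [[q1 q2] q3].
  exact: packing_mul.
Qed.

Lemma cone_packing_ex a : exists N, forall R0, exists R, (R0 <= R)%nat /\ packing G X a 1 R N.
Proof.
  have [N hN] := cone_packing a 1 (le_n 1); exists N => R0.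
  by have [n [h1 h2]] := ae_ex _ U _ (ae_and _ U _ _ (Rr_inf R0) hN); exists (Rr n).
Qed.

Lemma cone_subexp c : (1 <= c)%nat -> ~ (forall m, (2 ^ m <= vol G X (c * m))%nat).
Proof.
  move=> c1; have [N hN] := cone_packing 1 2 ltac:(lia).
  have [n [h1 h2]] := ae_ex _ U _ (ae_and _ U _ _ hN (Rr_inf (2 * (c * (2 * (N + 1)))))).
  have [F0 [k1 k2]] := packing_covering _ _ HX 1 2 (Rr n) N ltac:(lia) h1.
  apply: (growth_contra G X HX (Rr n / 2) (2 * (N + 1)) c (N + 1)) => //; first lia.
  - exists F0; split; first lia.
    by move=> x hx; apply: k2; have := Nat.Div0.mul_div_le (Rr n) 2; lia.
  - by apply: Nat.div_le_lower_bound; lia.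
  - by have := Nat.pow_gt_lin_r 2 (2 * (N + 1)); lia.
Qed.
End ConeToPacking.

(** A cover of a small closed ball inside the compact neighbourhood [K] is completed by the open
    complement of the ball, indexed by [None], to a cover of [K]. *)
Lemma compact_ball_of_locally_compact (G : Group) (X : list G) (HX : generates G X) om d :
  nonprincipal_ultrafilter om -> scaling_sequence om d ->
  cone_locally_compact G X om d -> cone_has_compact_ball G X om d.
Proof.
  move=> U hd lc; set p : nat -> G := fun _ => one.
  have bp : cbounded G X om d p by exists 0; exact: cdist_refl.
  have [V [K [oV [Vp [cK sub]]]]] := lc p bp.
  have [e [e0 he]] := oV p bp Vp.
  exists p, (e / 2); split=> //; split; first lra.
  have inK : forall v, cone_closed_ball G X om d p (e / 2) v -> K v.
  { move=> v [bv [a [ha la]]]; apply: sub => //; apply: he => //; exists a; split=> //; lra. }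
  split; first by move=> v [].
  move=> I Ui oU cov.
  have [l hl] := proj2 cK (option I) (fun i => match i with Some i => Ui i | None => fun v => ~ cone_closed_ball G X om d p (e / 2) v end)
    ltac:(case=> [i|]; [exact: oU|move=> u bu nu; case: (bu) => a ha; exists (a - e / 2); split;
      [apply: Rnot_le_lt => le; apply: nu; split=> //; exists a; split=> //; lra|
       move=> v bv [a' [ha' la']] [_ [c [hc lc']]];
       have [c' [hc' lc'']] := cdist_tri G X HX om U d hd _ _ _ _ _ hc (cdist_sym G X HX om U d _ _ _ ha');
       have := cdist_uniq G X om U d _ _ _ _ ha hc'; lra]])
    ltac:(by move=> u ku; case: (classic (cone_closed_ball G X om d p (e / 2) u)) => [/cov [i hi]|nu]; [exists (Some i)|exists None]).
  have [l' hl'] : exists l', forall i, In (Some i) l -> In i l'.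
  { elim: (l) => [|[i|] l0 [l' IH]]; first by exists [].
    - by exists (i :: l') => j [[->]|/IH]; [left|right].
    - by exists l' => j [//|/IH]. }
  exists l' => u hu; have [[i|] [hi q]] := hl u (inK u hu); last by case: q.
  by exists i; split=> //; exact: hl'.
Qed.

(** The series can be prolonged while its last term is infinite. If [G] were not virtually nilpotent
    this would never stop, and [N] cyclic layers would give [2 ^ N <= N]. *)
Lemma compact_ball_virtually_nilpotent (G : Group) (X : list G) (HX : generates G X) om d :
  nonprincipal_ultrafilter om -> scaling_sequence om d ->
  cone_has_compact_ball G X om d -> virtually_nilpotent G.
Proof.
  move=> U hd [p [r [pb [r0 cpt]]]].
  have pk := cone_packing G X HX om U d hd p r pb r0 cpt.
  have pe := cone_packing_ex G X HX om U d hd p r pb r0 cpt.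
  have R_inf := Rr_inf om U d hd r r0.
  apply: NNPP => nvn.
  have st : forall h, exists D L : G -> Prop, is_subgroup G D /\ fi (fun _ : G => True) D /\ chain G D D L h /\ fg L.
  { elim=> [|h [D [L [sD [fD [cD fL]]]]]].
    - have sT : is_subgroup G (fun _ : G => True) by [].
      exists (fun _ => True), (fun _ => True); split=> //; split; first exact: fi_refl.
      by split; [constructor|exists (alphabet G X); exact: gen_all].
    - have nf : ~ fin L by move=> f; apply: nvn; apply: (chain_virtually_nilpotent G D L h).
      have va := core G X HX om U (Rr d r) R_inf pk L fL nf.
      exact: (chain_extend G X HX D L h sD fD cD fL va (pe 2%nat) (cone_subexp G X HX om U d hd p r pb r0 cpt)). }
  have [N hN] := pe 3%nat.
  have [D [L [sD [fD [cD _]]]]] := st N.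
  have := chain_bound G X HX D L N N sD fD cD hN.
  by have := Nat.pow_gt_lin_r 2 N; lia.
Qed.

Theorem theorem2 (G : Group) (X : list G) (HX : generates G X) :
  (forall (om : (nat -> Prop) -> R) (d : nat -> R),
      nonprincipal_ultrafilter om -> scaling_sequence om d ->
      cone_has_compact_ball G X om d -> virtually_nilpotent G) /\
  ((exists (om : (nat -> Prop) -> R) (d : nat -> R),
      nonprincipal_ultrafilter om /\ scaling_sequence om d /\
      cone_locally_compact G X om d) -> virtually_nilpotent G).
Proof.
  split; first by move=> om d; apply: compact_ball_virtually_nilpotent.
  move=> [om [d [U [hd lc]]]].
  apply: (compact_ball_virtually_nilpotent G X HX om d U hd).
  exact: compact_ball_of_locally_compact.
Qed.
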